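(* Let $K$ be an imaginary quadratic field of class number one with ring of integers $\mathcal{O}_K$, and let $\zeta_0$ be a generator of the group of roots of unity in $K$. Let $f,g:\mathcal{O}_K\to\mathbb{C}$ be arithmetic functions satisfying $f(\zeta_0^r\alpha)=f(\alpha)$ and $g(\zeta_0^r\alpha)=g(\alpha)$ for all $\alpha\in\mathcal{O}_K$ and all positive integers $r$, and suppose that $f$ and $g$ both satisfy the Siegel--Walfisz condition. Let $0<\vartheta\le 1/2$. If $f$ and $g$ both have level of distribution $\vartheta$, then their Dirichlet convolution $f*g$ also has level of distribution $\vartheta$.
   Context: Let $K$ be an imaginary quadratic field of class number one and $\mathcal{O}_K$ its ring of integers. For $\alpha\in\mathcal{O}_K$, $|\alpha|$ denotes its norm (so $|\sigma(\alpha)|=|\alpha|^{1/2}$ for each embedding $\sigma:K\to\mathbb{C}$, where $|\sigma(\alpha)|$ is the usual complex absolute value). For a nonzero integral ideal $\mathfrak{q}$, $|\mathfrak{q}|$ denotes its norm and $\varphi(\mathfrak{q})=\#(\mathcal{O}_K/\mathfrak{q})^{\times}$. For $\alpha\in\mathcal{O}_K$, $(\alpha,\mathfrak{q})=1$ means that $\alpha\mathcal{O}_K$ and $\mathfrak{q}$ are coprime. For nonzero $\alpha$, $\tau(\alpha)$ is the number of integral ideals dividing $\alpha\mathcal{O}_K$. A Dirichlet character modulo $\mathfrak{q}$ is a character of $(\mathcal{O}_K/\mathfrak{q})^{\times}$, regarded as a function on $\mathcal{O}_K$ by setting it to be $0$ on elements not coprime to $\mathfrak{q}$. For $N\ge 1$,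 $A^0(N)$ is the set of $\xi\in\mathcal{O}_K$ with $1\le|\sigma(\xi)|\le N$ for all embeddings $\sigma:K\to\mathbb{C}$, and $|A^0(N)|$ denotes its cardinality. Siegel--Walfisz condition: $f:\mathcal{O}_K\to\mathbb{C}$ satisfies it if there exist positive constants $C,D$ such that $f(\alpha)=O(\tau(\alpha)^C)$ for nonzero $\alpha$, and $$\sum_{\alpha\in A^0(N)}f(\alpha)\chi(\alpha)=O\left(\frac{|A^0(N)|}{(\log N)^{3D}}\right)$$ for any non-principal Dirichlet character $\chi$ modulo $\mathfrak{q}$ with $|\mathfrak{q}|\ll(\log N)^D$. Level of distribution: for $0<\vartheta\le 1$, $f:\mathcal{O}_K\to\mathbb{C}$ has level of distribution $\vartheta$ if for any $A>0$ there exists a constant $B=B(A)$ such that, with $Q=|A^0(N)|^{\vartheta}/(\log N)^B$, $$\sum_{|\mathfrak{q}|\le Q}\ \max_{M\le N}\ \max_{(\gamma,\mathfrak{q})=1}|\varepsilon(M;\mathfrak{q},\gamma;f)|\ll_{A,K}|A^0(N)|(\log N)^{-A},$$ where the sum is over nonzero integral ideals $\mathfrak{q}$, $\gamma$ runs over elements of $\mathcal{O}_K$ coprime to $\mathfrak{q}$, and $$\varepsilon(M;\mathfrak{q},\gamma;f)=\sum_{\substack{\alpha\in A^0(M)\\ \alpha\equiv\gamma\ (\mathrm{mod}\ \mathfrak{q})}}f(\alpha)-\frac{1}{\varphi(\mathfrak{q})}\sum_{\substack{\alpha\in A^0(M)\\(\alpha,\mathfrak{q})=1}}f(\alpha).$$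 Dirichlet convolution: for nonzero $\alpha\in\mathcal{O}_K$, $(f*g)(\alpha)=\sum_{\xi\eta=\alpha}f(\xi)g(\eta)$, the sum being over ordered pairs $(\xi,\eta)$ of elements of $\mathcal{O}_K$ with $\xi\eta=\alpha$. *)

(* Defs.v *)
From HB Require Import structures.
From mathcomp Require Import all_boot all_order all_algebra all_field.
From mathcomp Require Import finmap complex.
From mathcomp Require Import all_classical all_reals all_analysis.

Set Implicit Arguments.
Unset Strict Implicit.
Unset Printing Implicit Defensive.

Import Order.TTheory GRing.Theory Num.Theory.

Local Open Scope classical_set_scope.
Local Open Scope ring_scope.
Local Open Scope complex_scope.

(* Convention used throughout: [#|` fset_set A |] is the cardinality of a
   finite set [A] (it is 0 when [A] is infinite). Sums over finite sets of
   algebraic integers are [fsbigop] sums. *)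

(* A real quadratic field is one that embeds in the reals. *)
Definition imaginary_quadratic (R : realType) (K : fieldExtType rat) : Prop :=
  \dim {:K} = 2%N /\ ({rmorphism K -> R} -> False).

Definition alg_int (K : fieldExtType rat) : {pred K} :=
  fun x => `[< integralOver (intr : int -> K) x >].

Fact alg_int_subring_closed (K : fieldExtType rat) :
  subring_closed (@alg_int K).
Proof.
split=> [|x y /asboolP xK /asboolP yK|x y /asboolP xK /asboolP yK];
  apply/asboolP.
- exact: integral1.
- exact: integral_sub.
- exact: integral_mul.
Qed.

HB.instance Definition _ (K : fieldExtType rat) :=
  GRing.isSubringClosed.Build K (@alg_int K) (@alg_int_subring_closed K).

Record ringOfIntegers (K : fieldExtType rat) := RingOfIntegers {
  int_val :> K;
  _ : int_val \in @alg_int K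
}.

HB.instance Definition _ (K : fieldExtType rat) :=
  [isSub for @int_val K].
HB.instance Definition _ (K : fieldExtType rat) :=
  [Choice of ringOfIntegers K by <:].
HB.instance Definition _ (K : fieldExtType rat) :=
  [SubChoice_isSubComNzRing of ringOfIntegers K by <:].

Definition is_ideal (A : comNzRingType) (I : set A) : Prop :=
  [/\ I 0, forall x y, I x -> I y -> I (x + y)
    & forall a x, I x -> I (a * x)].

Definition nz_ideal (A : comNzRingType) (I : set A) : Prop :=
  is_ideal I /\ exists2 x, I x & x != 0.

Definition principal_ideal (A : comNzRingType) (a : A) : set A :=
  [set a * x | x in setT].

Definition ideal_mul (A : comNzRingType) (I J : set A) : set A :=
  [set x | exists2 s : seq (A * A),
     (forall p, p \in s -> I p.1 /\ J p.2) & x = \sum_(p <- s) p.1 * p.2].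

Definition ideal_dvd (A : comNzRingType) (I J : set A) : Prop :=
  exists2 I', is_ideal I' & ideal_mul I I' = J.

(* Two nonzero ideals are in the same class when a I = b J for some nonzero
   elements a, b; these classes are the elements of the ideal class group,
   every fractional ideal being a multiple of an integral one. *)
Definition ideal_equiv (A : comNzRingType) (I J : set A) : Prop :=
  exists a b : A, [/\ a != 0, b != 0
    & [set a * x | x in I] = [set b * y | y in J]].

Definition ideal_class (A : comNzRingType) (I : set A) : set (set A) :=
  [set J | nz_ideal J /\ ideal_equiv I J].

Definition class_number (K : fieldExtType rat) : nat :=
  #|` fset_set [set ideal_class I | I in @nz_ideal (ringOfIntegers K)] |.

Definition residue (A : comNzRingType) (q : set A) (a : A) : set A :=
  [set b | q (b - a)].

Definition ideal_norm (A : comNzRingType) (q : set A) : nat :=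
  #|` fset_set [set residue q a | a in setT] |.

(* a A and q are coprime, that is, a A + q = A; equivalently, the class of a
   is invertible in A / q. *)
Definition coprime_to (A : comNzRingType) (q : set A) (a : A) : Prop :=
  exists x y, q y /\ a * x + y = 1.

Definition ideal_totient (A : comNzRingType) (q : set A) : nat :=
  #|` fset_set [set residue q a | a in coprime_to q] |.

Definition num_ideal_divisors (A : comNzRingType) (a : A) : nat :=
  #|` fset_set [set d : set A | is_ideal d /\
                                ideal_dvd d (principal_ideal a)] |.

(* The extension by 0 to A of a character of the units of A / q. *)
Definition dirichlet_character (A : comNzRingType) (C : numClosedFieldType)
    (q : set A) (chi : A -> C) : Prop :=
  [/\ forall a, ~ coprime_to q a -> chi a = 0,
      forall a b, q (a - b) -> chi a = chi b,
      chi 1 = 1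
    & forall a b, coprime_to q a -> coprime_to q b ->
        chi (a * b) = chi a * chi b].

Definition principal_character (A : comNzRingType) (C : numClosedFieldType)
    (q : set A) (chi : A -> C) : Prop :=
  forall a, coprime_to q a -> chi a = 1.

Definition is_root_of_unity (K : fieldType) (x : K) : Prop :=
  exists2 n : nat, (0 < n)%N & x ^+ n = 1.

Definition roots_of_unity_generator (K : fieldType) (z : K) : Prop :=
  is_root_of_unity z /\
  forall x : K, is_root_of_unity x -> exists r : int, x = z ^ r.

(* The modulus of a complex number, as an element of R ([`|z|] lies in R[i]). *)
Definition cabs (R : realType) (z : R[i]) : R := ComplexField.Normc.normc z.

Definition A0 (R : realType) (K : fieldExtType rat) (N : R) : set (ringOfIntegers K) :=
  [set xi | forall s : {rmorphism K -> R[i]},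
      1 <= cabs (s (int_val xi)) <= N].
Arguments A0 {R} K N.

Definition cardA0 (R : realType) (K : fieldExtType rat) (N : R) : R :=
  (#|` fset_set (A0 K N) |)%:R.

Section ArithmeticFunctions.
Variables (R : realType) (K : fieldExtType rat).
Implicit Types (f g : ringOfIntegers K -> R[i]) (q : set (ringOfIntegers K)).

(* The asymptotic estimates below are stated for all real N >= 2. *)

Definition siegel_walfisz f : Prop :=
  exists C D : R, [/\ 0 < C, 0 < D,
    (exists c : R, forall a : ringOfIntegers K, a != 0 ->
       cabs (f a) <= c * (num_ideal_divisors a)%:R `^ C)
  & forall c : R, exists c' : R, forall (N : R) q (chi : ringOfIntegers K -> R[i]),
      2 <= N -> nz_ideal q -> (ideal_norm q)%:R <= c * ln N `^ D ->
      dirichlet_character q chi -> ~ principal_character q chi ->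
      cabs (\sum_(a \in A0 K N) f a * chi a)
        <= c' * (cardA0 K N / ln N `^ (3 * D))].

Definition discrepancy (M : R) q (gamma : ringOfIntegers K) f : R[i] :=
  \sum_(a \in A0 K M `&` [set a | q (a - gamma)]) f a
  - (ideal_totient q)%:R^-1 * \sum_(a \in A0 K M `&` coprime_to q) f a.

(* The maxima, which run over finitely many values, are written as suprema in
   the extended reals, and the sum over ideals as a sum of nonnegative
   extended reals. The constant c may depend on f, as it must. *)
Definition level_of_distribution (theta : R) f : Prop :=
  forall A : R, 0 < A -> exists B c : R, forall N : R, 2 <= N ->
    let Q := cardA0 K N `^ theta / ln N `^ B in
    (\esum_(q in [set q | nz_ideal q /\ ((ideal_norm q)%:R <= Q)%R])
        ereal_sup [set ereal_sup
            [set (cabs (discrepancy M q gamma f))%:E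
            | gamma in coprime_to q]
          | M in [set M : R | (1 <= M <= N)%R]]
      <= (c * (cardA0 K N * ln N `^ (- A)))%:E)%E.

(* Meant for nonzero a, for which the sum is finite. *)
Definition dirichlet_conv f g : ringOfIntegers K -> R[i] :=
  fun a => \sum_(p \in [set p : ringOfIntegers K * ringOfIntegers K | p.1 * p.2 = a]) f p.1 * g p.2.

End ArithmeticFunctions.

(* Main.v *)
Require Import Defs.
From HB Require Import structures.
From mathcomp Require Import all_boot all_order all_algebra all_field all_fingroup.
From mathcomp Require Import finmap complex ring lra zify.
From mathcomp Require Import all_classical all_reals all_analysis.

Set Implicit Arguments.
Unset Strict Implicit.
Unset Printing Implicit Defensive.

Import Order.TTheory GRing.Theory Num.Theory.
Local Open Scope ring_scope.
Local Open Scope complex_scope.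

(** This is Motohashi's induction principle over [O = Z[om]], a principal ideal
    domain.  Everything is counted by elements of [O] and their norm [nm];
    write [l = ln N] and [Z = N ^ 2 = expR (2 * l)].

    In a pair [x * y] of norm at most [Z] one factor has norm at most [N]
    ([hyperbola]), so it is enough to distribute the products with weight
    [a x * g y], where [nm x <= N] and [g] has a level of distribution
    ([conv_half]).  The range of [nm x] is cut into dyadic pieces.

    If [nm x] is at most a power of [l], the condition
    [x * y = c (mod q)] is a condition on [y] alone and the level of
    distribution of [g] applies directly ([pair_disc_direct]).

    For the larger pieces, the discrepancy modulo [q] is the sum, over the
    nonunit divisors [r] of [q], of the components of conductor [r] of a
    function on the group of units modulo [q] ([disc_decomp]).  These components
    are orthogonal projections built from averages over subgroups and play the
    part of the sums over primitive characters.
    When [nm r] exceeds a power of [l], the condition [nm (x * y) <= T] is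
    separated ([separation]), each component becomes a convolution whose sup
    norm is at most a product of two mean squares, and the sum over [q] of these
    is controlled by a two-dimensional additive large sieve
    ([high_component], [large_sieve_quad], [high_total]).
    When [nm r] is below that power, the component of the [y] variable is small
    because [g] is well distributed modulo [r] and its small multiples; this is
    the level of distribution of [g] at the scale [Z / nm x >= N].  The
    coprimality of [y] to the complementary divisor [q / r] is handled by
    truncated inclusion-exclusion ([low_component], [low_total]).

    The functions are bounded by powers of the divisor function,
    whose mean values are bounded by powers of [l] ([divisor_bounded],
    [moment_le]); all such losses are absorbed by saving a larger power of [l]
    in each estimate ([piece_dyadic]).

    Finally [O] is identified with the ring of integers of [K]
    ([quadratic_order]), and sums over ideals and over [A0] become sums over
    generators and over disks for [nm] ([esum_gens], [discrepancyE]). *)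

(** * Absolute values and exponentials *)

Section Cabs.
Variable R : realType.
Implicit Types (x y z : R[i]) (r : R).

Lemma normCE z : `|z| = (cabs z)%:C. Proof. by []. Qed.

Lemma cabs_ge0 z : 0 <= cabs z.
Proof. by rewrite -lecR -normCE normr_ge0. Qed.

Lemma cabs0 : cabs (0 : R[i]) = 0.
Proof. by apply: complexI; rewrite -normCE normr0. Qed.

Lemma cabsM x y : cabs (x * y) = cabs x * cabs y.
Proof. exact: ComplexField.Normc.normcM. Qed.

Lemma cabsN x : cabs (- x) = cabs x.
Proof. by apply: complexI; rewrite -!normCE normrN. Qed.

Lemma cabs_le_add x y : cabs (x + y) <= cabs x + cabs y.
Proof. by rewrite -lecR rmorphD /= -!normCE ler_normD. Qed.

Lemma cabs_le_sub x y : cabs (x - y) <= cabs x + cabs y.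
Proof. by rewrite -(cabsN y) cabs_le_add. Qed.

Lemma cabs_real r : cabs r%:C = `|r|.
Proof. by rewrite /cabs /= expr0n addr0 sqrtr_sqr. Qed.

Lemma cabs_nat n : cabs (n%:R : R[i]) = n%:R.
Proof. by apply: complexI; rewrite -normCE normr_nat rmorph_nat. Qed.

Lemma cabs1 : cabs (1 : R[i]) = 1.
Proof. exact: (cabs_nat 1). Qed.

Lemma cabsV x : cabs x^-1 = (cabs x)^-1.
Proof. exact: ComplexField.Normc.normcV. Qed.

Lemma cabsX x n : cabs (x ^+ n) = cabs x ^+ n.
Proof.
by elim: n => [|n IH]; rewrite ?expr0 ?cabs1 // !exprS cabsM IH.
Qed.

Lemma cabs_conj x : cabs x^*%C = cabs x.
Proof. by apply: complexI; rewrite -!normCE normcJ. Qed.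

Lemma conjM x y : (x * y)^*%C = x^*%C * y^*%C.
Proof. exact: rmorphM. Qed.

Lemma conjB x y : (x - y)^*%C = x^*%C - y^*%C.
Proof. exact: rmorphB. Qed.

Lemma conj_sum (I : Type) (s : seq I) (P : pred I) (F : I -> R[i]) :
  (\sum_(i <- s | P i) F i)^*%C = \sum_(i <- s | P i) (F i)^*%C.
Proof. exact: rmorph_sum. Qed.

Lemma mul_conj x : x * x^*%C = (cabs x ^+ 2)%:C.
Proof. by rewrite -sqr_normc normCE rmorphXn. Qed.

Lemma cabs_sum (I : Type) (s : seq I) (P : pred I) (F : I -> R[i]) :
  cabs (\sum_(i <- s | P i) F i) <= \sum_(i <- s | P i) cabs (F i).
Proof.
elim/big_ind2: _ => [|x1 x2 y1 y2 h1 h2|//]; first by rewrite cabs0.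
by apply: (le_trans (cabs_le_add _ _)); apply: lerD.
Qed.

Lemma cabs_sum_le (I : Type) (s : seq I) (P : pred I) (F : I -> R[i])
    (G : I -> R) : (forall i, P i -> cabs (F i) <= G i) ->
  cabs (\sum_(i <- s | P i) F i) <= \sum_(i <- s | P i) G i.
Proof. by move=> h; apply: (le_trans (cabs_sum _ _ _)); apply: ler_sum. Qed.

Lemma cabs_ge_Re x : complex.Re x <= cabs x.
Proof.
rewrite -lecR -normCE; apply: le_trans (normc_ge_Re x); rewrite lecR.
exact: ler_norm.
Qed.

Lemma cauchy_schwarz_sq (I : Type) (s : seq I) (P : pred I) (a b : I -> R) :
  (\sum_(i <- s | P i) a i * b i) ^+ 2 <=
  (\sum_(i <- s | P i) a i ^+ 2) * (\sum_(i <- s | P i) b i ^+ 2).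
Proof.
set A := \sum_(i <- s | P i) a i ^+ 2; set B := \sum_(i <- s | P i) b i ^+ 2.
set S := \sum_(i <- s | P i) a i * b i.
have A0 : 0 <= A by apply: sumr_ge0 => i _; apply: sqr_ge0.
have key t : 0 <= A * t ^+ 2 - 2 * S * t + B.
  have -> : A * t ^+ 2 - 2 * S * t + B =
      \sum_(i <- s | P i) (t * a i - b i) ^+ 2.
    rewrite /A /B /S mulr_suml mulr_sumr mulr_suml -sumrB -big_split /=.
    by apply: eq_bigr => i _; ring.
  by apply: sumr_ge0 => i _; apply: sqr_ge0.
have [A1|A1] := eqVneq A 0.
  have k1 := key ((B + 1) / (2 * S)).
  have [->|S0] := eqVneq S 0; first by rewrite expr0n /= A1 mul0r.
  move: k1; rewrite A1 mul0r add0r.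
  have -> : 2 * S * ((B + 1) / (2 * S)) = B + 1.
    by rewrite mulrCA divff ?mulr1 // mulf_neq0 // pnatr_eq0.
  lra.
have Ap : 0 < A by rewrite lt_def A1.
have := key (S / A).
have -> : A * (S / A) ^+ 2 - 2 * S * (S / A) + B = (A * B - S ^+ 2) / A.
  by field; rewrite A1.
by rewrite pmulr_lge0 ?invr_gt0 // subr_ge0.
Qed.

Lemma cauchy_schwarz (I : Type) (s : seq I) (P : pred I) (a b : I -> R) :
  \sum_(i <- s | P i) a i * b i <=
  Num.sqrt (\sum_(i <- s | P i) a i ^+ 2) *
  Num.sqrt (\sum_(i <- s | P i) b i ^+ 2).
Proof.
apply: (le_trans (ler_norm _)).
rewrite -sqrtrM; last by apply: sumr_ge0 => i _; apply: sqr_ge0.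
by rewrite -sqrtr_sqr ler_sqrt ?cauchy_schwarz_sq //;
  apply: mulr_ge0; apply: sumr_ge0 => i _; apply: sqr_ge0.
Qed.

End Cabs.

Section Ecx.
Variable R : realType.
Implicit Types (x y : R).

Definition ecx x : R[i] := cos (2 * pi * x) +i* sin (2 * pi * x).

Lemma ecxD x y : ecx (x + y) = ecx x * ecx y.
Proof.
rewrite /ecx mulrDr cosD sinD; apply/eqP; rewrite eq_complex /=.
by rewrite eqxx /=; apply/eqP; ring.
Qed.

Lemma ecx0 : ecx 0 = 1.
Proof. by rewrite /ecx mulr0 cos0 sin0. Qed.

Lemma ecx1 : ecx 1 = 1.
Proof.
have -> : (1 : R[i]) = 1 +i* 0 by [].
rewrite /ecx mulr1 mulr_natl cos2pi; congr (_ +i* _).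
by rewrite -[_ *+ 2]add0r sinD2pi sin0.
Qed.

Lemma ecx_nat x n : ecx (n%:R * x) = ecx x ^+ n.
Proof.
elim: n => [|n IH]; first by rewrite mul0r ecx0 expr0.
by rewrite exprS -IH -ecxD; congr ecx; rewrite -addn1 natrD; ring.
Qed.

Lemma ecxN x : ecx (- x) = (ecx x)^*%C.
Proof. by rewrite /ecx mulrN cosN sinN. Qed.

Lemma cabs_ecx x : cabs (ecx x) = 1.
Proof. by rewrite /cabs /= cos2Dsin2 sqrtr1. Qed.

Lemma ecx_int (m : int) : ecx m%:~R = 1.
Proof.
have h n : ecx n%:R = 1 by rewrite -[n%:R]mulr1 ecx_nat ecx1 expr1n.
case: m => n; first exact: h.
by rewrite NegzE mulrNz ecxN h conjc1.
Qed.

Lemma ecxDint x (m : int) : ecx (x + m%:~R) = ecx x.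
Proof. by rewrite ecxD ecx_int mulr1. Qed.

(** Doubling [x] at most doubles the distance of [ecx x] to [1], and this
    distance is at least [1] for [x] in [1/4, 1/2]. *)
Lemma ecx_dist_le x : 0 <= x <= 1 / 2 -> 2 * x <= cabs (1 - ecx x).
Proof.
move=> /andP[x0 x1].
have base y : 1 / 4 <= y <= 1 / 2 -> 2 * y <= cabs (1 - ecx y).
  move=> /andP[y1 y2]; apply: le_trans (cabs_ge_Re _) => /=.
  have c : cos (2 * pi * y) <= 0.
    have := cos_ge0_pihalf (x := 2 * pi * y - pi) _; rewrite -[X in cos X]opprB cosN.
    have -> : pi - 2 * pi * y = - (2 * pi * y) + pi by ring.
    rewrite cosDpi cosN => h; rewrite -oppr_ge0; apply: h.
    by have := @pi_gt0 R; nra.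
  lra.
have [->|xn0] := eqVneq x 0; first by rewrite mulr0 cabs_ge0.
have xp : 0 < x by rewrite lt_def xn0.
have [n] : exists n, 1 / 4 <= 2 ^+ n * x.
  exists (Num.truncn (1 / x)); set n := Num.truncn _.
  have h : 1 / x < n.+1%:R by rewrite truncnS_gt.
  have : n.+1%:R <= (2 ^+ n.+1 : R).
    by rewrite -natrX ler_nat ltnW // ltn_expl.
  rewrite exprS => h2; have := lt_le_trans h h2.
  rewrite ltr_pdivrMr //; lra.
elim: n x x0 x1 {xn0 xp} => [|n IH] x x0 x1 h; first by apply: base; lra.
have [h1|h1] := lerP (1 / 4) x; first by apply: base; lra.
have := IH (2 * x) _ _ _; rewrite mulrA -exprSr => /(_ _ _ h) => IH'.
have : 2 * (2 * x) <= cabs (1 - ecx (2 * x)) by apply: IH'; lra.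
have -> : 1 - ecx (2 * x) = (1 - ecx x) * (1 + ecx x).
  by rewrite -[2 * x]/(2%:R * x) ecx_nat; ring.
rewrite cabsM => h2.
have : cabs (1 + ecx x) <= 2.
  by apply: (le_trans (cabs_le_add _ _)); rewrite cabs1 cabs_ecx; lra.
have := cabs_ge0 (1 - ecx x); nra.
Qed.

Lemma cabs_1Becx_sym x : cabs (1 - ecx (1 - x)) = cabs (1 - ecx x).
Proof.
rewrite (ecxD 1 (- x)) ecx1 mul1r ecxN.
have -> : 1 - (ecx x)^*%C = (1 - ecx x)^*%C by rewrite rmorphB rmorph1.
by rewrite cabs_conj.
Qed.

Lemma ecx_dist_ge x : 0 <= x <= 1 ->
  2 * Num.min x (1 - x) <= cabs (1 - ecx x).
Proof.
move=> x01; have [h|h] := lerP x (1 / 2).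
  by apply: le_trans (ecx_dist_le _); rewrite ?ler_pM2l ?ge_min ?lexx //; lra.
rewrite -cabs_1Becx_sym; apply: le_trans (ecx_dist_le _).
  by rewrite ler_pM2l ?ge_min ?lexx ?orbT //.
lra.
Qed.

Lemma ecx_neq1 x : 0 < x < 1 -> ecx x != 1.
Proof.
move=> h; apply/eqP => e; have := @ecx_dist_ge x _.
rewrite e subrr cabs0 => /(_ _); have [k|k] := lerP x (1 - x); lra.
Qed.

Lemma ecx_eq1 x : ecx x = 1 -> exists m : int, x = m%:~R.
Proof.
move=> h; exists (Num.floor x); apply/eqP.
have := floor_le x; have := floorD1_gt x; rewrite intrD => h1 h2.
rewrite eq_le h2 andbT leNgt; apply/negP => h3.
have : ecx (x - (Num.floor x)%:~R) != 1 by apply: ecx_neq1; lra.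
by rewrite ecxD -mulrNz ecx_int h mulr1 eqxx.
Qed.

Definition dirich (L : nat) x : R[i] := \sum_(j < L) ecx (j%:R * x).

Lemma dirich_le L x : cabs (dirich L x) <= L%:R.
Proof.
apply: (le_trans (cabs_sum _ _ _)); rewrite (eq_bigr (fun=> 1)).
  by rewrite sumr_const card_ord.
by move=> i _; rewrite cabs_ecx.
Qed.

Lemma dirich_geom L x : (1 - ecx x) * dirich L x = 1 - ecx x ^+ L.
Proof.
rewrite -[RHS]opprB subrX1 -mulNr opprB; congr (_ * _).
by apply: eq_bigr => i _; rewrite ecx_nat.
Qed.

Lemma dirich_dist L x : cabs (1 - ecx x) * cabs (dirich L x) <= 2.
Proof.
rewrite -cabsM dirich_geom; apply: (le_trans (cabs_le_sub _ _)).
by rewrite cabs1 cabsX cabs_ecx expr1n; lra.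
Qed.

Lemma dirich_le_inv L x : 0 < x < 1 -> cabs (dirich L x) <= (Num.min x (1 - x))^-1.
Proof.
move=> h; have h1 := dirich_dist L x; have h2 := @ecx_dist_ge x _.
have m0 : 0 < Num.min x (1 - x) by rewrite lt_min; lra.
rewrite -[X in _ <= X]mul1r ler_pdivlMr //.
have := h2 _; have -> : 0 <= x <= 1 by lra.
move=> /(_ isT) h3; have := cabs_ge0 (dirich L x); nra.
Qed.

Lemma sum_ecx_orth (P : nat) (d : R) : (0 < P)%N ->
  ecx (d) ^+ P = 1 -> ecx d != 1 -> \sum_(k < P) ecx (k%:R * d) = 0.
Proof.
move=> P0 h1 h2; have := dirich_geom P d; rewrite h1 subrr => /eqP.
by rewrite mulf_eq0 subr_eq0 eq_sym (negbTE h2) /= => /eqP.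
Qed.

End Ecx.

Arguments ecx : simpl never.
Arguments conjc : simpl never.

(** * Separating the two factors of a product *)

Section Separation.
Variable R : realType.

(** Concavity of the logarithm, in the form that makes the harmonic sum
    telescope. *)
Lemma ln_succ_ge (n : nat) : (0 < n)%N ->
  ((n.+1)%:R^-1 : R) <= ln n.+1%:R - ln n%:R.
Proof.
move=> n0; have np : (0 : R) < n%:R by rewrite ltr0n.
have e : 1 + - (n.+1%:R^-1) = n%:R / n.+1%:R :> R.
  by rewrite -natr1; field; rewrite natr1 pnatr_eq0.
have := @le_ln1Dx R (- (n.+1%:R^-1)) _.
rewrite e ln_div ?posrE ?ltr0n // => h.
have : (-1 : R) < - (n.+1)%:R^-1.
  by rewrite ltrN2 invf_lt1 ?ltr1n ?ltr0n.
by move=> /h h2; rewrite -lerN2 opprB.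
Qed.

Lemma harmonic_le (n : nat) : (0 < n)%N ->
  \sum_(k < n) (k.+1%:R^-1 : R) <= 1 + ln n%:R.
Proof.
case: n => // n _; elim: n => [|n IH].
  by rewrite big_ord_recr big_ord0 /= add0r invr1 ln1 addr0.
rewrite big_ord_recr /=; move: IH (@ln_succ_ge n.+1 isT).
by move: (ln _) (ln _) (_^-1) (\sum_(_ < _) _) => *; lra.
Qed.

Definition logfl (H : R) (m : nat) : nat := Num.truncn (H * ln m%:R).

(** With [H = 2 (Zm + 1)] the rounding errors of [H ln m] and [H ln n] are
    smaller than the gap [H ln (1 + 1 / t)]. *)
Lemma logfl_spec (Zm m n t : nat) : (0 < m)%N -> (0 < n)%N -> (0 < t)%N ->
  (t <= Zm)%N -> let H := 2 * Zm.+1%:R in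
  (logfl H m + logfl H n <= logfl H t)%N = (m * n <= t)%N.
Proof.
move=> m0 n0 t0 tZ H.
have H0 : 0 <= H by rewrite mulr_ge0.
have ln0 k : (0 < k)%N -> 0 <= ln k%:R :> R by move=> k0; rewrite ln_ge0 ?ler1n.
have lnM : ln (m * n)%:R = ln m%:R + ln n%:R :> R.
  by rewrite natrM lnM ?posrE ?ltr0n.
have mono a b : (0 < a)%N -> (a <= b)%N -> ln a%:R <= ln b%:R :> R.
  by move=> a0 ab; rewrite ler_ln ?posrE ?ltr0n ?ler_nat //; apply: leq_trans ab.
have lo k : (0 < k)%N -> (logfl H k)%:R <= H * ln k%:R.
  by move=> k0; rewrite truncn_le mulr_ge0 ?ln0.
have hi k : H * ln k%:R < (logfl H k)%:R + 1.
  by have := truncnS_gt (H * ln k%:R); rewrite -natr1.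
apply/idP/idP => h; last first.
  rewrite truncn_ge_nat ?mulr_ge0 ?ln0 // natrD.
  have := mono _ _ _ h; rewrite muln_gt0 m0 n0 => /(_ isT); rewrite lnM.
  have := lo m m0; have := lo n n0 => h1 h2 h3.
  by apply: (le_trans (lerD h2 h1)); rewrite -mulrDr ler_wpM2l.
rewrite leqNgt; apply/negP => h1.
have h2 := mono t.+1 _ isT h1; rewrite lnM in h2.
have h3 := ln_succ_ge t0.
have h4 : 2 <= H * (ln t.+1%:R - ln t%:R).
  apply: le_trans (_ : H * t.+1%:R^-1 <= _); last by rewrite ler_wpM2l.
  rewrite ler_pdivlMr ?ltr0n // /H ler_pM2l // ler_nat; lia.
have h5 : H * ln t.+1%:R <= H * (ln m%:R + ln n%:R) by rewrite ler_wpM2l.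
have : ((logfl H m + logfl H n)%N%:R : R) <= (logfl H t)%:R by rewrite ler_nat.
rewrite natrD; have := hi m; have := hi n; have := lo t t0.
move: h4 h5; rewrite mulrBr mulrDr; lra.
Qed.

Lemma sum_ecx_delta (P S w : nat) : (S < P)%N -> (w < P)%N ->
  \sum_(k < P) ecx (k%:R * ((S%:R - w%:R) / P%:R) : R) =
  (if S == w then P%:R else 0).
Proof.
move=> SP wP; have P0 : (0 < P)%N by apply: leq_ltn_trans SP.
have Pn : P%:R != 0 :> R by rewrite pnatr_eq0 -lt0n.
case: eqP => [->|/eqP ne].
  rewrite (eq_bigr (fun=> 1)); first by rewrite sumr_const card_ord.
  by move=> k _; rewrite subrr mul0r mulr0 ecx0.
apply: sum_ecx_orth => //.
  rewrite -ecx_nat mulrC divfK // -[S%:R]/((S%:Z)%:~R) -[w%:R]/((w%:Z)%:~R).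
  by rewrite -intrB ecx_int.
have Pp : 0 < P%:R :> R by rewrite ltr0n.
move: ne; rewrite neq_ltn => /orP[] h.
  have : ecx ((w%:R - S%:R) / P%:R : R) != 1.
    apply: ecx_neq1; rewrite divr_gt0 ?subr_gt0 ?ltr_nat //=.
    rewrite ltr_pdivrMr // mul1r; have : (w%:R : R) < P%:R by rewrite ltr_nat.
    by have := ler0n R S; lra.
  apply: contra => /eqP h1; rewrite -opprB mulNr ecxN h1.
  by rewrite rmorph1.
apply: ecx_neq1; rewrite divr_gt0 ?subr_gt0 ?ltr_nat //=.
rewrite ltr_pdivrMr // mul1r; have : (S%:R : R) < P%:R by rewrite ltr_nat.
by have := ler0n R w; lra.
Qed.

(** The condition [m * n <= t] becomes [u m + u n <= u t] for
    [u m = floor (H ln m)], since [ln (m n)] and [ln t] are either equal in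
    order or [1 / (t + 1)] apart; Fourier inversion of an initial segment of
    [Z/P] then separates the variables, and the coefficients decay like those
    of a Dirichlet kernel, whatever [t] is. *)
Lemma separation (Zm : nat) : (0 < Zm)%N ->
  exists (P : nat) (phi c : 'I_P -> nat -> R[i]) (ch : 'I_P -> R),
  [/\ forall k m, cabs (phi k m) = 1,
      forall k, 0 <= ch k,
      forall k t, (t <= Zm)%N -> cabs (c k t) <= ch k,
      \sum_k ch k <= 12 * (1 + ln Zm%:R)
    & forall m n t, (0 < m)%N -> (0 < n)%N -> (m * n <= Zm)%N -> (t <= Zm)%N ->
      \sum_k c k t * (phi k m * phi k n) = (m * n <= t)%N%:R].
Proof.
move=> Z0; pose H : R := 2 * Zm.+1%:R; pose P := (2 * Zm.+1 * Zm)%N.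
pose u := logfl H.
have P0 : (0 < P)%N by rewrite /P !muln_gt0 Z0.
have Pp : 0 < P%:R :> R by rewrite ltr0n.
have Pn : P%:R != 0 :> R by rewrite gt_eqF.
have lnZ : ln Zm%:R < Zm%:R :> R by apply: ln_sublinear; rewrite ltr0n.
have uP s : (s%:R <= H * ln Zm%:R) -> (s < P)%N.
  move=> h; rewrite -(ltr_nat R); apply: (le_lt_trans h).
  by rewrite /P /H !natrM ltr_pM2l // mulr_gt0 // ltr0n.
have ln0 k : (0 < k)%N -> 0 <= ln k%:R :> R by move=> k0; rewrite ln_ge0 ?ler1n.
have H0 : 0 <= H by rewrite mulr_ge0.
have mono a b : (0 < a)%N -> (a <= b)%N -> H * ln a%:R <= H * ln b%:R.
  move=> a0 ab; rewrite ler_wpM2l // ler_ln ?posrE ?ltr0n ?ler_nat //.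
  exact: leq_trans ab.
have lo k : (0 < k)%N -> (u k)%:R <= H * ln k%:R.
  by move=> k0; rewrite truncn_le mulr_ge0 ?ln0.
exists P, (fun k m => ecx (k%:R * ((u m)%:R / P%:R))),
  (fun k t => if t == 0%N then 0 else
     P%:R^-1 * \sum_(w < (u t).+1) ecx (w%:R * - (k%:R / P%:R))),
  (fun k => if (k : nat) == 0%N then 1 else k%:R^-1 + (P - k)%N%:R^-1).
split.
- by move=> k m; apply: cabs_ecx.
- by move=> k; case: ifP => // _; rewrite addr_ge0 ?invr_ge0.
- move=> k t tZ /=; have [_|t0] := eqVneq t 0%N.
    by rewrite cabs0; case: ifP => // _; rewrite addr_ge0 ?invr_ge0.
  rewrite -lt0n in t0.
  have hu : (u t < P)%N by apply: uP; apply: (le_trans (lo _ t0)); apply: mono.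
  rewrite cabsM cabsV cabs_nat mulrC ler_pdivrMr //.
  rewrite -/(dirich (u t).+1 (- (k%:R / P%:R))).
  case: ifP => [_|/negbT k0].
    by rewrite mul1r; apply: (le_trans (dirich_le _ _)); rewrite ler_nat.
  rewrite -lt0n in k0.
  have kP : (k%:R : R) < P%:R by rewrite ltr_nat.
  have kp : (0 : R) < k%:R by rewrite ltr0n.
  have -> : dirich (u t).+1 (- (k%:R / P%:R)) = dirich (u t).+1 (1 - k%:R / P%:R) :> R[i].
    apply: eq_bigr => j _; rewrite mulrBr mulr1 ecxD.
    by rewrite -[(j : nat)%:R]/(((j : nat)%:Z)%:~R) ecx_int mul1r mulrN.
  have q1 : k%:R / P%:R < 1 :> R by rewrite ltr_pdivrMr ?mul1r.
  have q0 : 0 < k%:R / P%:R :> R by rewrite divr_gt0.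
  apply: (le_trans (dirich_le_inv _ _)); first by lra.
  rewrite natrB; last exact: ltnW.
  have -> : 1 - (1 - k%:R / P%:R) = k%:R / P%:R :> R by ring.
  have -> : 1 - k%:R / P%:R = (P%:R - k%:R) / P%:R :> R by field.
  have -> : (k%:R^-1 + (P%:R - k%:R)^-1) * P%:R =
      P%:R / k%:R + P%:R / (P%:R - k%:R) :> R by rewrite mulrDl ![P%:R / _]mulrC.
  have pk : 0 < (P%:R - k%:R : R) by rewrite subr_gt0.
  rewrite minEle; case: ifP => _; rewrite invf_div.
    by rewrite lerDr divr_ge0 // ltW.
  by rewrite lerDl divr_ge0 // ltW.
- have -> : P = P.-1.+1 by rewrite prednK.
  rewrite big_ord_recl /=.
  have e1 : \sum_(i < P.-1) (((bump 0 i)%:R^-1 : R) + (P.-1.+1 - bump 0 i)%N%:R^-1)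
     = 2 * \sum_(i < P.-1) (i.+1%:R^-1 : R).
    rewrite big_split /= mulr_natl mulr2n; congr (_ + _).
    rewrite (reindex_inj rev_ord_inj) /=; apply: eq_bigr => i _.
    by congr (_%:R^-1); rewrite /bump /=; have := ltn_ord i; lia.
  rewrite e1.
  have P1 : (0 < P.-1)%N by rewrite /P; lia.
  have := harmonic_le P1 => h.
  have : ln (P.-1)%:R <= ln (4 * Zm%:R ^+ 2) :> R.
    rewrite ler_ln ?posrE ?ltr0n //; last first.
      by rewrite mulr_gt0 // exprn_gt0 ?ltr0n.
    rewrite -natrX -natrM ler_nat /P; nia.
  rewrite lnM ?posrE ?ltr0n //; last by rewrite exprn_gt0 ?ltr0n.
  rewrite lnXn ?ltr0n // => h2.
  have h4 : ln 4 < 4 :> R by apply: ln_sublinear.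
  have := ln0 _ Z0; rewrite mulr2n in h2; lra.
move=> m n t m0 n0 mnZ tZ.
have [->|t0] := posnP t.
  rewrite big1 => [|i _]; last by rewrite mul0r.
  by rewrite leqn0 muln_eq0; case: m m0 {mnZ} => // m _; case: n n0.
have hu : (u t < P)%N by apply: uP; apply: (le_trans (lo _ t0)); apply: mono.
have hs : (u m + u n < P)%N.
  apply: uP; rewrite natrD.
  have mn0 : (0 < m * n)%N by rewrite muln_gt0 m0.
  apply: le_trans (mono _ _ mn0 mnZ); rewrite natrM lnM ?posrE ?ltr0n // mulrDr.
  by rewrite lerD ?lo.
rewrite -(logfl_spec m0 n0 t0 tZ) -/H -/(u m) -/(u n) -/(u t).
transitivity (P%:R^-1 * \sum_(w < (u t).+1) \sum_(k < P)
    ecx (k%:R * (((u m + u n)%N%:R - w%:R) / P%:R) : R)).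
  rewrite exchange_big mulr_sumr /=; apply: eq_bigr => k _.
  rewrite -mulrA mulr_suml; congr (_ * _); apply: eq_bigr => w _.
  by rewrite -!ecxD; congr ecx; rewrite natrD; field.
rewrite (eq_bigr (fun w : 'I_(u t).+1 =>
   if (u m + u n)%N == w then (P%:R : R[i]) else 0)); last first.
  move=> w _; apply: sum_ecx_delta => //; apply: leq_ltn_trans hu.
  by rewrite -ltnS.
rewrite -big_mkcond /=; case: leqP => h.
  rewrite (big_pred1 (Ordinal (h : (u m + u n < (u t).+1)%N))).
    by rewrite mulVf // pnatr_eq0 -lt0n.
  by move=> w /=; rewrite -val_eqE /= eq_sym.
rewrite big1 ?mulr0 // => w /eqP e; move: (ltn_ord w); rewrite -e ltnS leqNgt h.
by [].
Qed.

End Separation.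

(** * Additive large sieve in dimension two *)

Section BigLe.
Variable R : realType.

Lemma ler_sum_sub (B : eqType) (s t : seq B) (F : B -> R) :
  uniq s -> {subset s <= t} -> (forall y, y \in t -> 0 <= F y) ->
  \sum_(y <- s) F y <= \sum_(y <- t) F y.
Proof.
elim: s t => [|x s IH] t /=.
  by move=> _ _ F0; rewrite big_nil big_seq; apply: sumr_ge0.
move=> /andP[xs us] st F0; have xt : x \in t by apply: st; rewrite inE eqxx.
rewrite big_cons (perm_big _ (perm_to_rem xt)) big_cons lerD2l; apply: IH => //.
  move=> y ys; have := st y; rewrite inE ys orbT => /(_ isT).
  rewrite (perm_mem (perm_to_rem xt)) inE => /orP[/eqP e|//].
  by rewrite -e ys in xs.
by move=> y /mem_rem; apply: F0.
Qed.

(** A sum is bounded by reindexing its terms injectively into a larger sum of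
    nonnegative terms. *)
Lemma ler_sum_map (A B : eqType) (s : seq A) (t : seq B) (h : A -> B)
    (G : A -> R) (F : B -> R) :
  uniq s -> {in s &, injective h} -> (forall x, x \in s -> h x \in t) ->
  (forall x, x \in s -> G x <= F (h x)) -> (forall y, y \in t -> 0 <= F y) ->
  \sum_(x <- s) G x <= \sum_(y <- t) F y.
Proof.
move=> us ih st GF F0; apply: (@le_trans _ _ (\sum_(y <- map h s) F y)).
  by rewrite big_map [leLHS]big_seq [leRHS]big_seq; apply: ler_sum.
apply: ler_sum_sub => //; first by rewrite map_inj_in_uniq.
by move=> y /mapP[x xs ->]; apply: st.
Qed.

End BigLe.

Section LargeSieve.
Variable R : realType.

Lemma dirich_frac (L : nat) (x : R) :
  dirich L (x - (Num.floor x)%:~R) = dirich L x.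
Proof.
apply: eq_bigr => j _; rewrite mulrBr ecxD -[(j : nat)%:R]/(((j : nat)%:Z)%:~R).
by rewrite -intrM -mulrNz ecx_int mulr1.
Qed.

Lemma dirichN (L : nat) (x : R) : cabs (dirich L (- x)) = cabs (dirich L x).
Proof.
rewrite -[RHS]cabs_conj rmorph_sum; congr cabs; apply: eq_bigr => j _.
by rewrite mulrN ecxN.
Qed.

(** The index of the cell of length [1 / n0] of the circle that contains [x]. *)
Definition cellk (n0 : nat) (x : R) : nat :=
  Num.truncn (n0%:R * (x - (Num.floor x)%:~R)).

Lemma frac_itv (x : R) : 0 <= x - (Num.floor x)%:~R < 1.
Proof. by have := floor_le x; have := floorD1_gt x; rewrite intrD; lra. Qed.

Lemma cellk_lt (n0 : nat) (x : R) : (0 < n0)%N -> (cellk n0 x < n0)%N.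
Proof.
move=> n00; have n0p : (0 : R) < n0%:R by rewrite ltr0n.
have := frac_itv x => h; rewrite truncn_lt_nat; last by apply: mulr_ge0; lra.
by rewrite gtr_pMr //; lra.
Qed.

(** Points of one cell are close modulo the integers; pigeonholing by cells
    turns this into a count. *)
Lemma cellk_near (n0 : nat) (x y : R) : (0 < n0)%N -> cellk n0 x = cellk n0 y ->
  exists u : int, `|x - y - u%:~R| < n0%:R^-1.
Proof.
move=> n00; have n0p : (0 : R) < n0%:R by rewrite ltr0n.
exists (Num.floor x - Num.floor y); rewrite intrB.
have fx := frac_itv x; have fy := frac_itv y.
have := @trunc_itv R (n0%:R * (x - (Num.floor x)%:~R)) _.
have := @trunc_itv R (n0%:R * (y - (Num.floor y)%:~R)) _.
rewrite -/(cellk n0 x) -/(cellk n0 y) H -natr1.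
move: (Num.floor x)%:~R (Num.floor y)%:~R (cellk n0 y)%:R fx fy => a b c fx fy.
have h1 : 0 <= n0%:R * (y - b) by apply: mulr_ge0; lra.
have h2 : 0 <= n0%:R * (x - a) by apply: mulr_ge0; lra.
move=> /(_ h1) k1 /(_ h2) k2.
rewrite -[X in _ < X]mul1r ltr_pdivlMr // -[X in _ * X < _](gtr0_norm n0p) -normrM ltr_norml.
have -> : (x - y - (a - b)) * n0%:R = n0%:R * (x - a) - n0%:R * (y - b) by ring.
lra.
Qed.

(** [kerbd] dominates the square of the Dirichlet kernel on the [k]-th cell
    of length [1 / n0]; its shape makes its sum telescope. *)
Definition kerbd (L n0 : nat) (k : nat) : R :=
  4 * L%:R ^+ 2 / (1 + L%:R * k%:R / n0%:R) ^+ 2.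

Lemma kerbd_ge0 L n0 k : 0 <= kerbd L n0 k.
Proof. by rewrite /kerbd divr_ge0 ?sqr_ge0 // mulr_ge0 ?sqr_ge0. Qed.

Lemma kerbd_sum (L n0 n : nat) : (0 < L)%N -> (0 < n0)%N ->
  \sum_(k < n) kerbd L n0 k <= 4 * L%:R * (L%:R + n0%:R).
Proof.
move=> L0 n00; have Lp : (0 : R) < L%:R by rewrite ltr0n.
have np : (0 : R) < n0%:R by rewrite ltr0n.
case: n => [|n].
  by rewrite big_ord0; apply: mulr_ge0; [apply: mulr_ge0 | apply: addr_ge0].
suff : \sum_(k < n.+1) kerbd L n0 k <=
    4 * L%:R * (L%:R + n0%:R) - 4 * L%:R * n0%:R / (1 + L%:R * n%:R / n0%:R).
  move=> h; apply: (le_trans h); rewrite gerBl; apply: divr_ge0.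
    by rewrite !mulr_ge0.
  by apply: addr_ge0 => //; apply: divr_ge0 => //; apply: mulr_ge0.
elim: n => [|n IH].
  rewrite big_ord_recr big_ord0 /= /kerbd mulr0 mul0r addr0 expr1n add0r !divr1.
  by rewrite expr2; lra.
rewrite big_ord_recr /=; apply: (le_trans (lerD IH (lexx _))).
rewrite -!addrA lerD2l /kerbd /= -[n.+1%:R]natr1.
set a := 1 + L%:R * n%:R / n0%:R.
have -> : L%:R * (n%:R + 1) / n0%:R = L%:R * n%:R / n0%:R + L%:R / n0%:R :> R.
  by field; rewrite gt_eqF.
have a1 : 1 <= a by rewrite /a lerDl divr_ge0 // mulr_ge0.
rewrite addrA -/a; set d := L%:R / n0%:R.
have d0 : 0 < d by rewrite divr_gt0.
have -> : 4 * L%:R ^+ 2 / (a + d) ^+ 2 = 4 * L%:R * n0%:R * (d / (a + d) ^+ 2) :> R.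
  have -> : L%:R ^+ 2 = L%:R * n0%:R * d by rewrite /d; field; rewrite gt_eqF.
  by rewrite !mulrA.
have q0 : 0 <= 4 * L%:R * n0%:R :> R by rewrite !mulr_ge0.
suff : d / (a + d) ^+ 2 <= a^-1 - (a + d)^-1.
  by move=> h; rewrite addrC lerBlDr [leRHS]addrC -mulrBr; apply: ler_wpM2l.
have -> : a^-1 - (a + d)^-1 = d / (a * (a + d)).
  by field; apply/andP; split; apply: lt0r_neq0; lra.
apply: ler_wpM2l; first exact: ltW.
by rewrite lef_pV2 ?posrE ?exprn_gt0 ?mulr_gt0 //; nra.
Qed.

End LargeSieve.

Section LargeSieve.
Variable R : realType.

(** The kernel decays with the distance of the cell from [0] on the circle,
    on either side. *)
Lemma dirich_cell (L n0 : nat) (x : R) : (0 < L)%N -> (0 < n0)%N ->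
  cabs (dirich L x) ^+ 2 <=
  kerbd R L n0 (minn (cellk n0 x) (n0.-1 - cellk n0 x)).
Proof.
move=> L0 n00; have n0p : (0 : R) < n0%:R by rewrite ltr0n.
have Lp : (0 : R) < L%:R by rewrite ltr0n.
have kn := @cellk_lt R n0 x n00.
rewrite -dirich_frac; have fx := frac_itv x.
set y := x - _ in fx *; have := @trunc_itv R (n0%:R * y) _.
rewrite -/(cellk n0 x) -natr1 => /(_ _).
have ny : 0 <= n0%:R * y by apply: mulr_ge0; lra.
move=> /(_ ny) h; set k := cellk n0 x in kn h *.
set kap := minn k _.
have k1 : (kap%:R : R) <= n0%:R * y.
  by apply: (@le_trans _ _ k%:R); rewrite ?ler_nat ?geq_minl //; lra.
have k2 : (kap%:R : R) <= n0%:R * (1 - y).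
  apply: (@le_trans _ _ (n0.-1 - k)%N%:R); first by rewrite ler_nat geq_minr.
  rewrite natrB; last by lia.
  have : (n0%:R : R) = n0.-1%:R + 1 by rewrite natr1 prednK.
  by move=> e; rewrite mulrBr mulr1 {1}e; lra.
set d := cabs _; have d0 : 0 <= d by apply: cabs_ge0.
have dL : d <= L%:R by apply: dirich_le.
have dk : d * kap%:R <= n0%:R.
  have [->|kap0] := posnP kap; first by rewrite mulr0 ler0n.
  have kp : (0 : R) < kap%:R by rewrite ltr0n.
  have y1 : 0 < y by have := lt_le_trans kp k1; rewrite pmulr_rgt0.
  have := @dirich_le_inv R L y _; have -> : 0 < y < 1 by lra.
  move=> /(_ isT) h1.
  have m0 : 0 < Num.min y (1 - y) by rewrite lt_min; lra.
  have : d * Num.min y (1 - y) <= 1 by rewrite -ler_pdivlMr // div1r.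
  have : kap%:R <= n0%:R * Num.min y (1 - y) by rewrite minEle; case: ifP.
  by move: (Num.min _ _) m0 => m m0; nra.
rewrite /kerbd ler_pdivlMr; last first.
  by rewrite exprn_gt0 // ltr_wpDr // divr_ge0 ?mulr_ge0.
have -> : 4 * L%:R ^+ 2 = (2 * L%:R) ^+ 2 :> R by ring.
rewrite -exprMn lerXn2r ?nnegrE ?mulr_ge0 ?addr_ge0 ?divr_ge0 ?mulr_ge0 //.
rewrite mulrDr mulr1.
have -> : d * (L%:R * kap%:R / n0%:R) = L%:R * (d * kap%:R / n0%:R) by ring.
have : d * kap%:R / n0%:R <= 1 by rewrite ler_pdivrMr ?mul1r.
by move: (d * kap%:R / n0%:R) => z hz; nra.
Qed.

Lemma kerbd_sym_sum (L n0 : nat) : (0 < L)%N -> (0 < n0)%N ->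
  \sum_(k < n0) kerbd R L n0 (minn k (n0.-1 - k)) <= 8 * L%:R * (L%:R + n0%:R).
Proof.
move=> L0 n00; apply: (@le_trans _ _
  (\sum_(k < n0) kerbd R L n0 k + \sum_(k < n0) kerbd R L n0 (n0.-1 - k)%N)).
  rewrite -big_split /=; apply: ler_sum => k _; rewrite /minn.
  by case: ifP => _; rewrite ?lerDl ?lerDr kerbd_ge0.
have -> : \sum_(k < n0) kerbd R L n0 (n0.-1 - k)%N = \sum_(k < n0) kerbd R L n0 k.
  rewrite (reindex_inj rev_ord_inj) /=; apply: eq_bigr => k _; congr kerbd.
  by have := ltn_ord k; lia.
by have := @kerbd_sum R L n0 n0 L0 n00; lra.
Qed.

Definition ecx_diff (L : nat) (j : 'I_L * 'I_L) (x : R) : R[i] :=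
  ecx (j.1%:R * x) * (ecx (j.2%:R * x))^*%C.
Arguments ecx_diff : simpl never.

Variables (T : eqType) (S : seq T) (cm cn : T -> int) (M : nat).
Variables (I : eqType) (pts : seq I) (al be : I -> R) (n0 m0 : nat).
Hypothesis n0_gt0 : (0 < n0)%N.
Hypothesis uS : uniq S.
Hypothesis S_bound : forall x, x \in S -> (`|cm x| <= M)%N /\ (`|cn x| <= M)%N.
Hypothesis S_inj : {in S &, forall x y, cm x = cm y -> cn x = cn y -> x = y}.

Definition near_pts (i j : I) : Prop := exists u v : int,
  `|al i - al j - u%:~R| < n0%:R^-1 /\ `|be i - be j - v%:~R| < n0%:R^-1.

Hypothesis upts : uniq pts.
Hypothesis sparse : forall s : seq I, uniq s -> {subset s <= pts} ->
  {in s &, forall i j, near_pts i j} -> (size s <= m0)%N.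

Let L := (3 * M).+1.
Let w (x : R) := cabs (dirich L x) ^+ 2.
Let W i j := w (al i - al j) * w (be i - be j).
Let bnd : R := m0%:R * (8 * L%:R * (L%:R + n0%:R)) ^+ 2.

Local Lemma w_ge0 x : 0 <= w x. Proof. exact: sqr_ge0. Qed.
Local Lemma W_ge0 i j : 0 <= W i j. Proof. by rewrite mulr_ge0 ?w_ge0. Qed.

Local Lemma W_sym i j : W i j = W j i.
Proof.
by rewrite /W /w -(dirichN L (al i - _)) -(dirichN L (be i - _)) !opprB.
Qed.

(** Group the points [j] by the pair of cells of their differences with [i]:
    at most [m0] points share a pair, and the kernel bounds sum to the square
    of a one-dimensional sum. *)
Local Lemma row_bound i : \sum_(j <- pts) W i j <= bnd.
Proof.
pose g (k : 'I_n0) := kerbd R L n0 (minn k (n0.-1 - k)).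
pose ck (x : R) : 'I_n0 := Ordinal (cellk_lt x n0_gt0).
pose p j := (ck (al i - al j), ck (be i - be j)).
apply: (@le_trans _ _ (\sum_(j <- pts) g (p j).1 * g (p j).2)).
  apply: ler_sum => j _; apply: ler_pM; rewrite ?w_ge0 //; exact: dirich_cell.
rewrite (partition_big p predT) //=.
apply: (@le_trans _ _ (\sum_q m0%:R * (g q.1 * g q.2))).
  apply: ler_sum => q _.
  rewrite (eq_bigr (fun=> g q.1 * g q.2)) => [|j /eqP <- //].
  rewrite big_const_seq iter_addr_0 -[_ *+ count _ _]mulr_natl.
  apply: ler_wpM2r; first by rewrite mulr_ge0 ?kerbd_ge0.

  rewrite ler_nat -size_filter; apply: sparse.
  - exact: filter_uniq.
  - by move=> j; rewrite mem_filter => /andP[].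
  move=> j j'; rewrite !mem_filter => /andP[/eqP h1 _] /andP[/eqP h2 _].
  have := h1; rewrite -h2 => -[] /esym e1 /esym e2.
  have [u hu] := cellk_near n0_gt0 e1; have [v hv] := cellk_near n0_gt0 e2.
  exists u, v; move: hu hv.
  have -> : al i - al j' - (al i - al j) = al j - al j' by ring.
  by have -> : be i - be j' - (be i - be j) = be j - be j' by ring.
rewrite -mulr_sumr /bnd; apply: ler_wpM2l => //.
have -> : \sum_q g q.1 * g q.2 = (\sum_k g k) * (\sum_k g k).
  by rewrite big_distrlr /= pair_big.
have := @kerbd_sym_sum L n0 isT n0_gt0; rewrite expr2 => h.
by apply: ler_pM => //; apply: sumr_ge0 => k _; apply: kerbd_ge0.
Qed.

Local Notation E := (@ecx_diff L).
Let B (i : I) (x : T) : R[i] := ecx ((cm x)%:~R * al i + (cn x)%:~R * be i).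

Local Lemma E_conj j x y : E j x * (E j y)^*%C =
  ecx (j.1%:R * (x - y)) * (ecx (j.2%:R * (x - y)))^*%C.
Proof.
by rewrite /ecx_diff conjM conjcK !mulrBr !ecxD !ecxN conjM conjcK; ring.
Qed.

Local Lemma E_sum x y : \sum_j E j x * (E j y)^*%C = (w (x - y))%:C.
Proof.
rewrite /w -mul_conj /dirich conj_sum big_distrlr pair_big.
by apply: eq_bigr => j _; exact: E_conj.
Qed.

Let Phi (c : I -> R[i]) q :=
  cabs (\sum_(i <- pts) c i * (E q.1 (al i) * E q.2 (be i))) ^+ 2.

(** Expanding the square over the box of frequencies produces the kernel [W]
    at the differences of the points. *)
Local Lemma sum_Phi c : (\sum_q Phi c q)%:C =
  \sum_(i <- pts) \sum_(j <- pts) c i * (c j)^*%C * (W i j)%:C.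
Proof.
rewrite rmorph_sum.
transitivity (\sum_q \sum_(i <- pts) \sum_(j <- pts) c i * (c j)^*%C *
   ((E q.1 (al i) * (E q.1 (al j))^*%C) * (E q.2 (be i) * (E q.2 (be j))^*%C))).
  apply: eq_bigr => q _; rewrite /Phi /= -mul_conj conj_sum big_distrlr.
  apply: eq_bigr => i _; apply: eq_bigr => j _; rewrite /= (conjM (c j)) (conjM (E _ _)).
  by ring.
rewrite exchange_big; apply: eq_bigr => i _ /=.
rewrite exchange_big; apply: eq_bigr => j _ /=.
by rewrite -mulr_sumr /W rmorphM /= -!E_sum big_distrlr pair_big.
Qed.

(** Schur's test for the symmetric nonnegative matrix [W]. *)
Local Lemma sum_Phi_le c :
  \sum_q Phi c q <= bnd * \sum_(i <- pts) cabs (c i) ^+ 2.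
Proof.
apply: (@le_trans _ _ (\sum_(i <- pts) \sum_(j <- pts)
    (cabs (c i) ^+ 2 / 2 * W i j + cabs (c j) ^+ 2 / 2 * W i j))).
  have -> : \sum_q Phi c q = cabs ((\sum_q Phi c q)%:C).
    rewrite cabs_real ger0_norm //; apply: sumr_ge0 => q _; exact: sqr_ge0.
  rewrite sum_Phi; apply: cabs_sum_le => i _; apply: cabs_sum_le => j _.
  rewrite !cabsM cabs_conj cabs_real (ger0_norm (W_ge0 i j)) -mulrDl.
  apply: ler_wpM2r; first exact: W_ge0.
  have := sqr_ge0 (cabs (c i) - cabs (c j)); rewrite !expr2; lra.
under eq_bigr do rewrite big_split /=.
rewrite big_split /= [X in _ + X]exchange_big /=.
rewrite [X in _ + X](eq_bigr (fun i => \sum_(j <- pts) cabs (c i) ^+ 2 / 2 * W i j)); last first.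
  by move=> i _; apply: eq_bigr => j _; rewrite W_sym.
rewrite -big_split mulr_sumr /=; apply: ler_sum => i _.
rewrite -mulr_sumr -mulrDl -splitr mulrC ler_wpM2r ?sqr_ge0 //.
exact: row_bound.
Qed.

(** Every frequency of [S] is a difference [j1 - j2] of indices below [L] in
    at least [M + 1] ways, in each coordinate, so the square of the box
    dominates the sum over [S]. *)
Local Lemma dual_bound (c : I -> R[i]) :
  M.+1%:R ^+ 2 * \sum_(x <- S) cabs (\sum_(i <- pts) c i * B i x) ^+ 2 <=
  bnd * \sum_(i <- pts) cabs (c i) ^+ 2.
Proof.
apply: le_trans (sum_Phi_le c).
pose J := ('I_M.+1 * 'I_M.+1)%type.
have -> : M.+1%:R ^+ 2 * \sum_(x <- S) cabs (\sum_(i <- pts) c i * B i x) ^+ 2 =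
  \sum_(p <- [seq (x, st) | x <- S, st <- enum {: J}])
     cabs (\sum_(i <- pts) c i * B i p.1) ^+ 2.
  rewrite big_allpairs /= mulr_sumr; apply: eq_bigr => x _ /=.
  rewrite big_const_seq iter_addr_0 count_predT -cardE card_prod card_ord.
  by rewrite -[RHS]mulr_natl natrM expr2.
pose sh (m : int) (s : 'I_M.+1) : 'I_L * 'I_L :=
  (inord (absz (m + M%:Z + s%:Z)), inord (M + s)%N).
have shE m s : (`|m| <= M)%N -> ((sh m s).1 : nat)%:Z = m + M%:Z + s%:Z /\
     ((sh m s).2 : nat)%:Z = M%:Z + s%:Z.
  move=> h; have sM := ltn_ord s; rewrite /sh /= !inordK; last 2 first.
    - by rewrite /L; lia.
    - by rewrite /L; lia.
  by split; lia.
pose h (p : T * J) := (sh (cm p.1) p.2.1, sh (cn p.1) p.2.2).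
apply: (ler_sum_map (h := h)).
- apply: allpairs_uniq => //; first exact: enum_uniq.
  by move=> [x st] [y st'] _ _ [-> ->].
- move=> [x [s t]] [y [s' t']] /allpairsP[[x1 st1] [/= x1S _ [-> e1]]].
  move=> /allpairsP[[y1 st2] [/= y1S _ [-> e2]]] {x y}.
  have [xm xn] := S_bound x1S; have [ym yn] := S_bound y1S.
  rewrite /h /= => -[] /val_eqP/eqP /= a1 /val_eqP/eqP /= a2.
  move=> /val_eqP/eqP /= a3 /val_eqP/eqP /= a4.
  have [b1 b2] := shE _ s xm; have [b3 b4] := shE _ t xn.
  have [b5 b6] := shE _ s' ym; have [b7 b8] := shE _ t' yn.
  move: b1 b2 b3 b4 b5 b6 b7 b8; rewrite /sh /= a1 a2 a3 a4 => b1 b2 b3 b4 b5 b6 b7 b8.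
  have es : s = s' by apply: val_inj => /=; move: b2; rewrite b6; lia.
  have et : t = t' by apply: val_inj => /=; move: b4; rewrite b8; lia.
  have ex : x1 = y1.
    apply: S_inj => //; first by move: b1; rewrite b5 es; lia.
    by move: b3; rewrite b7 et; lia.
  by rewrite ex es et.
- by move=> p _; rewrite mem_index_enum.
- move=> [x [s t]] /allpairsP[[x1 st1] [/= x1S _ [-> e1]]].
  have [xm xn] := S_bound x1S.
  rewrite /Phi /h /=; set u := \sum_(i <- pts) _; set v := \sum_(i <- pts) _.
  suff -> : u = v by [].
  apply: eq_bigr => i _; congr (_ * _).
  have [b1 b2] := shE _ s xm; have [b3 b4] := shE _ t xn.
  rewrite /B /ecx_diff -!ecxN -!ecxD; congr ecx.
  have cast (n : nat) : (n%:R : R) = n%:Z%:~R by [].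
  by rewrite !cast b1 b2 b3 b4 !intrD; ring.
- by move=> q _; apply: sqr_ge0.
Qed.

(** Two-dimensional additive large sieve; the dual inequality is proved by
    majorising the box by a product of Fejer kernels, whose values at the
    differences of points are summed cell by cell. *)
Lemma large_sieve (F : T -> R[i]) :
  \sum_(i <- pts) cabs (\sum_(x <- S) F x * B i x) ^+ 2 <=
  m0%:R * (72 * (M.+1%:R + n0%:R)) ^+ 2 * \sum_(x <- S) cabs (F x) ^+ 2.
Proof.
pose s i := \sum_(x <- S) F x * B i x.
pose V := \sum_(i <- pts) cabs (s i) ^+ 2.
rewrite -/V; have V0 : 0 <= V by apply: sumr_ge0 => i _; apply: sqr_ge0.
pose b x := \sum_(i <- pts) (s i)^*%C * B i x.
have VE : V%:C = \sum_(x <- S) F x * b x.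
  rewrite rmorph_sum.
  transitivity (\sum_(i <- pts) \sum_(x <- S) F x * ((s i)^*%C * B i x)).
    apply: eq_bigr => i _; rewrite /= -mul_conj mulrC {2}/s mulr_sumr.
    by apply: eq_bigr => x _; ring.
  by rewrite exchange_big; apply: eq_bigr => x _; rewrite mulr_sumr.
have Vle : V <= \sum_(x <- S) cabs (F x) * cabs (b x).
  rewrite -[V]ger0_norm // -cabs_real VE; apply: cabs_sum_le => x _.
  by rewrite cabsM.
pose nF := \sum_(x <- S) cabs (F x) ^+ 2; pose nb := \sum_(x <- S) cabs (b x) ^+ 2.
have V2 : V ^+ 2 <= nF * nb.
  apply: le_trans (cauchy_schwarz_sq _ _ _ _).
  by rewrite lerXn2r ?nnegrE //; apply: le_trans Vle.
have nF0 : 0 <= nF by apply: sumr_ge0 => i _; apply: sqr_ge0.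
have := dual_bound (fun i => (s i)^*%C); rewrite -/nb.
under [X in _ <= _ * X]eq_bigr do rewrite cabs_conj.
rewrite -/V => hb.
rewrite -/nF.
have Mp : (0 : R) < M.+1%:R by rewrite ltr0n.
have bnd0 : 0 <= bnd by rewrite mulr_ge0 ?sqr_ge0.
have [->|Vn] := eqVneq V 0.
  by rewrite mulr_ge0 // mulr_ge0 // sqr_ge0.
have Vp : 0 < V by rewrite lt_def Vn.
have h1 : M.+1%:R ^+ 2 * V <= nF * bnd.
  rewrite -(ler_pM2r Vp) -mulrA -expr2.
  apply: (@le_trans _ _ (M.+1%:R ^+ 2 * (nF * nb))); first by rewrite ler_pM2l ?exprn_gt0.
  by rewrite mulrCA -[leRHS]mulrA; apply: ler_wpM2l.
rewrite -(@ler_pM2l _ (M.+1%:R ^+ 2)) ?exprn_gt0 //.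
apply: (le_trans h1); rewrite mulrC mulrA; apply: ler_wpM2r => //.
rewrite /bnd [leRHS]mulrCA; apply: ler_wpM2l => //.
rewrite -exprMn lerXn2r ?nnegrE ?mulr_ge0 ?addr_ge0 //.
have : (L%:R : R) <= 3 * M.+1%:R by rewrite /L -natrM ler_nat mulnS addnC -addn1 leq_add2l.
have n0p : (0 : R) <= n0%:R by [].
have : (0 : R) <= L%:R by [].
move: (L%:R : R) (n0%:R : R) n0p (M.+1%:R : R) Mp => l n n0' m mp l0 lm.
have h2 : 8 * l * (l + n) <= 8 * (3 * m) * (3 * m + n).
  by apply: ler_pM; lra.
by apply: (le_trans h2); nra.
Qed.

End LargeSieve.

(** * Projections in the group algebra of an abelian group *)

Section Group.
Variables (R : realType) (gT : finGroupType).
Hypothesis mulgC : forall x y : gT, (x * y = y * x)%g.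
Implicit Types (F G : gT -> R[i]) (H K : {group gT}) (Hs : seq {group gT}).
Implicit Types (P Q : (gT -> R[i]) -> gT -> R[i]).

Definition ip F G : R[i] := \sum_x F x * (G x)^*%C.
Definition nrm2 F : R := \sum_x cabs (F x) ^+ 2.

Lemma nrm2_ge0 F : 0 <= nrm2 F.
Proof. by apply: sumr_ge0 => x _; apply: sqr_ge0. Qed.

Lemma ip_nrm2 F : ip F F = (nrm2 F)%:C.
Proof. by rewrite rmorph_sum; apply: eq_bigr => x _; rewrite mul_conj. Qed.

Lemma cabs_ip F G : cabs (ip F G) <= Num.sqrt (nrm2 F) * Num.sqrt (nrm2 G).
Proof.
apply: (le_trans (cabs_sum _ _ _)); apply: le_trans (cauchy_schwarz _ _ _ _).
by apply: ler_sum => x _; rewrite cabsM cabs_conj.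
Qed.

Definition kerop (w : gT -> R[i]) F x := \sum_y w y * F (x * y)%g.
(** Convolution operators; on an abelian group they commute with each other
    and with translations. *)
Definition convop P := exists w, forall F x, P F x = kerop w F x.
Definition selfadj P := forall F G, ip (P F) G = ip F (P G).
Definition idemp P := forall F, P (P F) = P F.
(** Orthogonal projections in the group algebra. *)
Definition oproj P := [/\ convop P, selfadj P & idemp P].

Lemma convopC P Q F : convop P -> convop Q -> P (Q F) = Q (P F).
Proof.
move=> [v hv] [w hw]; apply/funext => x; rewrite hv hw /kerop.
transitivity (\sum_y \sum_z v y * w z * F (x * y * z)%g).
  by apply: eq_bigr => y _; rewrite hw mulr_sumr; apply: eq_bigr => z _; rewrite mulrA.
rewrite exchange_big; apply: eq_bigr => z _ /=; rewrite hv mulr_sumr.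
apply: eq_bigr => y _; rewrite mulrCA mulrA; congr (_ * F _).
by rewrite -!mulgA (mulgC y).
Qed.

Lemma convop_comp P Q : convop P -> convop Q -> convop (P \o Q).
Proof.
move=> [v hv] [w hw]; exists (fun u => \sum_y v y * w (y^-1 * u)%g) => F x /=.
rewrite hv /kerop.
transitivity (\sum_y \sum_u v y * w (y^-1 * u)%g * F (x * u)%g).
  apply: eq_bigr => y _; rewrite hw /kerop mulr_sumr.
  rewrite (reindex_inj (mulgI y^-1)%g) /=; apply: eq_bigr => u _.
  by rewrite mulrA; congr (_ * F _); rewrite -mulgA mulKVg.
by rewrite exchange_big; apply: eq_bigr => u _; rewrite mulr_suml.
Qed.

Lemma convop_sub P Q : convop P -> convop Q -> convop (fun F x => P F x - Q F x).
Proof.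
move=> [v hv] [w hw]; exists (fun u => v u - w u) => F x.
by rewrite hv hw /kerop -sumrB; apply: eq_bigr => y _; rewrite mulrBl.
Qed.

Lemma convop_id : convop (fun F x => F x).
Proof.
exists (fun u => (u == 1%g)%:R) => F x; rewrite /kerop (bigD1 1%g) //= eqxx.
by rewrite mulg1 mul1r big1 ?addr0 // => y /negbTE ->; rewrite mul0r.
Qed.

(** Commuting orthogonal projections compose to an orthogonal projection;
    commutation is automatic for convolution operators. *)
Lemma oproj_comp P Q : oproj P -> oproj Q -> oproj (P \o Q).
Proof.
move=> [cP sP iP] [cQ sQ iQ]; split; first exact: convop_comp.
  by move=> F G /=; rewrite sP sQ (convopC _ cP cQ).
by move=> F /=; rewrite -(convopC (Q F) cP cQ) iQ iP.
Qed.

Lemma oproj_id : oproj (fun F x => F x).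
Proof. by split; [exact: convop_id| |]. Qed.

Lemma ipBl F F' G : ip (fun x => F x - F' x) G = ip F G - ip F' G.
Proof. by rewrite /ip -sumrB; apply: eq_bigr => x _; rewrite mulrBl. Qed.

Lemma ipBr F G G' : ip F (fun x => G x - G' x) = ip F G - ip F G'.
Proof. by rewrite /ip -sumrB; apply: eq_bigr => x _; rewrite conjB mulrBr. Qed.

Lemma convopB P F G : convop P ->
  P (fun x => F x - G x) = (fun x => P F x - P G x).
Proof.
move=> [w hw]; apply/funext => x; rewrite !hw /kerop -sumrB.
by apply: eq_bigr => y _; rewrite mulrBr.
Qed.

Lemma oproj_compl P : oproj P -> oproj (fun F x => F x - P F x).
Proof.
move=> [cP sP iP]; split; first exact: convop_sub convop_id cP.
  by move=> F G; rewrite ipBl ipBr sP.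
by move=> F; apply/funext => x; rewrite convopB // iP subrr subr0.
Qed.

Lemma oproj_ip P F : oproj P -> ip F (P F) = (nrm2 (P F))%:C.
Proof. by move=> [_ sP iP]; rewrite -ip_nrm2 sP iP. Qed.

Lemma oproj_le P F : oproj P -> nrm2 (P F) <= nrm2 F.
Proof.
move=> oP; have h : nrm2 (P F) <= Num.sqrt (nrm2 F) * Num.sqrt (nrm2 (P F)).
  by apply: le_trans (cabs_ip _ _); rewrite oproj_ip // cabs_real ler_norm.
have [->|n0] := eqVneq (nrm2 (P F)) 0; first exact: nrm2_ge0.
have np : 0 < Num.sqrt (nrm2 (P F)) by rewrite sqrtr_gt0 lt_def n0 nrm2_ge0.
rewrite -ler_sqrt ?nrm2_ge0 // -(ler_pM2r np).
by rewrite -expr2 sqr_sqrtr ?nrm2_ge0.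
Qed.

(** The orthogonal projection onto the functions on [gT / H]. *)
Definition avg (H : {group gT}) F x : R[i] := #|H|%:R^-1 * \sum_(h in H) F (x * h)%g.

Lemma card_neq0 H : (#|H|%:R : R[i]) != 0.
Proof. by rewrite pnatr_eq0 -lt0n cardG_gt0. Qed.

Lemma avg_inv H F x k : k \in H -> avg H F (x * k)%g = avg H F x.
Proof.
move=> kH; congr (_ * _); rewrite [RHS](reindex_inj (mulgI k)) /=.
by apply: eq_big => h; rewrite ?groupMl // mulgA.
Qed.

Lemma avg_id H F x : (forall h, h \in H -> F (x * h)%g = F x) -> avg H F x = F x.
Proof.
move=> h; rewrite /avg (eq_bigr (fun=> F x)) // sumr_const -[F x *+ _]mulr_natl mulrA.
by rewrite mulVf ?mul1r // card_neq0.
Qed.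

Lemma oproj_avg H : oproj (avg H).
Proof.
split.
- exists (fun y => #|H|%:R^-1 * (y \in H)%:R) => F x.
  rewrite /avg /kerop mulr_sumr big_mkcond; apply: eq_bigr => y _.
  by case: (y \in H); rewrite ?mulr1 // mulr0 mul0r.
- move=> F G; rewrite /ip /avg.
  transitivity (\sum_(h in H) #|H|%:R^-1 * \sum_x F (x * h)%g * (G x)^*%C).
    rewrite (eq_bigr (fun x => \sum_(h in H) #|H|%:R^-1 * (F (x * h)%g * (G x)^*%C))).
      by rewrite exchange_big; apply: eq_bigr => h _; rewrite mulr_sumr.
    by move=> x _; rewrite -mulrA mulr_suml mulr_sumr.
  transitivity (\sum_(h in H) #|H|%:R^-1 * \sum_x F x * (G (x * h)%g)^*%C).
    rewrite (reindex_inj invg_inj) /=; apply: eq_big => h; first by rewrite groupV.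
    move=> _; congr (_ * _); rewrite (reindex_inj (mulIg h)) /=.
    by apply: eq_bigr => x _; rewrite mulgK.
  rewrite (eq_bigr (fun h => \sum_x #|H|%:R^-1 * (F x * (G (x * h)%g)^*%C))); last first.
    by move=> h _; rewrite mulr_sumr.
  rewrite exchange_big; apply: eq_bigr => x _ /=.
  rewrite -mulr_sumr -mulr_sumr conjM conj_sum mulrCA; congr (_ * (_ * _)).
  by rewrite conjc_inv conjc_nat.
- move=> F; apply/funext => x; apply: avg_id => h hH; exact: avg_inv.
Qed.

(** The orthogonal projection onto the complement of all functions that are
    invariant under some [H] in [Hs]. *)
Definition sieve_out Hs F : gT -> R[i] := foldl (fun F H x => F x - avg H F x) F Hs.

Lemma sieve_out_rcons Hs H F :
  sieve_out (rcons Hs H) F = fun x => sieve_out Hs F x - avg H (sieve_out Hs F) x.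
Proof. by rewrite /sieve_out foldl_rcons. Qed.

Lemma oproj_sieve Hs : oproj (sieve_out Hs).
Proof.
elim/last_ind: Hs => [|Hs H IH]; first exact: oproj_id.
have -> : sieve_out (rcons Hs H) =
    (fun F x => F x - avg H F x) \o sieve_out Hs.
  by apply/funext => F; rewrite sieve_out_rcons.
exact: oproj_comp (oproj_compl (oproj_avg H)) IH.
Qed.

Lemma avg_sieve0 Hs H F x : H \in Hs -> avg H (sieve_out Hs F) x = 0.
Proof.
elim/last_ind: Hs x => // Hs K IH x; rewrite mem_rcons inE.
have [cH _ iH] := oproj_avg H; have [cK _ iK] := oproj_avg K.
rewrite sieve_out_rcons convopB //.
have [->|nHK] := eqVneq H K; first by move=> _; rewrite iK subrr.
move=> /= HHs; rewrite IH // (convopC _ cH cK).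
have -> : avg H (sieve_out Hs F) = fun=> 0 by apply/funext => y; apply: IH.
by rewrite /avg big1 ?mulr0 ?subrr.
Qed.

(** The component of [F] that lives on [gT / H] and is orthogonal to all
    functions on [gT / K] with [K] in [Hs]. *)
Definition component Hs H F := avg H (sieve_out Hs F).

Lemma oproj_component Hs H : oproj (component Hs H).
Proof. exact: oproj_comp (oproj_avg H) (oproj_sieve Hs). Qed.

(** Telescoping: at each step the part invariant under the next subgroup is
    split off. *)
Lemma component_sum Hs F n x : (n <= size Hs)%N ->
  F x = \sum_(k < n) component (take k Hs) (nth 1%G Hs k) F x
        + sieve_out (take n Hs) F x.
Proof.
elim: n => [|n IH] h; first by rewrite big_ord0 add0r take0.
rewrite [LHS](IH (ltnW h)) big_ord_recr (take_nth 1%G h) sieve_out_rcons.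
by rewrite -addrA; congr (_ + _); rewrite /component addrC subrK.
Qed.

Lemma component_inv Hs H F x k : k \in H ->
  component Hs H F (x * k)%g = component Hs H F x.
Proof. exact: avg_inv. Qed.

Lemma avg_component0 Hs H K F x : K \in Hs -> avg K (component Hs H F) x = 0.
Proof.
move=> KHs; rewrite /component.
have [cH _ _] := oproj_avg H; have [cK _ _] := oproj_avg K.
rewrite (convopC _ cK cH) (_ : avg K _ = fun=> 0).
  by rewrite /avg big1 ?mulr0.
by apply/funext => y; rewrite avg_sieve0.
Qed.

(** If [avg H F] oscillates by at most [s], so does its part orthogonal to the
    constants, in mean square; invariance under [H] turns the mean square into a
    supremum. *)
Lemma component_low Hs H F (s : R) x : 0 <= s -> [set: gT]%G \in Hs ->
  (forall y z, cabs (avg H F y - avg H F z) <= s) ->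
  cabs (component Hs H F x) <= #|gT|%:R / #|H|%:R * s.
Proof.
move=> s0 tHs hs; set h := component Hs H F.
have [cH _ _] := oproj_avg H; have [cS _ _] := oproj_sieve Hs.
have [cT _ _] := oproj_avg [set: gT]%G.
have gp : (0 : R) < #|gT|%:R by rewrite -cardsT ltr0n; exact: (cardG_gt0 [set: gT]%G).
have Hp : (0 : R) < #|H|%:R by rewrite ltr0n cardG_gt0.
pose T := [set: gT]%G.
have hE : h = sieve_out Hs (fun y => avg H F y - avg T (avg H F) y).
  rewrite convopB // (convopC _ cS cT); apply/funext => y.
  by rewrite avg_sieve0 // subr0 (convopC _ cS cH).
have h1 : nrm2 h <= #|gT|%:R * s ^+ 2.
  rewrite hE; apply: le_trans (oproj_le _ (oproj_sieve Hs)) _.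
  have -> : #|gT|%:R * s ^+ 2 = \sum_(y in gT) s ^+ 2.
    by rewrite sumr_const mulr_natl.
  apply: ler_sum => y _.
  rewrite lerXn2r ?nnegrE ?cabs_ge0 //.
  have -> : avg H F y - avg T (avg H F) y =
      #|T|%:R^-1 * \sum_(k in T) (avg H F y - avg H F (y * k)%g).
    rewrite sumrB mulrBr; congr (_ - _).
    by rewrite sumr_const -[avg _ _ _ *+ _]mulr_natl mulrA mulVf ?mul1r // card_neq0.
  rewrite cabsM cabsV cabs_nat; apply: le_trans (_ : #|T|%:R^-1 * (#|T|%:R * s) <= s).
    apply: ler_wpM2l; first by rewrite invr_ge0.
    rewrite mulr_natl -sumr_const; apply: cabs_sum_le => k _; exact: hs.
  by rewrite mulrA mulVf ?mul1r // pnatr_eq0 -lt0n cardG_gt0.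
have h2 : #|H|%:R * cabs (h x) ^+ 2 <= nrm2 h.
  rewrite mulr_natl -sumr_const /nrm2.
  apply: (@le_trans _ _ (\sum_(k in H) cabs (h (x * k)%g) ^+ 2)).
    by apply: ler_sum => k kH; rewrite /h component_inv.
  rewrite [leRHS](reindex_inj (mulgI x)) /= [leRHS](bigID (mem H)) /= lerDl.
  by apply: sumr_ge0 => y _; apply: sqr_ge0.
have HT : (#|H|%:R : R) <= #|gT|%:R by rewrite ler_nat max_card.
rewrite -(@ler_pXn2r _ 2) ?nnegrE ?cabs_ge0 //; last first.
  by rewrite mulr_ge0 // divr_ge0 // ltW.
rewrite exprMn; apply: (@le_trans _ _ (#|gT|%:R / #|H|%:R * s ^+ 2)).
  rewrite mulrAC ler_pdivlMr // mulrC; exact: le_trans h2 h1.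
apply: ler_wpM2r; first exact: sqr_ge0.
by rewrite expr2; apply: ler_peMl; rewrite ?divr_ge0 // ler_pdivlMr ?mul1r.
Qed.

Definition gconv F G g : R[i] := \sum_x F x * G (x^-1 * g)%g.

Lemma gconvC F G : gconv F G = gconv G F.
Proof.
apply/funext => g; rewrite /gconv (reindex_inj invg_inj) /=.
rewrite (reindex_inj (mulIg g^-1)%g) /=; apply: eq_bigr => x _.
rewrite invgK invMg invgK mulrC; congr (_ * F _).
  by rewrite mulgKV.
by rewrite mulgC.
Qed.

Lemma convop_gconv P F G : convop P -> P (gconv F G) = gconv F (P G).
Proof.
move=> [w hw]; apply/funext => g; rewrite hw /kerop /gconv.
transitivity (\sum_y \sum_x w y * (F x * G (x^-1 * (g * y))%g)).
  by apply: eq_bigr => y _; rewrite mulr_sumr.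
rewrite exchange_big; apply: eq_bigr => x _ /=; rewrite hw mulr_sumr.
by apply: eq_bigr => y _; rewrite mulrCA mulgA.
Qed.

(** A projection may be applied to both factors of a convolution, which is
    then bounded by Cauchy's inequality. *)
Lemma oproj_gconv P F G g : oproj P ->
  cabs (P (gconv F G) g) <= Num.sqrt (nrm2 (P F)) * Num.sqrt (nrm2 (P G)).
Proof.
move=> [cP sP iP].
have -> : P (gconv F G) = gconv (P F) (P G).
  by rewrite -iP convop_gconv // gconvC convop_gconv // gconvC.
rewrite /gconv; pose G' x := (P G (x^-1 * g)%g)^*%C.
have -> : \sum_x P F x * P G (x^-1 * g)%g = ip (P F) G'.
  by apply: eq_bigr => x _; rewrite /G' conjcK.
apply: (le_trans (cabs_ip _ _)).
suff -> : nrm2 G' = nrm2 (P G) by [].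
rewrite /nrm2 [RHS](reindex_inj (mulIg g)) [RHS](reindex_inj invg_inj) /=.
by apply: eq_bigr => x _; rewrite /G' cabs_conj.
Qed.

Lemma convop_transl (J : Type) (s : seq J) (Q : pred J) (a : J -> R[i])
    (X : J -> gT) (G : J -> gT -> R[i]) P g : convop P ->
  P (fun x => \sum_(j <- s | Q j) a j * G j ((X j)^-1 * x)%g) g =
  \sum_(j <- s | Q j) a j * P (G j) ((X j)^-1 * g)%g.
Proof.
move=> [w hw]; rewrite hw /kerop.
transitivity (\sum_y \sum_(j <- s | Q j) a j * (w y * G j ((X j)^-1 * (g * y))%g)).
  by apply: eq_bigr => y _; rewrite mulr_sumr; apply: eq_bigr => j _; rewrite mulrCA.
rewrite exchange_big; apply: eq_bigr => j _ /=; rewrite hw mulr_sumr.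
by apply: eq_bigr => y _; rewrite mulgA.
Qed.

Lemma convop_lin (J : Type) (s : seq J) (a : J -> R[i])
    (G : J -> gT -> R[i]) P g : convop P ->
  P (fun x => \sum_(j <- s) a j * G j x) g = \sum_(j <- s) a j * P (G j) g.
Proof.
move=> [w hw]; rewrite hw /kerop.
transitivity (\sum_y \sum_(j <- s) a j * (w y * G j (g * y)%g)).
  by apply: eq_bigr => y _; rewrite mulr_sumr; apply: eq_bigr => j _; rewrite mulrCA.
by rewrite exchange_big; apply: eq_bigr => j _ /=; rewrite hw mulr_sumr.
Qed.

End Group.

(** * Imaginary quadratic orders *)

(** The ring of integers of an imaginary quadratic field of class number one,
    described by a Z-basis [1, om]; [qt] and [qn] are the trace and the norm of
    [om]. *)
Record quadOrder (O : comNzRingType) := QuadOrder {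
  om : O;
  qt : int;
  qn : int;
  disc_neg : qt ^+ 2 < 4 * qn;
  om_sq : om ^+ 2 = qt%:~R * om - qn%:~R;
  co1 : O -> int;
  co2 : O -> int;
  coE : forall x, x = (co1 x)%:~R + (co2 x)%:~R * om;
  co_free : forall m n : int, m%:~R + n%:~R * om = 0 -> m = 0 /\ n = 0;
  quad_pid : forall I : set O, nz_ideal I -> exists a, I = principal_ideal a
}.

Section Norm.
Variables (O : comNzRingType) (Q : quadOrder O).
Implicit Types x y z r d : O.
Let w := om Q.
Let t := qt Q.
Let n := qn Q.
Let c1 := co1 Q.
Let c2 := co2 Q.

Lemma co_eq (a b : int) x : x = a%:~R + b%:~R * w -> c1 x = a /\ c2 x = b.
Proof.
move=> h; have := @co_free O Q (c1 x - a) (c2 x - b) _.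
have -> : (c1 x - a)%:~R + (c2 x - b)%:~R * w = 0.
  rewrite !intrB mulrBl addrACA -opprD -h {3}(coE Q x).
  by rewrite subrr.
move=> /(_ erefl)[/eqP + /eqP]; rewrite !subr_eq0 => /eqP -> /eqP ->.
by [].
Qed.

Lemma coD x y : c1 (x + y) = c1 x + c1 y /\ c2 (x + y) = c2 x + c2 y.
Proof.
by apply: co_eq; rewrite {1}(coE Q x) {1}(coE Q y) !intrD mulrDl addrACA.
Qed.

Lemma coN x : c1 (- x) = - c1 x /\ c2 (- x) = - c2 x.
Proof. by apply: co_eq; rewrite {1}(coE Q x) !mulrNz mulNr opprD. Qed.

Lemma coM x y : c1 (x * y) = c1 x * c1 y - n * (c2 x * c2 y) /\
  c2 (x * y) = c1 x * c2 y + c2 x * c1 y + t * (c2 x * c2 y).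
Proof.
apply: co_eq; rewrite {1}(coE Q x) {1}(coE Q y) -/w -/(c1 x) -/(c1 y) -/(c2 x) -/(c2 y).
move: (c1 x) (c2 x) (c1 y) (c2 y) => a b c d.
have -> : (a%:~R + b%:~R * w) * (c%:~R + d%:~R * w) =
  a%:~R * c%:~R + (a%:~R * d%:~R + b%:~R * c%:~R) * w + b%:~R * d%:~R * w ^+ 2.
  by rewrite expr2; ring.
rewrite (om_sq Q) -/t -/n -/w !(intrD, intrM, intrB); ring.
Qed.

Lemma co0 : c1 0 = 0 /\ c2 0 = 0.
Proof. by apply: co_eq; rewrite mul0r addr0. Qed.

Lemma co_1 : c1 1 = 1 /\ c2 1 = 0.
Proof. by apply: co_eq; rewrite mul0r addr0. Qed.

Lemma co_int (m : int) : c1 m%:~R = m /\ c2 m%:~R = 0.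
Proof. by apply: co_eq; rewrite mul0r addr0. Qed.

Lemma co_inj x y : c1 x = c1 y -> c2 x = c2 y -> x = y.
Proof. by move=> h1 h2; rewrite (coE Q x) (coE Q y) -/(c1 x) h1 -/(c2 x) h2. Qed.

Definition nmz x : int := co1 Q x ^+ 2 + qt Q * (co1 Q x * co2 Q x) + qn Q * co2 Q x ^+ 2.
Definition nm x : nat := absz (nmz x).

(** Completing the square; the discriminant being negative, the norm form is
    positive definite. *)
Lemma nmz_sq x : 4 * nmz x = (2 * c1 x + t * c2 x) ^+ 2 + (4 * n - t ^+ 2) * c2 x ^+ 2.
Proof. by rewrite /nmz -/c1 -/c2 -/t -/n; ring. Qed.

Lemma disc_ge1 : 1 <= 4 * n - t ^+ 2.
Proof. by have := disc_neg Q; rewrite -/n -/t; lia. Qed.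

Lemma nmz_ge0 x : 0 <= nmz x.
Proof.
have := nmz_sq x; have := disc_ge1; have := sqr_ge0 (2 * c1 x + t * c2 x).
have := sqr_ge0 (c2 x); move: (c2 x ^+ 2) (_ ^+ 2) (4 * n - _) => a b c; nia.
Qed.

Lemma nmE x : (nm x)%:Z = nmz x.
Proof. by rewrite /nm gez0_abs ?nmz_ge0. Qed.

Lemma nmzM x y : nmz (x * y) = nmz x * nmz y.
Proof.
rewrite /nmz -/c1 -/c2 -/t -/n; have [-> ->] := coM x y.
move: (c1 x) (c2 x) (c1 y) (c2 y) => a b c d; ring.
Qed.

Lemma nmM x y : nm (x * y) = (nm x * nm y)%N.
Proof. by rewrite /nm nmzM abszM. Qed.

Lemma nm_eq0 x : (nm x == 0)%N = (x == 0).
Proof.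
apply/idP/idP => [/eqP h|/eqP ->]; last first.
  by rewrite /nm /nmz -/c1 -/c2; have [-> ->] := co0; rewrite !mul0r !mulr0.
have h0 : nmz x = 0 by rewrite -nmE h.
have := nmz_sq x; rewrite h0 mulr0; have := disc_ge1.
have := sqr_ge0 (2 * c1 x + t * c2 x); have := sqr_ge0 (c2 x) => h1 h2 h3 h4.
have h5 : c2 x ^+ 2 = 0 by move: h1 h2 h3 h4; move: (_ ^+ 2) (_ ^+ 2) (4 * n - _) => a b c; nia.
have e2 : c2 x = 0 by apply/eqP; rewrite -sqrf_eq0 h5.
have h6 : (2 * c1 x) ^+ 2 = 0.
  by move: h4; rewrite e2 mulr0 addr0 expr0n /= mulr0 addr0 => ->.
have e1 : c1 x = 0 by apply/eqP; move/eqP: h6; rewrite sqrf_eq0; lia.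
by rewrite (coE Q x) -/(c1 x) -/(c2 x) e1 e2 mul0r addr0.
Qed.

Lemma nm_gt0 x : (0 < nm x)%N = (x != 0).
Proof. by rewrite lt0n nm_eq0. Qed.

Lemma nm1 : nm 1 = 1%N.
Proof. by rewrite /nm /nmz -/c1 -/c2; have [-> ->] := co_1; rewrite !mulr0. Qed.

Lemma quad_mulf_eq0 x y : (x * y == 0) = (x == 0) || (y == 0).
Proof. by rewrite -!nm_eq0 nmM muln_eq0. Qed.

Lemma quad_mulf_neq0 x y : x != 0 -> y != 0 -> x * y != 0.
Proof. by move=> hx hy; rewrite quad_mulf_eq0 negb_or hx hy. Qed.

Lemma quad_mulfI r x y : r != 0 -> r * x = r * y -> x = y.
Proof.
move=> r0 /eqP; rewrite -subr_eq0 -mulrBr quad_mulf_eq0 (negbTE r0) subr_eq0.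
by move=> /eqP.
Qed.

(** The conjugate of [x], in coordinates; [x * cj x] is the norm of [x]. *)
Definition cj x : O := (co1 Q x + qt Q * co2 Q x)%:~R - (co2 Q x)%:~R * om Q.

Lemma co_cj x : c1 (cj x) = c1 x + t * c2 x /\ c2 (cj x) = - c2 x.
Proof. by apply: co_eq; rewrite mulrNz mulNr. Qed.

Lemma mul_cj x : x * cj x = (nm x)%:R.
Proof.
have [h1 h2] := coM x (cj x); have [k1 k2] := co_cj x.
rewrite -[(nm x)%:R]/((nm x)%:Z%:~R) nmE; apply: co_inj.
  rewrite h1 k1 k2 (co_int _).1 /nmz -/c1 -/c2 -/t -/n.
  by move: (c1 x) (c2 x) => a b; ring.
rewrite h2 k1 k2 (co_int _).2; move: (c1 x) (c2 x) => a b; ring.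
Qed.

Lemma nm_cj x : nm (cj x) = nm x.
Proof.
rewrite /nm; congr absz; rewrite /nmz -/c1 -/c2 -/t -/n; have [-> ->] := co_cj x.
by move: (c1 x) (c2 x) => a b; ring.
Qed.

Lemma cjM x y : cj (x * y) = cj x * cj y.
Proof.
apply: co_inj; rewrite ?(co_cj _).1 ?(co_cj _).2 ?(coM _ _).1 ?(coM _ _).2
  ?(co_cj _).1 ?(co_cj _).2.
  by move: (c1 x) (c2 x) (c1 y) (c2 y) => a b c d; ring.
by move: (c1 x) (c2 x) (c1 y) (c2 y) => a b c d; ring.
Qed.

(** [nm] is equivalent to the square of the sup norm of the coordinates. *)
(** Bounds the coordinates of an element by the square root of its norm. *)
Definition coK : nat := (2 + absz (qt Q))%N.
Definition nmK : nat := (1 + absz (qt Q) + absz (qn Q))%N.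

Lemma nm_le_co x (B : nat) : (absz (c1 x) <= B)%N -> (absz (c2 x) <= B)%N ->
  (nm x <= nmK * B ^ 2)%N.
Proof.
move=> h1 h2; rewrite /nm /nmz -/c1 -/c2 -/t -/n /nmK -/t -/n.
apply: (@leq_trans (absz (c1 x ^+ 2)%R + absz (t * (c1 x * c2 x))%R + absz (n * c2 x ^+ 2)%R)%N).
  by move: (c1 x ^+ 2) (t * _) (n * _) => a b c; lia.
rewrite (abszM t) (abszM (c1 x)) (abszM n) !abszX !mulnDl mul1n; apply: leq_add; last first.
  by rewrite leq_mul2l leq_exp2r // h2 orbT.
by apply: leq_add; rewrite ?leq_exp2r // leq_mul2l expnS expn1 leq_mul ?orbT.
Qed.

Lemma co_le_nm x : (absz (c1 x) ^ 2 <= coK ^ 2 * nm x)%N /\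
  (absz (c2 x) ^ 2 <= coK ^ 2 * nm x)%N.
Proof.
have hs := nmz_sq x; have d1 := disc_ge1; have e := nmE x.
have tt : coK%:Z = 2 + `|t| by rewrite /coK PoszD -/t.
have c2s : c2 x ^+ 2 <= 4 * nmz x.
  rewrite hs; have := sqr_ge0 (2 * c1 x + t * c2 x); have := sqr_ge0 (c2 x).
  by move: (c2 x ^+ 2) (_ ^+ 2) (4 * n - _) d1 => a b c; nia.
have c1s : (2 * c1 x + t * c2 x) ^+ 2 <= 4 * nmz x.
  rewrite hs lerDl mulr_ge0 ?sqr_ge0 //; lia.
have cast (a : int) : (absz a ^ 2)%N%:Z = a ^+ 2 by rewrite PoszM expr2 abszE -normrM ger0_norm // -expr2 sqr_ge0.
have castK : (coK ^ 2 * nm x)%N%:Z = (2 + `|t|) ^+ 2 * nmz x by rewrite PoszM e -mulnn PoszM tt expr2.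
have N0 := nmz_ge0 x.
split; rewrite -lez_nat cast castK; last first.
  apply: (le_trans c2s); apply: ler_wpM2r => //.
  have -> : (2 + `|t|) ^+ 2 = 4 + (4 * `|t| + `|t| ^+ 2) by ring.
  by rewrite lerDl addr_ge0 ?mulr_ge0 ?sqr_ge0.
have h : (2 * c1 x) ^+ 2 <= 4 * (1 + `|t|) ^+ 2 * nmz x.
  (* (u - v) ^ 2 <= (1 + s) u ^ 2 + (1 + 1 / s) v ^ 2, cleared of denominators *)
  have -> : 2 * c1 x = (2 * c1 x + t * c2 x) - t * c2 x by ring.
  set v := c2 x; set u := 2 * c1 x + t * v.
  have tv : (t * v) ^+ 2 = `|t| ^+ 2 * v ^+ 2 by rewrite exprMn real_normK // num_real.
  have uv : - (2 * u * (t * v)) <= `|t| * (u ^+ 2 + v ^+ 2).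
    apply: le_trans (ler_norm _) _.
    have -> : - (2 * u * (t * v)) = - (t * (2 * (u * v))) by ring.
    rewrite normrN normrM; apply: ler_wpM2l => //; rewrite ler_norml.
    have := sqr_ge0 (u + v); have := sqr_ge0 (u - v); rewrite !expr2; lia.
  have -> : (u - t * v) ^+ 2 = u ^+ 2 + - (2 * u * (t * v)) + (t * v) ^+ 2 by ring.
  rewrite tv.
  have k2 : `|t| * (u ^+ 2 + v ^+ 2) <= `|t| * (4 * nmz x + 4 * nmz x).
    by apply: ler_wpM2l => //; apply: lerD.
  have k3 : `|t| ^+ 2 * v ^+ 2 <= `|t| ^+ 2 * (4 * nmz x).
    by apply: ler_wpM2l => //; rewrite sqr_ge0.
  have -> : 4 * (1 + `|t|) ^+ 2 * nmz x = 4 * nmz x +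
    `|t| * (4 * nmz x + 4 * nmz x) + `|t| ^+ 2 * (4 * nmz x) by ring.
  by rewrite !lerD // (le_trans uv k2).
have h' : c1 x ^+ 2 <= (1 + `|t|) ^+ 2 * nmz x.
  by move: h; rewrite exprMn -mulrA -[2 ^+ 2]/(4 : int) ler_pM2l.
apply: (le_trans h'); apply: ler_wpM2r => //.
by rewrite lerXn2r ?nnegrE ?addr_ge0 // lerD2r.
Qed.

End Norm.

(** * Points of bounded norm, divisibility, residues *)

Section Ball.
Variables (O : comNzRingType) (Q : quadOrder O).
Implicit Types x y z r d a b q : O.
Local Notation nm := (nm Q).
Local Notation w := (om Q).
Local Notation c1 := (co1 Q).
Local Notation c2 := (co2 Q).
Local Notation coK := (coK Q).
Local Notation nmK := (nmK Q).

Definition irange (B : nat) : seq int := [seq i%:Z - B%:Z | i <- iota 0 (2 * B).+1].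

Lemma mem_irange B (m : int) : (absz m <= B)%N -> m \in irange B.
Proof.
move=> h; apply/mapP; exists (absz (m + B%:Z)); last by lia.
by rewrite mem_iota; lia.
Qed.

(** The elements of norm at most [k], cut out of a box that certainly
    contains them. *)
Definition nball (k : nat) : seq O :=
  undup [seq z <- [seq i%:~R + j%:~R * w | i <- irange (coK * k), j <- irange (coK * k)]
        | (nm z <= k)%N].

Lemma nball_uniq k : uniq (nball k). Proof. exact: undup_uniq. Qed.

Lemma mem_nball k x : (x \in nball k) = (nm x <= k)%N.
Proof.
rewrite mem_undup mem_filter andb_idr // => h.
have [h1 h2] := co_le_nm Q x.
have kk (c : nat) : (c ^ 2 <= coK ^ 2 * nm x)%N -> (c <= coK * k)%N.
  move=> hc; rewrite -(@leq_exp2r _ _ 2) // expnMn; apply: (leq_trans hc).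
  rewrite leq_mul2l; apply/orP; right; apply: (leq_trans h).
  by case: (k) => // k'; rewrite expnS expn1 leq_pmulr.
apply/allpairsP; exists (c1 x, c2 x); split; last exact: coE.
  by apply: mem_irange; exact: kk.
by apply: mem_irange; exact: kk.
Qed.

Lemma nat_sqrt_ex (k : nat) : exists s, (s ^ 2 <= k < s.+1 ^ 2)%N.
Proof.
elim: k => [|k [s /andP[h1 h2]]]; first by exists 0%N.
have [h|h] := leqP (s.+1 ^ 2) k.+1; last by exists s; rewrite h (leq_trans h1).
exists s.+1; rewrite h /=; apply: (leq_ltn_trans h2).
by rewrite ltn_exp2r.
Qed.

Lemma nball_coords k : (0 < k)%N -> exists M : nat,
  (M.+1 ^ 2 <= 16 * coK ^ 2 * k)%N /\
  forall x, x \in nball k -> (absz (c1 x) <= M)%N /\ (absz (c2 x) <= M)%N.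
Proof.
move=> k0; have [s /andP[h1 h2]] := nat_sqrt_ex k.
have s0 : (0 < s)%N by case: s h1 h2 => // _; case: k k0 => [//|[|k]].
have K0 : (2 <= coK)%N by rewrite /coK.
exists (coK * s.+1)%N; split.
  apply: (@leq_trans ((4 * coK * s) ^ 2)).
    by rewrite leq_exp2r //; nia.
  by rewrite !expnMn leq_mul2l h1 orbT.
move=> x; rewrite mem_nball => hx; have [k1 k2] := co_le_nm Q x.
have kk (c : nat) : (c ^ 2 <= coK ^ 2 * nm x)%N -> (c <= coK * s.+1)%N.
  move=> hc; rewrite -(@leq_exp2r _ _ 2) // expnMn; apply: (leq_trans hc).
  by rewrite leq_mul2l (leq_trans hx) ?orbT // ltnW.
by split; apply: kk.
Qed.

Lemma size_coords (M : nat) (s : seq O) : uniq s ->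
  (forall x, x \in s -> (absz (c1 x) <= M)%N /\ (absz (c2 x) <= M)%N) ->
  (size s <= (2 * M).+1 ^ 2)%N.
Proof.
move=> us h.
have -> : ((2 * M).+1 ^ 2)%N = size [seq (i, j) | i <- irange M, j <- irange M].
  by rewrite size_allpairs !size_map !size_iota mulnn.
rewrite -(size_map (fun x => (c1 x, c2 x))); apply: uniq_leq_size.
  by rewrite map_inj_uniq // => x y [] /co_inj h1 /h1.
move=> p /mapP[x xs ->]; have [h1 h2] := h x xs.
by apply/allpairsP; exists (c1 x, c2 x); split=> //; apply: mem_irange.
Qed.

Definition ballC : nat := (64 * coK ^ 2)%N.

Lemma size_nball k : (0 < k)%N -> (size (nball k) <= ballC * k)%N.
Proof.
move=> k0; have [M [h1 h2]] := nball_coords k0.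
apply: (leq_trans (size_coords (nball_uniq k) h2)).
apply: (@leq_trans (4 * M.+1 ^ 2)).
  by rewrite -[4%N]/(2 ^ 2)%N -expnMn leq_exp2r //; lia.
by rewrite /ballC; nia.
Qed.

(** The coordinate box of side the square root of [k / nmK] already lies in
    [nball k]. *)
Lemma size_nball_ge k : (k <= nmK * size (nball k))%N.
Proof.
have K0 : (0 < nmK)%N by rewrite /nmK.
have [s /andP[h1 h2]] := nat_sqrt_ex (k %/ nmK).
apply: (@leq_trans (nmK * s.+1 ^ 2)).
  by have := divn_eq k nmK; have := ltn_pmod k K0; nia.
rewrite leq_mul2l; apply/orP; right.
pose l := [seq i%:Z%:~R + j%:Z%:~R * w | i <- iota 0 s.+1, j <- iota 0 s.+1].
have -> : (s.+1 ^ 2)%N = size l by rewrite size_allpairs !size_iota mulnn.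
apply: uniq_leq_size.
  apply: allpairs_uniq; rewrite ?iota_uniq // => -[i j] [i' j'] _ _ /= h.
  have [e1 e2] := co_eq (erefl (i%:Z%:~R + j%:Z%:~R * w)).
  have [e3 e4] := co_eq h; move: e3 e4; rewrite e1 e2 => -[->] [->].
  by [].
move=> x /allpairsP[[i j] [hi hj ->]]; rewrite mem_nball.
move: hi hj; rewrite !mem_iota !ltnS [_.1]/= [_.2]/= => hi hj.
have [e1 e2] := co_eq (erefl (i%:Z%:~R + j%:Z%:~R * w)).
apply: (@leq_trans (nmK * s ^ 2)).
  by apply: nm_le_co; rewrite ?e1 ?e2.
by have := leq_trunc_div k nmK; nia.
Qed.

Definition dvq d x : bool := `[< exists y, x = d * y >].

Lemma dvqP d x : reflect (exists y, x = d * y) (dvq d x).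
Proof. exact: asboolP. Qed.

Lemma dvq_mulr d x : dvq d (d * x). Proof. by apply/dvqP; exists x. Qed.
Lemma dvqq d : dvq d d. Proof. by rewrite -{2}[d]mulr1 dvq_mulr. Qed.
Lemma dvq0 d : dvq d 0. Proof. by rewrite -(mulr0 d) dvq_mulr. Qed.

Lemma dvq_trans d x y : dvq d x -> dvq x y -> dvq d y.
Proof. by move=> /dvqP[u ->] /dvqP[v ->]; rewrite -mulrA dvq_mulr. Qed.

Lemma dvq_mull d x y : dvq d x -> dvq d (x * y).
Proof. by move=> /dvqP[u ->]; rewrite -mulrA dvq_mulr. Qed.

Lemma dvq_mulR d x y : dvq d y -> dvq d (x * y).
Proof. by rewrite mulrC; apply: dvq_mull. Qed.

Lemma dvqD d x y : dvq d x -> dvq d y -> dvq d (x + y).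
Proof. by move=> /dvqP[u ->] /dvqP[v ->]; rewrite -mulrDr dvq_mulr. Qed.

Lemma dvqN d x : dvq d x -> dvq d (- x).
Proof. by move=> /dvqP[u ->]; rewrite -mulrN dvq_mulr. Qed.

Lemma dvqB d x y : dvq d x -> dvq d y -> dvq d (x - y).
Proof. by move=> h1 h2; apply: dvqD => //; apply: dvqN. Qed.

Lemma dvqC d x y : dvq d (x - y) = dvq d (y - x).
Proof. by apply/idP/idP => /dvqN; rewrite opprB. Qed.

Lemma dvq_congr d x y : dvq d (x - y) -> dvq d x = dvq d y.
Proof.
move=> h; apply/idP/idP => k; last by rewrite -(subrK y x) dvqD.
by rewrite -(subKr x y) dvqB.
Qed.

Lemma dvq_subtrans d x y z : dvq d (x - y) -> dvq d (y - z) -> dvq d (x - z).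
Proof. by move=> h1 h2; rewrite -(subrK y x) -addrA; apply: dvqD. Qed.

Lemma dvq_nm_le d x : x != 0 -> dvq d x -> (nm d <= nm x)%N.
Proof.
move=> x0 /dvqP[y e]; rewrite e nmM leq_pmulr // nm_gt0.
by apply: contra x0 => /eqP y0; rewrite e y0 mulr0.
Qed.

Lemma dvq_neq0 d x : x != 0 -> dvq d x -> d != 0.
Proof. by move=> x0 /dvqP[y e]; apply: contra x0 => /eqP d0; rewrite e d0 mul0r. Qed.

Lemma dvq_pmul2l r d x : r != 0 -> dvq (r * d) (r * x) = dvq d x.
Proof.
move=> r0; apply/dvqP/dvqP => -[y e]; exists y; last by rewrite e mulrA.
by apply: (quad_mulfI Q r0); rewrite e mulrA.
Qed.

Lemma dvq_small d x : dvq d x -> (nm x < nm d)%N -> x = 0.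
Proof.
move=> h; have [-> //|x0] := eqVneq x 0.
by rewrite ltnNge dvq_nm_le.
Qed.

Lemma nm1_unit x : nm x = 1%N -> exists y, x * y = 1.
Proof. by move=> h; exists (cj Q x); rewrite mul_cj h. Qed.

Lemma nm1_dvq x y : nm x = 1%N -> dvq x y.
Proof. by move=> /nm1_unit[u h]; apply/dvqP; exists (u * y); rewrite mulrA h mul1r. Qed.

(** A generator of the ideal spanned by [a] and [b]. *)
Lemma bezout a b : b != 0 -> exists g u v a' b',
  [/\ g = a * u + b * v, a = g * a' & b = g * b'].
Proof.
move=> b0; pose I : set O := [set z | exists u v, z = a * u + b * v]%classic.
have [|g hg] := quad_pid Q (I := I).
  split; last by exists b => //; exists 0, 1; rewrite mulr0 mulr1 add0r.
  split.
  - by exists 0, 0; rewrite !mulr0 addr0.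
  - by move=> x y [u [v ->]] [u' [v' ->]]; exists (u + u'), (v + v'); ring.
  - by move=> c x [u [v ->]]; exists (c * u), (c * v); ring.
have : I g by rewrite hg; exists 1; rewrite ?mulr1.
have : I a by exists 1, 0; rewrite mulr1 mulr0 addr0.
have : I b by exists 0, 1; rewrite mulr1 mulr0 add0r.
rewrite {1 2}hg => -[b' _ eb] [a' _ ea] [u [v eg]].
by exists g, u, v, a', b'; split.
Qed.

Definition cop q a : bool := `[< exists x z, a * x + q * z = 1 >].

Lemma copP q a : reflect (exists x z, a * x + q * z = 1) (cop q a).
Proof. exact: asboolP. Qed.

Lemma coprime_toE q a : coprime_to (principal_ideal q) a <-> cop q a.
Proof.
split=> [[x [y [[z _ <-] e]]]|/copP[x [z e]]]; first by apply/copP; exists x, z.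
by exists x, (q * z); split=> //; exists z.
Qed.

Lemma copC q a : cop q a = cop a q.
Proof. by apply/copP/copP => -[x [z e]]; exists z, x; rewrite addrC. Qed.

Lemma cop1 q : cop q 1.
Proof. by apply/copP; exists 1, 0; rewrite mulr1 mulr0 addr0. Qed.

Lemma cop_mul q a b : cop q a -> cop q b -> cop q (a * b).
Proof.
move=> /copP[x [z e]] /copP[x' [z' e']]; apply/copP.
exists (x * x'), (a * x * z' + z * b * x' + q * z * z').
by rewrite -[RHS]mulr1 -{1}e -e'; ring.
Qed.

Lemma cop_dvl q a b : dvq a b -> cop q b -> cop q a.
Proof.
by move=> /dvqP[u ->] /copP[x [z e]]; apply/copP; exists (u * x), z; rewrite mulrA.
Qed.

Lemma cop_dvr q r a : dvq r q -> cop q a -> cop r a.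
Proof. by move=> h; rewrite ![cop _ a]copC; apply: cop_dvl. Qed.

Lemma cop_mulE q r a : cop (q * r) a = cop q a && cop r a.
Proof.
apply/idP/andP => [h|[h1 h2]].
  split; first exact: cop_dvr (dvq_mulr q r) h.
  by apply: cop_dvr h; rewrite mulrC dvq_mulr.
by rewrite copC; apply: cop_mul; rewrite copC.
Qed.

Lemma cop_congr q a b : dvq q (a - b) -> cop q a = cop q b.
Proof.
have key x y : dvq q (x - y) -> cop q x -> cop q y.
  move=> /dvqP[u e] /copP[v [z e']]; apply/copP; exists v, (u * v + z).
  by rewrite -e' mulrDr mulrA -e; ring.
by move=> h; apply/idP/idP; apply: key => //; rewrite dvqC.
Qed.

Lemma cop_gauss q a x : cop q a -> dvq q (a * x) -> dvq q x.
Proof.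
move=> /copP[u [z e]] h; rewrite -[x]mul1r -e mulrDl; apply: dvqD.
  by rewrite mulrAC; apply: dvq_mull.
by rewrite -mulrA dvq_mulr.
Qed.

Lemma cop_inv q a : cop q a -> exists b, cop q b /\ dvq q (a * b - 1).
Proof.
move=> /copP[x [z e]]; exists x; split; last first.
  by rewrite -e opprD addNKr dvqN // dvq_mulr.
by apply/copP; exists a, z; rewrite mulrC.
Qed.

Lemma not_cop_dvq q a : q != 0 -> ~~ cop q a ->
  exists g, [/\ nm g != 1%N, dvq g q & dvq g a].
Proof.
move=> q0 h; have [g [u [v [a' [b' [eg ea eb]]]]]] := bezout a q0.
exists g; split; [|by rewrite eb dvq_mulr|by rewrite ea dvq_mulr].
apply: contra h => /eqP /nm1_unit [y ey]; apply/copP; exists (u * y), (v * y).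
by rewrite !mulrA -mulrDl -eg.
Qed.

(** A choice of one element in each residue class, the same for all members
    of the class. *)
Definition rep r x : O := xget 0 [set y | dvq r (y - x)]%classic.

Lemma rep_mod r x : dvq r (rep r x - x).
Proof.
rewrite /rep; apply: (@xgetPex _ 0 [set y | dvq r (y - x)]%classic).
by exists x; rewrite /= subrr dvq0.
Qed.

Lemma rep_eq r x y : dvq r (x - y) -> rep r x = rep r y.
Proof.
move=> h; rewrite /rep; congr (xget 0 _); apply/seteqP; split => z /= k.
  exact: dvq_subtrans k h.
by apply: dvq_subtrans k _; rewrite dvqC.
Qed.

Lemma rep_eqE r x y : (rep r x == rep r y) = dvq r (x - y).
Proof.
apply/eqP/idP => [h|/rep_eq //]; apply: (@dvq_subtrans _ _ (rep r x)).
  by rewrite dvqC rep_mod.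
by rewrite h rep_mod.
Qed.

Lemma rep_idem r x : rep r (rep r x) = rep r x.
Proof. by apply: rep_eq; apply: rep_mod. Qed.

(** Rounding the coordinates of [x / r] gives a remainder of small norm,
    though not always smaller than [nm r]. *)
Lemma divq_ex r x : r != 0 -> exists y, (nm (x - r * y)%R <= nmK * nm r)%N.
Proof.
move=> r0; have D0 : (0 < nm r)%N by rewrite nm_gt0.
pose D := (nm r)%:Z; pose z := x * cj Q r.
pose y : O := (c1 z %/ D)%Z%:~R + (c2 z %/ D)%Z%:~R * w; exists y.
have [y1 y2] := co_eq (erefl y : y = (c1 z %/ D)%Z%:~R + (c2 z %/ D)%Z%:~R * w).
have e : (x - r * y) * cj Q r = z - D%:~R * y.
  by rewrite mulrBl -/z mulrAC mul_cj.
have eD u : c1 (D%:~R * u) = D * c1 u /\ c2 (D%:~R * u) = D * c2 u.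
  have [-> ->] := coM Q D%:~R u; have [-> ->] := co_int Q D.
  by rewrite !mul0r !mulr0 subr0 !addr0.
have DD : D != 0 by rewrite /D; lia.
have f1 : (absz (c1 (z - D%:~R * y)) <= nm r)%N.
  rewrite (coD Q _ _).1 (coN Q _).1 (eD _).1 y1 {1}(divz_eq (c1 z) D) mulrC addrAC subrr add0r.
  by have := modz_ge0 (c1 z) DD; have := ltz_mod (c1 z) DD; rewrite /D; lia.
have f2 : (absz (c2 (z - D%:~R * y)) <= nm r)%N.
  rewrite (coD Q _ _).2 (coN Q _).2 (eD _).2 y2 {1}(divz_eq (c2 z) D) mulrC addrAC subrr add0r.
  by have := modz_ge0 (c2 z) DD; have := ltz_mod (c2 z) DD; rewrite /D; lia.
have := nm_le_co f1 f2; rewrite -e nmM nm_cj expnS expn1 mulnA leq_pmul2r //.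
Qed.

Definition Rep r : seq O := undup [seq rep r x | x <- nball (nmK * nm r)].

Lemma Rep_uniq r : uniq (Rep r). Proof. exact: undup_uniq. Qed.

Lemma mem_Rep r x : r != 0 -> rep r x \in Rep r.
Proof.
move=> r0; rewrite mem_undup; have [y h] := divq_ex x r0.
apply/mapP; exists (x - r * y); first by rewrite mem_nball.
by apply: rep_eq; rewrite subKr dvq_mulr.
Qed.

Lemma Rep_id r x : x \in Rep r -> rep r x = x.
Proof. by rewrite mem_undup => /mapP[y _ ->]; rewrite rep_idem. Qed.

Lemma Rep_inj r x y : x \in Rep r -> y \in Rep r -> dvq r (x - y) -> x = y.
Proof. by move=> /Rep_id {2}<- /Rep_id {2}<- /rep_eq. Qed.

(** A map that is injective on classes permutes a finite system of residues. *)
Lemma Rep_reindex (V : nmodType) r (h : O -> V) (phi : O -> O) (P : pred O) : r != 0 ->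
  (forall x y, dvq r (x - y) -> h x = h y) ->
  (forall x, P x -> P (rep r (phi x))) ->
  (forall x y, P x -> P y -> dvq r (phi x - phi y) -> dvq r (x - y)) ->
  \sum_(x <- Rep r | P x) h (phi x) = \sum_(x <- Rep r | P x) h x.
Proof.
move=> r0 per hP inj.
have -> : \sum_(x <- Rep r | P x) h (phi x) =
    \sum_(x <- map (fun x => rep r (phi x)) (seq.filter P (Rep r))) h x.
  rewrite big_map big_filter; apply: eq_bigr => x _; apply: per.
  by rewrite dvqC rep_mod.
rewrite -[RHS]big_filter; apply: perm_big.
set l := map _ _.
have ul : uniq l.
  rewrite map_inj_in_uniq ?filter_uniq ?Rep_uniq // => x y.
  rewrite !mem_filter => /andP[px xR] /andP[py yR] /eqP; rewrite rep_eqE.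
  by move=> /(inj _ _ px py); apply: Rep_inj.
have sl : {subset l <= seq.filter P (Rep r)}.
  move=> z /mapP[x]; rewrite mem_filter => /andP[px _] ->.
  by rewrite mem_filter hP //= mem_Rep.
apply: uniq_perm => //; first by rewrite filter_uniq ?Rep_uniq.
have hs : (size (seq.filter P (Rep r)) <= size l)%N by rewrite size_map.
by case: (uniq_min_size ul sl hs).
Qed.

Definition repC : nat := (ballC * nmK)%N.

Lemma size_Rep r : r != 0 -> (size (Rep r) <= repC * nm r)%N.
Proof.
move=> r0; apply: (leq_trans (size_undup _)); rewrite size_map.
by rewrite /repC -mulnA; apply: size_nball; rewrite muln_gt0 nm_gt0 r0 andbT /nmK.
Qed.

Lemma nm_para x y : (nm (x - y)%R <= 2 * (nm x + nm y))%N.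
Proof.
have : nmz Q (x - y) + nmz Q (x + y) = 2 * (nmz Q x + nmz Q y).
  rewrite /nmz !(coD Q _ _).1 !(coD Q _ _).2 !(coN Q _).1 !(coN Q _).2.
  move: (c1 x) (c2 x) (c1 y) (c2 y) => a b c d; ring.
by rewrite -!nmE; lia.
Qed.

(** Elements of norm less than [nm r / 4] are pairwise incongruent modulo
    [r], since their differences have norm below [nm r]. *)
Lemma size_Rep_ge r : r != 0 -> (nm r <= 8 * nmK * size (Rep r))%N.
Proof.
move=> r0; have n0 : (0 < nm r)%N by rewrite nm_gt0.
pose k := ((nm r).-1 %/ 4)%N.
have hk : (4 * k < nm r)%N by have := leq_trunc_div (nm r).-1 4; rewrite /k; lia.
have hk2 : (nm r <= 4 * k + 4)%N.
  by have := divn_eq (nm r).-1 4; have := ltn_pmod (nm r).-1 (isT : 0 < 4)%N; rewrite /k; lia.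
have h : (size (nball k) <= size (Rep r))%N.
  rewrite -(size_map (rep r)); apply: uniq_leq_size.
    rewrite map_inj_in_uniq ?nball_uniq // => x y; rewrite !mem_nball => hx hy /eqP.
    rewrite rep_eqE => /dvq_small h; apply/eqP; rewrite -subr_eq0; apply/eqP/h.
    by have := nm_para x y; lia.
  by move=> z /mapP[x _ ->]; apply: mem_Rep.
have := size_nball_ge k; have R0 : (0 < size (Rep r))%N.
  by have := mem_Rep 0 r0; case: (Rep r).
have K0 : (0 < nmK)%N by rewrite /nmK.
nia.
Qed.

End Ball.

(** * Primes and divisors *)

Section Primes.
Variables (O : comNzRingType) (Q : quadOrder O).
Implicit Types x y z r d a b q p s : O.
Local Notation nm := (nm Q).

Definition dvs x : seq O := [seq d <- nball Q (nm x) | dvq d x].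
(** The number of elements, not of ideals, that divide [x]; the difference is
    a bounded factor. *)
Definition tau x : nat := size (dvs x).

Lemma mem_dvs x d : x != 0 -> (d \in dvs x) = dvq d x.
Proof.
move=> x0; rewrite mem_filter mem_nball andb_idr //; exact: dvq_nm_le.
Qed.

Lemma dvs_uniq x : uniq (dvs x). Proof. by rewrite filter_uniq ?nball_uniq. Qed.

(** A divisor of [x * y] is, by means of the greatest common divisor with
    [x], the product of a divisor of [x] and a divisor of [y]. *)
Lemma tau_mul x y : x != 0 -> y != 0 -> (tau (x * y) <= tau x * tau y)%N.
Proof.
move=> x0 y0; rewrite /tau -(size_allpairs (fun a b : O => a * b)).
apply: uniq_leq_size; first exact: dvs_uniq.
have xy0 := quad_mulf_neq0 Q x0 y0.
move=> d; rewrite mem_dvs // => /dvqP[e ed].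
have d0 : d != 0.
  by apply: contra xy0 => /eqP d0; rewrite ed d0 mul0r.
have [g [u [v [x' [d' [eg ex ed']]]]]] := bezout Q x d0.
apply/allpairsP; exists (g, d') => /=; split => //.
  by rewrite mem_dvs // ex dvq_mulr.
have g0 : g != 0 by apply: contra d0 => /eqP g0; rewrite ed' g0 mul0r.
have e1 : x' * u + d' * v = 1.
  by apply: (quad_mulfI Q g0); rewrite mulr1 mulrDr !mulrA -ex -ed'.
have c : cop d' x' by apply/copP; exists u, v.
rewrite mem_dvs //; apply: (cop_gauss c); apply/dvqP; exists e.
by apply: (quad_mulfI Q g0); rewrite !mulrA -ex -ed'.
Qed.

Definition qprime p := [/\ nm p != 1%N, p != 0 &
  forall a b, dvq p (a * b) -> dvq p a || dvq p b].

(** A nonunit divisor of least norm is prime. *)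
Lemma qprime_dvd x : x != 0 -> nm x != 1%N -> exists2 p, qprime p & dvq p x.
Proof.
move: {2}(nm x) (leqnn (nm x)) => k; elim: k x => [|k IH] x hk x0 x1.
  by move: hk; rewrite leqn0 nm_eq0 (negbTE x0).
have [[d [dx d1 dlt]]|h] := pselect (exists d, [/\ dvq d x, nm d != 1%N & (nm d < nm x)%N]).
  have d0 := dvq_neq0 x0 dx.
  have [p pp pd] := IH d (leq_trans dlt hk) d0 d1.
  by exists p => //; apply: dvq_trans dx.
exists x; last exact: dvqq.
split=> // a b hab; apply/orP; have [|nxa] := boolP (dvq x a); first by left.
right; have [g [u [v [a' [x' [eg ea ex]]]]]] := bezout Q a x0.
have gx : dvq g x by rewrite ex dvq_mulr.
have [g1|g1] := eqVneq (nm g) 1%N.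
  have [y ey] := nm1_unit g1; apply: (cop_gauss (a := a)) => //.
  by apply/copP; exists (u * y), (v * y); rewrite !mulrA -mulrDl -eg.
have [hg|hg] := ltnP (nm g) (nm x); first by case: h; exists g; split.
have : nm x' = 1%N.
  move: hg; rewrite {1}ex nmM; have g0 := dvq_neq0 x0 gx.
  have x'0 : x' != 0 by apply: contra x0 => /eqP e; rewrite ex e mulr0.
  by move: g0 x'0; rewrite -!(nm_gt0 Q); nia.
move=> /nm1_unit[y ey]; case/negP: nxa; rewrite ea; apply/dvqP; exists (y * a').
by rewrite ex mulrA -(mulrA g) ey mulr1.
Qed.

(** Pairwise nonassociated primes. *)
Definition indep (ps : seq O) :=
  (forall p, p \in ps -> qprime p) /\
  pairwise (fun p p' => ~~ dvq p p' && ~~ dvq p' p) ps.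

Lemma indep_cons p ps : indep (p :: ps) ->
  [/\ qprime p, forall p', p' \in ps -> ~~ dvq p p' & indep ps].
Proof.
move=> [h1 /=/andP[/allP h2 h3]]; split; first by apply: h1; rewrite inE eqxx.
  by move=> p' /h2 /andP[].
by split=> // p' p'ps; apply: h1; rewrite inE p'ps orbT.
Qed.

Definition prodq (ps : seq O) : O := \prod_(p <- ps) p.

Lemma prodq_cons p ps : prodq (p :: ps) = p * prodq ps.
Proof. by rewrite /prodq big_cons. Qed.

Lemma dvq_prodq p ps : p \in ps -> dvq p (prodq ps).
Proof.
elim: ps => // p' ps IH; rewrite inE prodq_cons => /orP[/eqP ->|/IH].
  exact: dvq_mulr.
exact: dvq_mulR.
Qed.

Lemma prime_ndvd_prodq p ps : qprime p -> (forall p', p' \in ps -> ~~ dvq p p') ->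
  ~~ dvq p (prodq ps).
Proof.
move=> [p1 p0 hp]; elim: ps => [|p' ps IH] h.
  rewrite /prodq big_nil; apply: contra p1 => /dvqP[y e].
  by have := nm1 Q; rewrite e nmM => /eqP; rewrite muln_eq1 => /andP[].
rewrite prodq_cons; apply/negP => /hp /orP[]; first by apply/negP/h; rewrite inE eqxx.
by apply/negP/IH => p'' h'; apply: h; rewrite inE h' orbT.
Qed.

Lemma prodq_dvd ps x : indep ps -> (forall p, p \in ps -> dvq p x) -> dvq (prodq ps) x.
Proof.
elim: ps => [|p ps IH] hi h; first by rewrite /prodq big_nil (nm1_dvq (Q := Q)) ?nm1.
have [pp npd hi'] := indep_cons hi.
have /dvqP[y e] : dvq (prodq ps) x by apply: IH => // p' h'; apply: h; rewrite inE h' orbT.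
have : dvq p x by apply: h; rewrite inE eqxx.
have [_ _ hp] := pp.
rewrite e => /hp /orP[]; first by rewrite (negbTE (prime_ndvd_prodq pp npd)).
by move=> /dvqP[z ->]; rewrite prodq_cons mulrA (mulrC p) dvq_mulr.
Qed.

(** [ps] is a set of representatives of the primes dividing [s]. *)
Definition prime_support s (ps : seq O) :=
  [/\ indep ps, forall p, p \in ps -> dvq p s &
      forall p, qprime p -> dvq p s -> exists2 p', p' \in ps & dvq p' p].

Lemma qprime_sym p p' : qprime p -> qprime p' -> dvq p p' -> dvq p' p.
Proof.
move=> [p1 p0 _] [p'1 p'0 hp'] /dvqP[u e].
have : dvq p' (p * u) by rewrite -e dvqq.
move=> /hp' /orP[//|/dvqP[v ev]]; exfalso; move/negP: p1; apply.
have : nm p' = (nm p * nm p' * nm v)%N by rewrite -!nmM -mulrA -ev -e.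
move: p'0; rewrite -(nm_gt0 Q) => h1 h2.
have : (nm p * nm v == 1)%N by rewrite -(eqn_pmul2l h1) muln1 mulnA (mulnC (nm p')) -h2.
by rewrite muln_eq1 => /andP[].
Qed.

Lemma prime_support_ex s : s != 0 -> exists ps, prime_support s ps.
Proof.
move=> s0.
have key (l : seq O) : (forall p, p \in l -> qprime p) ->
    exists ps, [/\ indep ps, {subset ps <= l} &
      forall p, p \in l -> exists2 p', p' \in ps & dvq p' p].
  elim: l => [|p l IH] hl; first by exists [::].
  have [|ps [h1 h2 h3]] := IH; first by move=> p' h'; apply: hl; rewrite inE h' orbT.
  have pp : qprime p by apply: hl; rewrite inE eqxx.
  have [/hasP[p' p'ps hp']|/hasPn hn] := boolP (has (fun p' => dvq p' p) ps).
    exists ps; split=> //; first by move=> x /h2 h; rewrite inE h orbT.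
    by move=> x; rewrite inE => /orP[/eqP ->|/h3 //]; exists p'.
  exists (p :: ps); split.
  - case: h1 => h11 h12; split.
      by move=> x; rewrite inE => /orP[/eqP ->|/h11].
    rewrite /= h12 andbT; apply/allP => x xps; rewrite hn // andbT.
    by apply: contra (hn _ xps) => /(qprime_sym pp (h11 _ xps)).
  - by move=> x; rewrite !inE => /orP[->//|/h2 ->]; rewrite orbT.
  - move=> x; rewrite inE => /orP[/eqP ->|/h3 [p' h' hd]].
      by exists p; [rewrite inE eqxx | exact: dvqq].
    by exists p'; rewrite // inE h' orbT.
pose l := [seq p <- dvs s | `[< qprime p >]].
have [|ps [h1 h2 h3]] := key l; first by move=> p; rewrite mem_filter => /andP[/asboolP].
exists ps; split=> //.
  by move=> p /h2; rewrite mem_filter mem_dvs // => /andP[].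
by move=> p pp ps'; apply: h3; rewrite mem_filter mem_dvs // ps' andbT; apply/asboolP.
Qed.

Lemma qprime_ncop p s x : qprime p -> dvq p s -> dvq p x -> ~~ cop s x.
Proof.
move=> [p1 _ _] ps px; apply: contra p1 => /copP[u [v e]].
have : dvq p 1 by rewrite -e; apply: dvqD; apply: dvq_mull.
by move=> /dvqP[y ey]; have := nm1 Q; rewrite ey nmM => /eqP; rewrite muln_eq1 => /andP[].
Qed.

Lemma cop_support s ps x : s != 0 -> prime_support s ps ->
  cop s x = all (fun p => ~~ dvq p x) ps.
Proof.
move=> s0 [[h1 h1'] h2 h3]; apply/idP/allP => [h p pps|h].
  by apply: contraL h => px; apply: (qprime_ncop (h1 _ pps)) => //; apply: h2.
apply/negPn/negP => nc; have [g [g1 gs gx]] := not_cop_dvq Q s0 nc.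
have [p pp pg] := qprime_dvd (dvq_neq0 s0 gs) g1.
have [p' p'ps p'p] := h3 p pp (dvq_trans pg gs).
by have := h _ p'ps; rewrite (dvq_trans p'p) // (dvq_trans pg).
Qed.

(** Products over distinct subsets of the prime support are distinct
    divisors. *)
Lemma pow2_le_tau s ps : s != 0 -> prime_support s ps -> (2 ^ size ps <= tau s)%N.
Proof.
move=> s0 [hi h2 _]; have hd := prodq_dvd hi h2.
have key (l : seq O) : indep l -> exists D : seq O,
   [/\ uniq D, size D = (2 ^ size l)%N & forall d, d \in D -> dvq d (prodq l)].
  elim: l => [|p l IH] hl.
    by exists [:: 1]; split=> // d; rewrite inE => /eqP ->; rewrite (nm1_dvq (Q := Q)) ?nm1.
  have [pp npd hl'] := indep_cons hl; have [D [D1 D2 D3]] := IH hl'.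
  have p0 : p != 0 by case: pp.
  exists (D ++ map (fun d => p * d) D); split.
  - rewrite cat_uniq D1 map_inj_uniq ?D1 ?andbT /=; last first.
      by move=> x y; apply: quad_mulfI p0.
    apply/hasPn => _ /mapP[d dD ->]; apply/negP => /D3 h.
    have := prime_ndvd_prodq pp npd; rewrite (dvq_trans _ h) ?dvq_mulr //.
  - by rewrite size_cat size_map D2 /= expnS mul2n addnn.
  - move=> d; rewrite mem_cat prodq_cons => /orP[/D3 h|/mapP[e eD ->]].
      exact: dvq_mulR.
    by rewrite (dvq_pmul2l Q) //; apply: D3.
have [D [D1 D2 D3]] := key ps hi.
rewrite -D2; apply: uniq_leq_size => // d /D3 h.
by rewrite mem_dvs //; apply: dvq_trans hd.
Qed.

(** Induction on the primes: unless [p] divides [r], adding [prodq ps] to [y]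
    moves the [y] excluded by [p] injectively into those that it keeps, and
    does not affect the other primes. *)
Lemma count_sieve r s ps : s != 0 -> indep ps -> (forall p, p \in ps -> dvq p s) ->
  (size (Rep Q s) <= 2 ^ size ps *
     count (fun y => all (fun p => ~~ dvq p (1 + r * y)) ps) (Rep Q s))%N.
Proof.
move=> s0; elim: ps => [|p ps IH] hi hs.
  by rewrite expn0 mul1n -(count_predT (Rep Q s)); apply: sub_count.
have [pp npd hi'] := indep_cons hi; have [_ _ hp] := pp.
have hs' p' : p' \in ps -> dvq p' s by move=> h; apply: hs; rewrite inE h orbT.
have hps : dvq p s by apply: hs; rewrite inE eqxx.
apply: (leq_trans (IH hi' hs')); rewrite /= expnS -[leqRHS]mulnA [leqRHS]mulnCA leq_mul2l.
apply/orP; right.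
set A := fun y : O => all (fun p0 => ~~ dvq p0 (1 + r * y)) ps.
have -> : count A (Rep Q s) = (count (fun y => dvq p (1 + r * y)%R && A y) (Rep Q s) +
    count (fun y => ~~ dvq p (1 + r * y)%R && A y) (Rep Q s))%N.
  rewrite -[LHS]size_filter -(count_predC (fun y => dvq p (1 + r * y))).
  by rewrite !count_filter.
rewrite mul2n -addnn leq_add2r -!size_filter.
have [pr|npr] := boolP (dvq p r).
  rewrite -[X in (X <= _)%N]/(size _) size_filter.
  rewrite (eq_count (a2 := pred0)) ?count_pred0 // => y /=.
  apply/negbTE/negP => /andP[h _]; have : dvq p 1.
    by rewrite (dvq_congr (y := 1 + r * y)) // opprD addrA subrr add0r; apply: dvqN; apply: dvq_mull.
  by move=> /dvqP[z ez]; have := nm1 Q; rewrite ez nmM => /eqP; rewrite muln_eq1; case: pp => /negbTE ->.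
pose phi y := rep s (y + prodq ps).
have shift (p' y : O) : dvq p' s -> dvq p' (1 + r * phi y - (1 + r * (y + prodq ps))).
  move=> h; rewrite opprD addrACA subrr add0r -mulrBr; apply: dvq_mulR.
  exact: dvq_trans h (rep_mod _ _).
rewrite -(size_map phi); apply: uniq_leq_size.
  rewrite map_inj_in_uniq ?filter_uniq ?Rep_uniq // => x y.
  rewrite !mem_filter => /andP[_ xR] /andP[_ yR] /eqP; rewrite rep_eqE.
  by rewrite opprD addrACA subrr addr0; apply: Rep_inj xR yR.
move=> z /mapP[y]; rewrite !mem_filter => /andP[/andP[py /allP Ay] yR] ->.
rewrite mem_Rep // andbT; apply/andP; split.
  rewrite (dvq_congr (shift p y hps)); apply/negP => h.
  have : dvq p (r * prodq ps).
    have -> : r * prodq ps = (1 + r * (y + prodq ps)) - (1 + r * y) by ring.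
    exact: dvqB.
  by move=> /hp /orP[|]; rewrite ?(negbTE npr) // (negbTE (prime_ndvd_prodq pp npd)).
apply/allP => p' p'ps; rewrite (dvq_congr (shift p' y (hs' _ p'ps))).
rewrite (dvq_congr (y := 1 + r * y)) ?Ay //.
have -> : 1 + r * (y + prodq ps) - (1 + r * y) = r * prodq ps by ring.
by rewrite dvq_mulR // dvq_prodq.
Qed.

End Primes.

(** * Units modulo an element *)

(** The unit group of [O / q], carried by a system of representatives. *)
Section UnitGroup.
Variables (O : comNzRingType) (Q : quadOrder O) (q : O).
Hypothesis q0 : q != 0.
Implicit Types x y r : O.

Definition unitReps : seq O := [seq x <- Rep Q q | cop q x].
Definition unitq (_ : q != 0) : Type := seq_sub unitReps.
HB.instance Definition _ := Finite.on (unitq q0).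
Local Notation gT := (unitq q0).

Definition lift (u : gT) : O := ssval u.

Lemma lift_cop u : cop q (lift u).
Proof. by have := ssvalP u; rewrite mem_filter => /andP[]. Qed.

Lemma unitReps1 : rep q 1 \in unitReps.
Proof. by rewrite mem_filter mem_Rep // andbT (cop_congr (rep_mod q 1)) cop1. Qed.

(** The class of [x]; the class of [1] is the default value when [x] is not
    coprime to [q]. *)
Definition toU x : gT := insubd (SeqSub unitReps1 : gT) (rep q x).

Lemma lift_toU x : cop q x -> lift (toU x) = rep q x.
Proof.
move=> cx; rewrite /lift /toU; apply: (@insubdK _ _ (unitq q0)).
by rewrite mem_filter mem_Rep // (cop_congr (rep_mod q x)) cx.
Qed.

Lemma lift_inj : injective lift. Proof. exact: val_inj. Qed.

Lemma toU_lift u : toU (lift u) = u.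
Proof.
apply: lift_inj; rewrite lift_toU ?lift_cop // (@Rep_id _ Q) //.
by have := ssvalP u; rewrite mem_filter => /andP[].
Qed.

Lemma toU_mod x : cop q x -> dvq q (lift (toU x) - x).
Proof. by move=> h; rewrite lift_toU // rep_mod. Qed.

Lemma toU_eqP x y : cop q x -> cop q y -> (toU x == toU y) = dvq q (x - y).
Proof. by move=> hx hy; rewrite -(inj_eq lift_inj) !lift_toU // rep_eqE. Qed.

Lemma toU_eq x y : cop q x -> cop q y -> dvq q (x - y) -> toU x = toU y.
Proof. by move=> hx hy h; apply/eqP; rewrite toU_eqP. Qed.

Lemma dvq_mulB (d x y x' y' : O) : dvq d (x - x') -> dvq d (y - y') -> dvq d (x * y - x' * y').
Proof.
move=> h1 h2; have -> : x * y - x' * y' = (x - x') * y + x' * (y - y') by ring.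
by apply: dvqD; [apply: dvq_mull|apply: dvq_mulR].
Qed.

Definition umul (u v : gT) : gT := toU (lift u * lift v).
Definition uinv (u : gT) : gT := toU (xget 1 [set b | cop q b /\ dvq q (lift u * b - 1)]%classic).

Lemma uinv_spec u : let b := xget 1 [set b | cop q b /\ dvq q (lift u * b - 1)]%classic in
  cop q b /\ dvq q (lift u * b - 1).
Proof.
by apply: (@xgetPex _ 1 [set b | cop q b /\ dvq q (lift u * b - 1)]%classic);
  apply: cop_inv; apply: lift_cop.
Qed.

Lemma umulA : associative umul.
Proof.
move=> u v z; apply: toU_eq; rewrite ?cop_mul ?lift_cop //.
have h a b : dvq q (lift (umul a b) - lift a * lift b).
  by apply: toU_mod; rewrite cop_mul ?lift_cop.
apply: (@dvq_subtrans _ _ _ (lift u * lift v * lift z)).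
  by rewrite -mulrA; apply: dvq_mulB; rewrite ?subrr ?dvq0.
by rewrite dvqC; apply: dvq_mulB; rewrite ?subrr ?dvq0.
Qed.

Lemma umul1 : left_id (toU 1) umul.
Proof.
move=> u; rewrite -[RHS]toU_lift; apply: toU_eq; rewrite ?cop_mul ?lift_cop //.
rewrite -{2}[lift u]mul1r; apply: dvq_mulB; rewrite ?subrr ?dvq0 //.
by apply: toU_mod; apply: cop1.
Qed.

Lemma umulV : left_inverse (toU 1) uinv umul.
Proof.
move=> u; apply: toU_eq; rewrite ?cop_mul ?lift_cop ?cop1 //.
have [h1 h2] := uinv_spec u; apply: dvq_subtrans h2; rewrite mulrC.
by apply: dvq_mulB; rewrite ?subrr ?dvq0 //; apply: toU_mod.
Qed.

HB.instance Definition _ := Finite_isGroup.Build (unitq q0) umulA umul1 umulV.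

Lemma umulE (u v : gT) : (u * v)%g = toU (lift u * lift v). Proof. by []. Qed.

Lemma toU1 : toU 1 = 1%g :> gT. Proof. by []. Qed.

Lemma umulC (u v : gT) : (u * v = v * u)%g.
Proof. by rewrite !umulE mulrC. Qed.

Lemma toUM x y : cop q x -> cop q y -> toU (x * y) = (toU x * toU y)%g.
Proof.
move=> hx hy; rewrite umulE; apply: toU_eq; rewrite ?cop_mul ?lift_cop //.
by apply: dvq_mulB; rewrite dvqC toU_mod.
Qed.

Lemma liftM (u v : gT) : dvq q (lift (u * v)%g - lift u * lift v).
Proof. by apply: toU_mod; rewrite cop_mul ?lift_cop. Qed.

Lemma sum_unitq (V : nmodType) (F : O -> V) (P : pred O) :
  \sum_(u : gT | P (lift u)) F (lift u) = \sum_(x <- Rep Q q | cop q x && P x) F x.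
Proof.
have -> : \sum_(u : gT | P (lift u)) F (lift u) =
    \sum_(x <- map lift (index_enum gT) | P x) F x by rewrite big_map.
rewrite -big_filter_cond; apply: perm_big; apply: uniq_perm.
- by rewrite map_inj_uniq ?index_enum_uniq //; exact: lift_inj.
- by rewrite filter_uniq ?Rep_uniq.
move=> x; apply/mapP/idP => [[u _ ->]|h]; first exact: ssvalP.
exists (toU x); first exact: mem_index_enum.
by move: h; rewrite mem_filter => /andP[cx xR]; rewrite lift_toU // (@Rep_id _ Q).
Qed.

Lemma card_unitq : #|{: gT}| = size unitReps.
Proof.
rewrite -sum1_card (sum_unitq (fun=> 1%N) predT).
by rewrite (eq_bigl (cop q)) => [|x]; rewrite ?andbT // -big_filter sum1_size.
Qed.

(** The kernel of reduction to [O / r], for [r] dividing [q]. *)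
Definition kerU_set r : {set gT} := [set u | dvq r q ==> dvq r (lift u - 1)].

Lemma kerU_group_set r : group_set (kerU_set r).
Proof.
have lq (u : gT) x : dvq r q -> dvq q (lift u - x) -> dvq r (lift u - x) by apply: dvq_trans.
apply/group_setP; split.
  rewrite inE; apply/implyP => h; apply: lq => //; exact: toU_mod (cop1 _).
move=> u v; rewrite !inE => /implyP hu /implyP hv; apply/implyP => h.
apply: (@dvq_subtrans _ _ _ (lift u * lift v)); first by apply: lq => //; exact: liftM.
by rewrite -[X in _ - X](mulr1 1); apply: dvq_mulB; [apply: hu|apply: hv].
Qed.
Canonical kerU r : {group gT} := Group (kerU_group_set r).

Lemma mem_kerU r (u v : gT) : dvq r q ->
  ((u^-1 * v)%g \in kerU r) = dvq r (lift v - lift u).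
Proof.
move=> rq; rewrite inE rq /=.
have lr a b : dvq q (a - b) -> dvq r (a - b) by apply: dvq_trans.
have h1 : dvq r (lift u * lift (u^-1 * v)%g - lift v).
  have : dvq r (lift (u * (u^-1 * v))%g - lift u * lift (u^-1 * v)%g) by apply: lr; exact: liftM.
  by rewrite mulKVg dvqC.
apply/idP/idP => h.
  apply: (@dvq_subtrans _ _ _ (lift u * lift (u^-1 * v)%g)); first by rewrite dvqC.
  by rewrite -{2}[lift u]mulr1 -mulrBr; apply: dvq_mulR.
apply: (@cop_gauss _ _ (lift u)); first by apply: cop_dvr rq (lift_cop u).
rewrite mulrBr mulr1; exact: dvq_subtrans h1 h.
Qed.

Lemma sum_coset (V : nmodType) r (u : gT) (F : gT -> V) : dvq r q ->
  \sum_(h in kerU r) F (u * h)%g = \sum_(v | dvq r (lift v - lift u)) F v.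
Proof.
move=> rq; rewrite [RHS](reindex_inj (mulgI u)) /=; apply: eq_bigl => h.
by rewrite -mem_kerU // mulKg.
Qed.

Lemma card_coset r (u : gT) : dvq r q ->
  #|[pred v | dvq r (lift v - lift u)]| = #|kerU r|.
Proof. by move=> rq; rewrite -!sum1_card -(sum_coset u (fun=> 1%N) rq). Qed.

Lemma card_unitq_le r : dvq r q -> r != 0 -> (#|{: gT}| <= size (Rep Q r) * #|kerU r|)%N.
Proof.
move=> rq r0; rewrite -[X in (X <= _)%N]sum1_card.
apply: (@leq_trans (\sum_(u : gT) \sum_(x <- Rep Q r | rep r (lift u) == x) 1)%N).
  apply: leq_sum => u _; rewrite (big_rem (rep r (lift u))) ?mem_Rep //= eqxx.
  by rewrite leq_addr.
rewrite (exchange_big_dep predT) //=.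
apply: (@leq_trans (\sum_(x <- Rep Q r) #|kerU r|)%N); last first.
  by rewrite big_const_seq iter_addn_0 count_predT mulnC.
apply: leq_sum => x _; rewrite sum1_card.
case: (pickP [pred u : gT | rep r (lift u) == x]) => [u /= /eqP <-|h]; last first.
  by rewrite (eq_card h) card0.
rewrite -(card_coset u rq) subset_leq_card //.
apply/fintype.subsetP => v hv; change (is_true (dvq r (lift v - lift u))).
by rewrite -rep_eqE; exact: hv.
Qed.

(** Elements of the kernel are the classes [1 + r * y] prime to [q]; it
    suffices to keep them prime to the primes of [s], which [count_sieve]
    bounds from below. *)
Lemma card_kerU_ge r s ps : q = r * s -> prime_support Q s ps ->
  (size (Rep Q s) <= 2 ^ size ps * #|kerU r|)%N.
Proof.
move=> qE hps; have rq : dvq r q by rewrite qE dvq_mulr.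
have r0 : r != 0 by apply: contra q0 => /eqP e; rewrite qE e mul0r.
have s0 : s != 0 by apply: contra q0 => /eqP e; rewrite qE e mulr0.
have [hi h2 _] := hps.
apply: (leq_trans (count_sieve r s0 hi h2)); rewrite leq_mul2l; apply/orP; right.
have c1 y : all (fun p => ~~ dvq p (1 + r * y)) ps -> cop q (1 + r * y).
  rewrite -(cop_support _ s0 hps) => h; rewrite qE cop_mulE h andbT.
  by apply/copP; exists 1, (- y); ring.
rewrite -size_filter -(size_map (fun y => toU (1 + r * y))) cardE.
apply: uniq_leq_size.
  rewrite map_inj_in_uniq ?filter_uniq ?Rep_uniq // => x y.
  rewrite !mem_filter => /andP[/c1 cx xR] /andP[/c1 cy yR] /eqP; rewrite toU_eqP //.
  have -> : 1 + r * x - (1 + r * y) = r * (x - y) by ring.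
  by rewrite qE (dvq_pmul2l Q) //; apply: Rep_inj xR yR.
move=> u /mapP[y]; rewrite mem_filter => /andP[/c1 cy _] ->.
rewrite mem_enum inE rq /=; apply: (@dvq_subtrans _ _ _ (1 + r * y)).
  by apply: dvq_trans rq _; apply: toU_mod.
by rewrite addrAC subrr add0r dvq_mulr.
Qed.

End UnitGroup.

(** * Additive characters *)

Section AdditiveCharacters.
Variables (R : realType) (O : comNzRingType) (Q : quadOrder O).
Implicit Types x y z r d a q s : O.
Local Notation nm := (nm Q).
Local Notation c1 := (co1 Q).
Local Notation c2 := (co2 Q).
Local Notation Rep := (Rep Q).

(** The coordinate of [x / r] along [om]: the trace form attached to the
    inverse different, so that [ecx (Lq _ r)] is a nondegenerate additive
    character of [O / r]. *)
Definition Lq x r : R := (c2 (x * cj Q r))%:~R / (nm r)%:R.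

Lemma LqD x y r : Lq (x + y) r = Lq x r + Lq y r.
Proof. by rewrite /Lq mulrDl (coD Q _ _).2 intrD mulrDl. Qed.

Lemma LqN x r : Lq (- x) r = - Lq x r.
Proof. by rewrite /Lq mulNr (coN Q _).2 mulrNz mulNr. Qed.

Lemma LqB x y r : Lq (x - y) r = Lq x r - Lq y r.
Proof. by rewrite LqD LqN. Qed.

Lemma c2_intM (m : int) x : c2 (m%:~R * x) = m * c2 x.
Proof. by rewrite (coM Q _ _).2 (co_int Q m).1 (co_int Q m).2 !mul0r mulr0 !addr0. Qed.

Lemma Lq_scale d x r : d != 0 -> Lq (d * x) (d * r) = Lq x r.
Proof.
move=> d0; rewrite /Lq cjM mulrACA mul_cj -[(nm d)%:R]/((nm d)%:Z%:~R) c2_intM.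
rewrite nmM natrM intrM invfM mulrACA.
have n0 : ((nm d)%:R : R) != 0 by rewrite pnatr_eq0 nm_eq0.
by rewrite -[((nm d)%:Z)%:~R]/((nm d)%:R) divff // mul1r.
Qed.

Lemma Lq_mul x r : r != 0 -> Lq (r * x) r = (c2 x)%:~R.
Proof.
move=> r0; rewrite -{2}[r]mulr1 Lq_scale // /Lq nm1 divr1.
have -> : cj Q 1 = 1; last by rewrite mulr1.
by rewrite /cj (co_1 Q).1 (co_1 Q).2 mulr0 addr0 mul0r subr0.
Qed.

Lemma Lq_coords a r x :
  Lq (a * x) r = (c1 x)%:~R * Lq a r + (c2 x)%:~R * Lq (a * om Q) r.
Proof.
rewrite {1}(coE Q x) mulrDr LqD; congr (_ + _).
  by rewrite mulrC /Lq -mulrA c2_intM intrM mulrA.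
by rewrite mulrCA /Lq -(mulrA (_%:~R)) c2_intM intrM mulrA.
Qed.

Lemma Lq_int x r : r != 0 -> dvq r x -> exists m : int, Lq x r = m%:~R.
Proof. by move=> r0 /dvqP[y ->]; exists (c2 y); rewrite Lq_mul. Qed.

Lemma ecx_Lq_congr x y r : r != 0 -> dvq r (x - y) -> ecx (Lq x r) = ecx (Lq y r).
Proof.
move=> r0 /(Lq_int r0)[m]; rewrite LqB => h.
by rewrite -(subrK (Lq y r) (Lq x r)) h addrC ecxDint.
Qed.

(** If the coordinates of [y / r] obtained from [y] and from [om * y] are
    integers then so are both coordinates of [y / r]. *)
Lemma Lq_nondeg r y : r != 0 -> (exists m : int, Lq y r = m%:~R) ->
  (exists m : int, Lq (om Q * y) r = m%:~R) -> dvq r y.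
Proof.
move=> r0 [m hm] [m' hm'].
have n0 : ((nm r)%:R : R) != 0 by rewrite pnatr_eq0 nm_eq0.
set z := y * cj Q r.
have e2 : c2 z = m * (nm r)%:Z.
  by apply/eqP; rewrite -(eqr_int R) intrM -hm /Lq divfK.
have e1 : c1 z + qt Q * c2 z = m' * (nm r)%:Z.
  apply/eqP; rewrite -(eqr_int R) [X in _ == X]intrM -hm' /Lq divfK // -mulrA -/z.
  rewrite (coM Q _ _).2; have [-> ->] : c1 (om Q) = 0 /\ c2 (om Q) = 1.
    by apply: co_eq; rewrite mul1r add0r.
  by rewrite mul0r !mul1r add0r.
apply/dvqP; exists ((m' - qt Q * m)%:~R + m%:~R * om Q).
apply: (quad_mulfI Q (r := cj Q r)); first by rewrite -(nm_gt0 Q) nm_cj nm_gt0.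
rewrite mulrC -/z [RHS]mulrA [cj Q r * r]mulrC mul_cj (coE Q z) e2.
have -> : c1 z = (m' - qt Q * m) * (nm r)%:Z by rewrite mulrBl -e1 e2; ring.
by rewrite !intrM -[(nm r)%:R]/((nm r)%:Z%:~R); ring.
Qed.

(** Small coordinates force a small norm; this separates distinct fractions. *)
Lemma Lq_small x r (eps : R) : r != 0 -> 0 <= eps ->
  `|Lq x r| <= eps -> `|Lq (x * om Q) r| <= eps ->
  (nm x)%:R <= (nmK Q)%:R * ((1 + absz (qt Q))%N%:R * eps) ^+ 2 * (nm r)%:R.
Proof.
move=> r0 e0 h1 h2; set z := x * cj Q r.
have np : (0 : R) < (nm r)%:R by rewrite ltr0n nm_gt0.
have k2 : `|(c2 z)%:~R : R| <= eps * (nm r)%:R.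
  by move: h1; rewrite /Lq -/z normrM normfV normr_nat ler_pdivrMr.
have k1 : `|(c1 z + qt Q * c2 z)%:~R : R| <= eps * (nm r)%:R.
  move: h2; rewrite /Lq mulrAC -/z normrM normfV normr_nat ler_pdivrMr //.
  rewrite (coM Q _ _).2; have [-> ->] : c1 (om Q) = 0 /\ c2 (om Q) = 1.
    by apply: co_eq; rewrite mul1r add0r.
  by rewrite !mulr1 mulr0 addr0.
set B := (1 + absz (qt Q))%N%:R * (eps * (nm r)%:R) : R.
have B0 : 0 <= eps * (nm r)%:R by rewrite mulr_ge0 // ltW.
have m2 : `|(c2 z)%:~R : R| <= B.
  by apply: (le_trans k2); rewrite /B ler_peMl // ler1n.
have m1 : `|(c1 z)%:~R : R| <= B.
  have -> : c1 z = (c1 z + qt Q * c2 z) - qt Q * c2 z by rewrite addrK.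
  rewrite intrB; apply: (le_trans (ler_normB _ _)).
  rewrite /B natrD mulrDl mul1r; apply: lerD => //.
  rewrite intrM normrM; apply: ler_pM => //.
  by rewrite natr_absz intr_norm.
have nB : ((nm z)%:R : R) <= (nmK Q)%:R * B ^+ 2.
  have : (nm z <= nmK Q * (maxn (absz (c1 z)) (absz (c2 z))) ^ 2)%N.
    by apply: nm_le_co; rewrite ?leq_maxl ?leq_maxr.
  rewrite -(ler_nat R) => h; apply: (le_trans h); rewrite natrM ler_wpM2l // natrX.
  have ca (a : int) : ((absz a)%:R : R) = `|a%:~R| by rewrite natr_absz intr_norm.
  have Bp : 0 <= B by rewrite /B mulr_ge0.
  rewrite lerXn2r ?nnegrE //.
  by rewrite /maxn; case: ifP => _; rewrite ca.
move: nB; rewrite nmM nm_cj natrM -(ler_pdivlMr _ _ np) => h; apply: (le_trans h).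
rewrite ler_pdivrMr // /B; rewrite le_eqVlt; apply/orP; left; apply/eqP; ring.
Qed.

(** Orthogonality of the additive characters: a nontrivial one is shifted by
    some residue, by nondegeneracy. *)
Lemma ecx_orth r y : r != 0 -> \sum_(a <- Rep r) ecx (Lq (a * y) r) =
  if dvq r y then (size (Rep r))%:R else 0.
Proof.
move=> r0; case: ifPn => h.
  rewrite (eq_bigr (fun=> 1)).
    by rewrite big_const_seq iter_addr_0 count_predT.
  move=> a _; have [m ->] := Lq_int r0 (dvq_mulR a h); exact: ecx_int.
have [z hz] : exists z, ecx (Lq (z * y) r) != 1.
  apply: contrapT => hn; case/negP: h; apply: Lq_nondeg => //.
    rewrite -[y]mul1r; apply: ecx_eq1; apply/eqP/negPn/negP => h; apply: hn.
    by exists 1.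
  by apply: ecx_eq1; apply/eqP/negPn/negP => h; apply: hn; exists (om Q).
set X := \sum_(a <- _) _.
have : X = ecx (Lq (z * y) r) * X.
  rewrite {1}/X -(@Rep_reindex _ Q _ r (fun a => ecx (Lq (a * y) r)) (fun a => z + a) predT) //.
  - by rewrite mulr_sumr; apply: eq_bigr => a _; rewrite mulrDl LqD ecxD.
  - by move=> a b h'; apply: ecx_Lq_congr => //; rewrite -mulrBl dvq_mull.
  - by move=> a b _ _; rewrite opprD addrACA subrr add0r.
move=> /eqP; rewrite -{1}[X]mul1r -subr_eq0 -mulrBl mulf_eq0 subr_eq0 eq_sym.
by rewrite (negbTE hz) => /eqP.
Qed.

End AdditiveCharacters.

Section HighConductor.
Variables (R : realType) (O : comNzRingType) (Q : quadOrder O).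
Variables (q r s : O).
Hypothesis q0 : q != 0.
Hypothesis qE : q = r * s.
Local Notation gT := (unitq Q q0).
Local Notation nm := (nm Q).
Local Notation Rep := (Rep Q).
Implicit Types x y a : O.

(** The function on the unit group counting the [x] of [S] with weight [F]. *)
Definition grp_fun (S : seq O) (F : O -> R[i]) (u : gT) : R[i] :=
  \sum_(x <- S | cop q x && (toU Q q0 x == u)) F x.

Variables (S : seq O) (F : O -> R[i]).

Lemma sum_grp_fun (G : gT -> R[i]) : \sum_u grp_fun S F u * G u =
  \sum_(x <- S | cop q x) F x * G (toU Q q0 x).
Proof.
under eq_bigr do rewrite mulr_suml.
rewrite (exchange_big_dep (fun x => cop q x)) /=; last by move=> u x _ /andP[].
apply: eq_bigr => x cx; rewrite (big_pred1 (toU Q q0 x)) // => u.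
by rewrite /= cx eq_sym.
Qed.

Let r0 : r != 0. Proof. by apply: contra q0 => /eqP e; rewrite qE e mul0r. Qed.
Let rq : dvq r q. Proof. by rewrite qE dvq_mulr. Qed.

Variable Hs : seq {group gT}.
Hypothesis Hs_dvd : forall d, dvq d r -> (nm d < nm r)%N -> kerU Q q0 d \in Hs.

Let K := kerU Q q0 r.
Let h := component Hs K (grp_fun S F).
Let kinv : R[i] := #|K|%:R^-1.
(** The component seen as a function on [O], periodic modulo [r] and
    supported on the elements prime to [r]. *)
Let hO x : R[i] := kinv * \sum_(v : gT | dvq r (lift v - x)) h v.

Local Lemma hO_congr x y : dvq r (x - y) -> hO x = hO y.
Proof.
move=> hxy; congr (_ * _); apply: eq_bigl => v; apply: dvq_congr.
by rewrite opprB addrC addrA subrK dvqC.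
Qed.

Local Lemma hO_lift u : hO (lift u) = h u.
Proof.
rewrite /hO -(sum_coset u h rq) (eq_bigr (fun=> h u)); last first.
  by move=> k kK; rewrite /h component_inv.
by rewrite sumr_const -[_ *+ _]mulr_natl mulrA mulVf ?mul1r // card_neq0.
Qed.

Local Lemma hO_ncop x : ~~ cop r x -> hO x = 0.
Proof.
move=> ncx; rewrite /hO big1 ?mulr0 // => v hv; case/negP: ncx.
rewrite -(cop_congr hv); exact: cop_dvr rq (lift_cop v).
Qed.

Local Lemma sum_hO (phi : O -> R[i]) : (forall x y, dvq r (x - y) -> phi x = phi y) ->
  \sum_(y <- Rep r) hO y * phi y = kinv * \sum_u h u * phi (lift u).
Proof.
move=> per; under eq_bigr do rewrite /hO -mulrA mulr_suml.
rewrite -mulr_sumr; congr (_ * _).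
rewrite (exchange_big_dep predT) //=; apply: eq_bigr => u _.
rewrite -big_filter.
have -> : [seq y <- Rep r | dvq r (lift u - y)] = [:: rep r (lift u)].
  apply: perm_small_eq => //; apply: uniq_perm => //.
    by rewrite filter_uniq ?Rep_uniq.
  move=> y; rewrite mem_filter inE; apply/andP/eqP => [[hy yR]|->].
    by rewrite -(Rep_id yR); apply: rep_eq; rewrite dvqC.
  by rewrite mem_Rep // dvqC rep_mod.
by rewrite big_seq1; congr (_ * _); apply: per; apply: rep_mod.
Qed.

Let m := size (Rep r).
Local Lemma m_gt0 : (0 < m)%N.
Proof. by have := mem_Rep Q 0 r0; rewrite /m; case: (Rep r). Qed.

(** The additive Fourier transform of [hO] on [O / r]. *)
Let hat a : R[i] := \sum_(y <- Rep r) hO y * ecx (Lq R Q (a * y) r).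

Local Lemma hO_inv x :
  hO x = m%:R^-1 * \sum_(a <- Rep r) hat a * (ecx (Lq R Q (a * x) r))^*%C.
Proof.
transitivity (m%:R^-1 * \sum_(y <- Rep r) hO y *
    \sum_(a <- Rep r) ecx (Lq R Q (a * (y - x)) r)); last first.
  congr (_ * _); under [RHS]eq_bigr do rewrite mulr_suml.
  rewrite exchange_big; apply: eq_bigr => y _; rewrite mulr_sumr.
  by apply: eq_bigr => a _; rewrite mulrBr LqB ecxD ecxN mulrA.
rewrite -(hO_congr (rep_mod r x)).
rewrite big_seq (eq_bigr (fun y => if y == rep r x then hO (rep r x) * m%:R else 0)).
  rewrite -big_seq -big_mkcond -big_filter filter_pred1_uniq ?Rep_uniq ?mem_Rep // big_seq1.
  by rewrite mulrC mulfK // pnatr_eq0 -lt0n m_gt0.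
move=> y yR; rewrite ecx_orth // -rep_eqE (Rep_id yR).
by case: eqP => [->|_]; rewrite ?mulr0.
Qed.

Local Lemma hat_parseval :
  \sum_(a <- Rep r) cabs (hat a) ^+ 2 = m%:R * ((nrm2 h) / #|K|%:R).
Proof.
apply: complexI; rewrite rmorph_sum.
transitivity (\sum_(a <- Rep r) \sum_(y <- Rep r)
    hat a * ((hO y)^*%C * (ecx (Lq R Q (a * y) r))^*%C)).
  apply: eq_bigr => a _; rewrite /= -mul_conj {2}/hat conj_sum mulr_sumr.
  by apply: eq_bigr => y _; rewrite conjM.
rewrite exchange_big /=.
transitivity (\sum_(y <- Rep r) m%:R * (hO y * (hO y)^*%C)).
  apply: eq_bigr => y _; rewrite {2}hO_inv.
  under eq_bigr do rewrite mulrCA.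
  rewrite -mulr_sumr; move: (\sum_(_ <- _) _) (_^*%C) => X c.
  have mn : (m%:R : R[i]) != 0 by rewrite pnatr_eq0 -lt0n m_gt0.
  by field.
rewrite -mulr_sumr (sum_hO (phi := fun y => (hO y)^*%C)); last first.
  by move=> x y hxy; rewrite (hO_congr hxy).
under eq_bigr do rewrite hO_lift.
rewrite -/(ip h h) ip_nrm2 rmorphM /= rmorph_nat; congr (_ * _).
by rewrite mulrC rmorphM /= fmorphV rmorph_nat.
Qed.

(** [h] is orthogonal to every function with a smaller period. *)
Local Lemma hat_ncop a : ~~ cop r a -> hat a = 0.
Proof.
move=> nca; have [g [g1 /dvqP[d rE] /dvqP[a' aE]]] := not_cop_dvq Q r0 nca.
have g0 : g != 0 by apply: contra r0 => /eqP e; rewrite rE e mul0r.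
have d0 : d != 0 by apply: contra r0 => /eqP e; rewrite rE e mulr0.
have dr : dvq d r by rewrite rE mulrC dvq_mulr.
have ltd : (nm d < nm r)%N.
  by rewrite rE nmM; move: g0 d0 g1; rewrite -!(nm_gt0 Q); nia.
have Le y : Lq R Q (a * y) r = Lq R Q (a' * y) d by rewrite aE rE -mulrA Lq_scale.
rewrite /hat (sum_hO (phi := fun y => ecx (Lq R Q (a * y) r))); last first.
  by move=> x y hxy; apply: ecx_Lq_congr => //; rewrite -mulrBr dvq_mulR.
pose G (u : gT) : R[i] := (ecx (Lq R Q (a * lift u) r))^*%C.
have -> : \sum_u h u * ecx (Lq R Q (a * lift u) r) = ip h G.
  by apply: eq_bigr => u _; rewrite /G conjcK.
have [_ sa _] := @oproj_avg R gT (kerU Q q0 d).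
have -> : G = avg (kerU Q q0 d) G.
  apply/funext => u; rewrite avg_id // => k kK; rewrite /G !Le; congr (_^*%C).
  apply: ecx_Lq_congr => //; rewrite -mulrBr; apply: dvq_mulR.
  by rewrite -(mem_kerU _ _ (dvq_trans dr rq)) mulKg.
rewrite -sa /ip big1 ?mulr0 // => u _; rewrite avg_component0 ?mul0r //.
  exact: umulC.
exact: Hs_dvd.
Qed.

(** The part of [F] modulo [q] of conductor [r] is controlled by the additive
    Fourier coefficients of [F] at the reduced fractions of denominator [r]. *)
Lemma high_bound : nrm2 h <= (m%:R * #|K|%:R)^-1 *
  \sum_(a <- Rep r | cop r a)
    cabs (\sum_(x <- S | cop s x) F x * ecx (Lq R Q (a * x) r)) ^+ 2.
Proof.
pose T a := \sum_(x <- S | cop s x) F x * ecx (Lq R Q (a * x) r).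
set V := nrm2 h; have V0 : 0 <= V by apply: nrm2_ge0.
have mp : (0 : R) < m%:R by rewrite ltr0n m_gt0.
have Kp : (0 : R) < #|K|%:R by rewrite ltr0n cardG_gt0.
have e1 : V%:C = m%:R^-1 * \sum_(a <- Rep r | cop r a) (hat a)^*%C * T a.
  rewrite -oproj_ip; last by apply: oproj_component; exact: umulC.
  rewrite /ip sum_grp_fun.
  transitivity (\sum_(x <- S | cop s x) F x * (hO x)^*%C).
    rewrite [RHS](bigID (cop r)) /= [X in _ + X]big1 ?addr0; last first.
      by move=> x /andP[_ /hO_ncop ->]; rewrite conjc0 mulr0.
    apply: eq_big => x; first by rewrite qE cop_mulE andbC.
    move=> cx; rewrite -/h -hO_lift; congr (_ * _^*%C); apply: hO_congr.
    exact: dvq_trans rq (toU_mod Q q0 cx).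
  rewrite /T mulr_sumr.
  under [RHS]eq_bigr do rewrite mulr_sumr mulr_sumr.
  rewrite exchange_big; apply: eq_bigr => x _ /=.
  rewrite {1}hO_inv conjM conjc_inv conjc_nat conj_sum !mulr_sumr.
  rewrite (bigID (cop r)) /= [X in _ + X]big1 ?addr0; last first.
    by move=> a /hat_ncop ->; rewrite mul0r conjc0 !mulr0.
  apply: eq_bigr => a _; rewrite conjM conjcK; ring.
have e2 : V <= m%:R^-1 * \sum_(a <- Rep r | cop r a) cabs (hat a) * cabs (T a).
  rewrite -[V]ger0_norm // -cabs_real e1 cabsM cabsV cabs_nat ler_wpM2l ?invr_ge0 //.
  by apply: cabs_sum_le => a _; rewrite cabsM cabs_conj.
set SS := \sum_(a <- Rep r | cop r a) _; have SS0 : 0 <= SS by apply: sumr_ge0 => a _; apply: sqr_ge0.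
have e3 : V ^+ 2 <= m%:R^-1 ^+ 2 * ((m%:R * (V / #|K|%:R)) * SS).
  apply: (@le_trans _ _ (m%:R^-1 ^+ 2 *
     (\sum_(a <- Rep r | cop r a) cabs (hat a) * cabs (T a)) ^+ 2)).
    rewrite -exprMn lerXn2r ?nnegrE //; apply: le_trans e2; exact: V0.
  rewrite ler_wpM2l ?sqr_ge0 //; apply: le_trans (cauchy_schwarz_sq _ _ _ _) _.
  apply: ler_wpM2r => //; rewrite -hat_parseval.
  rewrite [leRHS](bigID (cop r)) /= lerDl; apply: sumr_ge0 => a _; exact: sqr_ge0.
have [->|Vn] := eqVneq V 0; first by rewrite mulr_ge0 // invr_ge0 mulr_ge0 // ltW.
have Vp : 0 < V by rewrite lt_def Vn.
rewrite -(ler_pM2l Vp) -expr2; apply: (le_trans e3).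
by rewrite le_eqVlt; apply/orP; left; apply/eqP; field; rewrite !gt_eqF.
Qed.

End HighConductor.

(** * Mean values of the divisor function *)

Section Moments.
Variables (R : realType) (O : comNzRingType) (Q : quadOrder O).
Implicit Types x y z r d a q s : O.
Local Notation nm := (nm Q).
Local Notation nball := (nball Q).
Local Notation dvs := (dvs Q).
Local Notation tau := (tau Q).

(** The cofactor of a divisor [d] of [x]. *)
Definition quo x d : O := xget 0 [set y | x = d * y]%classic.

Lemma quoE x d : dvq d x -> x = d * quo x d.
Proof. by move=> /dvqP h; apply: (@xgetPex _ 0 [set y | x = d * y]%classic). Qed.

(** Write [x = d * e] and enlarge the range of [e]. *)
Lemma sum_divisors n (H : O -> O -> R) : (forall d x, 0 <= H d x) ->
  \sum_(x <- nball n | x != 0) \sum_(d <- dvs x) H d x <=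
  \sum_(d <- nball n | d != 0)
     \sum_(e <- nball n | (e != 0) && (nm (d * e) <= n)%N) H d (d * e).
Proof.
move=> H0.
apply: (@le_trans _ _ (\sum_(x <- nball n | x != 0)
    \sum_(d <- nball n | (d != 0) && dvq d x) H d x)).
  rewrite big_seq_cond [leRHS]big_seq_cond; apply: ler_sum => x /andP[xn x0].
  rewrite -[leRHS]big_filter; apply: ler_sum_sub => //; first exact: dvs_uniq.
  move=> d; rewrite mem_dvs // mem_filter => dx; rewrite dx andbT (dvq_neq0 x0 dx) /=.
  by rewrite mem_nball; move: xn; rewrite mem_nball; apply: leq_trans; apply: dvq_nm_le.
rewrite (exchange_big_dep (fun d => d != 0)) /=; last by move=> x d _ /andP[].
apply: ler_sum => d d0.
rewrite -big_filter -[leRHS]big_filter.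
apply: (ler_sum_map (h := fun x => quo x d)) => //.
- by rewrite filter_uniq ?nball_uniq.
- move=> x y; rewrite !mem_filter => /andP[/andP[_ /andP[_ dx]] _] /andP[/andP[_ /andP[_ dy]] _] e.
  by rewrite (quoE dx) (quoE dy) e.
- move=> x; rewrite !mem_filter !mem_nball => /andP[/andP[x0 /andP[_ dx]] xn].
  rewrite -quoE // xn andbT.
  have e0 : quo x d != 0 by apply: contra x0 => /eqP h; rewrite (quoE dx) h mulr0.
  rewrite e0 /=; apply: leq_trans xn; apply: (dvq_nm_le Q) => //.
  by rewrite {2}(quoE dx) mulrC dvq_mulr.
- by move=> x; rewrite !mem_filter => /andP[/andP[_ /andP[_ dx]] _]; rewrite -quoE.
Qed.

(** Divisor moments with the weight [1 / nm x]; this weight makes them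
    submultiplicative. *)
Definition moment (k n : nat) : R :=
  \sum_(x <- nball n | x != 0) (tau x)%:R ^+ k / (nm x)%:R.

Lemma momentE k n : moment k n =
  \sum_(x <- nball n | x != 0) (tau x)%:R ^+ k / (nm x)%:R.
Proof. by []. Qed.

Lemma moment_ge0 k n : 0 <= moment k n.
Proof. by apply: sumr_ge0 => x _; rewrite divr_ge0 // exprn_ge0. Qed.

(** One factor [tau x] is opened as a sum over [x = d * e], and [tau (d * e)
    <= tau d * tau e]. *)
Lemma moment_sq k n : moment k.+1 n <= moment k n ^+ 2.
Proof.
apply: (@le_trans _ _ (\sum_(x <- nball n | x != 0) \sum_(d <- dvs x)
   (tau x)%:R ^+ k / (nm x)%:R)).
  apply: ler_sum => x _; rewrite big_const_seq iter_addr_0 count_predT.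
  by rewrite -[leRHS]mulr_natl exprS mulrA.
apply: (le_trans (@sum_divisors n (fun _ x => (tau x)%:R ^+ k / (nm x)%:R) _)).
  by move=> _ x; rewrite divr_ge0 // exprn_ge0.
rewrite expr2 /moment mulr_suml; apply: ler_sum => d d0; rewrite mulr_sumr.
apply: (@le_trans _ _ (\sum_(e <- nball n | (e != 0) && (nm (d * e) <= n)%N)
    (tau d)%:R ^+ k / (nm d)%:R * ((tau e)%:R ^+ k / (nm e)%:R))).
  apply: ler_sum => e /andP[e0 _].
  rewrite mulf_div -exprMn nmM natrM; apply: ler_wpM2r; first by rewrite invr_ge0 mulr_ge0.
  by rewrite lerXn2r ?nnegrE ?mulr_ge0 // -natrM ler_nat; apply: tau_mul.
rewrite [leRHS](bigID (fun e => (nm (d * e) <= n)%N)) /= lerDl.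
by apply: sumr_ge0 => e _; rewrite mulr_ge0 // divr_ge0 // exprn_ge0.
Qed.

(** Each dyadic range of norms contributes a bounded amount, as [nball] grows
    linearly. *)
Lemma moment0_pow2 J : moment 0 (2 ^ J) <= 2 * (ballC Q)%:R * J.+1%:R.
Proof.
elim: J => [|J IH].
  apply: (@le_trans _ _ (\sum_(x <- nball 1) 1)).
    rewrite expn0 [leRHS](bigID (fun x => x != 0)) /= -[leLHS]addr0; apply: lerD.
      apply: ler_sum => x x0; rewrite expr0 div1r invf_le1 ?ltr0n ?nm_gt0 //.
      by rewrite ler1n nm_gt0.
    by apply: sumr_ge0.
  rewrite big_const_seq iter_addr_0 count_predT mulr1.
  apply: (@le_trans _ _ (ballC Q)%:R).
    by have := size_nball Q (isT : 0 < 1)%N; rewrite muln1 -(ler_nat R).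
  by rewrite mulr_natl mulr2n lerDl.
have -> : J.+2%:R = J.+1%:R + 1 :> R by rewrite natr1.
rewrite mulrDr mulr1 /moment (bigID (fun x => (nm x <= 2 ^ J)%N)) /=; apply: lerD.
  apply: le_trans IH; rewrite -big_filter /moment -[leRHS]big_filter.
  apply: ler_sum_sub.
  - by rewrite filter_uniq ?nball_uniq.
  - by move=> x; rewrite !mem_filter !mem_nball => /andP[/andP[-> ->]].
  - by move=> x _; rewrite divr_ge0 ?exprn_ge0.
apply: (@le_trans _ _ (\sum_(x <- nball (2 ^ J.+1)) (2 ^ J)%N%:R^-1)).
  rewrite [leRHS](bigID (fun x => (x != 0) && ~~ (nm x <= 2 ^ J)%N)) /= -[leLHS]addr0.
  apply: lerD; last by apply: sumr_ge0 => x _; rewrite invr_ge0.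
  apply: ler_sum => x /andP[x0 h]; rewrite expr0 div1r lef_pV2 ?posrE ?ltr0n ?expn_gt0 ?nm_gt0 //.
  by rewrite ler_nat ltnW // ltnNge.
rewrite big_const_seq iter_addr_0 count_predT -[leLHS]mulr_natl.
rewrite ler_pdivrMr ?ltr0n ?expn_gt0 //.
have := size_nball Q (expn_gt0 2 J.+1 : 0 < 2 ^ J.+1)%N.
rewrite -(ler_nat R) => h; apply: (le_trans h); rewrite expnS !natrM.
by rewrite le_eqVlt; apply/orP; left; apply/eqP; ring.
Qed.

Lemma ln2_ge : 1 / 2 <= ln 2 :> R.
Proof.
rewrite -(@ler_expR R) lnK ?posrE //.
have e : expR (1 / 2 : R) = (expR (- (1 / 2)))^-1 by rewrite expRN invrK.
rewrite e -[leRHS]invrK lef_pV2 ?posrE ?expR_gt0 ?invr_gt0 //.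
by have := @expR_ge1Dx R (- (1 / 2)); lra.
Qed.

(** [dyad l] is a number of dyadic scales that covers all norms up to
    [expR (4 * l)]. *)
Definition dyad (l : R) : nat := (Num.truncn (8 * l)).+1.

Lemma dyad_cover (n : nat) (l : R) : 1 <= l -> n%:R <= expR (4 * l) ->
  (n <= 2 ^ dyad l)%N.
Proof.
move=> l1 h; rewrite -(ler_nat R); apply: (le_trans h).
rewrite natrX -[2%:R ^+ _]lnK ?posrE ?exprn_gt0 // ler_expR lnXn //.
rewrite -[ln 2 *+ _]mulr_natl; have := truncnS_gt (8 * l); rewrite -/(dyad l) => h1.
apply: le_trans (_ : (dyad l)%:R * (1 / 2) <= _); first by lra.
by apply: ler_wpM2l => //; exact: ln2_ge.
Qed.

Lemma dyad_le (l : R) : 1 <= l -> (dyad l).+1%:R <= 10 * l.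
Proof.
move=> l1; have : (Num.truncn (8 * l))%:R <= 8 * l by rewrite truncn_le; lra.
by rewrite /dyad -!natr1; lra.
Qed.

Lemma moment_le k n (l : R) : 1 <= l -> n%:R <= expR (4 * l) ->
  moment k n <= (20 * (ballC Q)%:R * l) ^+ (2 ^ k).
Proof.
move=> l1 hn; elim: k => [|k IH].
  rewrite expn0 expr1; apply: (@le_trans _ _ (moment 0 (2 ^ dyad l))).
    rewrite /moment -big_filter -[leRHS]big_filter; apply: ler_sum_sub.
    - by rewrite filter_uniq ?nball_uniq.
    - move=> x; rewrite !mem_filter !mem_nball => /andP[-> h] /=.
      by apply: leq_trans h _; apply: dyad_cover.
    - by move=> x _; rewrite divr_ge0 ?exprn_ge0.
  apply: (le_trans (moment0_pow2 _)); have := dyad_le l1.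
  have : (0 : R) <= (ballC Q)%:R by [].
  by move: (_.+1%:R) ((ballC Q)%:R : R) => a b; nra.
apply: (le_trans (moment_sq _ _)).
by rewrite expnSr exprM lerXn2r ?nnegrE ?moment_ge0 // exprn_ge0 // !mulr_ge0 //; lra.
Qed.

Lemma tau_sum_le k n : \sum_(x <- nball n | x != 0) (tau x)%:R ^+ k <= n%:R * moment k n.
Proof.
rewrite mulr_sumr big_seq_cond [leRHS]big_seq_cond; apply: ler_sum => x.
rewrite mem_nball => /andP[hx x0]; rewrite mulrCA; apply: ler_peMr.
  by rewrite exprn_ge0.
by rewrite ler_pdivlMr ?ltr0n ?nm_gt0 // mul1r ler_nat.
Qed.

End Moments.

Section LargeSieveO.
Variables (R : realType) (O : comNzRingType) (Q : quadOrder O).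
Implicit Types x y z r d a q s : O.
Local Notation nm := (nm Q).
Local Notation nball := (nball Q).
Local Notation Rep := (Rep Q).

(** The reduced fractions [a / r] with [nm r <= R0]. *)
Definition farey (R0 : nat) : seq (O * O) :=
  [seq (r, a) | r <- [seq r <- nball R0 | r != 0], a <- [seq a <- Rep r | cop r a]].

(** The reciprocal of a spacing of the points attached to the fractions of
    [farey R0]. *)
Definition lsK (R0 : nat) : nat := (nmK Q * (1 + absz (qt Q)) * R0).+1.

(** Nearby points of the torus come from fractions that differ by an element
    of [O]: the numerator of their difference would otherwise have too small
    a norm. *)
Lemma farey_diff (R0 : nat) r a r' a' (u v : int) : r != 0 -> r' != 0 ->
  (nm r <= R0)%N -> (nm r' <= R0)%N ->
  `|Lq R Q a r - Lq R Q a' r' - u%:~R| < (lsK R0)%:R^-1 ->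
  `|Lq R Q (a * om Q) r - Lq R Q (a' * om Q) r' - v%:~R| < (lsK R0)%:R^-1 ->
  exists b, a * r' - a' * r = b * (r * r').
Proof.
move=> r0 r'0 hr hr' h1 h2.
pose b : O := (v - qt Q * u)%:~R + u%:~R * om Q; exists b.
have rr0 : r * r' != 0 by apply: (quad_mulf_neq0 Q).
have [b1 b2] := co_eq (erefl b : b = (v - qt Q * u)%:~R + u%:~R * om Q).
pose x := a * r' - a' * r - r * r' * b.
have om12 : co1 Q (om Q) = 0 /\ co2 Q (om Q) = 1 by apply: co_eq; rewrite mul1r add0r.
have ex y z : Lq R Q (z * r' - y * r) (r * r') = Lq R Q z r - Lq R Q y r'.
  rewrite LqB; congr (_ - _); last by rewrite [y * r]mulrC Lq_scale.
  by rewrite [z * r']mulrC [r * r']mulrC Lq_scale.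
have e1 : Lq R Q x (r * r') = Lq R Q a r - Lq R Q a' r' - u%:~R.
  by rewrite /x LqB ex Lq_mul // b2.
have e2 : Lq R Q (x * om Q) (r * r') = Lq R Q (a * om Q) r - Lq R Q (a' * om Q) r' - v%:~R.
  have -> : x * om Q = (a * om Q) * r' - (a' * om Q) * r - r * r' * (b * om Q).
    by rewrite /x; ring.
  rewrite LqB ex Lq_mul // (coM Q b _).2 om12.1 om12.2 b1 b2.
  by congr (_ - _%:~R); ring.
suff : x = 0 by move=> /eqP; rewrite subr_eq0 => /eqP ->; ring.
apply/eqP; rewrite -(nm_eq0 Q) -leqn0 -ltnS -(ltr_nat R).
pose eps : R := (lsK R0)%:R^-1.
have e0 : 0 <= eps by rewrite invr_ge0.
have := @Lq_small R O Q x _ eps rr0 e0; rewrite e1 e2.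
move=> /(_ (ltW h1) (ltW h2)) h; apply: (le_lt_trans h).
rewrite /eps expr_div_n nmM.
have lp : (0 : R) < (lsK R0)%:R by rewrite ltr0n.
rewrite mulrA mulrAC ltr_pdivrMr ?exprn_gt0 // mul1r.
rewrite -!natrX -!natrM ltr_nat /lsK.
move: (nmK Q) (1 + _)%N (nm r) (nm r') hr hr' (isT : (1 <= nmK Q)%N) => k t n n' hr hr' k1.
have : (k * t ^ 2 * (n * n') <= (k * t * R0) ^ 2)%N.
  rewrite !expnMn -[X in (_ <= X)%N]mulnA -[X in (X <= _)%N]mulnA; apply: leq_mul.
    by rewrite expnS expn1 leq_pmulr.
  by rewrite leq_mul2l [(R0 ^ 2)%N]expnS expn1 leq_mul ?orbT.
nia.
Qed.

(** Collects the number of units, the size of the coordinates and the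
    constant of [large_sieve]. *)
Definition lsC : R := 72 ^+ 2 * 2 * (size (nball 1))%:R *
  (16 * (coK Q)%:R ^+ 2 + (2 * (nmK Q * (1 + absz (qt Q)))%N%:R) ^+ 2).

Lemma lsC_ge0 : 0 <= lsC.
Proof.
apply: mulr_ge0; first by rewrite mulr_ge0 // mulr_ge0 // sqr_ge0.
by rewrite addr_ge0 ?sqr_ge0 // mulr_ge0 ?sqr_ge0.
Qed.

(** Coordinates turn the additive characters of the fractions [a / r] into
    points of a torus; [farey_diff] says that only associates of one fraction
    can be close to each other. *)
Lemma large_sieve_quad (R0 X : nat) (S : seq O) (F : O -> R[i]) :
  (0 < R0)%N -> (0 < X)%N -> uniq S -> {subset S <= nball X} ->
  \sum_(r <- nball R0 | r != 0) \sum_(a <- Rep r | cop r a)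
     cabs (\sum_(x <- S) F x * ecx (Lq R Q (a * x) r)) ^+ 2 <=
  lsC * (X%:R + R0%:R ^+ 2) * \sum_(x <- S) cabs (F x) ^+ 2.
Proof.
move=> R00 X0 uS SX; have [M [hM1 hM2]] := nball_coords Q X0.
have -> : \sum_(r <- nball R0 | r != 0) \sum_(a <- Rep r | cop r a)
     cabs (\sum_(x <- S) F x * ecx (Lq R Q (a * x) r)) ^+ 2 =
  \sum_(p <- farey R0) cabs (\sum_(x <- S) F x * ecx (
     (co1 Q x)%:~R * Lq R Q p.2 p.1 + (co2 Q x)%:~R * Lq R Q (p.2 * om Q) p.1)) ^+ 2.
  rewrite /farey big_allpairs_dep /= big_filter; apply: eq_bigr => r _.
  rewrite big_filter; apply: eq_bigr => a _; congr (cabs _ ^+ 2).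
  by apply: eq_bigr => x _; rewrite Lq_coords.
have n00 : (0 < lsK R0)%N by [].
have mem_farey p : p \in farey R0 ->
    [/\ p.1 != 0, (nm p.1 <= R0)%N, p.2 \in Rep p.1 & cop p.1 p.2].
  move=> /allpairsPdep[r [a [hr ha ->]]] /=; move: hr ha.
  by rewrite !mem_filter mem_nball => /andP[-> ->] /andP[-> ->].
apply: (le_trans (@large_sieve R O S (co1 Q) (co2 Q) M _ (farey R0)
   (fun p => Lq R Q p.2 p.1) (fun p => Lq R Q (p.2 * om Q) p.1)
   (lsK R0) (size (nball 1)) n00 uS _ _ _ _ F)).
- by move=> x xS; apply: hM2; apply: SX.
- by move=> x y _ _; apply: co_inj.
- apply: allpairs_uniq_dep.
  + by rewrite filter_uniq ?nball_uniq.
  + by move=> r _; rewrite filter_uniq ?Rep_uniq.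
  + by move=> [x y] [x' y'] _ _ /= [-> ->].
- move=> [|p0 s] us ss hs //.
  have p0s : p0 \in p0 :: s by rewrite inE eqxx.
  have [r00 hr0 _ c0] := mem_farey _ (ss _ p0s).
  have key p : p \in p0 :: s -> exists b, p.2 * p0.1 - p0.2 * p.1 = b * (p.1 * p0.1).
    move=> ps; have [r1 hr1 _ _] := mem_farey _ (ss _ ps).
    have [u [v [h1 h2]]] := hs _ _ ps p0s.
    exact: farey_diff r1 r00 hr1 hr0 h1 h2.
  have dv p : p \in p0 :: s -> dvq p0.1 p.1 /\ dvq p.1 p0.1.
    move=> ps; have [b e] := key p ps; have [_ _ _ c] := mem_farey _ (ss _ ps).
    split; [apply: (cop_gauss c0) | apply: (cop_gauss c)].
      apply/dvqP; exists (p.2 - b * p.1).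
      have -> : p0.2 * p.1 = p.2 * p0.1 - (p.2 * p0.1 - p0.2 * p.1) by ring.
      by rewrite e; ring.
    apply/dvqP; exists (p0.2 + b * p0.1).
    have -> : p.2 * p0.1 = p0.2 * p.1 + (p.2 * p0.1 - p0.2 * p.1) by ring.
    by rewrite e; ring.
  rewrite -(size_map (fun p => quo p.1 p0.1)); apply: uniq_leq_size.
    rewrite map_inj_in_uniq // => p p' ps p's eq.
    have [d1 _] := dv p ps; have [d1' _] := dv p' p's.
    have er : p.1 = p'.1 by rewrite (quoE d1) (quoE d1') eq.
    have [b e] := key p ps; have [b' e'] := key p' p's.
    have [_ _ a1 _] := mem_farey _ (ss _ ps); have [_ _ a2 _] := mem_farey _ (ss _ p's).
    have : dvq p.1 (p.2 - p'.2).
      apply/dvqP; exists (b - b'); apply: (quad_mulfI Q r00).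
      have -> : p0.1 * (p.2 - p'.2) = (p.2 * p0.1 - p0.2 * p.1) - (p'.2 * p0.1 - p0.2 * p'.1).
        by rewrite er; ring.
      by rewrite e e' er; ring.
    rewrite -er in a2; move=> /(Rep_inj a1 a2) e2.
    by case: p p' er e2 {ps p's eq d1 d1' e e' a1 a2} => [? ?] [? ?] /= -> ->.
  move=> u /mapP[p ps ->]; rewrite mem_nball.
  have [d1 d2] := dv p ps; have [r1 _ _ _] := mem_farey _ (ss _ ps).
  have := dvq_nm_le Q r00 d2; rewrite {1}(quoE d1) nmM -[leqRHS]muln1.
  by rewrite leq_pmul2l // nm_gt0.
apply: ler_wpM2r; first by apply: sumr_ge0 => x _; apply: sqr_ge0.
have hM : (M.+1%:R ^+ 2 : R) <= 16 * (coK Q)%:R ^+ 2 * X%:R.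
  by rewrite -!natrX -!natrM ler_nat.
have hK : ((lsK R0)%:R ^+ 2 : R) <= (2 * (nmK Q * (1 + absz (qt Q)))%N%:R) ^+ 2 * R0%:R ^+ 2.
  rewrite -exprMn lerXn2r ?nnegrE ?mulr_ge0 // -!natrM ler_nat /lsK.
  have : (0 < nmK Q * (1 + absz (qt Q)))%N by rewrite muln_gt0.
  by move: (_ * _)%N => k k0; nia.
have -> : lsC * (X%:R + R0%:R ^+ 2) = (size (nball 1))%:R * (72 ^+ 2 * 2 *
   ((16 * (coK Q)%:R ^+ 2 + (2 * (nmK Q * (1 + absz (qt Q)))%N%:R) ^+ 2) *
   (X%:R + R0%:R ^+ 2))) by rewrite /lsC; ring.
apply: ler_wpM2l => //.
have X0' : (0 : R) <= X%:R by [].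
have R0' : (0 : R) <= R0%:R ^+ 2 by rewrite sqr_ge0.
have c0 : 0 <= 16 * (coK Q)%:R ^+ 2 :> R by rewrite mulr_ge0 ?sqr_ge0.
have d0 : 0 <= (2 * (nmK Q * (1 + absz (qt Q)))%N%:R) ^+ 2 :> R by rewrite sqr_ge0.
set c := 16 * (coK Q)%:R ^+ 2 in hM c0 *; set d := (2 * _) ^+ 2 in hK d0 *.
set x := (X%:R : R) in X0' hM *; set r := R0%:R ^+ 2 in R0' hK *.
clearbody c d x r; move: X0' R0' => x0 r0.
rewrite exprMn.
have : (M.+1%:R + (lsK R0)%:R) ^+ 2 <= 2 * (M.+1%:R ^+ 2 + (lsK R0)%:R ^+ 2) :> R.
  have := sqr_ge0 (M.+1%:R - (lsK R0)%:R : R); rewrite !expr2; move: (M.+1%:R : R) ((lsK R0)%:R : R) => e f; lra.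
have := mulr_ge0 c0 r0; have := mulr_ge0 d0 x0.
have -> : (c + d) * (x + r) = c * x + d * r + c * r + d * x by ring.
have s0 : 0 <= 72 ^+ 2 :> R by apply: sqr_ge0.
move: (72 ^+ 2) s0 => k k0.
move: (M.+1%:R ^+ 2) ((lsK R0)%:R ^+ 2) ((M.+1%:R + (lsK R0)%:R) ^+ 2) hM hK => e f g hM hK h1 h2 h3.
by rewrite -mulrA; apply: ler_wpM2l => //; lra.
Qed.

End LargeSieveO.

(** * Discrepancies and conductors *)

Section Decomposition.
Variables (R : realType) (O : comNzRingType) (Q : quadOrder O) (q : O).
Hypothesis q0 : q != 0.
Implicit Types x y z r d s : O.
Local Notation nm := (nm Q).
Local Notation gT := (unitq Q q0).
Local Notation kerU := (kerU Q q0).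
Local Notation toU := (toU Q q0).

Lemma kerU_nm1 d : nm d = 1%N -> kerU d = [set: gT]%G.
Proof.
move=> h; apply: val_inj; apply/setP => u; rewrite !inE; apply/implyP => _.
exact: nm1_dvq h.
Qed.

Lemma kerU_full : kerU q = 1%G.
Proof.
apply: val_inj; apply/setP => u; rewrite !inE dvqq /= -toU1 -{2}(toU_lift u).
by rewrite toU_eqP ?cop1 ?lift_cop.
Qed.

(** Every function on the unit group is its mean plus its components of
    conductor [r], for [r] a nonunit divisor of [q]: the divisors are treated
    in the order of their norms. *)
Lemma disc_decomp (D : gT -> R[i]) g (phi : O -> R) :
  (forall (Hs : seq {group gT}) r, dvq r q -> nm r != 1%N ->
     (forall d, dvq d r -> (nm d < nm r)%N -> kerU d \in Hs) ->
     cabs (component Hs (kerU r) D g) <= phi r) ->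
  cabs (D g - avg [set: gT]%G D g) <= \sum_(r <- dvs Q q | nm r != 1%N) phi r.
Proof.
move=> hphi; pose x0 : O := 0; pose ds := sort (fun x y => (nm x <= nm y)%N) (dvs Q q).
pose Hs := map kerU ds.
have mds d : (d \in ds) = dvq d q by rewrite mem_sort mem_dvs.
have szds : size Hs = size ds by rewrite size_map.
have tot : total (fun x y => (nm x <= nm y)%N) by move=> x y; apply: leq_total.
have tr : transitive (fun x y => (nm x <= nm y)%N) by move=> y x z; apply: leq_trans.
have sds : sorted (fun x y => (nm x <= nm y)%N) ds by apply: sort_sorted.
have early k d : (k < size ds)%N -> dvq d q -> (nm d < nm (nth x0 ds k))%N ->
    kerU d \in take k Hs.
  move=> hk dq hd; rewrite /Hs -map_take; apply: map_f.
  have dds : d \in ds by rewrite mds.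
  have hi : (index d ds < k)%N.
    rewrite ltnNge; apply/negP => hki.
    have := sorted_leq_nth tr (fun x => leqnn _) x0 sds k (index d ds).
    rewrite !inE hk index_mem dds => /(_ isT isT hki).
    by rewrite nth_index // leqNgt hd.
  rewrite -(nth_index x0 dds) -(nth_take x0 hi); apply: mem_nth.
  by rewrite size_take hk.
have nthH k : (k < size ds)%N -> nth 1%G Hs k = kerU (nth x0 ds k).
  by move=> hk; rewrite /Hs (nth_map x0).
have qHs : 1%G \in Hs by rewrite -kerU_full; apply: map_f; rewrite mds dvqq.
have rem0 : sieve_out Hs D g = 0.
  rewrite -(@avg_id R gT 1%G (sieve_out Hs D) g) ?avg_sieve0 //; first exact: umulC.
  by move=> h; rewrite inE => /eqP ->; rewrite mulg1.
pose cmp k := component (take k Hs) (kerU (nth x0 ds k)) D g.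
have DE : D g = \sum_(k < size ds) cmp k.
  rewrite (@component_sum R gT Hs D (size ds) g) ?szds // -szds take_size rem0 addr0.
  by rewrite szds; apply: eq_bigr => k _; rewrite nthH.
have ds0 : (0 < size ds)%N.
  have : 1 \in ds by rewrite mds (nm1_dvq (Q := Q)) ?nm1.
  by case: (ds).
have nm_nth k : (k < size ds)%N -> (0 < nm (nth x0 ds k))%N.
  move=> hk; rewrite nm_gt0; apply: (dvq_neq0 q0).
  by rewrite -mds mem_nth.
have nm00 : nm (nth x0 ds 0) = 1%N.
  have d1 : 1 \in ds by rewrite mds (nm1_dvq (Q := Q)) ?nm1.
  have := sorted_leq_nth tr (fun x => leqnn _) x0 sds 0 (index 1 ds).
  rewrite !inE ds0 index_mem d1 nth_index // nm1 => /(_ isT isT isT).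
  by have := nm_nth _ ds0 => h1 h2; apply/eqP; rewrite eqn_leq h2 h1.
have c0 : cmp 0%N = avg [set: gT]%G D g.
  by rewrite /cmp take0 (kerU_nm1 nm00).
have unit0 k : (0 < k)%N -> (k < size ds)%N -> nm (nth x0 ds k) = 1%N -> cmp k = 0.
  move=> k0 hk h1; rewrite /cmp (kerU_nm1 h1) /component avg_sieve0 //; first exact: umulC.
  rewrite -(kerU_nm1 nm00) -(nthH _ ds0) -(nth_take _ k0); apply: mem_nth.
  by rewrite size_take szds hk.
have -> : D g - avg [set: gT]%G D g =
    \sum_(k < size ds | nm (nth x0 ds k) != 1%N) cmp k.
  rewrite DE -c0 (bigID (fun k : 'I_(size ds) => nm (nth x0 ds k) != 1%N)) /=.
  rewrite [X in _ + X - _](bigD1 (Ordinal ds0)) /=; last by rewrite negbK nm00.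
  rewrite [X in _ + (_ + X) - _]big1 ?addr0 ?addrK // => k /andP[h1 h2].
  apply: unit0 => //; last by apply/eqP; rewrite negbK in h1.
  by rewrite lt0n; apply: contra h2 => /eqP e; apply/eqP/val_inj.
apply: (@le_trans _ _ (\sum_(k < size ds | nm (nth x0 ds k) != 1%N) phi (nth x0 ds k))).
  apply: cabs_sum_le => k k1; apply: hphi => //.
    by rewrite -mds mem_nth.
  move=> d dk hd; apply: early => //; apply: dvq_trans dk _.
  by rewrite -mds mem_nth.
rewrite -(big_mkord (fun k => nm (nth x0 ds k) != 1%N) (fun k => phi (nth x0 ds k))).
rewrite -(big_nth x0 (fun d => nm d != 1%N) phi).
by rewrite (perm_big (dvs Q q)) // perm_sort.
Qed.

Variables (SX SY : seq O) (a b : O -> R[i]).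

(** The sum over the pairs whose product lies in a given class, as a function
    on the unit group. *)
Definition pairD (T : nat) (u : gT) : R[i] :=
  \sum_(x <- SX | cop q x) \sum_(y <- SY | [&& cop q y, (nm (x * y) <= T)%N
    & (toU x * toU y)%g == u]) a x * b y.

(** The discrepancy of the sequence [x * y], weighted by [a x * b y]. *)
Definition pair_disc (T : nat) (c : O) : R[i] :=
  \sum_(x <- SX) \sum_(y <- SY | (nm (x * y) <= T)%N && dvq q (x * y - c)) a x * b y
  - (size (unitReps Q q))%:R^-1 *
    \sum_(x <- SX) \sum_(y <- SY | (nm (x * y) <= T)%N && cop q (x * y)) a x * b y.

(** Subtracting the expected value is subtracting the mean over the group. *)
Lemma pair_discE T c : cop q c ->
  pair_disc T c = pairD T (toU c) - avg [set: gT]%G (pairD T) (toU c).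
Proof.
move=> cc; rewrite /pair_disc; congr (_ - _).
  rewrite (bigID (cop q)) /= [X in _ + X]big1 ?addr0; last first.
    move=> x ncx; apply: big_pred0 => y; apply/negbTE; apply: contra ncx.
    move=> /andP[_ h]; apply: cop_dvl (dvq_mulr x y) _.
    by rewrite (cop_congr h).
  apply: eq_bigr => x cx; apply: eq_bigl => y.
  have [cy|ncy] := boolP (cop q y); last first.
    apply/negbTE; rewrite negb_and; apply/orP; right; apply: contra ncy => h.
    by apply: cop_dvl (_ : dvq y (x * y)) _; rewrite ?(cop_congr h) // mulrC dvq_mulr.
  by rewrite /= -toUM // toU_eqP ?cop_mul.
rewrite /avg cardsT card_unitq; congr (_ * _).
rewrite (reindex_inj (mulgI (toU c)^-1)%g) /=.
under [RHS]eq_bigr do rewrite mulKVg.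
rewrite /pairD exchange_big /= (bigID (cop q)) /= [X in _ + X]big1 ?addr0; last first.
  move=> x ncx; apply: big_pred0 => y; apply/negbTE; apply: contra ncx => /andP[_].
  exact: cop_dvl (dvq_mulr x y).
apply: eq_bigr => x cx.
rewrite (exchange_big_dep (fun y => (nm (x * y) <= T)%N && cop q (x * y))) /=; last first.
  by move=> u y _ /and3P[cy -> _]; rewrite cop_mul.
apply: eq_bigr => y /andP[hT cxy].
have cy : cop q y by apply: cop_dvl cxy; rewrite mulrC dvq_mulr.
by rewrite (big_pred1 (toU x * toU y)%g) // => u; rewrite /= finset.in_setT hT cy /= eq_sym.
Qed.

(** Fixing the first factor, the class of the second is translated by its
    inverse. *)
Lemma pairD_transl T u : pairD T u = \sum_(x <- SX | cop q x) a x *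
   grp_fun [seq y <- SY | (nm (x * y) <= T)%N] b ((toU x)^-1 * u)%g.
Proof.
apply: eq_bigr => x cx; rewrite /grp_fun big_filter_cond mulr_sumr.
apply: eq_bigl => y; rewrite andbCA; congr (_ && (_ && _)).
by apply/eqP/eqP => [<-|->]; [rewrite mulKg | rewrite mulKVg].
Qed.

End Decomposition.

(** * Components of large and of small conductor *)

Section HighComponent.
Variables (R : realType) (O : comNzRingType) (Q : quadOrder O) (q r s : O).
Hypothesis q0 : q != 0.
Hypothesis qE : q = r * s.
Implicit Types x y z d : O.
Local Notation nm := (nm Q).
Local Notation gT := (unitq Q q0).
Local Notation kerU := (kerU Q q0).
Local Notation toU := (toU Q q0).
Local Notation Rep := (Rep Q).

(** The mean square at the fractions of denominator [r], restricted to
    arguments prime to [s]. *)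
Definition lsum (S : seq O) (F : O -> R[i]) (r s : O) : R :=
  \sum_(a <- Rep r | cop r a)
    cabs (\sum_(x <- S | cop s x) F x * ecx (Lq R Q (a * x) r)) ^+ 2.

Lemma lsum_ge0 S F r' s' : 0 <= lsum S F r' s'.
Proof. by apply: sumr_ge0 => a _; apply: sqr_ge0. Qed.

Definition repW : R := (8 * nmK Q)%N%:R ^+ 2.

Let r0 : r != 0. Proof. by apply: contra q0 => /eqP e; rewrite qE e mul0r. Qed.
Let s0 : s != 0. Proof. by apply: contra q0 => /eqP e; rewrite qE e mulr0. Qed.
Let rq : dvq r q. Proof. by rewrite qE dvq_mulr. Qed.

(** At least a proportion [2 ^- size ps] of the classes modulo [s] gives
    kernel elements, and this power of two is at most [tau s]. *)
Lemma nm_s_le : (nm s <= 8 * nmK Q * tau Q s * #|kerU r|)%N.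
Proof.
have [ps hps] := prime_support_ex Q s0.
apply: (leq_trans (size_Rep_ge Q s0)); rewrite -[leqRHS]mulnA leq_mul2l.
apply/orP; right; apply: (leq_trans (card_kerU_ge q0 qE hps)).
by rewrite leq_mul2r (pow2_le_tau s0 hps) orbT.
Qed.

Lemma card_weight : ((size (Rep r))%:R * #|kerU r|%:R)^-1 <=
  repW * (tau Q s)%:R / ((nm r)%:R * (nm s)%:R) :> R.
Proof.
have rp : (0 : R) < (nm r)%:R by rewrite ltr0n nm_gt0.
have sp : (0 : R) < (nm s)%:R by rewrite ltr0n nm_gt0.
have mp : (0 : R) < (size (Rep r))%:R.
  by have := mem_Rep Q 0 r0; rewrite ltr0n; case: (Rep r).
have Kp : (0 : R) < #|kerU r|%:R by rewrite ltr0n cardG_gt0.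
rewrite -[leLHS]div1r ler_pdivrMr ?mulr_gt0 // mulrAC ler_pdivlMr ?mulr_gt0 // mul1r.
rewrite /repW -natrX -!natrM ler_nat.
apply: (leq_trans (leq_mul (size_Rep_ge Q r0) nm_s_le)).
by rewrite expnS expn1; move: (8 * nmK Q)%N (size _) (tau _ _) #|_| => a b c d; nia.
Qed.

Variable Hs : seq {group gT}.
Hypothesis Hs_dvd : forall d, dvq d r -> (nm d < nm r)%N -> kerU d \in Hs.

Section Separated.
Variables (SX SY : seq O) (a b : O -> R[i]) (Zm P : nat).
Variables (phi c : 'I_P -> nat -> R[i]) (ch : 'I_P -> R).
Hypothesis ch_ge0 : forall k, 0 <= ch k.
Hypothesis c_le : forall k t, (t <= Zm)%N -> cabs (c k t) <= ch k.
Hypothesis sepP : forall m n t, (0 < m)%N -> (0 < n)%N -> (m * n <= Zm)%N ->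
  (t <= Zm)%N -> \sum_k c k t * (phi k m * phi k n) = (m * n <= t)%N%:R.
Hypothesis SXY : forall x y, x \in SX -> y \in SY ->
  [/\ x != 0, y != 0 & (nm (x * y) <= Zm)%N].

(** The phase that carries the condition on the norm of the product after
    separation. *)
Definition twist (f : O -> R[i]) (k : 'I_P) x : R[i] := f x * phi k (nm x).

(** After separation of the norm condition the sum over pairs is a
    combination of convolutions on the group. *)
Lemma pairD_sep T u : (T <= Zm)%N -> @pairD R O Q q q0 SX SY a b T u =
  \sum_k c k T * gconv (@grp_fun R O Q q q0 SX (twist a k)) (@grp_fun R O Q q q0 SY (twist b k)) u.
Proof.
move=> TZ; under eq_bigr do rewrite /gconv (sum_grp_fun _ _ (fun v => @grp_fun R O Q q q0 SY _ (v^-1 * u)%g)).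
transitivity (\sum_(x <- SX | cop q x) \sum_(y <- SY | cop q y && (toU y == (toU x)^-1 * u)%g)
    \sum_k a x * b y * (c k T * (phi k (nm x) * phi k (nm y)))).
  rewrite /pairD big_seq_cond [RHS]big_seq_cond; apply: eq_bigr => x /andP[xS cx].
  rewrite big_seq_cond [RHS]big_seq_cond.
  transitivity (\sum_(y <- SY | (y \in SY) && (cop q y && (toU y == (toU x)^-1 * u)%g))
      a x * b y * (nm (x * y) <= T)%N%:R).
    rewrite [RHS](bigID (fun y => (nm (x * y) <= T)%N)) /= [X in _ + X]big1 ?addr0; last first.
      by move=> y /andP[_ /negbTE ->]; rewrite mulr0.
    apply: eq_big => y.
      have -> : (toU x * toU y == u)%g = (toU y == (toU x)^-1 * u)%g.
        by apply/eqP/eqP => [<-|->]; [rewrite mulKg | rewrite mulKVg].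
      by move: (y \in SY) (cop q y) (nm (x * y) <= T)%N (_ == _) => [] [] [] [].
    by move=> /and4P[_ _ -> _]; rewrite mulr1.
  apply: eq_bigr => y /and3P[yS cy _]; rewrite -mulr_sumr.
  have [x0 y0 hxy] := SXY xS yS.
  by rewrite sepP ?nm_gt0 -?nmM.
transitivity (\sum_(x <- SX | cop q x) \sum_k
    \sum_(y <- SY | cop q y && (toU y == (toU x)^-1 * u)%g)
    a x * b y * (c k T * (phi k (nm x) * phi k (nm y)))).
  by apply: eq_bigr => x _; rewrite exchange_big.
rewrite exchange_big; apply: eq_bigr => k _ /=; rewrite mulr_sumr.
apply: eq_bigr => x cx; rewrite /grp_fun /twist !mulr_sumr; apply: eq_bigr => y _.
by ring.
Qed.

(** Each convolution is estimated in sup norm by the mean squares of the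
    components of its factors. *)
Lemma high_component T g : (T <= Zm)%N ->
  cabs (component Hs (kerU r) (@pairD R O Q q q0 SX SY a b T) g) <=
  repW * (tau Q s)%:R / ((nm r)%:R * (nm s)%:R) * \sum_k ch k *
    (Num.sqrt (lsum SX (twist a k) r s) * Num.sqrt (lsum SY (twist b k) r s)).
Proof.
move=> TZ; have oc := @oproj_component R gT (@umulC O Q q q0) Hs (kerU r).
have cc : convop (component Hs (kerU r) (R := R)) by case: oc.
have -> : @pairD R O Q q q0 SX SY a b T = fun u => \sum_k c k T *
    gconv (@grp_fun R O Q q q0 SX (twist a k)) (@grp_fun R O Q q q0 SY (twist b k)) u.
  by apply/funext => u; apply: pairD_sep.
rewrite convop_lin // mulr_sumr; apply: cabs_sum_le => k _; rewrite cabsM mulrCA.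
apply: ler_pM; rewrite ?cabs_ge0 ?c_le //.
apply: (le_trans (oproj_gconv (@umulC O Q q q0) _ _ _ oc)).
have hX := high_bound qE SX (twist a k) Hs_dvd.
have hY := high_bound qE SY (twist b k) Hs_dvd.
set w := (_ * _)^-1 in hX hY; have w0 : 0 <= w by rewrite invr_ge0 mulr_ge0.
apply: (@le_trans _ _ (Num.sqrt (w * lsum SX (twist a k) r s) *
                       Num.sqrt (w * lsum SY (twist b k) r s))).
  by apply: ler_pM; rewrite ?sqrtr_ge0 // ler_sqrt // mulr_ge0 // lsum_ge0.
rewrite !sqrtrM // mulrACA -expr2 sqr_sqrtr //.
apply: ler_wpM2r; first by rewrite mulr_ge0 ?sqrtr_ge0.
exact: card_weight.
Qed.

End Separated.
End HighComponent.

Section Sieve.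
Variables (R : realType) (O : comNzRingType) (Q : quadOrder O).
Implicit Types x y z r d s p m : O.
Local Notation nm := (nm Q).
Variables (S : seq O) (al : O -> R[i]).

(** The sum of [al] over multiples of every element of [D] that are multiples
    of no element of [C]. *)
Definition siftsum (D C : seq O) : R[i] :=
  \sum_(y <- S | all (fun p => dvq p y) D && all (fun p => ~~ dvq p y) C) al y.

Lemma siftsum_consC D C p : siftsum D (p :: C) = siftsum D C - siftsum (rcons D p) C.
Proof.
apply/eqP; rewrite eq_sym subr_eq; apply/eqP.
rewrite [LHS](bigID (fun y => dvq p y)) /= addrC; congr (_ + _); apply: eq_bigl => y /=.
  by rewrite -andbA; congr (_ && _); rewrite andbC.
by rewrite all_rcons andbC andbA.
Qed.

Lemma siftsum_consD D C p : siftsum (p :: D) C = siftsum D C - siftsum D (rcons C p).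
Proof.
apply/eqP; rewrite eq_sym subr_eq; apply/eqP.
rewrite [LHS](bigID (fun y => dvq p y)) /=; congr (_ + _); apply: eq_bigl => y /=.
  by rewrite andbC andbA.
by rewrite all_rcons -andbA; congr (_ && _); rewrite andbC.
Qed.

(** Adding one prime to the condition [C] at most doubles the bound. *)
Lemma siftsum_unsift (ps : seq O) (E : R) :
  (forall L, subseq L ps -> cabs (siftsum L [::]) <= E) ->
  forall C D, subseq (D ++ C) ps -> cabs (siftsum D C) <= 2 ^+ size C * E.
Proof.
move=> h; elim=> [|p C IH] D; first by rewrite cats0 mul1r => /h.
move=> hs; rewrite siftsum_consC; apply: (le_trans (cabs_le_sub _ _)).
rewrite /= exprS -mulrA mulr_natl mulr2n; apply: lerD; apply: IH.
  by apply: subseq_trans hs; apply: cat_subseq; rewrite ?subseq_refl ?subseq_cons.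
by rewrite cat_rcons.
Qed.

(** Exchanging one divisibility for a coprimality condition at most doubles
    the bound. *)
Lemma siftsum_resift (ps : seq O) (E : R) :
  (forall L, subseq L ps -> cabs (siftsum [::] L) <= E) ->
  forall D C, subseq (C ++ D) ps -> cabs (siftsum D C) <= 2 ^+ size D * E.
Proof.
move=> h; elim=> [|p D IH] C; first by rewrite cats0 mul1r => /h.
move=> hs; rewrite siftsum_consD; apply: (le_trans (cabs_le_sub _ _)).
rewrite /= exprS -mulrA mulr_natl mulr2n; apply: lerD; apply: IH.
  by apply: subseq_trans hs; apply: cat_subseq; rewrite ?subseq_refl ?subseq_cons.
by rewrite cat_rcons.
Qed.

(** Truncated inclusion-exclusion: products of primes of norm at most [z] are
    traded for coprimality conditions to small moduli, the larger ones are
    estimated trivially. *)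
Lemma sieve_bound s ps (z : nat) (eps : R) : s != 0 -> prime_support Q s ps ->
  0 <= eps ->
  (forall L, subseq L ps -> (nm (prodq L) <= z)%N -> cabs (siftsum [::] L) <= eps) ->
  cabs (siftsum [::] ps) <= (tau Q s)%:R ^+ 2 * eps + (tau Q s)%:R *
    \sum_(y <- S) cabs (al y) * (count (fun d => dvq d y && (z < nm d)%N) (dvs Q s))%:R.
Proof.
move=> s0 hps e0 h; have [hi h2 _] := hps.
set Tail := \sum_(y <- S) _.
have Tail0 : 0 <= Tail by apply: sumr_ge0 => y _; rewrite mulr_ge0 ?cabs_ge0.
have p2 : (2 ^+ size ps : R) <= (tau Q s)%:R by rewrite -natrX ler_nat pow2_le_tau.
have sub_indep L : subseq L ps -> indep Q L.
  move=> hL; case: hi => i1 i2; split; last exact: subseq_pairwise hL i2.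
  by move=> p pL; apply: i1; apply: mem_subseq hL _ pL.
have hdv L : subseq L ps -> dvq (prodq L) s.
  move=> hL; apply: (prodq_dvd (sub_indep _ hL)) => p pL; apply: h2.
  exact: mem_subseq hL _ pL.
have key L : subseq L ps -> cabs (siftsum L [::]) <= (tau Q s)%:R * eps + Tail.
  move=> hL; have [hz|hz] := leqP (nm (prodq L)) z.
    apply: (@le_trans _ _ (2 ^+ size L * eps)).
      apply: (@siftsum_resift L) => [L' hL'|]; last by rewrite subseq_refl.
      apply: h; first exact: subseq_trans hL.
      apply: leq_trans hz; apply: dvq_nm_le; first by apply: dvq_neq0 s0 (hdv _ hL).
      apply: (prodq_dvd (sub_indep _ (subseq_trans hL' hL))) => p pL'.
      by apply: dvq_prodq; apply: mem_subseq hL' _ pL'.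
    apply: ler_wpDr => //; apply: ler_wpM2r => //; apply: le_trans p2.
    by rewrite ler_weXn2l ?ler1n // size_subseq.
  apply: ler_wpDl; first by rewrite mulr_ge0.
  apply: (le_trans (cabs_sum _ _ _)); rewrite big_mkcond /Tail; apply: ler_sum => y _.
  case: ifP => [|_]; last by rewrite mulr_ge0 ?cabs_ge0.
  rewrite /= andbT => /allP hy; rewrite ler_peMr ?cabs_ge0 // ler1n -has_count.
  apply/hasP; exists (prodq L); first by rewrite mem_dvs // hdv.
  by rewrite hz andbT; apply: (prodq_dvd (sub_indep _ hL)).
have := @siftsum_unsift ps _ key ps [::] (subseq_refl _) => hfin.
apply: (le_trans hfin); apply: (@le_trans _ _ ((tau Q s)%:R * ((tau Q s)%:R * eps + Tail))).
  by apply: ler_wpM2r => //; rewrite addr_ge0 // mulr_ge0.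
by rewrite mulrDr mulrA expr2.
Qed.

End Sieve.

Section LowComponent.
Variables (R : realType) (O : comNzRingType) (Q : quadOrder O).
Implicit Types x y z r d s p m q e : O.
Local Notation nm := (nm Q).

(** The discrepancy of [b] on [S] in the class of [v] modulo [m]. *)
Definition class_disc (S : seq O) (b : O -> R[i]) m v : R[i] :=
  \sum_(y <- S | dvq m (y - v)) b y
  - (size (unitReps Q m))%:R^-1 * \sum_(y <- S | cop m y) b y.

Lemma unitReps_le m : m != 0 -> (size (unitReps Q m) <= repC Q * nm m)%N.
Proof.
move=> m0; apply: leq_trans (size_Rep Q m0).
by rewrite size_filter count_size.
Qed.

(** The condition modulo [r] is refined to classes modulo [r * e], where
    coprimality to [e] is a union of classes; the mean values cancel. *)
Lemma coset_diff (S : seq O) (b : O -> R[i]) r e u u' (eta : R) :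
  r * e != 0 -> cop (r * e) u -> cop (r * e) u' ->
  (forall v, cop (r * e) v -> cabs (class_disc S b (r * e) v) <= eta) ->
  cabs (\sum_(y <- S | cop e y) b y * ((dvq r (y - u))%:R - (dvq r (y - u'))%:R)) <=
  2 * (repC Q * nm (r * e))%N%:R * eta.
Proof.
move=> m0 cu cu' h; set m := r * e in m0 cu cu' h *.
have rm : dvq r m by rewrite dvq_mulr.
pose mean := (size (unitReps Q m))%:R^-1 * \sum_(y <- S | cop m y) b y.
pose K := #|kerU Q m0 r|.
have eta0 : 0 <= eta by apply: le_trans (h _ cu); apply: cabs_ge0.
have key v : cop m v -> \sum_(y <- S | cop e y) b y * (dvq r (y - v))%:R =
    \sum_(w : unitq Q m0 | dvq r (lift w - v)) class_disc S b m (lift w) + K%:R * mean.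
  move=> cv.
  have -> : K%:R * mean = \sum_(w : unitq Q m0 | dvq r (lift w - v)) mean.
    rewrite [RHS](eq_bigl (fun w : unitq Q m0 => dvq r (lift w - lift (toU Q m0 v)))); last first.
      move=> w; apply: dvq_congr; rewrite opprB addrC addrA subrK.
      by apply: dvq_trans rm _; apply: toU_mod.
    rewrite -(sum_coset (toU Q m0 v) (fun=> mean) rm) sumr_const.
    by rewrite mulr_natl.
  rewrite -big_split /=.
  under [RHS]eq_bigr do rewrite /class_disc subrK.
  rewrite (exchange_big_dep (fun y => cop e y && dvq r (y - v))) /=; last first.
    move=> w y hw hy; have cw := lift_cop w.
    have : cop m y by rewrite (cop_congr hy).
    rewrite cop_mulE => /andP[_ ->] /=; apply: dvq_subtrans hw.
    exact: dvq_trans rm hy.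
  rewrite [RHS]big_mkcondr; apply: eq_bigr => y ce; case: ifPn => hy; last by rewrite mulr0.
  rewrite mulr1; have cy : cop m y.
    rewrite cop_mulE ce andbT (cop_congr hy); exact: cop_dvr rm cv.
  rewrite (big_pred1 (toU Q m0 y)) // => w /=.
  have -> : (w == toU Q m0 y) = dvq m (lift w - y).
    by rewrite -{1}(toU_lift w) toU_eqP ?lift_cop.
  rewrite [RHS]dvqC andb_idl // => hw; apply: (@dvq_subtrans _ _ _ y) => //.
  by rewrite dvqC; apply: dvq_trans rm hw.
have bnd v : cop m v ->
    cabs (\sum_(w : unitq Q m0 | dvq r (lift w - v)) class_disc S b m (lift w)) <=
    (repC Q * nm m)%N%:R * eta.
  move=> cv; apply: (@le_trans _ _ (\sum_(w : unitq Q m0) eta)).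
    apply: (le_trans (cabs_sum _ _ _)); rewrite big_mkcond; apply: ler_sum => w _.
    by case: ifP => // _; apply: h; apply: lift_cop.
  have -> : \sum_(w : unitq Q m0) eta = #|{: unitq Q m0}|%:R * eta.
    by rewrite mulr_natl -sumr_const; apply: eq_bigl.
  by apply: ler_wpM2r => //; rewrite ler_nat card_unitq unitReps_le.
have -> : \sum_(y <- S | cop e y) b y * ((dvq r (y - u))%:R - (dvq r (y - u'))%:R) =
  \sum_(w : unitq Q m0 | dvq r (lift w - u)) class_disc S b m (lift w) -
  \sum_(w : unitq Q m0 | dvq r (lift w - u')) class_disc S b m (lift w).
  under eq_bigr do rewrite mulrBr.
  by rewrite sumrB (key u cu) (key u' cu') opprD addrACA subrr addr0.
apply: (le_trans (cabs_le_sub _ _)).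
by rewrite -mulrA mulr_natl mulr2n; apply: lerD; apply: bnd.
Qed.

Variables (q r s : O).
Hypothesis q0 : q != 0.
Hypothesis qE : q = r * s.
Local Notation gT := (unitq Q q0).
Local Notation kerU := (kerU Q q0).

Let r0 : r != 0. Proof. by apply: contra q0 => /eqP e; rewrite qE e mul0r. Qed.
Let s0 : s != 0. Proof. by apply: contra q0 => /eqP e; rewrite qE e mulr0. Qed.
Let rq : dvq r q. Proof. by rewrite qE dvq_mulr. Qed.

Variable Hs : seq {group gT}.
Hypothesis Hs_dvd : forall d, dvq d r -> (nm d < nm r)%N -> kerU d \in Hs.
Hypothesis r1 : nm r != 1%N.

Variables (S : seq O) (b : O -> R[i]) (z : nat) (eta : R).
Hypothesis eta0 : 0 <= eta.
Hypothesis small_disc : forall m v, m != 0 -> (nm m <= nm r * z)%N -> cop m v ->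
  cabs (class_disc S b m v) <= eta.

(** Multiples of a divisor of [s] of norm exceeding [z]; there are few of
    them. *)
Definition tail_sum (S : seq O) (s : O) : R :=
  \sum_(y <- S) cabs (b y) * (count (fun d => dvq d y && (z < nm d)%N) (dvs Q s))%:R.

Local Lemma sifted_diff (u u' : gT) :
  cabs (\sum_(y <- S | cop s y) b y * ((dvq r (y - lift u))%:R - (dvq r (y - lift u'))%:R)) <=
  (tau Q s)%:R ^+ 2 * (2 * (repC Q * nm r * z)%N%:R * eta) + (tau Q s)%:R * (2 * tail_sum S s).
Proof.
have [ps hps] := prime_support_ex Q s0; have [hi h2 _] := hps.
pose al y := b y * ((dvq r (y - lift u))%:R - (dvq r (y - lift u'))%:R).
have -> : \sum_(y <- S | cop s y) b y * ((dvq r (y - lift u))%:R - (dvq r (y - lift u'))%:R)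
   = siftsum S al [::] ps.
  by apply: eq_bigl => y; rewrite /= (cop_support _ s0 hps).
apply: (le_trans (@sieve_bound R O Q S al s ps z (2 * (repC Q * nm r * z)%N%:R * eta)
   s0 hps _ _)).
- by rewrite !mulr_ge0.
- move=> L hL hz.
  have iL : indep Q L.
    case: hi => i1 i2; split; last exact: subseq_pairwise hL i2.
    by move=> p pL; apply: i1; apply: mem_subseq hL _ pL.
  have Ls : dvq (prodq L) s.
    by apply: (prodq_dvd iL) => p pL; apply: h2; apply: mem_subseq hL _ pL.
  have L0 := dvq_neq0 s0 Ls.
  have LL : prime_support Q (prodq L) L.
    split=> //; first by move=> p; apply: dvq_prodq.
    move=> p pp pL; apply: contrapT => hn.
    have := prime_ndvd_prodq pp (ps := L); rewrite pL => hh.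
    suff : ~~ true by [].
    apply: hh => p' p'L; apply/negP => pp'; apply: hn; exists p' => //.
    by apply: (qprime_sym pp) => //; case: iL => i1 _; apply: i1.
  have mq : dvq (r * prodq L) q by rewrite qE (dvq_pmul2l Q).
  have -> : siftsum S al [::] L = \sum_(y <- S | cop (prodq L) y) al y.
    by apply: eq_bigl => y; rewrite /= (cop_support _ L0 LL).
  apply: (le_trans (@coset_diff S b r (prodq L) (lift u) (lift u') eta _ _ _ _)).
  + exact: dvq_neq0 q0 mq.
  + exact: cop_dvr mq (lift_cop u).
  + exact: cop_dvr mq (lift_cop u').
  + move=> v cv; apply: small_disc => //; first exact: dvq_neq0 q0 mq.
    by rewrite nmM leq_mul2l hz orbT.
  apply: ler_wpM2r => //; apply: ler_wpM2l => //; rewrite ler_nat nmM -mulnA.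
  by rewrite !leq_mul2l hz !orbT.
rewrite lerD2l; apply: ler_wpM2l => //; rewrite /tail_sum mulr_sumr; apply: ler_sum => y _.
rewrite mulrA; apply: ler_wpM2r => //; rewrite /al cabsM mulrC.
apply: ler_wpM2r; first exact: cabs_ge0.
apply: (le_trans (cabs_le_sub _ _)); rewrite !cabs_nat.
by rewrite -natrD ler_nat; case: dvq; case: dvq.
Qed.

(** The mean of the function over cosets of the kernel counts elements in a
    class modulo [r] prime to [s]; the oscillation of these counts is
    estimated by the sieve. *)
Lemma low_component g :
  cabs (component Hs (kerU r) (@grp_fun R O Q q q0 S b) g) <=
  (repC Q * nm r)%N%:R * ((8 * nmK Q * tau Q s)%N%:R / (nm s)%:R) *
  ((tau Q s)%:R ^+ 2 * (2 * (repC Q * nm r * z)%N%:R * eta) +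
   (tau Q s)%:R * (2 * tail_sum S s)).
Proof.
set Bd := _ + _.
have Tail0 : 0 <= tail_sum S s by apply: sumr_ge0 => y _; rewrite mulr_ge0 ?cabs_ge0.
have Bd0 : 0 <= Bd by rewrite /Bd addr_ge0 // !mulr_ge0 // exprn_ge0.
have Kp : (0 : R) < #|kerU r|%:R by rewrite ltr0n cardG_gt0.
have sp : (0 : R) < (nm s)%:R by rewrite ltr0n nm_gt0.
have K1 : #|kerU r|%:R^-1 <= (8 * nmK Q * tau Q s)%N%:R / (nm s)%:R :> R.
  rewrite -[leLHS]div1r ler_pdivrMr // mulrAC ler_pdivlMr // mul1r -natrM ler_nat.
  exact: nm_s_le.
have avgE (v : gT) : avg (kerU r) (@grp_fun R O Q q q0 S b) v =
    #|kerU r|%:R^-1 * \sum_(y <- S | cop s y) b y * (dvq r (y - lift v))%:R.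
  rewrite /avg sum_coset //; congr (_ * _); rewrite /grp_fun.
  rewrite (exchange_big_dep (fun y => cop q y && dvq r (y - lift v))) /=; last first.
    move=> w y hw /andP[cy /eqP e]; rewrite cy /=; rewrite -e in hw.
    apply: dvq_subtrans hw; rewrite dvqC; apply: dvq_trans rq _; exact: toU_mod.
  rewrite [RHS](bigID (fun y => dvq r (y - lift v))) /= [X in _ = _ + X]big1 ?addr0; last first.
    by move=> y /andP[_ /negbTE ->]; rewrite mulr0.
  apply: eq_big => y.
    apply: andb_id2r => hy; rewrite qE cop_mulE (cop_congr hy).
    by rewrite (cop_dvr rq (lift_cop v)).
  move=> /andP[cy hy]; rewrite hy mulr1 (big_pred1 (toU Q q0 y)) // => w /=.
  rewrite cy /= [w == _]eq_sym andb_idl // => /eqP <-.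
  apply: dvq_subtrans hy; apply: dvq_trans rq _; exact: toU_mod.
have TH : [set: gT]%G \in Hs.
  rewrite -(kerU_nm1 q0 (nm1 Q)); apply: Hs_dvd; first exact: nm1_dvq (nm1 Q).
  by rewrite nm1 ltn_neqAle eq_sym r1 nm_gt0.
apply: (le_trans (@component_low R gT (@umulC O Q q q0) Hs (kerU r)
   (@grp_fun R O Q q q0 S b) (#|kerU r|%:R^-1 * Bd) g _ TH _)).
- by rewrite mulr_ge0 // invr_ge0.
- move=> u v; rewrite !avgE -mulrBr cabsM cabsV cabs_nat; apply: ler_wpM2l.
    by rewrite invr_ge0.
  rewrite -sumrB; under eq_bigr do rewrite -mulrBr.
  exact: sifted_diff.
rewrite mulrA; apply: ler_wpM2r => //; apply: ler_pM; rewrite ?divr_ge0 ?invr_ge0 //.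
rewrite ler_pdivrMr // -natrM ler_nat; have h := card_unitq_le Q q0 rq r0; apply: leq_trans h _.
by rewrite leq_mul2r size_Rep ?orbT.
Qed.

End LowComponent.

(** * Summation over the moduli *)

Section Totals.
Variables (R : realType) (O : comNzRingType) (Q : quadOrder O).
Implicit Types x y z r d q s e : O.
Local Notation nm := (nm Q).
Local Notation nball := (nball Q).
Local Notation dvs := (dvs Q).
Local Notation tau := (tau Q).
Local Notation moment := (moment R Q).

Lemma quoK d e : d != 0 -> quo (d * e) d = e.
Proof. by move=> d0; apply: (quad_mulfI Q d0); rewrite -quoE // dvq_mulr. Qed.

Lemma sqrt_add_le (X u : R) : 0 <= X -> 0 <= u -> Num.sqrt (X + u ^+ 2) <= Num.sqrt X + u.
Proof.
move=> X0 u0; have s0 := sqrtr_ge0 X.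
rewrite -[leRHS]ger0_norm ?addr_ge0 // -sqrtr_sqr ler_sqrt ?sqr_ge0 //.
by rewrite sqrrD sqr_sqrtr // lerD2r lerDl mulrn_wge0 // mulr_ge0.
Qed.

(** Bounds, uniformly in the dyadic range of [nm d], the sum of the products
    of two large sieve terms with weight [1 / nm d]. *)
Definition dyadic_bound (X Y R0 Q0 : R) : R :=
  2 * (Num.sqrt X * Num.sqrt Y) / R0 + 2 * Num.sqrt X + 2 * Num.sqrt Y + 4 * Q0.

Lemma dyadic_bound_ge0 X Y (R0 Q0 : nat) : 0 <= dyadic_bound X Y R0%:R Q0%:R.
Proof.
have X0 := sqrtr_ge0 X; have Y0 := sqrtr_ge0 Y.
have h : 0 <= 2 * (Num.sqrt X * Num.sqrt Y) / R0%:R by rewrite divr_ge0 // !mulr_ge0.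
by rewrite /dyadic_bound; have := ler0n R Q0; lra.
Qed.

(** Cauchy's inequality in each dyadic range of [nm d]; the factor [1 / nm d]
    makes the ranges sum to a bounded multiple of their extreme values. *)
Lemma dyadic_sum (f g : O -> R) (al be X Y : R) (R0 Q0 J : nat) :
  (0 < R0)%N -> (Q0 < 2 ^ J)%N -> 0 <= X -> 0 <= Y -> 0 <= al -> 0 <= be ->
  (forall d, 0 <= f d) -> (forall d, 0 <= g d) ->
  (forall j, \sum_(d <- nball (2 ^ j.+1) | d != 0) f d ^+ 2 <= al * (X + (2 ^ j.+1)%N%:R ^+ 2)) ->
  (forall j, \sum_(d <- nball (2 ^ j.+1) | d != 0) g d ^+ 2 <= be * (Y + (2 ^ j.+1)%N%:R ^+ 2)) ->
  \sum_(d <- nball Q0 | (d != 0) && (R0 <= nm d)%N) (nm d)%:R^-1 * (f d * g d) <=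
  J%:R * (Num.sqrt al * Num.sqrt be * dyadic_bound X Y R0%:R Q0%:R).
Proof.
move=> R00 QJ X0 Y0 al0 be0 f0 g0 hf hg.
have R0p : (0 : R) < R0%:R by rewrite ltr0n.
set B := _ * dyadic_bound _ _ _ _.
have B0 : 0 <= B by rewrite /B mulr_ge0 ?dyadic_bound_ge0 // mulr_ge0 ?sqrtr_ge0.
have FG0 d : 0 <= (nm d)%:R^-1 * (f d * g d) by rewrite mulr_ge0 ?invr_ge0 ?mulr_ge0.
apply: (@le_trans _ _ (\sum_(j < J)
   \sum_(d <- nball Q0 | [&& d != 0, (R0 <= nm d)%N & trunc_log 2 (nm d) == j])
     (nm d)%:R^-1 * (f d * g d))).
  rewrite (exchange_big_dep (fun d => (d != 0) && (R0 <= nm d)%N)) /=; last first.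
    by move=> j d _ /and3P[-> ->].
  rewrite big_seq_cond [leRHS]big_seq_cond; apply: ler_sum => d /andP[dQ /andP[d0 hd]].
  have hj : (trunc_log 2 (nm d) < J)%N.
    rewrite -(@ltn_exp2l 2) //; apply: leq_ltn_trans QJ; move: dQ; rewrite mem_nball.
    by apply: leq_trans; apply: trunc_logP; rewrite ?nm_gt0.
  by rewrite (big_pred1 (Ordinal hj)) // => j; rewrite d0 hd /= -val_eqE /= eq_sym.
apply: (@le_trans _ _ (\sum_(j < J) B)); last first.
  by rewrite sumr_const card_ord mulr_natl.
apply: ler_sum => j _.
have [/hasP[d0 d0Q /and3P[d00 hR /eqP hj]]|/hasPn hn] := boolP (has (fun d =>
    [&& d != 0, (R0 <= nm d)%N & trunc_log 2 (nm d) == j]) (nball Q0)); last first.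
  by rewrite big_seq_cond big_pred0 // => d; apply/negbTE; apply/negP => /andP[/hn/negbTE ->].
have jlo : (2 ^ j <= Q0)%N.
  move: d0Q; rewrite mem_nball; apply: leq_trans; rewrite -hj.
  by apply: trunc_logP; rewrite ?nm_gt0.
have jhi : (R0 <= 2 ^ j.+1)%N.
  by rewrite -hj; apply: (leq_trans hR); apply: ltnW; apply: trunc_log_ltn.
set u : R := (2 ^ j)%N%:R; have up : 0 < u by rewrite ltr0n expn_gt0.
have e2u : (2 ^ j.+1)%N%:R = 2 * u by rewrite expnS natrM.
apply: (@le_trans _ _ (u^-1 * \sum_(d <- nball (2 ^ j.+1) | d != 0) f d * g d)).
  rewrite mulr_sumr; apply: (@le_trans _ _ (\sum_(d <- nball Q0 |
     [&& d != 0, (R0 <= nm d)%N & trunc_log 2 (nm d) == j]) u^-1 * (f d * g d))).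
    apply: ler_sum => d /and3P[d1 _ /eqP h]; apply: ler_wpM2r; first by rewrite mulr_ge0.
    have hu : u <= (nm d)%:R.
      by rewrite ler_nat -h; apply: trunc_logP; rewrite ?nm_gt0.
    by rewrite lef_pV2 ?posrE // (lt_le_trans up).
  rewrite -big_filter -[leRHS]big_filter; apply: ler_sum_sub.
  - by rewrite filter_uniq ?nball_uniq.
  - move=> d; rewrite !mem_filter !mem_nball => /andP[/and3P[-> _ /eqP <-] _] /=.
    by apply: ltnW; apply: trunc_log_ltn.
  - by move=> d _; rewrite mulr_ge0 ?invr_ge0 ?mulr_ge0 // ltW.
apply: (@le_trans _ _ (u^-1 * ((Num.sqrt al * (Num.sqrt X + 2 * u)) *
    (Num.sqrt be * (Num.sqrt Y + 2 * u))))).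
  apply: ler_wpM2l; first by rewrite invr_ge0 ltW.
  apply: (le_trans (cauchy_schwarz _ _ _ _)).
  have key (h : O -> R) (c W : R) : 0 <= c -> 0 <= W ->
      \sum_(d <- nball (2 ^ j.+1) | d != 0) h d ^+ 2 <= c * (W + (2 ^ j.+1)%N%:R ^+ 2) ->
      Num.sqrt (\sum_(d <- nball (2 ^ j.+1) | d != 0) h d ^+ 2) <=
      Num.sqrt c * (Num.sqrt W + 2 * u).
    move=> c0 W0 hh; have t0 : 0 <= c * (W + (2 * u) ^+ 2).
      by rewrite mulr_ge0 // addr_ge0 // sqr_ge0.
    rewrite e2u in hh; apply: (@le_trans _ _ (Num.sqrt (c * (W + (2 * u) ^+ 2)))).
      by rewrite ler_sqrt.
    rewrite sqrtrM //; apply: ler_wpM2l; first exact: sqrtr_ge0.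
    by apply: sqrt_add_le => //; rewrite mulr_ge0 // ltW.
  by apply: ler_pM; rewrite ?sqrtr_ge0 //; apply: key.
have -> : u^-1 * ((Num.sqrt al * (Num.sqrt X + 2 * u)) * (Num.sqrt be * (Num.sqrt Y + 2 * u))) =
   Num.sqrt al * Num.sqrt be * (Num.sqrt X * Num.sqrt Y / u + 2 * Num.sqrt X + 2 * Num.sqrt Y + 4 * u).
  by field; rewrite gt_eqF.
apply: ler_wpM2l; first by rewrite mulr_ge0 ?sqrtr_ge0.
rewrite /dyadic_bound; apply: lerD; last first.
  by rewrite ler_pM2l // /u ler_nat.
rewrite !lerD2r [2 * (_ * _)]mulrC -[leRHS]mulrA; apply: ler_wpM2l; first by rewrite mulr_ge0 ?sqrtr_ge0.
rewrite ler_pdivlMr // mulrC ler_pdivrMr // -e2u ler_nat //.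
Qed.

Section High.
Variables (SX SY : seq O) (a b : O -> R[i]) (XX YY Q0 R0 J P : nat) (nF nG : R).
Variables (phi : 'I_P -> nat -> R[i]) (ch : 'I_P -> R).
Hypothesis phi1 : forall k m, cabs (phi k m) = 1.
Hypothesis ch_ge0 : forall k, 0 <= ch k.
Hypotheses (XX0 : (0 < XX)%N) (YY0 : (0 < YY)%N) (R00 : (0 < R0)%N) (QJ : (Q0 < 2 ^ J)%N).
Hypotheses (uX : uniq SX) (uY : uniq SY).
Hypothesis SX_ball : {subset SX <= nball XX}.
Hypothesis SY_ball : {subset SY <= nball YY}.
Hypothesis nF_ge : \sum_(x <- SX) cabs (a x) ^+ 2 <= nF.
Hypothesis nG_ge : \sum_(y <- SY) cabs (b y) ^+ 2 <= nG.

(** The bound of [high_component] for the divisor [r] of [q]. *)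
Definition high_term q r : R :=
  repW R Q * (tau (quo q r))%:R / ((nm r)%:R * (nm (quo q r))%:R) * \sum_k ch k *
    (Num.sqrt (lsum Q SX (twist Q phi a k) r (quo q r)) *
     Num.sqrt (lsum Q SY (twist Q phi b k) r (quo q r))).

Lemma lsum_le (S : seq O) (f : O -> R[i]) (n : nat) (nf : R) (k : 'I_P) s j :
  (0 < n)%N -> uniq S -> {subset S <= nball n} ->
  \sum_(x <- S) cabs (f x) ^+ 2 <= nf ->
  \sum_(d <- nball (2 ^ j.+1) | d != 0)
    Num.sqrt (lsum Q S (twist Q phi f k) d s) ^+ 2 <=
  lsC R Q * nf * (n%:R + (2 ^ j.+1)%N%:R ^+ 2).
Proof.
move=> n0 uS Sn hf; under eq_bigr do rewrite sqr_sqrtr ?lsum_ge0 //.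
have := @large_sieve_quad R O Q (2 ^ j.+1) n [seq x <- S | cop s x] (twist Q phi f k) _ n0 _ _.
rewrite expn_gt0 filter_uniq //= => /(_ isT isT) h.
have h' : {subset [seq x <- S | cop s x] <= nball n}.
  by move=> x; rewrite mem_filter => /andP[_]; apply: Sn.
apply: (@le_trans _ _ (\sum_(d <- nball (2 ^ j.+1) | d != 0) \sum_(a0 <- Rep Q d | cop d a0)
  cabs (\sum_(x <- [seq x <- S | cop s x]) twist Q phi f k x * ecx (Lq R Q (a0 * x) d)) ^+ 2)).
  by apply: ler_sum => d _; apply: ler_sum => a0 _; rewrite big_filter.
apply: (le_trans (h h')); rewrite [leRHS]mulrAC; apply: ler_wpM2l.
  by rewrite mulr_ge0 ?lsC_ge0 // addr_ge0 // sqr_ge0.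
apply: le_trans hf; rewrite big_filter [leRHS](bigID (cop s)) /= -[leLHS]addr0; apply: lerD.
  by apply: ler_sum => x _; rewrite /twist cabsM phi1 mulr1.
by apply: sumr_ge0 => x _; apply: sqr_ge0.
Qed.

(** Writing [q = r * s], the sum over [s] costs a divisor moment, and the sum
    over [r] is a large sieve sum. *)
Lemma high_total :
  \sum_(q <- nball Q0 | q != 0) \sum_(r <- dvs q | (R0 <= nm r)%N) high_term q r <=
  repW R Q * (\sum_k ch k) * moment 1 Q0 *
    (J%:R * (lsC R Q * (Num.sqrt nF * Num.sqrt nG) * dyadic_bound XX%:R YY%:R R0%:R Q0%:R)).
Proof.
have nF0 : 0 <= nF by apply: le_trans nF_ge; apply: sumr_ge0 => x _; apply: sqr_ge0.
have nG0 : 0 <= nG by apply: le_trans nG_ge; apply: sumr_ge0 => x _; apply: sqr_ge0.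
have W0 : 0 <= repW R Q by apply: sqr_ge0.
have lC0 : 0 <= lsC R Q by apply: lsC_ge0.
pose A k d e := Num.sqrt (lsum Q SX (twist Q phi a k) d e).
pose B k d e := Num.sqrt (lsum Q SY (twist Q phi b k) d e).
have AB0 k d e : 0 <= A k d e * B k d e by rewrite mulr_ge0 ?sqrtr_ge0.
have ht0 q r : 0 <= high_term q r.
  rewrite /high_term mulr_ge0 ?divr_ge0 ?mulr_ge0 //.
  by apply: sumr_ge0 => k _; rewrite mulr_ge0 // AB0.
pose H r q := if (R0 <= nm r)%N then high_term q r else 0.
have H0 r q : 0 <= H r q by rewrite /H; case: ifP.
apply: le_trans (_ : \sum_(q <- nball Q0 | q != 0) \sum_(r <- dvs q) H r q <= _).
  by apply: ler_sum => q _; rewrite big_mkcond.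
apply: (le_trans (@sum_divisors R O Q Q0 H H0)).
apply: (@le_trans _ _ (\sum_(d <- nball Q0 | (d != 0) && (R0 <= nm d)%N)
   \sum_(e <- nball Q0 | e != 0) \sum_k
     repW R Q * ch k * ((tau e)%:R / (nm e)%:R) * ((nm d)%:R^-1 * (A k d e * B k d e)))).
  rewrite [leRHS]big_mkcondr; apply: ler_sum => d d0; rewrite /H; case: ifP => hd; last first.
    by apply: sumr_le0.
  apply: (@le_trans _ _ (\sum_(e <- nball Q0 | e != 0) high_term (d * e) d)).
    rewrite [leRHS](bigID (fun e => (nm (d * e) <= Q0)%N)) /= lerDl.
    exact: sumr_ge0.
  apply: ler_sum => e e0; rewrite /high_term quoK // mulr_sumr; apply: ler_sum => k _.
  rewrite -/(A k d e) -/(B k d e) invfM; rewrite le_eqVlt; apply/orP; left; apply/eqP; ring.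
rewrite exchange_big /=; under eq_bigr do rewrite exchange_big /=.
rewrite exchange_big /=.
set Z := J%:R * _.
have -> : repW R Q * (\sum_k ch k) * moment 1 Q0 * Z =
    \sum_k repW R Q * ch k * (moment 1 Q0 * Z).
  by rewrite -mulr_suml -mulr_sumr mulrA.
apply: ler_sum => k _.
have -> : repW R Q * ch k * (moment 1 Q0 * Z) = \sum_(e <- nball Q0 | e != 0)
   repW R Q * ch k * ((tau e)%:R / (nm e)%:R) * Z.
  rewrite -mulr_suml -mulr_sumr mulrA; congr (_ * Z).
apply: ler_sum => e e0; rewrite -mulr_sumr; apply: ler_wpM2l.
  by rewrite mulr_ge0 ?divr_ge0 // mulr_ge0.
rewrite /Z; have -> : lsC R Q * (Num.sqrt nF * Num.sqrt nG) * dyadic_bound XX%:R YY%:R R0%:R Q0%:R =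
  Num.sqrt (lsC R Q * nF) * Num.sqrt (lsC R Q * nG) * dyadic_bound XX%:R YY%:R R0%:R Q0%:R.
  have eC : lsC R Q = Num.sqrt (lsC R Q) * Num.sqrt (lsC R Q) by rewrite -expr2 sqr_sqrtr.
  rewrite (sqrtrM nF lC0) (sqrtrM nG lC0) {1}eC.
  by move: (Num.sqrt (lsC R Q)) (Num.sqrt nF) (Num.sqrt nG) (dyadic_bound _ _ _ _) => *; ring.
apply: dyadic_sum; rewrite ?ler0n ?mulr_ge0 //; try by move=> d; apply: sqrtr_ge0.
  by move=> j; apply: lsum_le.
by move=> j; apply: lsum_le.
Qed.

End High.

Section Low.
Variables (SY : seq O) (b : O -> R[i]) (YY Q0 R0 z k : nat) (na cb eta : R).
Hypotheses (R00 : (0 < R0)%N) (z0 : (0 < z)%N) (eta0 : 0 <= eta) (na0 : 0 <= na) (cb0 : 0 <= cb).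
Hypothesis uY : uniq SY.
Hypothesis SY_ball : forall y, y \in SY -> (y != 0) && (y \in nball YY).
Hypothesis b_le : forall y, y \in SY -> cabs (b y) <= cb * (tau y)%:R ^+ k.

(** The bound of [low_component] for the divisor [r] of [q], with the weight
    [na] of the other variable. *)
Definition low_term q r : R := na *
  ((repC Q * nm r)%N%:R * ((8 * nmK Q * tau (quo q r))%N%:R / (nm (quo q r))%:R) *
  ((tau (quo q r))%:R ^+ 2 * (2 * (repC Q * nm r * z)%N%:R * eta) +
   (tau (quo q r))%:R * (2 * tail_sum Q b z SY (quo q r)))).

(** Division by [d] maps the multiples of [d] of norm at most [YY] into those
    of norm at most [YY / nm d]. *)
Lemma sum_multiples d : d != 0 ->
  \sum_(y <- SY | dvq d y) cabs (b y) <=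
  cb * (tau d)%:R ^+ k * (YY%:R / (nm d)%:R) * moment k YY.
Proof.
move=> d0; have dp : (0 : R) < (nm d)%:R by rewrite ltr0n nm_gt0.
rewrite !momentE mulr_sumr -big_filter -[leRHS]big_filter.
apply: (ler_sum_map (h := fun y => quo y d)).
- by rewrite filter_uniq.
- move=> x y; rewrite !mem_filter => /andP[dx _] /andP[dy _] e.
  by rewrite (quoE dx) (quoE dy) e.
- move=> y; rewrite !mem_filter => /andP[dy /SY_ball/andP[y0 yY]].
  have e0 : quo y d != 0 by apply: contra y0 => /eqP h; rewrite (quoE dy) h mulr0.
  rewrite e0 mem_nball /=; move: yY; rewrite mem_nball; apply: leq_trans.
  by apply: dvq_nm_le => //; rewrite {2}(quoE dy) mulrC dvq_mulr.
- move=> y; rewrite mem_filter => /andP[dy yS]; have /andP[y0 yY] := SY_ball yS.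
  have e0 : quo y d != 0 by apply: contra y0 => /eqP h; rewrite (quoE dy) h mulr0.
  have ep : (0 : R) < (nm (quo y d))%:R by rewrite ltr0n nm_gt0.
  apply: (le_trans (b_le yS)); rewrite -!mulrA; apply: ler_wpM2l => //.
  apply: (@le_trans _ _ ((tau d)%:R ^+ k * (tau (quo y d))%:R ^+ k)).
    rewrite -exprMn lerXn2r ?nnegrE ?mulr_ge0 // -natrM ler_nat {1}(quoE dy).
    exact: tau_mul.
  apply: ler_wpM2l; first by rewrite exprn_ge0.
  rewrite mulrA mulrCA; apply: ler_peMr; first by rewrite exprn_ge0.
  rewrite -mulrA -invfM ler_pdivlMr ?mulr_gt0 // mul1r -natrM ler_nat -nmM -quoE //.
  by move: yY; rewrite mem_nball.
- by move=> e _; rewrite mulr_ge0 ?divr_ge0 ?mulr_ge0 ?exprn_ge0 ?divr_ge0 ?mulr_ge0 ?exprn_ge0.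
Qed.

(** Each tail divisor [d] of norm exceeding [z] divides both [e] and [y],
    which saves two factors [nm d]; one gives a convergent moment and the
    other the gain [1 / z]. *)
Lemma tail_total :
  \sum_(e <- nball Q0 | e != 0) (tau e)%:R ^+ 2 / (nm e)%:R * tail_sum Q b z SY e <=
  cb * YY%:R * moment 2 Q0 * moment k YY * moment k.+2 Q0 / z%:R.
Proof.
have zp : (0 : R) < z%:R by rewrite ltr0n.
pose H d e : R := if (z < nm d)%N then
   (tau e)%:R ^+ 2 / (nm e)%:R * \sum_(y <- SY | dvq d y) cabs (b y) else 0.
have H0 d e : 0 <= H d e.
  rewrite /H; case: ifP => // _; rewrite mulr_ge0 ?divr_ge0 ?exprn_ge0 //.
  by apply: sumr_ge0 => y _; apply: cabs_ge0.
apply: (@le_trans _ _ (\sum_(e <- nball Q0 | e != 0) \sum_(d <- dvs e) H d e)).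
  apply: ler_sum => e e0; rewrite /tail_sum mulr_sumr.
  rewrite (eq_bigr (fun y => \sum_(d <- dvs e | dvq d y && (z < nm d)%N)
     (tau e)%:R ^+ 2 / (nm e)%:R * cabs (b y))); last first.
    by move=> y _; rewrite big_const_seq iter_addr_0 -[RHS]mulr_natr mulrA.
  rewrite (exchange_big_dep (fun d => (z < nm d)%N)) /=; last by move=> y d _ /andP[].
  rewrite big_mkcond; apply: ler_sum => d _; rewrite /H; case: ifP => hz //.
  by rewrite mulr_sumr; rewrite (eq_bigl (fun y => dvq d y)) // => y; rewrite hz andbT.
apply: (le_trans (@sum_divisors R O Q Q0 H H0)).
apply: (@le_trans _ _ (\sum_(d <- nball Q0 | d != 0) cb * YY%:R * moment 2 Q0 * moment k YY *
    ((tau d)%:R ^+ k.+2 / (nm d)%:R) / z%:R)); last first.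
  by rewrite -mulr_suml -mulr_sumr.
apply: ler_sum => d d0; have dp : (0 : R) < (nm d)%:R by rewrite ltr0n nm_gt0.
have [hz|hz] := boolP (z < nm d)%N; last first.
  rewrite big1 => [|e _]; last by rewrite /H (negbTE hz).
  apply: divr_ge0 => //; apply: mulr_ge0; last by rewrite divr_ge0 ?exprn_ge0.
  by do 2![apply: mulr_ge0; last exact: moment_ge0]; rewrite mulr_ge0.
have zd : (nm d)%:R^-1 <= z%:R^-1 :> R.
  by rewrite lef_pV2 ?posrE // ler_nat ltnW.
set Bd := \sum_(y <- SY | dvq d y) cabs (b y).
have Bd0 : 0 <= Bd by apply: sumr_ge0 => y _; apply: cabs_ge0.
rewrite (eq_bigr (fun e => (tau (d * e))%:R ^+ 2 / (nm (d * e))%:R * Bd)); last first.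
  by move=> e _; rewrite /H hz.
apply: (@le_trans _ _ ((tau d)%:R ^+ 2 / (nm d)%:R * moment 2 Q0 * Bd)).
  rewrite -mulr_suml; apply: ler_wpM2r => //; rewrite !momentE mulr_sumr.
  apply: (@le_trans _ _ (\sum_(e <- nball Q0 | (e != 0) && (nm (d * e) <= Q0)%N)
     (tau d)%:R ^+ 2 / (nm d)%:R * ((tau e)%:R ^+ 2 / (nm e)%:R))).
    apply: ler_sum => e /andP[e0 _]; rewrite mulf_div -exprMn nmM natrM.
    apply: ler_wpM2r; first by rewrite invr_ge0 mulr_ge0.
    by rewrite lerXn2r ?nnegrE ?mulr_ge0 // -natrM ler_nat; apply: tau_mul.
  rewrite [leRHS](bigID (fun e => (nm (d * e) <= Q0)%N)) /= lerDl.
  by apply: sumr_ge0 => e _; rewrite mulr_ge0 ?divr_ge0 ?exprn_ge0.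
apply: (@le_trans _ _ ((tau d)%:R ^+ 2 / (nm d)%:R * moment 2 Q0 *
   (cb * (tau d)%:R ^+ k * (YY%:R / (nm d)%:R) * moment k YY))).
  by apply: ler_wpM2l; [rewrite mulr_ge0 ?divr_ge0 ?exprn_ge0 ?moment_ge0 | exact: sum_multiples].
have -> : (tau d)%:R ^+ 2 / (nm d)%:R * moment 2 Q0 *
   (cb * (tau d)%:R ^+ k * (YY%:R / (nm d)%:R) * moment k YY) =
  cb * YY%:R * moment 2 Q0 * moment k YY * ((tau d)%:R ^+ k.+2 / (nm d)%:R) * (nm d)%:R^-1.
  by rewrite -[k.+2]addn2 exprD; ring.
apply: ler_wpM2l => //.
apply: mulr_ge0; last by rewrite divr_ge0 ?exprn_ge0.
by do 2![apply: mulr_ge0; last exact: moment_ge0]; rewrite mulr_ge0.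
Qed.

(** There are at most a power of [R0] choices of [r], and the sum over the
    cofactors costs divisor moments. *)
Lemma low_total :
  \sum_(q <- nball Q0 | q != 0) \sum_(r <- dvs q | (nm r < R0)%N) low_term q r <=
  na * ((repC Q)%:R * (8 * nmK Q)%N%:R * R0%:R * (ballC Q * R0)%N%:R) *
  (2 * (repC Q * R0 * z)%N%:R * eta * moment 3 Q0 +
   2 * (cb * YY%:R * moment 2 Q0 * moment k YY * moment k.+2 Q0 / z%:R)).
Proof.
have tl0 e : 0 <= tail_sum Q b z SY e.
  by apply: sumr_ge0 => y _; rewrite mulr_ge0 ?cabs_ge0.
pose T e : R := (tau e)%:R / (nm e)%:R * ((tau e)%:R ^+ 2 * (2 * (repC Q * R0 * z)%N%:R * eta) +
   (tau e)%:R * (2 * tail_sum Q b z SY e)).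
pose c : R := na * ((repC Q)%:R * (8 * nmK Q)%N%:R * R0%:R).
have c0 : 0 <= c by rewrite !mulr_ge0.
have T0 e : 0 <= T e.
  by rewrite /T mulr_ge0 ?divr_ge0 // addr_ge0 // mulr_ge0 ?exprn_ge0 ?mulr_ge0.
have lt0' q r : 0 <= low_term q r.
  rewrite /low_term mulr_ge0 // mulr_ge0 ?mulr_ge0 ?divr_ge0 // addr_ge0 // mulr_ge0 ?exprn_ge0 ?mulr_ge0 //.
pose H r q : R := if (nm r < R0)%N then low_term q r else 0.
have H0 r q : 0 <= H r q by rewrite /H; case: ifP.
apply: le_trans (_ : \sum_(q <- nball Q0 | q != 0) \sum_(r <- dvs q) H r q <= _).
  by apply: ler_sum => q _; rewrite big_mkcond.
apply: (le_trans (@sum_divisors R O Q Q0 H H0)).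
apply: (@le_trans _ _ (\sum_(d <- nball R0) \sum_(e <- nball Q0 | e != 0) c * T e)).
  apply: (@le_trans _ _ (\sum_(d <- nball Q0 | (d != 0) && (nm d < R0)%N)
      \sum_(e <- nball Q0 | e != 0) c * T e)).
    rewrite [leRHS]big_mkcondr; apply: ler_sum => d d0; rewrite /H; case: ifP => hd; last first.
      by apply: sumr_le0.
    apply: (@le_trans _ _ (\sum_(e <- nball Q0 | e != 0) low_term (d * e) d)).
      rewrite [leRHS](bigID (fun e => (nm (d * e) <= Q0)%N)) /= lerDl.
      exact: sumr_ge0.
    apply: ler_sum => e e0; rewrite /low_term quoK // /c -[leRHS]mulrA.
    apply: ler_wpM2l => //; rewrite /T [leRHS]mulrA; apply: ler_pM.
    - by rewrite mulr_ge0 ?divr_ge0.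
    - by rewrite addr_ge0 // mulr_ge0 ?exprn_ge0 ?mulr_ge0.
    - rewrite (natrM _ (8 * nmK Q) (tau e)) (natrM _ (repC Q) (nm d)).
      have -> : (repC Q)%:R * (nm d)%:R * ((8 * nmK Q)%:R * (tau e)%:R / (nm e)%:R) =
        (repC Q)%:R * (8 * nmK Q)%N%:R * (nm d)%:R * ((tau e)%:R / (nm e)%:R) :> R by ring.
      apply: ler_wpM2r; first by rewrite divr_ge0.
      by apply: ler_wpM2l; rewrite ?mulr_ge0 // ler_nat ltnW.
    rewrite lerD2r; apply: ler_wpM2l; first by rewrite exprn_ge0.
    apply: ler_wpM2r => //; apply: ler_wpM2l => //; rewrite ler_nat.
    by rewrite leq_mul2r leq_mul2l (ltnW hd) !orbT.
  rewrite -big_filter; apply: ler_sum_sub.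
  - by rewrite filter_uniq ?nball_uniq.
  - by move=> d; rewrite mem_filter !mem_nball => /andP[/andP[_ /ltnW]].
  - by move=> d _; apply: sumr_ge0 => e _; rewrite mulr_ge0.
rewrite big_const_seq iter_addr_0 count_predT -[leLHS]mulr_natl -mulr_sumr.
have TT : \sum_(e <- nball Q0 | e != 0) T e <= 2 * (repC Q * R0 * z)%N%:R * eta * moment 3 Q0 +
   2 * (cb * YY%:R * moment 2 Q0 * moment k YY * moment k.+2 Q0 / z%:R).
  have -> : \sum_(e <- nball Q0 | e != 0) T e = 2 * (repC Q * R0 * z)%N%:R * eta * moment 3 Q0 +
    2 * \sum_(e <- nball Q0 | e != 0) (tau e)%:R ^+ 2 / (nm e)%:R * tail_sum Q b z SY e.
    rewrite !momentE !mulr_sumr -big_split /=; apply: eq_bigr => e _; rewrite /T.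
    rewrite !exprS expr0; ring.
  by rewrite lerD2l ler_pM2l // tail_total.
have sz : ((size (nball R0))%:R : R) <= (ballC Q * R0)%N%:R by rewrite ler_nat size_nball.
have S0 : 0 <= \sum_(e <- nball Q0 | e != 0) T e by apply: sumr_ge0.
apply: (@le_trans _ _ ((ballC Q * R0)%N%:R * (c * (2 * (repC Q * R0 * z)%N%:R * eta * moment 3 Q0 +
   2 * (cb * YY%:R * moment 2 Q0 * moment k YY * moment k.+2 Q0 / z%:R))))).
  apply: ler_pM => //; first by rewrite mulr_ge0.
  by apply: ler_wpM2l.
by rewrite /c; rewrite le_eqVlt; apply/orP; left; apply/eqP; ring.
Qed.

End Low.
End Totals.

(** * Splitting the discrepancy of products *)

Section Pieces.
Variables (R : realType) (O : comNzRingType) (Q : quadOrder O).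
Implicit Types x y z r d q s e m v : O.
Local Notation nm := (nm Q).
Local Notation nball := (nball Q).
Local Notation dvs := (dvs Q).
Local Notation tau := (tau Q).
Local Notation ldisc := (@class_disc R O Q).

(** Elements with norm in [(L, n]]; for [L = 0] these are the nonzero
    elements of the ball. *)
Definition annulus (L n : nat) : seq O := [seq y <- nball n | (L < nm y)%N].

Lemma annulus_uniq L n : uniq (annulus L n).
Proof. by rewrite filter_uniq // nball_uniq. Qed.

Lemma mem_annulus L n y : (y \in annulus L n) = (L < nm y <= n)%N.
Proof. by rewrite mem_filter mem_nball. Qed.

Lemma annulus_neq0 L n y : y \in annulus L n -> y != 0.
Proof. by rewrite mem_annulus -(nm_gt0 Q) => /andP[+ _]; apply: leq_ltn_trans. Qed.

Lemma ldisc_perm S S' b m v : perm_eq S S' -> ldisc S b m v = ldisc S' b m v.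
Proof. by move=> h; rewrite /class_disc !(perm_big _ h). Qed.

Lemma ldisc_cat S S' b m v : ldisc (S ++ S') b m v = ldisc S b m v + ldisc S' b m v.
Proof. by rewrite /class_disc !big_cat /=; ring. Qed.

(** An annulus is a difference of two balls. *)
Lemma ldisc_annulus L n t b m v (eta : R) : (t <= n)%N ->
  (forall T, (T <= n)%N -> cabs (ldisc (annulus 0 T) b m v) <= eta) ->
  cabs (ldisc (annulus L t) b m v) <= 2 * eta.
Proof.
move=> tn h; have e0 : 0 <= eta by apply: le_trans (h 0%N _); rewrite ?cabs_ge0.
have [Lt|tL] := leqP L t.
  have e : ldisc (annulus L t) b m v =
      ldisc (annulus 0 t) b m v - ldisc (annulus 0 L) b m v.
    apply/eqP; rewrite eq_sym subr_eq -ldisc_cat; apply/eqP; apply: ldisc_perm.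
    apply: uniq_perm.
    - exact: annulus_uniq.
    - rewrite cat_uniq !annulus_uniq andbT; apply/hasPn => y; rewrite !mem_annulus.
      by move=> /andP[_ h2]; rewrite negb_and -leqNgt h2.
    by move=> y; rewrite mem_cat !mem_annulus; move: (nm y) => k; lia.
  rewrite e mulr_natl mulr2n; apply: (le_trans (cabs_le_sub _ _)).
  by apply: lerD; apply: h => //; apply: leq_trans tn.
have -> : annulus L t = [::].
  case E: (annulus L t) => [//|y S].
  have : y \in annulus L t by rewrite E mem_head.
  by rewrite mem_annulus => /andP[h1 h2]; move: (leq_ltn_trans h2 tL); rewrite ltnNge ltnW.
by rewrite /class_disc !big_nil mulr0 subr0 cabs0 mulr_ge0.
Qed.

(** For fixed [x] the conditions on [nm y] and [nm (x * y)] cut out an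
    annulus. *)
Lemma slice_disc L n T x b m v (eta : R) : x != 0 ->
  (forall T', (T' <= n)%N -> cabs (ldisc (annulus 0 T') b m v) <= eta) ->
  cabs (ldisc [seq y <- annulus L n | (nm (x * y) <= T)%N] b m v) <= 2 * eta.
Proof.
move=> x0 h; rewrite (@ldisc_perm _ (annulus L (minn n (T %/ nm x)))).
  by apply: (@ldisc_annulus L n) => //; apply: geq_minl.
apply: uniq_perm; rewrite ?annulus_uniq //; first by rewrite filter_uniq ?annulus_uniq.
move=> y; rewrite mem_filter !mem_annulus nmM leq_min leq_divRL ?nm_gt0 // mulnC.
by rewrite andbC -andbA.
Qed.

(** Grouping by the first factor: the class of [c] for [x * y] is a class for
    [y], so that a distribution estimate for [b] alone suffices. *)
Lemma pair_disc_direct q L n T c (SX : seq O) (a b : O -> R[i]) (eta : R) :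
  q != 0 -> cop q c -> (forall x, x \in SX -> x != 0) ->
  (forall T' v, (T' <= n)%N -> cop q v -> cabs (ldisc (annulus 0 T') b q v) <= eta) ->
  cabs (pair_disc Q q SX (annulus L n) a b T c) <= (\sum_(x <- SX) cabs (a x)) * (2 * eta).
Proof.
move=> q0 cc SX0 h; have eta0 : 0 <= eta by apply: le_trans (h 0%N c _ _); rewrite ?cabs_ge0.
rewrite /pair_disc mulr_sumr -sumrB mulr_suml big_seq [leRHS]big_seq.
apply: cabs_sum_le => x xS; have x0 := SX0 x xS.
have [cx|ncx] := boolP (cop q x); last first.
  rewrite !big_pred0 ?mulr0 ?subr0 ?cabs0 ?mulr_ge0 ?cabs_ge0 //.
    move=> y; apply/negbTE; apply: contra ncx => /andP[_].
    exact: cop_dvl (dvq_mulr x y).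
  move=> y; apply/negbTE; apply: contra ncx => /andP[_ hy].
  by apply: cop_dvl (dvq_mulr x y) _; rewrite (cop_congr hy).
have [x' [cx' hx']] := cop_inv cx.
have hcl y : dvq q (x * y - c) = dvq q (y - x' * c).
  apply/idP/idP => hy.
    have -> : y - x' * c = x' * (x * y - c) - (x * x' - 1) * y by ring.
    by apply: dvqB; [apply: dvq_mulR | apply: dvq_mull].
  have -> : x * y - c = x * (y - x' * c) + (x * x' - 1) * c by ring.
  by apply: dvqD; [apply: dvq_mulR | apply: dvq_mull].
have hco y : cop q (x * y) = cop q y.
  apply/idP/idP => [|cy]; last exact: cop_mul.
  by apply: cop_dvl; rewrite mulrC dvq_mulr.
have -> : \sum_(y <- annulus L n | (nm (x * y) <= T)%N && dvq q (x * y - c)) a x * b y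
   - (size (unitReps Q q))%:R^-1 *
     (\sum_(y <- annulus L n | (nm (x * y) <= T)%N && cop q (x * y)) a x * b y) =
   a x * ldisc [seq y <- annulus L n | (nm (x * y) <= T)%N] b q (x' * c).
  rewrite /class_disc !big_filter_cond mulrBr mulrCA.
  rewrite (mulr_sumr _ _ _ (a x)) (mulr_sumr _ _ _ (a x)).
  congr (_ - _ * _); first by apply: eq_bigl => y; rewrite hcl.
  by apply: eq_bigl => y; rewrite hco.
rewrite cabsM; apply: ler_wpM2l; first exact: cabs_ge0.
by apply: slice_disc => // T' hT'; apply: h => //; apply: cop_mul.
Qed.

Lemma tail_sum_ge0 (z : nat) (b : O -> R[i]) (S : seq O) s : 0 <= tail_sum Q b z S s.
Proof. by apply: sumr_ge0 => y _; rewrite mulr_ge0 ?cabs_ge0. Qed.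

Lemma high_term_ge0 (SX SY : seq O) (a b : O -> R[i]) (P : nat)
    (phi : 'I_P -> nat -> R[i]) (ch : 'I_P -> R) q r :
  (forall k, 0 <= ch k) -> 0 <= high_term Q SX SY a b phi ch q r.
Proof.
move=> ch0; rewrite /high_term mulr_ge0 ?divr_ge0 ?mulr_ge0 ?sqr_ge0 //.
by apply: sumr_ge0 => k _; rewrite mulr_ge0 // mulr_ge0 ?sqrtr_ge0.
Qed.

Lemma low_term_ge0 (SY : seq O) (b : O -> R[i]) (z : nat) (na eta : R) q r :
  0 <= na -> 0 <= eta -> 0 <= low_term Q SY b z na eta q r.
Proof.
move=> na0 eta0; have := tail_sum_ge0 z b SY (quo q r) => t0.
rewrite /low_term mulr_ge0 // mulr_ge0 ?mulr_ge0 ?divr_ge0 //.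
by rewrite addr_ge0 // mulr_ge0 ?exprn_ge0 ?mulr_ge0.
Qed.

Section Split.
Variables (SX : seq O) (a b : O -> R[i]) (L YY Zm P R0 z : nat) (na eta : R).
Variables (phi c : 'I_P -> nat -> R[i]) (ch : 'I_P -> R).
Hypothesis ch_ge0 : forall k, 0 <= ch k.
Hypothesis c_le : forall k t, (t <= Zm)%N -> cabs (c k t) <= ch k.
Hypothesis sepP : forall (m n t : nat), (0 < m)%N -> (0 < n)%N -> (m * n <= Zm)%N ->
  (t <= Zm)%N -> \sum_k c k t * (phi k m * phi k n) = (m * n <= t)%N%:R.
Hypothesis SX0 : forall x, x \in SX -> x != 0.
Hypothesis SXY : forall x y, x \in SX -> y \in annulus L YY -> (nm (x * y) <= Zm)%N.
Hypothesis na_ge : \sum_(x <- SX) cabs (a x) <= na.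
Hypothesis eta0 : 0 <= eta.
Hypothesis eta_ge : forall m v T, m != 0 -> (nm m <= R0 * z)%N -> cop m v -> (T <= YY)%N ->
  cabs (ldisc (annulus 0 T) b m v) <= eta.

(** Components of large conductor are separated into convolutions; those of
    small conductor inherit the regular distribution of [b]. *)
Lemma pair_disc_split q T v : q != 0 -> cop q v -> (T <= Zm)%N ->
  cabs (pair_disc Q q SX (annulus L YY) a b T v) <=
  \sum_(r <- dvs q | (R0 <= nm r)%N) high_term Q SX (annulus L YY) a b phi ch q r +
  \sum_(r <- dvs q | (nm r < R0)%N) low_term Q (annulus L YY) b z na (2 * eta) q r.
Proof.
move=> q0 cv TZ; rewrite (@pair_discE R O Q q q0) //; set SY := annulus L YY.
have na0 : 0 <= na by apply: le_trans na_ge; apply: sumr_ge0 => x _; apply: cabs_ge0.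
have e20 : 0 <= 2 * eta by rewrite mulr_ge0.
pose ht r := high_term Q SX SY a b phi ch q r.
pose lt r := low_term Q SY b z na (2 * eta) q r.
have ht0 r : 0 <= ht r by apply: high_term_ge0.
have lt0 r : 0 <= lt r by apply: low_term_ge0.
pose f r := if (R0 <= nm r)%N then ht r else lt r.
apply: (@le_trans _ _ (\sum_(r <- dvs q | nm r != 1%N) f r)); last first.
  have -> : \sum_(r <- dvs q | (R0 <= nm r)%N) high_term Q SX SY a b phi ch q r +
      \sum_(r <- dvs q | (nm r < R0)%N) low_term Q SY b z na (2 * eta) q r =
      \sum_(r <- dvs q) f r.
    rewrite [RHS](bigID (fun r => (R0 <= nm r)%N)) /=; congr (_ + _).
      by apply: eq_bigr => r hr; rewrite /f hr.
    rewrite (eq_bigl (fun r => ~~ (R0 <= nm r)%N)) => [|r]; last by rewrite ltnNge.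
    by apply: eq_bigr => r hr; rewrite /f (negbTE hr).
  rewrite [leRHS](bigID (fun r => nm r != 1%N)) /= lerDl.
  by apply: sumr_ge0 => r _; rewrite /f; case: ifP.
apply: disc_decomp => Hs r rq r1 Hs_dvd; have qE := quoE rq.
rewrite /f; case: (leqP R0 (nm r)) => hr.
  rewrite /ht /high_term; apply: (high_component qE Hs_dvd a b c_le sepP) => //.
  by move=> x y xS yS; rewrite SX0 ?(annulus_neq0 yS) ?SXY.
pose G x := @grp_fun R O Q q q0 [seq y <- SY | (nm (x * y) <= T)%N] b.
have -> : @pairD R O Q q q0 SX SY a b T =
    (fun u => \sum_(x <- SX | cop q x) a x * G x ((toU Q q0 x)^-1 * u)%g).
  by apply/funext => u; rewrite pairD_transl.
have [cc _ _] := @oproj_component R _ (@umulC O Q q q0) Hs (kerU Q q0 r).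
rewrite (convop_transl _ _ _ _ _ _ cc).

rewrite /lt /low_term; set B := (X in _ <= na * X).
have B0 : 0 <= B.
  have := tail_sum_ge0 z b SY (quo q r) => t0.
  by rewrite /B mulr_ge0 ?mulr_ge0 ?divr_ge0 // addr_ge0 // mulr_ge0 ?exprn_ge0 ?mulr_ge0.
apply: (@le_trans _ _ ((\sum_(x <- SX | cop q x) cabs (a x)) * B)); last first.
  apply: ler_wpM2r => //; apply: le_trans na_ge; rewrite [leRHS](bigID (cop q)) /= lerDl.
  by apply: sumr_ge0 => x _; apply: cabs_ge0.
rewrite mulr_suml big_seq_cond [leRHS]big_seq_cond; apply: cabs_sum_le => x /andP[xS cx].
rewrite cabsM; apply: ler_wpM2l; first exact: cabs_ge0.
apply: (le_trans (low_component (z := z) (eta := 2 * eta) qE Hs_dvd r1 _ _ _)) => //.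
  move=> m w m0 hm cw; apply: slice_disc; first exact: SX0.
  move=> T' hT'; apply: eta_ge => //; apply: leq_trans hm _.
  by rewrite leq_mul2r (ltnW hr) orbT.
rewrite /B; apply: ler_wpM2l; first by rewrite mulr_ge0 ?divr_ge0.
rewrite lerD2l; apply: ler_wpM2l => //; apply: ler_wpM2l => //.
rewrite /tail_sum big_filter [leRHS](bigID (fun y => (nm (x * y) <= T)%N)) /= lerDl.
by apply: sumr_ge0 => y _; rewrite mulr_ge0 ?cabs_ge0.
Qed.

End Split.
End Pieces.

(** * Bounds in powers of the logarithm *)

Section Asymptotic.
Variables (R : realType) (O : comNzRingType) (Q : quadOrder O).
Implicit Types x y z r d q s e m v : O.
Local Notation nm := (nm Q).
Local Notation nball := (nball Q).
Local Notation dvs := (dvs Q).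
Local Notation tau := (tau Q).
Local Notation ldisc := (@class_disc R O Q).
Local Notation moment := (moment R Q).
Local Notation annulus := (annulus Q).

(** Compare with the power [n + 1] of [expR (th * l / (n + 1)) >= th * l / (n
    + 1)]. *)
Lemma pow_le_expR (th C : R) (n : nat) : 0 < th -> exists l0 : R, 1 <= l0 /\
  forall l, l0 <= l -> C * l ^+ n <= expR (th * l).
Proof.
move=> th0; pose m := n.+1; have mp : (0 : R) < m%:R by rewrite ltr0n.
exists (1 + `|C| * (m%:R / th) ^+ m); split.
  by rewrite lerDl mulr_ge0 // exprn_ge0 // divr_ge0 // ltW.
move=> l hl.
have l0 : 0 < l.
  by apply: lt_le_trans hl; rewrite ltr_pwDl // mulr_ge0 // exprn_ge0 // divr_ge0 // ltW.
have -> : th * l = th * l / m%:R * m%:R by rewrite divfK ?gt_eqF.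
rewrite expRM_natr.
apply: (@le_trans _ _ ((th * l / m%:R) ^+ m)); last first.
  rewrite lerXn2r ?nnegrE ?expR_ge0 //; first by rewrite divr_ge0 // mulr_ge0 // ltW.
  by apply: le_trans (expR_ge1Dx _); rewrite lerDr.
rewrite [th * l]mulrC -mulrA exprMn [l ^+ m]exprSr -mulrA mulrC.
apply: ler_wpM2l; first by rewrite exprn_ge0 // ltW.
have tm : 0 < (th / m%:R) ^+ m by rewrite exprn_gt0 // divr_gt0.
rewrite -ler_pdivrMr // -exprVn invf_div; apply: le_trans hl.
apply: (@le_trans _ _ (`|C| * (m%:R / th) ^+ m)); last by rewrite lerDr.
by apply: ler_wpM2r; rewrite ?ler_norm // exprn_ge0 // divr_ge0 // ltW.
Qed.

Variables (k : nat) (l Mo ca cb : R) (a b : O -> R[i]).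
Hypotheses (l1 : 1 <= l) (Mo1 : 1 <= Mo) (ca0 : 0 <= ca) (cb0 : 0 <= cb).
Hypothesis moB : forall i n, (i <= k.*2.+3)%N -> n%:R <= expR (4 * l) -> moment i n <= Mo.
Hypothesis a_le : forall x, x != 0 -> cabs (a x) <= ca * (tau x)%:R ^+ k.
Hypothesis b_le : forall x, x != 0 -> cabs (b x) <= cb * (tau x)%:R ^+ k.

Let l0 : 0 < l. Proof. exact: lt_le_trans l1. Qed.
Let hk1 : (k <= k.*2.+3)%N. Proof. by rewrite -addnn -!addnS leq_addr. Qed.
Let hk2 : (k.+2 <= k.*2.+3)%N. Proof. by rewrite -addnn -!addnS -addSnnS -addSnnS leq_addr. Qed.
Let hk3 : (k.*2 <= k.*2.+3)%N. Proof. exact: leqW (leqW (leqnSn _)). Qed.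
Let Mo0 : 0 <= Mo. Proof. exact: le_trans Mo1. Qed.

(** First and second moments of a weight bounded by a power of [tau]. *)
Lemma sum_weight (S : seq O) (f : O -> R[i]) (cf : R) n : 0 <= cf ->
  (forall x, x != 0 -> cabs (f x) <= cf * (tau x)%:R ^+ k) ->
  uniq S -> (forall x, x \in S -> (x != 0) && (nm x <= n)%N) -> n%:R <= expR (4 * l) ->
  \sum_(x <- S) cabs (f x) <= cf * n%:R * Mo /\
  \sum_(x <- S) cabs (f x) ^+ 2 <= cf ^+ 2 * n%:R * Mo.
Proof.
move=> cf0 hf uS hS hn.
have key i : (i <= k.*2.+3)%N -> \sum_(x <- S) (tau x)%:R ^+ i <= n%:R * Mo.
  move=> hi; apply: (@le_trans _ _ (n%:R * moment i n)); last first.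
    by apply: ler_wpM2l => //; apply: moB.
  apply: le_trans (tau_sum_le R Q i n); rewrite -[leRHS]big_filter; apply: ler_sum_sub => //.
  by move=> x /hS; rewrite mem_filter mem_nball.
split.
  apply: (@le_trans _ _ (cf * \sum_(x <- S) (tau x)%:R ^+ k)).
    rewrite mulr_sumr big_seq [leRHS]big_seq; apply: ler_sum => x /hS/andP[x0 _]; exact: hf.
  by rewrite -mulrA; apply: ler_wpM2l => //; apply: key hk1.
apply: (@le_trans _ _ (cf ^+ 2 * \sum_(x <- S) (tau x)%:R ^+ k.*2)).
  rewrite mulr_sumr big_seq [leRHS]big_seq; apply: ler_sum => x /hS/andP[x0 _].
  by rewrite -muln2 exprM -exprMn lerXn2r ?nnegrE ?cabs_ge0 ?mulr_ge0 ?exprn_ge0 // hf.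
by rewrite -mulrA; apply: ler_wpM2l; [exact: exprn_ge0 | exact: key hk3].
Qed.

Section High.
Variables (SX SY : seq O) (XX YY Q0 R0 P : nat) (de : R).
Variables (phi : 'I_P -> nat -> R[i]) (ch : 'I_P -> R).
Hypothesis phi1 : forall i (n : nat), cabs (phi i n) = 1.
Hypothesis ch_ge0 : forall k, 0 <= ch k.
Hypothesis ch_sum : \sum_k ch k <= 60 * l.
Hypotheses (XX0 : (0 < XX)%N) (YY0 : (0 < YY)%N) (R00 : (0 < R0)%N).
Hypotheses (uX : uniq SX) (uY : uniq SY).
Hypothesis SX_ball : forall x, x \in SX -> (x != 0) && (nm x <= XX)%N.
Hypothesis SY_ball : forall x, x \in SY -> (x != 0) && (nm x <= YY)%N.
Hypothesis XXl : XX%:R <= expR (4 * l).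
Hypothesis YYl : YY%:R <= expR (4 * l).
Hypothesis Q0l : Q0%:R <= expR (4 * l).
Hypothesis de0 : 0 <= de.
Hypothesis sXY : Num.sqrt XX%:R * Num.sqrt YY%:R <= 2 * expR l.
Hypothesis R0d : R0%:R^-1 <= de.
Hypothesis sX : Num.sqrt XX%:R <= 2 * (expR l * de).
Hypothesis sY : Num.sqrt YY%:R <= expR l * de.
Hypothesis Qd : Q0%:R <= expR l * de.

(** [de] is the saving: [1 / R0], the level, and the lengths of both
    variables all contribute at most [expR l * de]. *)
Lemma high_asymp :
  \sum_(q <- nball Q0 | q != 0) \sum_(r <- dvs q | (R0 <= nm r)%N)
     high_term Q SX SY a b phi ch q r <=
  60 * 10 * 28 * (repW R Q * lsC R Q * ca * cb) * (l ^+ 2 * Mo ^+ 2) * (expR (2 * l) * de).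
Proof.
have W0 : 0 <= repW R Q by apply: sqr_ge0.
have L0 := lsC_ge0 R Q.
have QJ : (Q0 < 2 ^ (dyad l).+1)%N.
  by rewrite (leq_ltn_trans (dyad_cover l1 Q0l)) // ltn_exp2l.
have [_ nF] := sum_weight ca0 a_le uX SX_ball XXl.
have [_ nG] := sum_weight cb0 b_le uY SY_ball YYl.
have sbX : {subset SX <= nball XX} by move=> x /SX_ball/andP[_]; rewrite mem_nball.
have sbY : {subset SY <= nball YY} by move=> x /SY_ball/andP[_]; rewrite mem_nball.
apply: (le_trans (high_total phi1 ch_ge0 XX0 YY0 R00 QJ uX uY sbX sbY nF nG)).
have E0 : 0 <= expR l by apply: expR_ge0.
have -> : expR (2 * l) = expR l * expR l by rewrite -expRD; congr expR; ring.
have db : dyadic_bound XX%:R YY%:R R0%:R Q0%:R <= 14 * (expR l * de).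
  rewrite /dyadic_bound.
  have h : Num.sqrt XX%:R * Num.sqrt YY%:R / R0%:R <= 2 * expR l * de.
    by apply: ler_pM; rewrite ?mulr_ge0 ?sqrtr_ge0 ?invr_ge0.
  rewrite -(mulrA 2 _ R0%:R^-1); move: h sX sY Qd; rewrite -(mulrA 2 (expR l) de).
  set u := _ / R0%:R; move: u (Num.sqrt XX%:R) (Num.sqrt YY%:R) (Q0%:R) (expR l * de).
  by move=> u v w t e *; lra.
have sq : Num.sqrt (ca ^+ 2 * XX%:R * Mo) * Num.sqrt (cb ^+ 2 * YY%:R * Mo) <=
    ca * cb * Mo * (2 * expR l).
  have e (u v : R) : 0 <= u -> 0 <= v ->
      Num.sqrt (u ^+ 2 * v * Mo) = u * Num.sqrt v * Num.sqrt Mo.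
    move=> u0 v0; rewrite sqrtrM ?mulr_ge0 ?sqr_ge0 // sqrtrM ?sqr_ge0 //.
    by rewrite sqrtr_sqr ger0_norm.
  rewrite !e //.
  have -> : ca * Num.sqrt XX%:R * Num.sqrt Mo * (cb * Num.sqrt YY%:R * Num.sqrt Mo) =
     ca * cb * Num.sqrt Mo ^+ 2 * (Num.sqrt XX%:R * Num.sqrt YY%:R) by ring.
  by rewrite sqr_sqrtr //; apply: ler_wpM2l => //; rewrite !mulr_ge0.
have m1 : moment 1 Q0 <= Mo by apply: moB.
have Jl : ((dyad l).+1%:R : R) <= 10 * l by apply: dyad_le.
have C0 : 0 <= \sum_k ch k by apply: sumr_ge0.
move: ch_sum; move: (\sum_k ch k) C0 => C C0 C60.
have M10 := moment_ge0 R Q 1 Q0.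
apply: (@le_trans _ _ (repW R Q * (60 * l) * Mo *
  (10 * l * (lsC R Q * (ca * cb * Mo * (2 * expR l)) * (14 * (expR l * de)))))); last first.
  by rewrite le_eqVlt; apply/orP; left; apply/eqP; ring.
have db0 := dyadic_bound_ge0 (R := R) XX%:R YY%:R R0 Q0.
apply: ler_pM.
- by rewrite !mulr_ge0.
- by rewrite mulr_ge0 // mulr_ge0 // !mulr_ge0 ?sqrtr_ge0.
- by apply: ler_pM => //; [rewrite mulr_ge0 | apply: ler_wpM2l].
apply: ler_pM => //; first by rewrite mulr_ge0 // !mulr_ge0 ?sqrtr_ge0.
apply: ler_pM => //; first by rewrite !mulr_ge0 ?sqrtr_ge0.
exact: ler_wpM2l.
Qed.
End High.

Section Low.
Variables (SY : seq O) (XX YY Q0 R0 z : nat) (na eta : R).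
Hypotheses (R00 : (0 < R0)%N) (z0 : (0 < z)%N) (eta0 : 0 <= eta) (na0 : 0 <= na).
Hypothesis uY : uniq SY.
Hypothesis SY_ball : forall x, x \in SY -> (x != 0) && (nm x <= YY)%N.
Hypothesis YYl : YY%:R <= expR (4 * l).
Hypothesis Q0l : Q0%:R <= expR (4 * l).
Hypothesis na_le : na <= ca * XX%:R * Mo.
Hypothesis XYl : XX%:R * YY%:R <= 4 * expR (2 * l).

(** The first term carries the distribution estimate [eta], the second one
    the truncation of the sieve at [z]. *)
Lemma low_asymp :
  \sum_(q <- nball Q0 | q != 0) \sum_(r <- dvs q | (nm r < R0)%N)
     low_term Q SY b z na (2 * eta) q r <=
  ca * ((repC Q)%:R * (8 * nmK Q)%N%:R * (ballC Q)%:R) * Mo ^+ 4 * R0%:R ^+ 2 *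
   (4 * (repC Q)%:R * (R0%:R * z%:R * (XX%:R * eta)) + 8 * cb * expR (2 * l) / z%:R).
Proof.
have e20 : 0 <= 2 * eta by rewrite mulr_ge0.
have SYb y : y \in SY -> (y != 0) && (y \in nball YY) by rewrite mem_nball; apply: SY_ball.
have bS y : y \in SY -> cabs (b y) <= cb * (tau y)%:R ^+ k by move=> /SY_ball/andP[y0 _]; apply: b_le.
apply: (le_trans (low_total Q0 R00 z0 e20 na0 cb0 uY SYb bS)).
have zp : (0 : R) < z%:R by rewrite ltr0n.
rewrite (natrM _ (repC Q * R0)) (natrM _ (repC Q)) (natrM _ (ballC Q)).
set c1 := (repC Q)%:R; set c2 := (8 * nmK Q)%N%:R; set c3 := (ballC Q)%:R.
move: na_le XYl; set X := XX%:R; set Y := YY%:R; set E := expR _ => naX XYE.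
set r := R0%:R; set zz := z%:R in zp *.
have X0 : 0 <= X by rewrite ler0n.
have Y0 : 0 <= Y by rewrite ler0n.
have [c10 c20 c30 r0] : [/\ 0 <= c1, 0 <= c2, 0 <= c3 & 0 <= r] by rewrite !ler0n.
have mo i n : (i <= k.*2.+3)%N -> n%:R <= expR (4 * l) -> 0 <= moment i n <= Mo.
  by move=> h1 h2; rewrite moment_ge0 moB.
have /andP[m3 m3'] := mo 3 Q0 isT Q0l.
have /andP[m2 m2'] := mo 2 Q0 isT Q0l.
have /andP[mk mk'] : 0 <= moment k YY <= Mo by apply: mo hk1 YYl.
have /andP[mk2 mk2'] : 0 <= moment k.+2 Q0 <= Mo by apply: mo hk2 Q0l.
move: (moment 3 Q0) (moment 2 Q0) (moment k YY) (moment k.+2 Q0) m3 m3' m2 m2' mk mk' mk2 mk2'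
  => M3 M2 Mk Mk2 m3 m3' m2 m2' mk mk' mk2 mk2'.
have E0 : 0 <= E by apply: expR_ge0.
have M13 : Mo <= Mo ^+ 3 by rewrite -{1}[Mo]expr1; apply: ler_weXn2l.
apply: (@le_trans _ _ (ca * X * Mo * (c1 * c2 * r * (c3 * r)) *
   (2 * (c1 * r * zz) * (2 * eta) * Mo ^+ 3 + 2 * (cb * Y * Mo ^+ 3 / zz)))).
  apply: ler_pM.
  - by apply: mulr_ge0 => //; rewrite !mulr_ge0.
  - by rewrite addr_ge0 // mulr_ge0 // ?mulr_ge0 // ?mulr_ge0 // ?mulr_ge0 // invr_ge0 ltW.
  - by apply: ler_wpM2r => //; rewrite !mulr_ge0.
  apply: lerD; last first.
    rewrite ler_pM2l // ler_pM2r ?invr_gt0 // -!mulrA; apply: ler_wpM2l => //.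
    apply: ler_wpM2l => //; rewrite !exprS expr0 mulr1.
    by apply: ler_pM => //; [rewrite mulr_ge0 | apply: ler_pM].
  apply: ler_wpM2l; first by rewrite !mulr_ge0 // ltW.
  exact: le_trans M13.
have -> : ca * X * Mo * (c1 * c2 * r * (c3 * r)) *
   (2 * (c1 * r * zz) * (2 * eta) * Mo ^+ 3 + 2 * (cb * Y * Mo ^+ 3 / zz)) =
  ca * (c1 * c2 * c3) * Mo ^+ 4 * r ^+ 2 *
   (4 * c1 * (r * zz * (X * eta)) + 2 * cb * (X * Y) / zz).
  by rewrite !exprS expr0; ring.
apply: ler_wpM2l; first by rewrite !mulr_ge0 // exprn_ge0.
rewrite lerD2l ler_pM2r ?invr_gt0 // -[8](_ : 2 * 4 = 8); last by ring.
have -> : 2 * 4 * cb * E = 2 * cb * (4 * E) by ring.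
by apply: ler_wpM2l => //; rewrite mulr_ge0.
Qed.
End Low.
End Asymptotic.

(** * Dyadic pieces *)

Section Core.
Variables (R : realType) (O : comNzRingType) (Q : quadOrder O) (ok : pred O).
Implicit Types x y z r d q s e m v : O.
Local Notation nm := (nm Q).
Local Notation nball := (nball Q).
Local Notation dvs := (dvs Q).
Local Notation tau := (tau Q).
Local Notation ldisc := (@class_disc R O Q).
Local Notation moment := (moment R Q).
Local Notation annulus := (annulus Q).

(** The sum of [w] over the moduli [q] up to the level, one for each ideal,
    saves the power [A] of [l]; [ok] selects the generators. *)
Definition small_total (th l cc : R) (b A : nat) (w : O -> R) : Prop :=
  forall n : nat, n%:R <= expR (th * l) / l ^+ b ->
    \sum_(q <- nball n | (q != 0) && ok q) w q <= cc * (expR (2 * l) / l ^+ A).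

(** A function [w] of the modulus that bounds all discrepancies up to norm
    [expR (2 * l)] and is small on average. It is also small at each modulus,
    which serves as a substitute for a Siegel-Walfisz bound. *)
Definition well_distributed_at (th l cc : R) (b A : nat) (g : O -> R[i]) (w : O -> R) : Prop :=
  [/\ forall q, 0 <= w q,
      forall q T c, q != 0 -> (nm q)%:R <= expR (th * l) / l ^+ b ->
        T%:R <= expR (2 * l) -> cop q c -> cabs (ldisc (annulus 0 T) g q c) <= w q,
      forall q, q != 0 -> (nm q)%:R <= expR (th * l) / l ^+ b ->
        w q <= cc * (expR (2 * l) / l ^+ A)
    & small_total th l cc b A w].

Definition well_distributed (th : R) (g : O -> R[i]) : Prop :=
  forall A : nat, exists (b : nat) (cc l0 : R), [/\ 1 <= l0, 0 <= cc &
    forall l, l0 <= l -> exists w, well_distributed_at th l cc b A g w].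

Lemma pow_div (l : R) (p q s : nat) : 1 <= l -> (p + s <= q)%N -> l ^+ p / l ^+ q <= (l ^+ s)^-1.
Proof.
move=> l1 h; have l0 : 0 < l by apply: lt_le_trans l1.
rewrite ler_pdivrMr ?exprn_gt0 // mulrC ler_pdivlMr ?exprn_gt0 // -exprD.
exact: ler_weXn2l.
Qed.

(** The discrepancy is additive in the range of the first factor. *)
Lemma pair_disc_bins q (J : nat) (h : O -> nat) (SX SY : seq O) (a b : O -> R[i]) T c :
  (forall x, x \in SX -> (h x < J)%N) ->
  pair_disc Q q SX SY a b T c =
  \sum_(j < J) pair_disc Q q [seq x <- SX | h x == j] SY a b T c.
Proof.
move=> hJ; have key (F : O -> R[i]) :
    \sum_(x <- SX) F x = \sum_(j < J) \sum_(x <- [seq x <- SX | h x == j]) F x.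
  under [RHS]eq_bigr do rewrite big_filter.
  rewrite (exchange_big_dep predT) //= big_seq [RHS]big_seq; apply: eq_bigr => x xS.
  by rewrite (big_pred1 (Ordinal (hJ x xS))) // => j; rewrite /= eq_sym.
rewrite /pair_disc key [in X in _ - X]key mulr_sumr -sumrB; apply: eq_bigr => j _.
by [].
Qed.

Section Pieces.
Variables (k A m HH EE a' b' : nat) (th ca cb cc l0' C1 : R) (g : O -> R[i]).
Hypotheses (th0 : 0 < th) (th1 : th <= 1) (ca0 : 0 <= ca) (cb0 : 0 <= cb) (cc0 : 0 <= cc).
Hypotheses (C10 : 0 <= C1).
Hypothesis hA1 : (2 * HH + m + A.+1 <= a')%N.
Hypothesis hA2 : (2 + 2 * m + A.+1 <= HH)%N.
Hypothesis hA3 : (4 * m + 3 * HH + EE + A.+1 <= a')%N.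
Hypothesis hA4 : (4 * m + 2 * HH + A.+1 <= EE)%N.
Hypothesis g_le : forall x, x != 0 -> cabs (g x) <= cb * (tau x)%:R ^+ k.
Hypothesis g_LD : forall l, l0' <= l -> exists w, well_distributed_at th l cc b' a' g w.

Variables (l : R) (a : O -> R[i]) (L j : nat).
Hypothesis a_le : forall x, x != 0 -> cabs (a x) <= ca * (tau x)%:R ^+ k.
Hypotheses (l1 : 1 <= l) (ll0 : l0' <= l / 2).
Hypothesis moB : forall i n, (i <= k.*2.+3)%N -> n%:R <= expR (4 * l) ->
  moment i n <= C1 * l ^+ m.
Hypothesis Mo1 : 1 <= C1 * l ^+ m.
Hypothesis lH : l ^+ HH <= expR (l / 2).
Hypothesis lE : 4 * l ^+ (HH + EE + b') <= expR (th * (l / 2)).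

Let n1 := Num.truncn (expR l).
Let nZ := Num.truncn (expR (2 * l)).
Let SX := [seq x <- annulus 0 n1 | trunc_log 2 (nm x) == j].
Let lp : 0 < l. Proof. exact: lt_le_trans l1. Qed.
Let lpw n : 0 < l ^+ n. Proof. by rewrite exprn_gt0. Qed.
Let Z0 : 0 < expR (2 * l). Proof. exact: expR_gt0. Qed.

(** The function [w] bounds the discrepancies of the products whose first
    factor has norm in [[2 ^ j, 2 ^ j.+1)]. *)
Definition piece_ok (w : O -> R) : Prop :=
  (forall q, 0 <= w q) /\
  (forall q T c, q != 0 -> (nm q)%:R <= expR (th * l) / l ^+ (b' + HH) ->
     T%:R <= expR (2 * l) -> cop q c ->
     cabs (pair_disc Q q SX (annulus L nZ) a g T c) <= w q).

Let uSX : uniq SX. Proof. by rewrite filter_uniq // annulus_uniq. Qed.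
Let SXb x : x \in SX -> [/\ x != 0, (2 ^ j <= nm x)%N, (nm x <= 2 ^ j.+1)%N & (nm x <= n1)%N].
Proof.
rewrite mem_filter mem_annulus => /andP[/eqP <- /andP[h1 h2]].
have /andP[h3 h4] := trunc_log_bounds (leqnn 2) h1.
by split => //; [rewrite -(nm_gt0 Q) | apply: ltnW].
Qed.
Let SXb' x : x \in SX -> (x != 0) && (nm x <= 2 ^ j.+1)%N.
Proof. by case/SXb => -> _ ->. Qed.
Let n1l : n1%:R <= expR l. Proof. by rewrite truncn_le expR_ge0. Qed.
Let nZl : nZ%:R <= expR (2 * l). Proof. by rewrite truncn_le expR_ge0. Qed.
Let e4 (t : R) : t <= 4 -> expR (t * l) <= expR (4 * l).
Proof. by move=> h; rewrite ler_expR; apply: ler_wpM2r => //; apply: ltW. Qed.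

(** The sum over [x] costs a power of [l], which the saving of [g] outweighs. *)
Lemma piece_direct : (2 ^ j)%N%:R <= l ^+ (2 * HH) -> (2 ^ j <= n1)%N ->
  exists2 w, piece_ok w &
    small_total th l (8 * ca * C1 * cc) (b' + HH) A.+1 w.
Proof.
move=> hj jn; have [|w [w0 w1 _ w3]] := g_LD (l := l); first by apply: le_trans ll0 _; move: l1; lra.
have mod b'' q : (nm q)%:R <= expR (th * l) / l ^+ (b' + b'') :> R ->
    (nm q)%:R <= expR (th * l) / l ^+ b' :> R.
  move=> h; apply: le_trans h _; apply: ler_wpM2l; first exact: expR_ge0.
  by rewrite lef_pV2 ?posrE //; apply: ler_weXn2l => //; rewrite leq_addr.
have jl : (2 ^ j.+1)%N%:R <= expR (4 * l) :> R.
  apply: (@le_trans _ _ (expR l * expR l)); last first.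
    by rewrite -expRD ler_expR; move: l1; lra.
  rewrite expnS natrM; apply: ler_pM => //; last by apply: le_trans n1l; rewrite ler_nat.
  by apply: le_trans (expR_ge1Dx _); move: l1; lra.
have [sa _] := sum_weight moB ca0 a_le uSX SXb' jl.
exists (fun q => (ca * (2 ^ j.+1)%N%:R * (C1 * l ^+ m)) * (2 * w q)).
  split=> [q|q T c q0 hq hT cq].
    by rewrite !mulr_ge0 // ltW.
  apply: (@le_trans _ _ ((\sum_(x <- SX) cabs (a x)) * (2 * w q))).
    apply: pair_disc_direct => //; first by move=> x /SXb[].
    move=> T' v hT' cv; apply: w1 => //; first exact: mod hq.
    by apply: le_trans nZl; rewrite ler_nat.
  by apply: ler_wpM2r => //; rewrite mulr_ge0.
move=> n hn; rewrite -mulr_sumr -mulr_sumr.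
have hn' : n%:R <= expR (th * l) / l ^+ b'.
  apply: le_trans hn _; apply: ler_wpM2l; first exact: expR_ge0.
  by rewrite lef_pV2 ?posrE //; apply: ler_weXn2l => //; rewrite leq_addr.
have := w3 n hn'; set W := \sum_(q <- _ | _) _ => hW.
apply: (@le_trans _ _ (ca * (2 * l ^+ (2 * HH)) * (C1 * l ^+ m) *
   (2 * (cc * (expR (2 * l) / l ^+ a'))))).
  have W0 : 0 <= W by apply: sumr_ge0.
  apply: ler_pM; rewrite ?mulr_ge0 ?(ltW (lpw _)) //; last by apply: ler_wpM2l.
  apply: ler_wpM2r; first by rewrite mulr_ge0 ?(ltW (lpw _)).
  by apply: ler_wpM2l => //; rewrite expnS natrM; apply: ler_wpM2l.
have -> : ca * (2 * l ^+ (2 * HH)) * (C1 * l ^+ m) * (2 * (cc * (expR (2 * l) / l ^+ a'))) =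
  4 * ca * C1 * cc * expR (2 * l) * (l ^+ (2 * HH + m) / l ^+ a') by rewrite exprD; ring.
apply: (@le_trans _ _ (4 * ca * C1 * cc * expR (2 * l) * (l ^+ A.+1)^-1)).
  apply: ler_wpM2l; first by rewrite !mulr_ge0 // ltW.
  exact: pow_div l1 hA1.
rewrite -[leLHS]mulrA; apply: ler_wpM2r; first by apply: mulr_ge0; rewrite ?invr_ge0; apply: ltW.
by rewrite -!mulrA ler_wpM2r ?mulr_ge0 // ler_nat.
Qed.

(** As [nm x >= 2 ^ j], the product condition forces [nm y <= expR (2 * l) /
    2 ^ j]. *)
Lemma slice_shrink x T : (2 ^ j <= nm x)%N -> (T <= nZ)%N ->
  perm_eq [seq y <- annulus L nZ | (nm (x * y) <= T)%N]
          [seq y <- annulus L (nZ %/ 2 ^ j) | (nm (x * y) <= T)%N].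
Proof.
move=> hx hT; apply: uniq_perm; first by rewrite filter_uniq ?annulus_uniq.
  by rewrite filter_uniq ?annulus_uniq.
move=> y; rewrite !mem_filter !mem_nball; case hxy: (nm (x * y) <= T)%N => //=.
case: (L < nm y)%N => //=.
have h : (nm y * 2 ^ j <= nZ)%N.
  by apply: leq_trans (leq_trans hxy hT); rewrite nmM mulnC leq_mul2r hx orbT.
by rewrite leq_divRL ?expn_gt0 // h; apply: leq_trans h; rewrite leq_pmulr ?expn_gt0.
Qed.

Lemma pair_disc_shrink q T c : (T <= nZ)%N ->
  pair_disc Q q SX (annulus L nZ) a g T c =
  pair_disc Q q SX (annulus L (nZ %/ 2 ^ j)) a g T c.
Proof.
move=> hT; have key (P : O -> pred O) :
    \sum_(x <- SX) \sum_(y <- annulus L nZ | (nm (x * y) <= T)%N && P x y) a x * g y =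
    \sum_(x <- SX) \sum_(y <- annulus L (nZ %/ 2 ^ j) | (nm (x * y) <= T)%N && P x y) a x * g y.
  rewrite big_seq [RHS]big_seq; apply: eq_bigr => x /SXb[_ hx _ _].
  by rewrite -[LHS]big_filter_cond -[RHS]big_filter_cond (perm_big _ (slice_shrink hx hT)).
by rewrite /pair_disc (key (fun x y => dvq q (x * y - c))) (key (fun x y => cop q (x * y))).
Qed.

Lemma near_pow n : exists2 r : nat, (0 < r)%N & l ^+ n <= r%:R <= 2 * l ^+ n.
Proof.
exists (Num.truncn (l ^+ n)).+1 => //; rewrite ltW ?truncnS_gt //=.
have h : (Num.truncn (l ^+ n))%:R <= l ^+ n by rewrite truncn_le ltW.
have h1 : 1 <= l ^+ n by rewrite exprn_ege1.
by rewrite -natr1 mulr_natl mulr2n lerD.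
Qed.

(** The implied constant: the first summand comes from large conductors, the
    second one from small conductors. *)
Definition dyadic_const : R :=
  60 * 10 * 28 * (repW R Q * lsC R Q * ca * cb) * C1 ^+ 2 +
  ca * ((repC Q)%:R * (8 * nmK Q)%N%:R * (ballC Q)%:R) * C1 ^+ 4 * 4 *
    (32 * (repC Q)%:R * cc * 2 ^+ a' + 8 * cb).

(** Conductors of norm at least [R0], about [l ^+ HH], are treated by the
    large sieve, the others by the distribution of [g] at the scale [expR (2
    * l) / 2 ^ j] with a sieve of level [z], about [l ^+ EE]. *)
Lemma piece_dyadic : l ^+ (2 * HH) <= (2 ^ j)%N%:R -> (2 ^ j <= n1)%N ->
  exists2 w, piece_ok w & small_total th l dyadic_const (b' + HH) A.+1 w.
Proof.
move=> hj jn; set X := (2 ^ j)%N in hj jn *; pose YY := (nZ %/ X)%N.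
have Xp : (0 < X)%N by rewrite expn_gt0.
have XR : (0 : R) < X%:R by rewrite ltr0n.
have Xl : X%:R <= expR l by apply: le_trans n1l; rewrite ler_nat.
have n1Z : (n1 <= nZ)%N by apply: le_truncn; rewrite ler_expR; move: l1; lra.
have YYp : (0 < YY)%N by rewrite divn_gt0 // (leq_trans jn).
have YX : YY%:R * X%:R <= expR (2 * l).
  by apply: le_trans nZl; rewrite -natrM ler_nat leq_trunc_div.
have YZ : YY%:R <= expR (2 * l) / X%:R by rewrite ler_pdivlMr.
have e3 : 3 <= expR (2 * l) by apply: le_trans (expR_ge1Dx _); move: l1; lra.
have e44 : expR (2 * l) * expR (2 * l) = expR (4 * l) by rewrite -expRD; congr expR; ring.
have E2 : expR (2 * l) = expR l * expR l by rewrite -expRD; congr expR; ring.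
have YY4 : YY%:R <= expR (4 * l).
  apply: (@le_trans _ _ (expR (2 * l))); last by apply: e4; lra.
  apply: le_trans nZl; by rewrite ler_nat leq_div.
have XX4 : (2 ^ j.+1)%N%:R <= expR (4 * l).
  rewrite expnS natrM -e44; apply: ler_pM => //.
    by apply: le_trans e3; rewrite ler_nat.
  by apply: le_trans Xl _; rewrite ler_expR; move: l1; lra.
have nZp : (0 < 2 * nZ)%N by rewrite muln_gt0 /=; apply: leq_trans n1Z; apply: leq_trans jn.
have [P [phi [c [ch [phi1 ch0 c_le chs sepP]]]]] := separation R nZp.
have ch60 : \sum_k ch k <= 60 * l.
  apply: (le_trans chs); have : ln (2 * nZ)%N%:R <= 4 * l.
    rewrite -[leRHS]expRK ler_ln ?posrE ?ltr0n ?expR_gt0 // natrM -e44.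
    by apply: ler_pM => //; apply: le_trans e3; rewrite ler_nat.
  by move: l1; move: (ln _) => t; lra.
have [R0 R0p /andP[R0l R0u]] := near_pow HH.
have [z zp /andP[zl zu]] := near_pow EE.
(* The second factor has norm at most [expR (2 * l')]; as [2 ^ j <= expR l],
   the logarithms [l'] and [l] are comparable, so the level of distribution
   of [g] at [l'] covers all moduli of norm at most a power of [l]. *)
pose lX := ln (X%:R : R); have lX0 : 0 <= lX by rewrite ln_ge0 // ler1n.
have lXl : lX <= l by rewrite -[leRHS]expRK ler_ln ?posrE ?expR_gt0.
pose l' := l - lX / 2.
have l'1 : l / 2 <= l' by rewrite /l'; lra.
have l'2 : l' <= l by rewrite /l'; lra.
have el' : expR (2 * l') = expR (2 * l) / X%:R.
  have -> : 2 * l' = 2 * l - lX by rewrite /l'; field.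
  by rewrite expRB lnK ?posrE.
have l'p : 0 < l' by apply: lt_le_trans l'1; rewrite divr_gt0.
have [w [w0 w1 w2 _]] := g_LD (le_trans ll0 l'1).
pose eta := cc * (2 ^+ a' * (expR (2 * l) / X%:R / l ^+ a')).
have eta0 : 0 <= eta by rewrite !mulr_ge0 ?invr_ge0 ?exprn_ge0 // ltW.
have eta_ge d v T : d != 0 -> (nm d <= R0 * z)%N -> cop d v -> (T <= YY)%N ->
    cabs (ldisc (annulus 0 T) g d v) <= eta.
  move=> d0 hm cv hT.
  have hm' : (nm d)%:R <= expR (th * l') / l' ^+ b'.
    apply: (@le_trans _ _ (R0%:R * z%:R)); first by rewrite -natrM ler_nat.
    apply: (@le_trans _ _ (2 * l ^+ HH * (2 * l ^+ EE))); first by apply: ler_pM.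
    rewrite ler_pdivlMr ?exprn_gt0 //.
    apply: (@le_trans _ _ (expR (th * (l / 2)))); last first.
      by rewrite ler_expR ler_pM2l.
    apply: le_trans lE; rewrite !exprD.
    have -> : 2 * l ^+ HH * (2 * l ^+ EE) * l' ^+ b' = 4 * (l ^+ HH * l ^+ EE * l' ^+ b') by ring.
    apply: ler_wpM2l => //; apply: ler_wpM2l; first by rewrite mulr_ge0 // ltW.
    by rewrite lerXn2r ?nnegrE // ltW.
  apply: (le_trans (w1 d T v d0 hm' _ cv)).
    by rewrite el'; apply: le_trans YZ; rewrite ler_nat.
  apply: (le_trans (w2 d d0 hm')); rewrite /eta el'; apply: ler_wpM2l => //.
  rewrite mulrCA; apply: ler_wpM2l; first by rewrite divr_ge0 // ltW.
  have -> : 2 ^+ a' * (l ^+ a')^-1 = ((l / 2) ^+ a')^-1.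
    by rewrite exprMn exprVn invfM invrK mulrC.
  rewrite lef_pV2 ?posrE ?exprn_gt0 ?divr_gt0 //.
  by rewrite lerXn2r ?nnegrE ?divr_ge0 // ltW.
pose Mo := C1 * l ^+ m; have Mo0 : 0 <= Mo by apply: le_trans Mo1.
pose na := ca * (2 ^ j.+1)%N%:R * Mo; have na0 : 0 <= na by apply: mulr_ge0 => //; apply: mulr_ge0.
have [sa _] := sum_weight moB ca0 a_le uSX SXb' XX4.
have SXY x y : x \in SX -> y \in annulus L YY -> (nm (x * y) <= 2 * nZ)%N.
  move=> /SXb[_ _ hx _]; rewrite mem_annulus => /andP[_ hy].
  rewrite nmM; apply: (leq_trans (leq_mul hx hy)).
  by rewrite expnS -mulnA leq_mul2l /= mulnC leq_trunc_div.
have SX0 x : x \in SX -> x != 0 by case/SXb.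
pose F q := \sum_(r <- dvs q | (R0 <= nm r)%N)
                high_term Q SX (annulus L YY) a g phi ch q r +
             \sum_(r <- dvs q | (nm r < R0)%N)
                low_term Q (annulus L YY) g z na (2 * eta) q r.
have e20 : 0 <= 2 * eta by apply: mulr_ge0.
have F0 q : 0 <= F q.
  by apply: addr_ge0; apply: sumr_ge0 => r _; [apply: high_term_ge0 | apply: low_term_ge0].
exists F; first split=> [//|q T v q0 hq hT cq].
  have hT' : (T <= nZ)%N by rewrite truncn_ge_nat ?expR_ge0.
  rewrite pair_disc_shrink //; apply: (pair_disc_split ch0 c_le sepP) => //.
  by apply: leq_trans hT' _; rewrite leq_pmull.
move=> n hn.
apply: (@le_trans _ _ (\sum_(q <- nball n | q != 0) F q)).
  rewrite [leRHS](bigID ok) /= lerDl; exact: sumr_ge0.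
have nE : n%:R <= expR l * (l ^+ HH)^-1.
  apply: le_trans hn _; apply: ler_pM; first exact: expR_ge0.
  - by rewrite invr_ge0 ltW.
  - by rewrite ler_expR; apply: ler_piMl => //; apply: ltW.
  by rewrite lef_pV2 ?posrE //; apply: ler_weXn2l => //; rewrite leq_addl.
have lH1 : (l ^+ HH)^-1 <= 1 by rewrite invf_le1 // exprn_ege1.
have n4 : n%:R <= expR (4 * l).
  apply: (le_trans nE); apply: (@le_trans _ _ (expR l)).
    by apply: ler_piMr => //; apply: expR_ge0.
  by rewrite ler_expR; move: l1; lra.
have YYb x : x \in annulus L YY -> (x != 0) && (nm x <= YY)%N.
  by move=> h; rewrite (annulus_neq0 h) /=; move: h; rewrite mem_annulus => /andP[].
have eh : expR (l / 2) * expR (l / 2) = expR l by rewrite -expRD; congr expR; field.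
have sXY : Num.sqrt (2 ^ j.+1)%N%:R * Num.sqrt YY%:R <= 2 * expR l.
  rewrite -sqrtrM // -[leRHS]ger0_norm ?mulr_ge0 ?expR_ge0 // -sqrtr_sqr ler_sqrt ?sqr_ge0 //.
  rewrite expnS natrM exprMn [expR l ^+ 2]expr2 -E2 -mulrA [X%:R * _]mulrC.
  by apply: ler_pM; rewrite ?mulr_ge0 // expr2; lra.
have R0d : R0%:R^-1 <= (l ^+ HH)^-1 by rewrite lef_pV2 ?posrE ?ltr0n.
have sX : Num.sqrt (2 ^ j.+1)%N%:R <= 2 * (expR l * (l ^+ HH)^-1).
  apply: (@le_trans _ _ (2 * expR (l / 2))); last first.
    by apply: ler_wpM2l => //; rewrite ler_pdivlMr // -eh ler_wpM2l // expR_ge0.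
  rewrite -[leRHS]ger0_norm ?mulr_ge0 ?expR_ge0 // -sqrtr_sqr ler_sqrt ?sqr_ge0 //.
  rewrite expnS natrM exprMn [expR (l / 2) ^+ 2]expr2 eh expr2.
  by apply: ler_pM => //; lra.
have de0 : 0 <= (l ^+ HH)^-1 by rewrite invr_ge0 ltW.
have sY : Num.sqrt YY%:R <= expR l * (l ^+ HH)^-1.
  rewrite -[leRHS]ger0_norm; last by rewrite mulr_ge0 ?expR_ge0.
  rewrite -sqrtr_sqr ler_sqrt ?sqr_ge0 //.
  apply: (le_trans YZ); rewrite exprMn [expR l ^+ 2]expr2 -E2 exprVn -exprM mulnC.
  by apply: ler_wpM2l; [exact: ltW | rewrite lef_pV2 ?posrE].
have hi := high_asymp l1 Mo1 ca0 cb0 moB a_le g_le phi1 ch0 ch60 _ YYp R0p uSX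
  (annulus_uniq Q L YY) SXb' YYb XX4 YY4 n4 sXY R0d sX sY nE.
have XYl : (2 ^ j.+1)%N%:R * YY%:R <= 4 * expR (2 * l).
  rewrite expnS natrM -mulrA [X%:R * _]mulrC; apply: ler_pM; rewrite ?mulr_ge0 //.
  by rewrite ler_nat.
have lo := low_asymp Mo1 ca0 cb0 moB g_le R0p zp eta0 na0 (annulus_uniq Q L YY) YYb YY4 n4
  (lexx na) XYl.
rewrite /F big_split /=; apply: (le_trans (lerD (hi _) lo)); first by rewrite expn_gt0.
rewrite /dyadic_const [leRHS]mulrDl; apply: lerD.
  have W0 : 0 <= repW R Q by apply: sqr_ge0.
  have L0 := lsC_ge0 R Q.
  have -> : 60 * 10 * 28 * (repW R Q * lsC R Q * ca * cb) * (l ^+ 2 * (C1 * l ^+ m) ^+ 2) *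
     (expR (2 * l) / l ^+ HH) = 60 * 10 * 28 * (repW R Q * lsC R Q * ca * cb) * C1 ^+ 2 *
     (expR (2 * l) * (l ^+ (2 + 2 * m) / l ^+ HH)).
    by rewrite exprMn -exprM exprD [(m * 2)%N]mulnC; ring.
  apply: ler_wpM2l; first by rewrite !mulr_ge0 ?exprn_ge0.
  by apply: ler_wpM2l; [rewrite ltW | apply: pow_div].
pose r0 := R0%:R : R; pose zz := z%:R : R; pose X2 := (2 ^ j.+1)%N%:R : R.
set K2 := (repC Q)%:R * _ * _; have K20 : 0 <= K2 by rewrite !mulr_ge0.
have L0 n' : 0 <= l ^+ n' by apply: ltW.
have c40 : 0 <= C1 ^+ 4 by apply: exprn_ge0.
pose V := expR (2 * l) * (l ^+ A.+1)^-1.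
have V0 : 0 <= V by apply: mulr_ge0; rewrite ?invr_ge0; [apply: ltW|].
have XXe : X2 * eta = 2 * cc * 2 ^+ a' * (expR (2 * l) / l ^+ a').
  by rewrite /X2 /eta expnS natrM -/X; field; rewrite gt_eqF //= gt_eqF.
have first_term : l ^+ (4 * m) * l ^+ (2 * HH) * (4 * l ^+ (HH + EE) * (X2 * eta)) <=
    8 * cc * 2 ^+ a' * V.
  rewrite XXe.
  have -> : l ^+ (4 * m) * l ^+ (2 * HH) * (4 * l ^+ (HH + EE) *
      (2 * cc * 2 ^+ a' * (expR (2 * l) / l ^+ a'))) =
    8 * cc * 2 ^+ a' * (expR (2 * l) * (l ^+ (4 * m + 3 * HH + EE) / l ^+ a')).
    have -> : (4 * m + 3 * HH + EE = 4 * m + (2 * HH + (HH + EE)))%N by ring.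
    rewrite [l ^+ (4 * m + _)]exprD [l ^+ (2 * HH + _)]exprD.
    by move: (l ^+ _) (l ^+ (2 * HH)) (l ^+ (HH + EE)) (_^-1) => *; ring.
  apply: ler_wpM2l; first by rewrite !mulr_ge0 ?exprn_ge0.
  by apply: ler_wpM2l; [exact: ltW | exact: pow_div].
have second_term : l ^+ (4 * m) * l ^+ (2 * HH) * (expR (2 * l) / l ^+ EE) <= V.
  have -> : l ^+ (4 * m) * l ^+ (2 * HH) * (expR (2 * l) / l ^+ EE) =
    expR (2 * l) * (l ^+ (4 * m + 2 * HH) / l ^+ EE) by rewrite exprD; ring.
  by apply: ler_wpM2l; [exact: ltW | exact: pow_div].
have r02 : r0 ^+ 2 <= 4 * l ^+ (2 * HH).
  have -> : 4 * l ^+ (2 * HH) = (2 * l ^+ HH) ^+ 2 by rewrite exprMn -exprM [(HH * 2)%N]mulnC; ring.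
  by rewrite lerXn2r ?nnegrE ?mulr_ge0 // ler0n.
have rz : r0 * zz <= 4 * l ^+ (HH + EE).
  rewrite exprD; have -> : 4 * (l ^+ HH * l ^+ EE) = 2 * l ^+ HH * (2 * l ^+ EE) by ring.
  by apply: ler_pM => //; rewrite ler0n.
have zi : zz^-1 <= (l ^+ EE)^-1 by rewrite lef_pV2 ?posrE // ltr0n.
have Xe0 : 0 <= X2 * eta by apply: mulr_ge0; rewrite ?ler0n.
rewrite -/r0 -/zz -/X2.
apply: (@le_trans _ _ (ca * K2 * (C1 * l ^+ m) ^+ 4 * (4 * l ^+ (2 * HH)) *
  (4 * (repC Q)%:R * (4 * l ^+ (HH + EE) * (X2 * eta)) + 8 * cb * expR (2 * l) / l ^+ EE))).
  apply: ler_pM.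
  - by apply: mulr_ge0; [apply: mulr_ge0; [exact: mulr_ge0 | exact: exprn_ge0] | exact: sqr_ge0].
  - apply: addr_ge0; first by rewrite mulr_ge0 // mulr_ge0 // mulr_ge0 // ler0n.
    by apply: mulr_ge0; [rewrite mulr_ge0 ?mulr_ge0 ?expR_ge0 | rewrite invr_ge0 ler0n].
  - apply: ler_wpM2l => //; apply: mulr_ge0; [exact: mulr_ge0 | exact: exprn_ge0].
  apply: lerD.
    by apply: ler_wpM2l; [rewrite mulr_ge0 | apply: ler_wpM2r].
  by apply: ler_wpM2l => //; rewrite !mulr_ge0 ?expR_ge0.
have -> : (C1 * l ^+ m) ^+ 4 = C1 ^+ 4 * l ^+ (4 * m) by rewrite exprMn -exprM [(m * 4)%N]mulnC.
apply: (@le_trans _ _ (ca * K2 * C1 ^+ 4 * 4 * (4 * (repC Q)%:R * (8 * cc * 2 ^+ a' * V) + 8 * cb * V))).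
  have -> : ca * K2 * (C1 ^+ 4 * l ^+ (4 * m)) * (4 * l ^+ (2 * HH)) *
    (4 * (repC Q)%:R * (4 * l ^+ (HH + EE) * (X2 * eta)) + 8 * cb * expR (2 * l) / l ^+ EE) =
    ca * K2 * C1 ^+ 4 * 4 * (4 * (repC Q)%:R * (l ^+ (4 * m) * l ^+ (2 * HH) *
       (4 * l ^+ (HH + EE) * (X2 * eta))) +
     8 * cb * (l ^+ (4 * m) * l ^+ (2 * HH) * (expR (2 * l) / l ^+ EE))).
    move: (C1 ^+ 4) (l ^+ (4 * m)) (l ^+ (2 * HH)) (l ^+ (HH + EE)) (expR _) (l ^+ EE)^-1 (X2 * eta).
    by move=> *; ring.
  apply: ler_wpM2l; first by rewrite !mulr_ge0.
  by apply: lerD; apply: ler_wpM2l; rewrite ?mulr_ge0.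
rewrite le_eqVlt; apply/orP; left; apply/eqP; rewrite -/V.
by move: (V) => W; ring.
Qed.

End Pieces.
End Core.

(** * Dirichlet convolution *)

Section Convolution.
Variables (R : realType) (O : comNzRingType) (Q : quadOrder O) (ok : pred O).
Implicit Types x y z r d q s e m v : O.
Local Notation nm := (nm Q).
Local Notation nball := (nball Q).
Local Notation tau := (tau Q).
Local Notation annulus := (annulus Q).
Local Notation cut t := (Num.truncn (expR t)).
Local Notation small_total := (@small_total R O Q ok).
Local Notation well_distributed := (@well_distributed R O Q ok).

(** Sum of the contributions of the dyadic pieces, whose number is at most a
    multiple of [l]. *)
Lemma conv_half (th : R) (k A : nat) (ca cb : R) (g : O -> R[i]) :
  0 < th -> th <= 1 -> 0 <= ca -> 0 <= cb -> well_distributed th g ->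
  (forall x, x != 0 -> cabs (g x) <= cb * (tau x)%:R ^+ k) ->
  exists (b : nat) (cc l0 : R), [/\ 1 <= l0, 0 <= cc & forall l, l0 <= l ->
    forall (L : nat) (a : O -> R[i]), (forall x, x != 0 -> cabs (a x) <= ca * (tau x)%:R ^+ k) ->
    exists w : O -> R, [/\ forall q, 0 <= w q,
      forall q T c, q != 0 -> (nm q)%:R <= expR (th * l) / l ^+ b ->
        T%:R <= expR (2 * l) -> cop q c ->
        cabs (pair_disc Q q (annulus 0 (cut l)) (annulus L (cut (2 * l))) a g T c) <= w q
    & small_total th l cc b A w]].
Proof.
move=> th0 th1 ca0 cb0 gD g_le.
(* Every divisor moment that occurs is at most a constant times [l ^+ m]. The
   exponents are fixed in this order: [HH] beats the moments in the large
   sieve, [EE] beats in addition the number of small conductors, and the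
   saving [a'] beats both cut-offs. *)
pose m := (2 ^ (k.*2.+3))%N; pose HH := (A + 4 * m + 4)%N.
pose EE := (2 * HH + 4 * m + A + 1)%N; pose a' := (3 * HH + EE + 4 * m + A + 1)%N.
have hA1 : (2 * HH + m + A.+1 <= a')%N by rewrite /a' /EE; clear; lia.
have hA2 : (2 + 2 * m + A.+1 <= HH)%N by rewrite /HH; clear; lia.
have hA3 : (4 * m + 3 * HH + EE + A.+1 <= a')%N by rewrite /a'; clear; lia.
have hA4 : (4 * m + 2 * HH + A.+1 <= EE)%N by rewrite /EE; clear; lia.
clearbody HH EE a'.
have [b' [cc [l0' [l0'1 cc0 g_LD]]]] := gD a'.
have B1 : 1 <= (ballC Q)%:R :> R.
  rewrite ler1n; have := size_nball Q (ltn0Sn 0); rewrite muln1; apply: leq_trans.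
  by have : (1 : O) \in nball 1 by [rewrite mem_nball nm1]; case: (nball 1).
have B20 : 1 <= 20 * (ballC Q)%:R :> R by lra.
pose C1 := (20 * (ballC Q)%:R) ^+ m : R.
have C11 : 1 <= C1 by apply: exprn_ege1.
have C10 : 0 <= C1 by apply: le_trans C11.
have half0 : 0 < 1 / 2 :> R by rewrite divr_gt0.
have thh0 : 0 < th / 2 by rewrite divr_gt0.
have [lA [lA1 lAh]] := pow_le_expR 1 HH half0.
have [lB [lB1 lBh]] := pow_le_expR 4 (HH + EE + b') thh0.
pose D := `|8 * ca * C1 * cc| + `|dyadic_const Q a' ca cb cc C1|.
have D0 : 0 <= D by apply: addr_ge0.
exists (b' + HH)%N, (10 * D), (1 + lA + lB + 2 * l0'); split; first lra.
  by rewrite mulr_ge0.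
move=> l hl L a a_le.
have l1 : 1 <= l by lra.
have ll0 : l0' <= l / 2 by lra.
have lp : 0 < l by lra.
have lH : l ^+ HH <= expR (l / 2).
  by have := lAh l; rewrite mul1r => h; apply: le_trans (h _) _; [lra | rewrite ler_expR; lra].
have lE : 4 * l ^+ (HH + EE + b') <= expR (th * (l / 2)).
  have -> : th * (l / 2) = th / 2 * l by field.
  by apply: lBh; lra.
have B20l : 1 <= 20 * (ballC Q)%:R * l by apply: (le_trans B20); apply: ler_peMr => //; lra.
have moB i n : (i <= k.*2.+3)%N -> n%:R <= expR (4 * l) -> moment R Q i n <= C1 * l ^+ m.
  move=> hi hn; apply: (le_trans (moment_le Q i l1 hn)); rewrite -exprMn.
  by apply: ler_weXn2l => //; rewrite leq_exp2l.
have Mo1 : 1 <= C1 * l ^+ m by rewrite -exprMn exprn_ege1.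
pose SXj j := [seq x <- annulus 0 (cut l) | trunc_log 2 (nm x) == j].
have piece j : exists w, (forall q, 0 <= w q) /\ (forall q T c, q != 0 ->
     (nm q)%:R <= expR (th * l) / l ^+ (b' + HH) -> T%:R <= expR (2 * l) -> cop q c ->
     cabs (pair_disc Q q (SXj j) (annulus L (cut (2 * l))) a g T c) <= w q) /\
     small_total th l D (b' + HH) A.+1 w.
  have weak (cst : R) w : cst <= D -> small_total th l cst (b' + HH) A.+1 w ->
      small_total th l D (b' + HH) A.+1 w.
    move=> hc h n hn; apply: (le_trans (h n hn)); apply: ler_wpM2r => //.
    by rewrite divr_ge0 ?expR_ge0 ?exprn_ge0 // ltW.
  have [jn|nj] := leqP (2 ^ j) (cut l).
    have [hj|hj] := lerP (2 ^ j)%N%:R (l ^+ (2 * HH)).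
      have [w [w0 w1] w2] := piece_direct ca0 cc0 C10 hA1 g_LD L a_le l1 ll0 moB hj jn.
      exists w; split=> //; split=> //; apply: weak w2.
      by apply: (le_trans (ler_norm _)); rewrite lerDl.
    have [w [w0 w1] w2] := piece_dyadic th0 th1 ca0 cb0 cc0 C10 hA2 hA3 hA4 g_le g_LD L a_le
       l1 ll0 moB Mo1 lH lE (ltW hj) jn.
    exists w; split=> //; split=> //; apply: weak w2.
    by apply: (le_trans (ler_norm _)); rewrite lerDr.
  (* The range of the first factor is empty. *)
  exists (fun=> 0); split=> //; split=> [q T c _ _ _ _|n _]; last first.
    by rewrite big1 // mulr_ge0 // divr_ge0 ?expR_ge0 ?exprn_ge0 // ltW.
  have -> : SXj j = [::].
    apply/eqP; rewrite -[_ == _]negbK -has_filter; apply/hasPn => x.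
    rewrite mem_annulus => /andP[h1 h2]; apply/eqP => e.
    have /andP[h3 _] := trunc_log_bounds (leqnn 2) h1.
    by move: nj; rewrite -e ltnNge (leq_trans h3 h2).
  by rewrite /pair_disc !big_nil mulr0 subr0 cabs0.
have [w hw] := choice piece.
pose J := (dyad l).+1.
exists (fun q => \sum_(j < J) w j q); split.
- by move=> q; apply: sumr_ge0 => j _; have [h _] := hw j.
- move=> q T c q0 hq hT cq; rewrite (@pair_disc_bins _ _ _ q J (fun x => trunc_log 2 (nm x))).
    by apply: cabs_sum_le => j _; have [_ [h _]] := hw j; apply: h.
  move=> x; rewrite mem_annulus => /andP[h1 h2]; rewrite ltnS -(leq_exp2l (m := 2)) //.
  have /andP[h3 _] := trunc_log_bounds (leqnn 2) h1.
  apply: (leq_trans h3); apply: dyad_cover => //.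
  apply: (@le_trans _ _ (expR l)); last by rewrite ler_expR; lra.
  apply: (@le_trans _ _ (cut l)%:R); first by rewrite ler_nat.
  by rewrite truncn_le expR_ge0.
move=> n hn; rewrite exchange_big /=.
apply: (@le_trans _ _ (\sum_(j < J) D * (expR (2 * l) / l ^+ A.+1))).
  by apply: ler_sum => j _; have [_ [_ h]] := hw j; apply: h.
rewrite sumr_const card_ord -[leLHS]mulr_natl.
apply: (@le_trans _ _ (10 * l * (D * (expR (2 * l) / l ^+ A.+1)))).
  apply: ler_wpM2r; last exact: dyad_le.
  by rewrite mulr_ge0 // divr_ge0 ?expR_ge0 ?exprn_ge0 // ltW.
rewrite le_eqVlt; apply/orP; left; apply/eqP; rewrite exprS.
have ln : l != 0 by rewrite gt_eqF.
by field; rewrite ?ln ?expf_neq0.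
Qed.

(** Dirichlet's hyperbola method: in a product of norm at most [n1 ^ 2] one of
    the factors has norm at most [n1]. *)
Lemma hyperbola (l : R) (f g : O -> R[i]) T (P : pred O) : 1 <= l ->
  T%:R <= expR (2 * l) ->
  \sum_(x <- annulus 0 (cut (2 * l))) \sum_(y <- annulus 0 (cut (2 * l)) |
     (nm (x * y) <= T)%N && P (x * y)) f x * g y =
  \sum_(x <- annulus 0 (cut l)) \sum_(y <- annulus 0 (cut (2 * l)) |
     (nm (x * y) <= T)%N && P (x * y)) f x * g y +
  \sum_(x <- annulus 0 (cut l)) \sum_(y <- annulus (cut l) (cut (2 * l)) |
     (nm (x * y) <= T)%N && P (x * y)) g x * f y.
Proof.
move=> l1 hT; set n1 := cut l; set nZ := cut (2 * l).
have n1Z : (n1 <= nZ)%N by apply: le_truncn; rewrite ler_expR; lra.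
have low (F : O -> R[i]) : \sum_(x <- annulus 0 nZ | (nm x <= n1)%N) F x = \sum_(x <- annulus 0 n1) F x.
  rewrite -big_filter; apply: perm_big; apply: uniq_perm; rewrite ?annulus_uniq //.
    by rewrite filter_uniq ?annulus_uniq.
  by move=> x; rewrite mem_filter !mem_annulus; move: (nm x) => i; lia.
have high (F : O -> R[i]) : \sum_(x <- annulus 0 nZ | ~~ (nm x <= n1)%N) F x = \sum_(x <- annulus n1 nZ) F x.
  rewrite -big_filter; apply: perm_big; apply: uniq_perm; rewrite ?annulus_uniq //.
    by rewrite filter_uniq ?annulus_uniq.
  by move=> x; rewrite mem_filter !mem_annulus; move: (nm x) => i; lia.
rewrite (bigID (fun x => (nm x <= n1)%N)) /= low high; congr (_ + _).
rewrite (exchange_big_dep predT) //= (bigID (fun x => (nm x <= n1)%N)) /= low.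
rewrite [X in _ + X]big1_seq ?addr0; last first.
  move=> y /andP[hy _]; rewrite big1_seq // => x /andP[/andP[h _]].
  rewrite mem_annulus => /andP[hx _]; exfalso; move: h; rewrite leqNgt => /negP; apply.
  rewrite -(ltr_nat R); apply: (le_lt_trans hT).
  have -> : expR (2 * l) = expR l * expR l by rewrite -expRD; congr expR; ring.
  have b x' : (n1 < nm x')%N -> expR l < (nm x')%:R.
    by move=> h; apply: lt_le_trans (truncnS_gt _) _; rewrite ler_nat.
  by rewrite nmM natrM; apply: ltr_pM; rewrite ?expR_ge0 ?b // ltnNge.
apply: eq_bigr => x _; apply: eq_big => y; first by rewrite mulrC.
by move=> _; rewrite mulrC.
Qed.

(** The hyperbola method reduces the convolution to two sums in which one
    factor has norm at most [expR l]. *)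
Theorem conv_distributed (th : R) (k : nat) (cf cg : R) (f g : O -> R[i]) :
  0 < th -> th <= 1 -> 0 <= cf -> 0 <= cg ->
  well_distributed th f -> well_distributed th g ->
  (forall x, x != 0 -> cabs (f x) <= cf * (tau x)%:R ^+ k) ->
  (forall x, x != 0 -> cabs (g x) <= cg * (tau x)%:R ^+ k) ->
  forall A : nat, exists (b : nat) (cc l0 : R), [/\ 1 <= l0, 0 <= cc & forall l, l0 <= l ->
    exists w : O -> R, [/\ forall q, 0 <= w q,
      forall q T c, q != 0 -> (nm q)%:R <= expR (th * l) / l ^+ b ->
        T%:R <= expR (2 * l) -> cop q c ->
        cabs (pair_disc Q q (annulus 0 (cut (2 * l))) (annulus 0 (cut (2 * l))) f g T c) <= w q
    & small_total th l cc b A w]].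
Proof.
move=> th0 th1 cf0 cg0 fD gD f_le g_le A.
have [b1 [c1 [l1 [l11 c10 h1]]]] := conv_half A th0 th1 cf0 cg0 gD g_le.
have [b2 [c2 [l2 [l21 c20 h2]]]] := conv_half A th0 th1 cg0 cf0 fD f_le.
exists (b1 + b2)%N, (c1 + c2), (l1 + l2); split; rewrite ?addr_ge0 //; first lra.
move=> l hl; have lp : 1 <= l by lra.
have [|w1 [w10 w11 w12]] := h1 l _ 0%N f f_le; first lra.
have [|w2 [w20 w21 w22]] := h2 l _ (cut l) g g_le; first lra.
have mod1 (t : R) : t <= expR (th * l) / l ^+ (b1 + b2) -> t <= expR (th * l) / l ^+ b1.
  move=> h; apply: le_trans h _; apply: ler_wpM2l; first exact: expR_ge0.
  rewrite lef_pV2 ?posrE ?exprn_gt0 //; try lra.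
  by apply: ler_weXn2l => //; rewrite leq_addr.
have mod2 (t : R) : t <= expR (th * l) / l ^+ (b1 + b2) -> t <= expR (th * l) / l ^+ b2.
  move=> h; apply: le_trans h _; apply: ler_wpM2l; first exact: expR_ge0.
  rewrite lef_pV2 ?posrE ?exprn_gt0 //; try lra.
  by apply: ler_weXn2l => //; rewrite leq_addl.
exists (fun q => w1 q + w2 q); split.
- by move=> q; rewrite addr_ge0.
- move=> q T c q0 hq hT cq.
  have -> : pair_disc Q q (annulus 0 (cut (2 * l))) (annulus 0 (cut (2 * l))) f g T c =
     pair_disc Q q (annulus 0 (cut l)) (annulus 0 (cut (2 * l))) f g T c +
     pair_disc Q q (annulus 0 (cut l)) (annulus (cut l) (cut (2 * l))) g f T c.
    rewrite /pair_disc (hyperbola f g (fun t => dvq q (t - c)) lp hT).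
    by rewrite (hyperbola f g (cop q) lp hT); ring.
  apply: (le_trans (cabs_le_add _ _)); apply: lerD.
    by apply: w11 => //; apply: mod1.
  by apply: w21 => //; apply: mod2.
move=> n hn; rewrite big_split mulrDl /=; apply: lerD.
  by apply: w12; apply: mod1.
by apply: w22; apply: mod2.
Qed.

End Convolution.

(** * The ring of integers *)

Section Coordinates.
Variable K : fieldExtType rat.
Hypothesis dimK : \dim {:K} = 2%N.

Let ratK (x y : rat) : ratr (x * y) = ratr x * ratr y :> K.
Proof. by rewrite -!alg_num_field -scalerAl mul1r scalerA. Qed.
Let ratD (x y : rat) : ratr (x + y) = ratr x + ratr y :> K.
Proof. by rewrite -!alg_num_field scalerDl. Qed.
Let ratN (x : rat) : ratr (- x) = - ratr x :> K.
Proof. by rewrite -!alg_num_field scaleNr. Qed.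
Let rat1 : ratr 1 = 1 :> K.
Proof. by rewrite -alg_num_field scale1r. Qed.
Let rat0 : ratr 0 = 0 :> K.
Proof. by rewrite -alg_num_field scale0r. Qed.

(** Complete the square in the equation of a generator and clear the
    denominator. *)
Lemma quadratic_generator : exists (w : K) (D : int),
  [/\ w \notin 1%VS, w ^+ 2 = D%:~R &
      forall x, exists a b : rat, x = ratr a + ratr b * w].
Proof.
have inQ (a : rat) : (ratr a : K) \in 1%VS by rewrite -alg_num_field; apply/vlineP; exists a.
have [v hv] : exists v : K, v \notin 1%VS.
  apply: contrapT => h; suff : \dim {:K} = \dim (1%VS : {vspace K}) by rewrite dimv1 dimK.
  congr (\dim _); apply/eqP; rewrite eqEsubv subvf andbT.
  by apply/subvP => x _; apply: contrapT => hx; apply: h; exists x; apply/negP.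
have full : (1 + <[v]>)%VS = fullv.
  apply/eqP; rewrite eqEdim subvf /= dimK ltnNge; apply/negP => hd.
  have : (1%VS == (1 + <[v]>)%VS :> {vspace K}) by rewrite eqEdim addvSl /= dimv1.
  move/eqP => e; move: hv; rewrite e => /negP; apply.
  by rewrite memvE addvSr.
have gen x : exists a b : rat, x = ratr a + ratr b * v.
  have : x \in (1 + <[v]>)%VS by rewrite full memvf.
  case/memv_addP => u /vlineP[a ->] [t /vlineP[b ->] ->]; exists a, b.
  by rewrite -!alg_num_field mulr_algl.
have [p [q e]] := gen (v ^+ 2).
pose D0 : rat := 4 * p + q ^+ 2; pose d : rat := (denq D0)%:~R.
have d0 : d != 0 by rewrite intr_eq0 denq_neq0.
pose w : K := ratr d * (2 * v - ratr q).
have dD : d * D0 = (numq D0)%:~R by rewrite mulrC /d -numqE.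
have rn (n : nat) : ratr n%:R = n%:R :> K by rewrite ratr_nat.
have dv : ratr d != 0 :> K by rewrite -alg_num_field scaler_eq0 oner_eq0 orbF.
have v2 : v ^+ 2 = ratr p + ratr q * v by [].
have rV (c : rat) : c != 0 -> ratr c^-1 = (ratr c)^-1 :> K.
  move=> c0; have cc : ratr c != 0 :> K by rewrite -alg_num_field scaler_eq0 oner_eq0 orbF.
  by apply: (mulfI cc); rewrite -ratK !divff // rat1.
have two : (2 : K) != 0 by rewrite -(rn 2) -alg_num_field scaler_eq0 oner_eq0 orbF.
exists w, (denq D0 * numq D0); split.
- apply: contra hv => /vlineP[t]; rewrite alg_num_field => ht.
  have -> : v = ratr ((t / d + q) / 2).
    by rewrite ratK rV // ratD ratK rV // -ht (rn 2) /w; field; rewrite dv two.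
  exact: inQ.
- have -> : w ^+ 2 = ratr d ^+ 2 * (4 * ratr p + ratr q ^+ 2).
    have -> : w ^+ 2 = ratr d ^+ 2 * (4 * v ^+ 2 - 4 * ratr q * v + ratr q ^+ 2) by rewrite /w; ring.
    by congr (_ * _); rewrite v2; ring.
  have -> : 4 * ratr p + ratr q ^+ 2 = ratr D0 :> K.
    by rewrite /D0 ratD ratK (rn 4) expr2 -ratK -expr2.
  by rewrite expr2 -mulrA -!ratK dD /d -intrM ratr_int.
move=> x; have [a [b ->]] := gen x; exists (a + b * q / 2), (b / (2 * d)).
rewrite ratD !ratK (rV 2) // (rV (2 * d)) ?mulf_neq0 // !ratK (rn 2) /w.
by field; rewrite dv two.
Qed.

Variables (w : K) (D : int).
Hypotheses (wN : w \notin 1%VS) (w2 : w ^+ 2 = D%:~R).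
Hypothesis wE : forall x, exists a b : rat, x = ratr a + ratr b * w.

(** Otherwise [w] would be rational. *)
Lemma coord_uniq (a b c d : rat) :
  ratr a + ratr b * w = ratr c + ratr d * w :> K -> a = c /\ b = d.
Proof.
move=> h; have h' : ratr (b - d) * w = ratr (c - a) :> K.
  rewrite !ratD !ratN mulrDl mulNr; apply/eqP; rewrite subr_eq -addrA [- _ + _]addrC addrA.
  by rewrite -h addrAC subrr add0r.
have bd : b = d.
  apply/eqP; rewrite -subr_eq0; apply/negPn/negP => bd0; case/negP: wN.
  have -> : w = ratr ((b - d)^-1 * (c - a)).
    by rewrite ratK -h' mulrA -ratK mulVf // rat1 mul1r.
  by rewrite -alg_num_field; apply/vlineP; exists ((b - d)^-1 * (c - a)).
split=> //; move: h; rewrite bd => /addIr; rewrite -!alg_num_field => /eqP.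
by rewrite -subr_eq0 -scalerBl scaler_eq0 oner_eq0 orbF subr_eq0 => /eqP.
Qed.

(** The coordinates of [x] in the basis [1, w]. *)
Definition rpart x : rat := xget 0 [set a | exists b, x = ratr a + ratr b * w]%classic.
Definition ipart x : rat := xget 0 [set b | x = ratr (rpart x) + ratr b * w]%classic.

Lemma partE x : x = ratr (rpart x) + ratr (ipart x) * w.
Proof.
have [a [b e]] := wE x.
have h1 : (exists b, x = ratr (rpart x) + ratr b * w).
  by apply: (@xgetPex _ 0 [set a | exists b, x = ratr a + ratr b * w]%classic); exists a, b.
exact: (@xgetPex _ 0 [set b | x = ratr (rpart x) + ratr b * w]%classic).
Qed.

Lemma part_eq x a b : x = ratr a + ratr b * w -> rpart x = a /\ ipart x = b.
Proof. by rewrite {1}(partE x); apply: coord_uniq. Qed.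

Lemma partD x y : rpart (x + y) = rpart x + rpart y /\ ipart (x + y) = ipart x + ipart y.
Proof. by apply: part_eq; rewrite {1}(partE x) {1}(partE y) !ratD mulrDl addrACA. Qed.
Lemma partN x : rpart (- x) = - rpart x /\ ipart (- x) = - ipart x.
Proof. by apply: part_eq; rewrite {1}(partE x) !ratN mulNr opprD. Qed.
Lemma partM x y : rpart (x * y) = rpart x * rpart y + D%:~R * (ipart x * ipart y) /\
  ipart (x * y) = rpart x * ipart y + ipart x * rpart y.
Proof.
apply: part_eq; rewrite {1}(partE x) {1}(partE y) !ratD !ratK ratr_int -w2.
move: (ratr (rpart x) : K) (ratr (rpart y) : K) (ratr (ipart x) : K) (ratr (ipart y) : K) => p q r s.
ring.
Qed.
Lemma part_rat a : rpart (ratr a) = a /\ ipart (ratr a) = 0.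
Proof. by apply: part_eq; rewrite rat0 mul0r addr0. Qed.

(** A square root of [D] in a field of characteristic zero determines an
    embedding. *)
Lemma embedding (F : numFieldType) (s : F) : s ^+ 2 = D%:~R ->
  exists phi : {rmorphism K -> F}, forall x, phi x = ratr (rpart x) + ratr (ipart x) * s.
Proof.
move=> s2; pose h x : F := ratr (rpart x) + ratr (ipart x) * s.
have hB : zmod_morphism h.
  move=> x y; have [d1 d2] := partD x (- y); have [n1 n2] := partN y.
  by rewrite /h d1 d2 n1 n2 !rmorphB /=; ring.
have hM : monoid_morphism h.
  split=> [|x y]; rewrite /h.
    have e1 : 1 = ratr 1 + ratr 0 * w by rewrite rat1 rat0 mul0r addr0.
    by have [-> ->] := part_eq e1; rewrite rmorph1 rmorph0 mul0r addr0.
  have [-> ->] := partM x y; rewrite !rmorphD !rmorphM /= ratr_int -s2.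
  by ring.
pose hZ := GRing.isZmodMorphism.Build K F h hB.
pose hR := GRing.isMonoidMorphism.Build K F h hM.
pose phi : {rmorphism K -> F} := HB.pack h hZ hR.
by exists phi.
Qed.

(** Both embeddings into the algebraic numbers send an algebraic integer to
    an algebraic integer, hence so are their sum and difference. *)
Lemma integral_parts x : x \in @alg_int K -> [/\ exists m : int, 2 * rpart x = m%:~R,
  exists m : int, 2 * D%:~R * ipart x = m%:~R &
  ipart x = 0 -> exists m : int, rpart x = m%:~R].
Proof.
move=> /asboolP[p pm px]; pose s : algC := sqrtC D%:~R.
have s2 : s ^+ 2 = D%:~R by apply: sqrtCK.
have aint (phi : {rmorphism K -> algC}) : phi x \in Aint.
  have r : root (map_poly (intr : int -> algC) p) (phi x).
    have := rmorph_root phi px; rewrite -map_poly_comp; congr (root _ _).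
    by apply: eq_map_poly => i /=; rewrite rmorph_int.
  apply: (root_monic_Aint r); first by rewrite monicE lead_coef_map_inj ?(monicP pm) //; apply: intr_inj.
  by apply/polyOverP => i; rewrite coef_map_id0 //; apply: intr_int.
have ratint (a : rat) : (ratr a : algC) \in Aint -> exists m : int, a = m%:~R.
  move=> h; have /intrP[m e] := Cint_rat_Aint (Crat_rat a) h; exists m.
  by apply: (fmorph_inj (ratr : {rmorphism rat -> algC})); rewrite /= e ratr_int.
have [phi1 e1] := embedding s2.
have sN2 : (- s) ^+ 2 = D%:~R by rewrite sqrrN.
have [phi2 e2] := embedding sN2.
have sA : s \in Aint.
  have r : root ('X^2 - (D%:~R)%:P) s by rewrite rootE !hornerE s2 subrr.
  apply: (root_monic_Aint r); first by rewrite monicXnsubC.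
  have -> : 'X^2 - (D%:~R)%:P = map_poly (intr : int -> algC) ('X^2 - D%:P).
    by rewrite rmorphB /= map_polyXn map_polyC.
  by apply/polyOverP => i; rewrite coef_map_id0 //; apply: intr_int.
have h1 := aint phi1; have h2 := aint phi2; rewrite e1 in h1; rewrite e2 in h2.
split.
- apply: ratint; rewrite rmorphM /= ratr_nat.
  have -> : 2 * ratr (rpart x) = ratr (rpart x) + ratr (ipart x) * s +
     (ratr (rpart x) + ratr (ipart x) * - s) by ring.
  exact: rpredD.
- apply: ratint; rewrite !rmorphM /= ratr_nat ratr_int -s2.
  have -> : 2 * s ^+ 2 * ratr (ipart x) = (ratr (rpart x) + ratr (ipart x) * s -
     (ratr (rpart x) + ratr (ipart x) * - s)) * s by ring.
  by apply: rpredM => //; apply: rpredB.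
by move=> i0; apply: ratint; move: h1; rewrite i0 rmorph0 mul0r addr0.
Qed.

Lemma no_real_embedding (R : realType) : ({rmorphism K -> R} -> False) -> D < 0.
Proof.
move=> h; rewrite ltNge; apply/negP => D0.
have s2 : Num.sqrt (D%:~R : R) ^+ 2 = D%:~R by rewrite sqr_sqrtr // ler0z.
by have [phi _] := embedding s2; apply: h phi.
Qed.

Lemma complex_embedding (R : realType) : exists _ : {rmorphism K -> R[i]}, True.
Proof. by have [phi _] := embedding (sqrtCK (D%:~R : R[i])); exists phi. Qed.

(** An embedding sends [w] to a square root of the negative integer [D],
    which is purely imaginary. *)
Lemma cabs_embedding (R : realType) (phi : {rmorphism K -> R[i]}) x : D < 0 ->
  cabs (phi x) ^+ 2 = ratr (rpart x) ^+ 2 - D%:~R * ratr (ipart x) ^+ 2.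
Proof.
move=> D0; have := erefl (phi w ^+ 2); rewrite -{2}rmorphXn w2 rmorph_int.
have key (a b : rat) : phi (ratr a + ratr b * w) = ratr a + ratr b * phi w.
  by rewrite rmorphD (rmorphM phi (ratr b) w) /= !fmorph_rat.
have -> : phi x = ratr (rpart x) + ratr (ipart x) * phi w by rewrite -key -partE.
case: (phi w) => u v; rewrite expr2 => hw.
have rc (a : rat) : (ratr a : R[i]) = (ratr a : R)%:C by rewrite (fmorph_rat (real_complex R)).
have ic : (D%:~R : R[i]) = (D%:~R : R)%:C by rewrite (rmorph_int (real_complex R)).
move: hw; rewrite ic => -[h1 h2].
have DR : (D%:~R : R) < 0 by rewrite ltrz0.
have u0 : u = 0.
  have : u * v = 0 by move: h2; rewrite [v * u]mulrC; move: (u * v) => t; lra.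
  move/eqP; rewrite mulf_eq0 => /orP[/eqP //|/eqP v0]; exfalso.
  by move: h1; rewrite v0; have := sqr_ge0 u; rewrite expr2; lra.
rewrite !rc u0 /cabs /=; rewrite u0 in h1; have h3 : v * v = - D%:~R by lra.
rewrite sqr_sqrtr ?addr_ge0 ?sqr_ge0 //.
move: (ratr (rpart x) : R) (ratr (ipart x) : R) h3 => p q h3.
have -> : D%:~R = - (v * v) :> R by rewrite h3 opprK.
by ring.
Qed.

End Coordinates.

Section RingOfIntegers.
Variables (R : realType) (K : fieldExtType rat).
Hypothesis K_imag : imaginary_quadratic R K.
Hypothesis K_class1 : class_number K = 1%N.
Local Notation O := (ringOfIntegers K).

Let iv : {rmorphism O -> K} := \val.
Lemma int_valD (x y : O) : int_val (x + y) = int_val x + int_val y.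
Proof. exact: (rmorphD iv). Qed.
Lemma int_valN (x : O) : int_val (- x) = - int_val x.
Proof. exact: (rmorphN iv). Qed.
Lemma int_valM (x y : O) : int_val (x * y) = int_val x * int_val y.
Proof. exact: (rmorphM iv). Qed.
Lemma int_val_int (m : int) : int_val (m%:~R : O) = m%:~R.
Proof. exact: (rmorph_int iv). Qed.
Lemma int_val_neq0 (x : O) : (int_val x != 0) = (x != 0).
Proof. by have e : int_val (0 : O) = 0 := rmorph0 iv; rewrite -e (inj_eq val_inj). Qed.

(** The class of [I] is that of the unit ideal, so [a * I = b * O] for some
    [a] and [b]; then [b = a * c] with [c] in [I], and [c] generates [I]. *)
Lemma class_one_principal (I : set O) : nz_ideal I -> exists a, I = principal_ideal a.
Proof.
move=> nI; have mulI (c x y : O) : c != 0 -> c * x = c * y -> x = y.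
  move=> c0 /(congr1 (@int_val K)); rewrite !int_valM => e; apply: val_inj => /=.
  by apply: mulfI e; rewrite int_val_neq0.
pose J : set O := principal_ideal 1.
have J1 y : J y by exists y; rewrite ?mul1r.
have nJ : nz_ideal J.
  by split; [split=> // | exists 1 => //; rewrite oner_neq0].
have eqr (I' : set O) : nz_ideal I' -> ideal_class I' I'.
  by move=> h; split=> //; exists 1, 1; rewrite oner_neq0; split.
have eIJ : ideal_class I = ideal_class J.
  pose S : set (set (set O)) := [set ideal_class I | I in @nz_ideal O]%classic.
  have c1 : #|` fset_set S| = 1%N by exact: K_class1.
  have finS : finite_set S.
    by apply: contrapT => h; move: c1; rewrite /fset_set; case: pselect => // _; rewrite cardfs0.
  have /cardfs1P[c ec] : #|` fset_set S| == 1%N by rewrite c1.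
  have inS A : S A -> A = c.
    move=> h; have : A \in fset_set S by rewrite in_fset_set //; exact: mem_set.
    by rewrite ec => /fset1P.
  have SI : S (ideal_class I) by exists I.
  have SJ : S (ideal_class J) by exists J.
  exact: etrans (inS _ SI) (esym (inS _ SJ)).
have [_ [a [b [a0 b0 e]]]] : ideal_class I J by rewrite eIJ; apply: eqr.
have [c Ic ec] : [set a * x | x in I]%classic b.
  by rewrite e; exists 1; rewrite ?mulr1.
exists c; apply/seteqP; split=> [x Ix|_ [y _ <-]]; last first.
  by have [[_ _ h] _] := nI; rewrite mulrC; apply: h.
have [y _ ey] : [set b * y | y in J]%classic (a * x) by rewrite -e; exists x.
by exists y => //; apply: (mulI a) => //; rewrite mulrA ec ey.
Qed.

Let sq_lt (u d : rat) : d < 0 -> 2 ^+ 2 * u < 4 * (u - d).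
Proof. by move=> d0; rewrite expr2; lra. Qed.

(** The second coordinates of the integers of [K], scaled to be integers,
    form an ideal of [Z]; an integer [om] whose coordinate is the least
    positive one generates [O] together with [1]. *)
Lemma quadratic_order : exists Q : quadOrder O,
  (forall (phi : {rmorphism K -> R[i]}) (x : O), cabs (phi (int_val x)) ^+ 2 = (nm Q x)%:R) /\
  exists _ : {rmorphism K -> R[i]}, True.
Proof.
have [dimK noR] := K_imag.
have [w [D [wN w2 wE]]] := quadratic_generator dimK.
have D0 := no_real_embedding wN w2 wE noR.
pose rp (x : O) := rpart w (int_val x); pose ip (x : O) := ipart w (int_val x).
have pO (x : O) := integral_parts wN w2 wE (valP x : int_val x \in @alg_int K).
have DQ : (D%:~R : rat) != 0 by rewrite intr_eq0 lt_eqF.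
have ipD x y : ip (x + y) = ip x + ip y by rewrite /ip int_valD; have [] := partD wN wE (int_val x) (int_val y).
have ipN x : ip (- x) = - ip x by rewrite /ip int_valN; have [] := partN wN wE (int_val x).
have rpD x y : rp (x + y) = rp x + rp y by rewrite /rp int_valD; have [] := partD wN wE (int_val x) (int_val y).
have rpN x : rp (- x) = - rp x by rewrite /rp int_valN; have [] := partN wN wE (int_val x).
have xE (x : O) : int_val x = ratr (rp x) + ratr (ip x) * w by apply: partE.
have rpM x y : rp (x * y) = rp x * rp y + D%:~R * (ip x * ip y).
  by rewrite /rp int_valM; have [] := partM wN w2 wE (int_val x) (int_val y).
have ipM x y : ip (x * y) = rp x * ip y + ip x * rp y.
  by rewrite /ip int_valM; have [] := partM wN w2 wE (int_val x) (int_val y).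
have inj x y : rp x = rp y -> ip x = ip y -> x = y.
  by move=> h1 h2; apply: val_inj; rewrite /= !xE h1 h2.
have zp (m : int) : rp m%:~R = m%:~R /\ ip m%:~R = 0.
  by rewrite /rp /ip int_val_int -ratr_int; apply: part_rat.
pose be (x : O) : rat := 2 * D%:~R * ip x.
have beD x y : be (x + y) = be x + be y by rewrite /be ipD mulrDr.
have beN x : be (- x) = - be x by rewrite /be ipN mulrN.
have beZ (m : int) x : be (m%:~R * x) = m%:~R * be x.
  by have [h1 h2] := zp m; rewrite /be ipM h1 h2 mul0r addr0; ring.
have beint x : exists m : int, be x = m%:~R by have [_ h _] := pO x.
have exw : exists n : nat, (0 < n)%N && `[< exists x, be x = n%:R >].
  have wO : w \in @alg_int K.
    apply/asboolP; exists ('X^2 - D%:P); first by rewrite monicXnsubC.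
    by rewrite rmorphB /= map_polyXn map_polyC rootE !hornerE w2 subrr.
  pose w' : O := RingOfIntegers wO.
  have ew : w = ratr 0 + ratr 1 * w.
    by rewrite -!alg_num_field scale0r scale1r add0r mul1r.
  have ip1 : ip w' = 1 by have [_] := part_eq wN wE ew.
  exists (2 * absz D)%N; apply/andP; split.
    by rewrite muln_gt0 absz_gt0 lt_eqF.
  apply/asboolP; exists (- w'); rewrite beN /be ip1 mulr1 natrM -mulrN; congr (_ * _).
  have eD : (absz D)%:R = (- D)%:~R :> rat by rewrite -(ltz0_abs D0).
  by rewrite eD mulrNz.
have [b0 /andP[b00 /asboolP[om eom]] minb0] := ex_minnP exw.
have minb n : (0 < n)%N -> (exists x, be x = n%:R) -> (b0 <= n)%N.
  by move=> h1 h2; apply: minb0; rewrite h1; apply/asboolP.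
have b0R : (b0%:R : rat) != 0 by rewrite pnatr_eq0 -lt0n.
have dec x : exists m n : int, x = m%:~R + n%:~R * om.
  have [t et] := beint x; pose n := (t %/ b0)%Z; pose y := x - n%:~R * om.
  have ey : be y = (t %% b0)%Z%:~R.
    rewrite /y beD beN beZ et eom {1}(divz_eq t b0) -/n intrD intrM.
    by rewrite -[b0%:R]/((b0 : int)%:~R); ring.
  have y0 : be y = 0.
    have b0z : (b0 : int) != 0 by rewrite eqz_nat -lt0n.
    have := modz_ge0 t b0z; case e : (t %% b0)%Z => [r|//] _.
    case: r e => [|r] e; first by rewrite ey e.
    have : (b0 <= r.+1)%N by apply: minb => //; exists y; rewrite ey e.
    by rewrite leqNgt -ltz_nat -e ltz_mod.
  have iy0 : ip y = 0.
    by move/eqP: y0; rewrite /be mulf_eq0 mulf_eq0 (negbTE DQ) /= => /eqP.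
  have [_ _ /(_ iy0) [m em]] := pO y; have [z1 z2] := zp m.
  exists m, n; rewrite -[x](subrK (n%:~R * om)) -/y; congr (_ + _).
  by apply: inj; rewrite ?z1 ?z2.
pose c1 x := xget 0 [set m : int | exists n : int, x = m%:~R + n%:~R * om]%classic.
pose c2 x := xget 0 [set n : int | x = (c1 x)%:~R + n%:~R * om]%classic.
have cE x : x = (c1 x)%:~R + (c2 x)%:~R * om.
  have h1 : exists n : int, x = (c1 x)%:~R + n%:~R * om.
    have [m [n e]] := dec x.
    by apply: (@xgetPex _ 0 [set m : int | exists n : int, x = m%:~R + n%:~R * om]%classic); exists m, n.
  exact: (@xgetPex _ 0 [set n : int | x = (c1 x)%:~R + n%:~R * om]%classic).
have rpc (m n : int) : rp (m%:~R + n%:~R * om) = m%:~R + n%:~R * rp om /\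
    ip (m%:~R + n%:~R * om) = n%:~R * ip om.
  have [z1 z2] := zp m; have [z3 z4] := zp n.
  by rewrite rpD ipD rpM ipM z1 z2 z3 z4; split; ring.
have iom : ip om != 0.
  by apply: contra b0R => /eqP h; rewrite -eom /be h mulr0.
have rp0 : rp 0 = 0 /\ ip 0 = 0 := zp 0.
have free (m n : int) : m%:~R + n%:~R * om = 0 -> m = 0 /\ n = 0.
  have [r1 r2] := rpc m n; have [r3 r4] := rp0 => e; move: r1 r2; rewrite e r3 r4 => r1 r2.
  have n0 : n = 0.
    by move/esym/eqP: r2; rewrite mulf_eq0 (negbTE iom) orbF intr_eq0 => /eqP.
  by split=> //; move/esym/eqP: r1; rewrite n0 mul0r addr0 intr_eq0 => /eqP.
pose t := c2 (om ^+ 2); pose n := - c1 (om ^+ 2).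
have om2 : om ^+ 2 = t%:~R * om - n%:~R.
  by rewrite {1}(cE (om ^+ 2)) /n mulrNz opprK addrC.
have [tE nE] : (t%:~R : rat) = 2 * rp om /\ (n%:~R : rat) = rp om ^+ 2 - D%:~R * ip om ^+ 2.
  have [r1 r2] := rpc (c1 (om ^+ 2)) t; rewrite -cE in r1 r2.
  have r3 : rp (om ^+ 2) = rp om * rp om + D%:~R * (ip om * ip om) by rewrite expr2 rpM.
  have r4 : ip (om ^+ 2) = 2 * rp om * ip om by rewrite expr2 ipM; ring.
  have tE : (t%:~R : rat) = 2 * rp om by apply: (mulIf iom); rewrite -r2 r4.
  split=> //; rewrite /n mulrNz.
  have -> : (c1 (om ^+ 2))%:~R = rp (om ^+ 2) - t%:~R * rp om by rewrite r1 addrK.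
  by rewrite r3 tE; ring.
have dn : t ^+ 2 < 4 * n.
  rewrite -(ltr_int rat) rmorphXn intrM /= tE nE exprMn.
  have i2 : 0 < ip om ^+ 2 by rewrite exprn_even_gt0.
  have DQ0 : (D%:~R : rat) < 0 by rewrite ltrz0.
  have : D%:~R * ip om ^+ 2 < 0 by rewrite nmulr_rlt0.
  exact: sq_lt.
pose Q := QuadOrder dn om2 cE free class_one_principal.
exists Q; split; last exact: (complex_embedding wN w2 wE R).
move=> phi x; rewrite (cabs_embedding w2 wE) //.
have nmQ : ((nm Q x)%:R : rat) = rp x ^+ 2 - D%:~R * ip x ^+ 2.
  have -> : ((nm Q x)%:R : rat) = (nmz Q x)%:~R by rewrite -nmE.
  have [r1 r2] := rpc (c1 x) (c2 x); rewrite -cE in r1 r2; rewrite r1 r2.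
  have -> : nmz Q x = c1 x ^+ 2 + t * (c1 x * c2 x) + n * c2 x ^+ 2 by [].
  rewrite !expr2 !intrD !intrM tE nE /=.
  by move: (c1 x)%:~R (c2 x)%:~R (rp om) (ip om) D%:~R => u v p q d; ring.
have -> : (nm Q x)%:R = ratr ((nm Q x)%:R : rat) :> R by rewrite ratr_nat.
by rewrite nmQ rmorphB !rmorphXn rmorphM /= rmorphXn ratr_int.
Qed.
End RingOfIntegers.

(** * Ideals and elements *)

Lemma card_seq_set (T : choiceType) (s : seq T) : uniq s ->
  #|` fset_set [set` s]%classic| = size s.
Proof.
move=> us; have -> : fset_set [set` s]%classic = [fset x | x in s]%fset.
  apply/fsetP => x; rewrite in_fset_set; last exact: finite_seq.
  by rewrite !inE mem_setE.
by rewrite card_fseq undup_id.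
Qed.

Lemma powR_expR (R : realType) (t u : R) : expR t `^ u = expR (u * t).
Proof. by rewrite -expRM mulrC. Qed.

Section Dictionary.
Variables (R : realType) (K : fieldExtType rat).
Local Notation O := (ringOfIntegers K).
Variable Q : quadOrder O.
Hypothesis nm_abs : forall (phi : {rmorphism K -> R[i]}) (x : O),
  cabs (phi (int_val x)) ^+ 2 = (nm Q x)%:R.
Hypothesis has_embedding : exists _ : {rmorphism K -> R[i]}, True.
Implicit Types (x y q a b : O) (I : set O).
Local Notation nm := (nm Q).
Local Notation nball := (nball Q).
Local Notation disk M := (annulus Q 0 (Num.truncn (M ^+ 2))).

(** All embeddings give the same absolute value, whose square is the norm. *)
Lemma A0E (M : R) : 0 <= M -> A0 K M = [set` disk M]%classic.
Proof.
move=> M0; apply/seteqP; split=> x /=; rewrite mem_annulus.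
  have [phi _] := has_embedding => /(_ phi)/andP[h1 h2]; apply/andP; split.
    rewrite -(ltr_nat R) -(nm_abs phi); apply: (@lt_le_trans _ _ 1) => //.
    by rewrite exprn_ege1.
  rewrite truncn_ge_nat ?sqr_ge0 // -(nm_abs phi).
  by rewrite lerXn2r ?nnegrE ?cabs_ge0.
move=> /andP[h1 h2] phi; have c0 := cabs_ge0 (phi (int_val x)).
rewrite truncn_ge_nat ?sqr_ge0 // in h2.
apply/andP; split; rewrite -(@ler_pXn2r _ 2) ?nnegrE //.
  by rewrite expr1n nm_abs ler1n.
by rewrite nm_abs.
Qed.

Lemma cardA0E (M : R) : 0 <= M -> cardA0 K M = (size (disk M))%:R.
Proof. by move=> M0; rewrite /cardA0 A0E // card_seq_set ?annulus_uniq. Qed.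

Lemma sum_disk (M : R) (P : set O) (p : pred O) (F : O -> R[i]) : 0 <= M ->
  (forall a, P a <-> p a) ->
  \sum_(a \in A0 K M `&` P) F a = \sum_(a <- disk M | p a) F a.
Proof.
move=> M0 hP; rewrite -[RHS]big_filter; set r := [seq a <- disk M | p a].
have -> : (A0 K M `&` P)%classic = [set` r]%classic.
  rewrite A0E //; apply/seteqP; split=> x /=.
    by case=> h1 /hP h2; rewrite mem_filter h2.
  by rewrite mem_filter => /andP[/hP h ?].
by rewrite -fsbig_seq // filter_uniq ?annulus_uniq.
Qed.

Lemma mem_principal q x : principal_ideal q x <-> dvq q x.
Proof.
split=> [[y _ <-]|/dvqP[y ->]]; first exact: dvq_mulr.
by exists y.
Qed.

(** The elements of [Rep Q q] represent each residue class once. *)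
Lemma card_residues q (P : set O) (p : pred O) : q != 0 ->
  (forall a, P a <-> p a) -> (forall a b, dvq q (a - b) -> p a = p b) ->
  #|` fset_set [set residue (principal_ideal q) a | a in P]%classic| =
  size [seq x <- Rep Q q | p x].
Proof.
move=> q0 hP hp; pose r := residue (principal_ideal q).
have rE a b : r a = r b <-> dvq q (a - b).
  split=> [h|h].
    have : r a a by rewrite /r /residue /= subrr; apply/mem_principal; apply: dvq0.
    by rewrite h => /mem_principal.
  apply/seteqP; split=> z /mem_principal hz; apply/mem_principal.
    by apply: dvq_subtrans hz h.
  by apply: dvq_subtrans hz _; rewrite dvqC.
have -> : [set r a | a in P]%classic = [set` [seq r x | x <- [seq x <- Rep Q q | p x]]]%classic.
  apply/seteqP; split=> I /=.
    move=> [a /hP pa <-]; apply/mapP; exists (rep q a); last by apply/rE; rewrite dvqC rep_mod.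
    by rewrite mem_filter mem_Rep // andbT (hp _ a) // rep_mod.
  by move=> /mapP[x]; rewrite mem_filter => /andP[/hP px _] ->; exists x.
rewrite card_seq_set ?size_map // map_inj_in_uniq ?filter_uniq ?Rep_uniq //.
move=> x y; rewrite !mem_filter => /andP[_ hx] /andP[_ hy] /rE; exact: (Rep_inj hx hy).
Qed.

Lemma norm_principal q : q != 0 -> ideal_norm (principal_ideal q) = size (Rep Q q).
Proof.
move=> q0; rewrite /ideal_norm (card_residues (p := predT) q0) //.
by rewrite filter_predT.
Qed.

Lemma totient_principal q : q != 0 -> ideal_totient (principal_ideal q) = size (unitReps Q q).
Proof.
move=> q0; rewrite /ideal_totient (card_residues (p := cop q) q0) //.
  by move=> a; apply: coprime_toE.
by move=> a b; apply: cop_congr.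
Qed.

Lemma discrepancyE (M : R) q c (f : O -> R[i]) : 0 <= M -> q != 0 ->
  discrepancy M (principal_ideal q) c f = @class_disc R O Q (disk M) f q c.
Proof.
move=> M0 q0; rewrite /discrepancy /class_disc totient_principal //.
rewrite (sum_disk (p := fun a => dvq q (a - c))) //; last by move=> a; apply: mem_principal.
by rewrite (sum_disk (p := cop q)) //; move=> a; apply: coprime_toE.
Qed.

(** One generator for each principal ideal. *)
Definition generator I : O := xget 0 [set a | I = principal_ideal a]%classic.
(** The elements chosen as generators; they index the nonzero ideals
    bijectively. *)
Definition canonical x : bool := x == generator (principal_ideal x).

Lemma generatorE x : principal_ideal (generator (principal_ideal x)) = principal_ideal x.
Proof.
by rewrite -(@xgetPex _ 0 [set a | principal_ideal x = principal_ideal a]%classic) //; exists x.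
Qed.

Lemma generator_canonical x : canonical (generator (principal_ideal x)).
Proof. by rewrite /canonical generatorE. Qed.

Lemma canonical_inj x y : canonical x -> canonical y ->
  principal_ideal x = principal_ideal y -> x = y.
Proof. by move=> /eqP {2}-> /eqP {2}-> ->. Qed.

Lemma principal_nz q : q != 0 -> nz_ideal (principal_ideal q).
Proof.
move=> q0; split; last by exists q => //; exists 1; rewrite ?mulr1.
split.
- by exists 0; rewrite ?mulr0.
- by move=> x y /mem_principal hx /mem_principal hy; apply/mem_principal; apply: dvqD.
- by move=> x y /mem_principal hy; apply/mem_principal; apply: dvq_mulR.
Qed.

Lemma nz_ideal_generator I : nz_ideal I ->
  exists q, [/\ q != 0, canonical q & I = principal_ideal q].
Proof.
move=> nI; have [a eI] := quad_pid Q nI.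
exists (generator I); rewrite eI generator_canonical generatorE; split=> //.
apply/eqP => g0; have [_ [x]] := nI; rewrite eI -generatorE g0 => /mem_principal/dvqP[y ->].
by rewrite mul0r eqxx.
Qed.

(** The ball is large enough to contain every element with at most [t]
    residues, by [size_Rep_ge]. *)
Definition gens (t : R) : seq O :=
  [seq q <- nball (Num.truncn ((8 * nmK Q)%N%:R * t)) |
     [&& q != 0, canonical q & (size (Rep Q q))%:R <= t]].

Lemma mem_gens t q : 0 <= t ->
  (q \in gens t) = [&& q != 0, canonical q & (size (Rep Q q))%:R <= t].
Proof.
move=> t0; rewrite mem_filter andb_idr // => /and3P[q0 _ h].
rewrite mem_nball truncn_ge_nat ?mulr_ge0 //.
apply: (@le_trans _ _ ((8 * nmK Q)%N%:R * (size (Rep Q q))%:R)); last exact: ler_wpM2l.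
by rewrite -natrM ler_nat size_Rep_ge.
Qed.

Lemma esum_gens (t : R) (E : set O -> \bar R) : 0 <= t -> (forall q, 0 <= E (principal_ideal q))%E ->
  (\esum_(I in [set I | nz_ideal I /\ ((ideal_norm I)%:R <= t)%R]%classic) E I =
   \sum_(q <- gens t) E (principal_ideal q))%E.
Proof.
move=> t0 E0.
have -> : [set I | nz_ideal I /\ ((ideal_norm I)%:R <= t)%R]%classic =
    [set` map (@principal_ideal O) (gens t)]%classic.
  apply/seteqP; split=> I /=.
    case=> /nz_ideal_generator[q [q0 cq ->]]; rewrite norm_principal // => h.
    by apply: map_f; rewrite mem_gens // q0 cq.
  move=> /mapP[q]; rewrite mem_gens // => /and3P[q0 _ h] ->.
  by split; [apply: principal_nz | rewrite norm_principal].
rewrite esum_fset; last by move=> I; rewrite inE => /mapP[q _ ->].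
  2: exact: finite_seq.
rewrite -fsbig_seq ?big_map // map_inj_in_uniq ?filter_uniq ?nball_uniq //.
by move=> x y; rewrite !mem_gens // => /and3P[_ cx _] /and3P[_ cy _]; apply: canonical_inj.
Qed.

Definition cV : R := (4 * nmK Q + ballC Q)%N%:R.

Lemma ballC_gt0 : (0 < ballC Q)%N.
Proof.
have := size_nball Q (ltn0Sn 0); rewrite muln1; apply: leq_trans.
by have : (1 : O) \in nball 1 by [rewrite mem_nball nm1]; case: (nball 1).
Qed.

Lemma cV1 : 1 <= cV.
Proof. by rewrite ler1n addn_gt0 ballC_gt0 orbT. Qed.

(** The number of integers of absolute value at most [N] is comparable to
    the square of [N]. *)
Lemma cardA0_bounds (l : R) : 1 / 2 <= l ->
  [/\ 1 <= cardA0 K (expR l), cardA0 K (expR l) <= cV * expR (2 * l) &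
      expR (2 * l) <= cV * cardA0 K (expR l)].
Proof.
move=> hl; have e2 : expR l ^+ 2 = expR (2 * l) by rewrite expRM_natl.
rewrite cardA0E ?expR_ge0 // e2; set n := Num.truncn _.
have Z1 : 2 <= expR (2 * l) by apply: le_trans (expR_ge1Dx _); lra.
have n1 : (0 < n)%N by rewrite truncn_gt0; lra.
have nl : n%:R <= expR (2 * l) by rewrite truncn_le expR_ge0.
have ln : expR (2 * l) < n%:R + 1 by rewrite natr1 truncnS_gt.
have n1R : 1 <= n%:R :> R by rewrite ler1n.
have s1 : (0 < size (annulus Q 0 n))%N.
  have : (1 : O) \in annulus Q 0 n by rewrite mem_annulus nm1.
  by case: (annulus Q 0 n).
have s2 : (size (nball n) <= (size (annulus Q 0 n)).+1)%N.
  apply: (@leq_trans (size ((0 : O) :: annulus Q 0 n))) => //.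
  apply: uniq_leq_size (nball_uniq Q n) _ => x; rewrite mem_nball inE mem_annulus => ->.
  by rewrite andbT nm_gt0 orbN.
have s3 : (size (annulus Q 0 n) <= size (nball n))%N by rewrite size_filter count_size.
split; first by rewrite ler1n.
  apply: (@le_trans _ _ ((ballC Q)%:R * n%:R)).
    by rewrite -natrM ler_nat (leq_trans s3) // size_nball.
  by apply: ler_pM => //; rewrite ler_nat leq_addl.
apply: (@le_trans _ _ (2 * n%:R)); first lra.
rewrite -!natrM ler_nat; apply: (@leq_trans (2 * (nmK Q * size (nball n)))).
  by rewrite leq_mul2l size_nball_ge.
rewrite mulnDl -mulnA; apply: (@leq_trans (4 * (nmK Q * size (annulus Q 0 n)))); last exact: leq_addr.
rewrite !(mulnCA _ (nmK Q)) leq_mul2l; apply/orP; right.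
by move: s1 s2; move: (size _) (size _) => i j; clear; lia.
Qed.

(** The quantity summed in the definition of the level of distribution. *)
Definition sup_disc (N : R) (f : O -> R[i]) I : \bar R :=
  ereal_sup [set ereal_sup
     [set (cabs (discrepancy M I gamma f))%:E | gamma in coprime_to I]
   | M in [set M : R | (1 <= M <= N)%R]]%classic.

(** The ball of norm [T] is the disk of radius the square root of [T]. *)
Lemma sup_disc_ge N f q (T : nat) c : q != 0 -> (0 < T)%N -> T%:R <= N ^+ 2 -> 0 <= N ->
  cop q c -> ((cabs (@class_disc R O Q (annulus Q 0 T) f q c))%:E <= sup_disc N f (principal_ideal q))%E.
Proof.
move=> q0 T0 TN N0 cc; pose M : R := Num.sqrt T%:R.
have M2 : M ^+ 2 = T%:R by rewrite sqr_sqrtr.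
have MT : Num.truncn (M ^+ 2) = T by rewrite M2; apply: truncn_def; rewrite lexx ltr_nat ltnSn.
have M0 : 0 <= M by apply: sqrtr_ge0.
apply: le_trans (ereal_sup_ubound _); last first.
  exists M => //=; apply/andP; split.
    by rewrite -(@ler_pXn2r _ 2) ?nnegrE // expr1n M2 ler1n.
  by rewrite -(@ler_pXn2r _ 2) ?nnegrE // M2.
apply: ereal_sup_ubound; exists c; first exact/coprime_toE.
by rewrite discrepancyE // MT.
Qed.

Lemma sup_disc_le N f q (w : R) : q != 0 -> 0 <= N ->
  (forall (T : nat) c, T%:R <= N ^+ 2 -> cop q c ->
     cabs (@class_disc R O Q (annulus Q 0 T) f q c) <= w) ->
  (sup_disc N f (principal_ideal q) <= w%:E)%E.
Proof.
move=> q0 N0 h; apply: ge_ereal_sup => _ [M /andP[M1 MN] <-].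
apply: ge_ereal_sup => _ [c /coprime_toE cc <-]; rewrite lee_fin.
have M0 : 0 <= M by apply: le_trans M1.
rewrite discrepancyE //; apply: h => //.
apply: (@le_trans _ _ (M ^+ 2)); first by rewrite truncn_le sqr_ge0.
by rewrite lerXn2r ?nnegrE.
Qed.

Lemma sup_disc_ge0 N f q : 1 <= N -> (0 <= sup_disc N f (principal_ideal q))%E.
Proof.
move=> N1; apply: (@le_trans _ _ (cabs (discrepancy 1 (principal_ideal q) 1 f))%:E).
  by rewrite lee_fin cabs_ge0.
apply: le_trans (ereal_sup_ubound _); last by exists 1 => //=; rewrite lexx.
by apply: ereal_sup_ubound; exists 1 => //; apply/coprime_toE; apply: cop1.
Qed.

Lemma ldisc_trivial S (f : O -> R[i]) q c :
  cabs (@class_disc R O Q S f q c) <= 2 * \sum_(y <- S) cabs (f y).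
Proof.
have h (p : pred O) : cabs (\sum_(y <- S | p y) f y) <= \sum_(y <- S) cabs (f y).
  apply: (le_trans (cabs_sum _ _ _)); rewrite [leRHS](bigID p) /= lerDl.
  by apply: sumr_ge0 => y _; apply: cabs_ge0.
rewrite /class_disc mulr_natl mulr2n; apply: (le_trans (cabs_le_sub _ _)); apply: lerD => //.
rewrite cabsM cabsV cabs_nat; apply: le_trans (h (cop q)); apply: ler_piMl; first exact: cabs_ge0.
case: (size _) => [|n]; first by rewrite invr0.
by rewrite invf_le1 ?ltr0n // ler1n.
Qed.

(** A sum of nonnegative extended reals with a finite bound has finite terms. *)
Lemma fine_sum (s : seq O) (E : O -> \bar R) (B : R) : uniq s ->
  (forall q, 0 <= E q)%E -> (\sum_(q <- s) E q <= B%:E)%E ->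
  (forall q, q \in s -> E q \is a fin_num) /\ \sum_(q <- s) fine (E q) <= B.
Proof.
move=> us E0 h; have fin q : q \in s -> E q \is a fin_num.
  move=> qs; rewrite ge0_fin_numE //; apply: (@le_lt_trans _ _ B%:E); last exact: ltry.
  by apply: le_trans h; rewrite (bigD1_seq q) //=; apply: leeDl; apply: sume_ge0.
split=> //; rewrite -lee_fin -sumEFin; apply: le_trans h; rewrite big_seq [leRHS]big_seq.
by apply: lee_sum => q qs; rewrite fineK ?fin.
Qed.

Lemma powR_shift (l B : R) : 1 <= l -> l `^ B <= l ^+ (Num.truncn `|B|).+1.
Proof.
move=> l1; rewrite -powR_mulrn; last by apply: le_trans l1.
by apply: ler_powR => //; apply: (le_trans (ler_norm B)); apply: ltW; apply: truncnS_gt.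
Qed.

(** The norm of an ideal is comparable to [nm], and the level in terms of the
    number of integers is comparable to a power of [expR l]; the constants
    are absorbed by one more power of [l]. *)
Lemma level_well_distributed (th : R) (f : O -> R[i]) : 0 < th -> th <= 1 ->
  level_of_distribution th f -> @well_distributed R O Q canonical (2 * th) f.
Proof.
move=> th0 th1 lev A; have A1 : 0 < A.+1%:R :> R by rewrite ltr0n.
have [B [c hc]] := lev _ A1.
pose b1 := (Num.truncn `|B|).+1.
have cV0 : 0 <= cV by apply: le_trans cV1.
exists b1.+1, (`|c| * cV), (1 + (repC Q)%:R * cV); split.
- by rewrite lerDl mulr_ge0.
- by rewrite mulr_ge0.
move=> l hl; have l1 : 1 <= l by apply: le_trans hl; rewrite lerDl mulr_ge0.
have lp : 0 < l by apply: lt_le_trans l1.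
have hl2 : 1 / 2 <= l by lra.
have [V1 V2 V3] := cardA0_bounds hl2; set V := cardA0 K (expR l) in V1 V2 V3.
have V0 : 0 <= V by apply: le_trans V1.
have N2 : 2 <= expR l by apply: le_trans (expR_ge1Dx _); lra.
have N1 : 1 <= expR l by lra.
have := hc (expR l) N2; rewrite /= expRK -/V; set t := V `^ th / l `^ B => hsum.
have t0 : 0 <= t by rewrite divr_ge0 ?powR_ge0.
have E0 q := sup_disc_ge0 f q N1.
rewrite (esum_gens t0 E0) in hsum.
set bnd := c * _ in hsum.
have [fin hsum'] := fine_sum (filter_uniq _ (nball_uniq Q _)) E0 hsum.
have bndle : bnd <= `|c| * cV * (expR (2 * l) / l ^+ A).
  have -> : bnd = c * (V / l ^+ A.+1) by rewrite /bnd powRN powR_mulrn // ltW.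
  apply: (@le_trans _ _ (`|c| * (V / l ^+ A.+1))).
    by apply: ler_wpM2r; rewrite ?ler_norm // divr_ge0 // exprn_ge0 // ltW.
  rewrite -!mulrA; apply: ler_wpM2l => //; rewrite mulrA; apply: ler_pM => //.
    by rewrite invr_ge0 exprn_ge0 // ltW.
  by rewrite lef_pV2 ?posrE ?exprn_gt0 //; apply: ler_weXn2l.
have size_t q : q != 0 -> (nm q)%:R <= expR (2 * th * l) / l ^+ b1.+1 -> (size (Rep Q q))%:R <= t.
  move=> q0 hq; apply: (@le_trans _ _ ((repC Q)%:R * (nm q)%:R)); first by rewrite -natrM ler_nat size_Rep.
  rewrite /t ler_pdivlMr ?powR_gt0 //.
  have Zth : expR (2 * th * l) <= cV * V `^ th.
    have -> : expR (2 * th * l) = expR (2 * l) `^ th by rewrite powR_expR; congr expR; ring.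
    apply: (@le_trans _ _ ((cV * V) `^ th)).
      by apply: ge0_ler_powR; rewrite ?nnegrE ?expR_ge0 ?mulr_ge0 // ltW.
    rewrite powRM //; apply: ler_wpM2r; first exact: powR_ge0.
    by rewrite -[leRHS]powRr1 //; apply: ler_powR => //; apply: cV1.
  apply: (@le_trans _ _ ((repC Q)%:R * (cV * V `^ th / l ^+ b1.+1) * l ^+ b1)).
    apply: ler_pM; rewrite ?mulr_ge0 ?powR_ge0 //.
      apply: ler_wpM2l => //; apply: (le_trans hq); apply: ler_wpM2r => //.
      by rewrite invr_ge0 exprn_ge0 // ltW.
    exact: powR_shift.
  have -> : (repC Q)%:R * (cV * V `^ th / l ^+ b1.+1) * l ^+ b1 = V `^ th * ((repC Q)%:R * cV / l).
    rewrite exprS; have ln0 : l != 0 by rewrite gt_eqF.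
    by field; rewrite ?ln0 ?expf_neq0.
  apply: ler_piMr; first exact: powR_ge0.
  by rewrite ler_pdivrMr // mul1r; apply: le_trans hl; rewrite lerDr.
pose w q : R := fine (sup_disc (expR l) f (principal_ideal q)).
have gw q : q != 0 -> (nm q)%:R <= expR (2 * th * l) / l ^+ b1.+1 ->
    exists2 q', q' \in gens t & principal_ideal q' = principal_ideal q.
  move=> q0 hq; exists (generator (principal_ideal q)); last exact: generatorE.
  have [q' [q'0 cq' e]] := nz_ideal_generator (principal_nz q0).
  have -> : generator (principal_ideal q) = q' by rewrite e; apply/esym/eqP.
  by rewrite mem_gens // q'0 cq' -norm_principal // -e norm_principal // size_t.
have w0 q : 0 <= w q by apply: fine_ge0; apply: E0.
exists w; split=> //.
- move=> q T d q0 hq hT cd.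
  have [->|T0] := posnP T.
    have -> : annulus Q 0 0 = [::].
      case e : (annulus Q 0 0) => [//|y s].
      by have : y \in annulus Q 0 0 by [rewrite e mem_head]; rewrite mem_annulus; case: (nm y).
    by rewrite /class_disc !big_nil mulr0 subr0 cabs0.
  have [q' q'g e] := gw q q0 hq; rewrite -lee_fin /w -e fineK ?fin // e.
  by apply: sup_disc_ge => //; rewrite -?expRM_natl // expR_ge0.
- move=> q q0 hq; have [q' q'g e] := gw q q0 hq; apply: le_trans bndle.
  apply: le_trans hsum'; rewrite (bigD1_seq q') ?filter_uniq ?nball_uniq //= /w -e lerDl.
  by apply: sumr_ge0 => y _; apply: w0.
move=> n hn; apply: le_trans bndle; apply: le_trans hsum'; rewrite -big_filter.
apply: ler_sum_sub; rewrite ?filter_uniq ?nball_uniq //.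
move=> q; rewrite mem_gens // mem_filter mem_nball => /andP[/andP[q0 cq] hq].
by rewrite q0 cq size_t //; apply: le_trans hn; rewrite ler_nat.
Qed.

(** The converse passage; for bounded [N] every quantity is bounded. *)
Lemma level_of_bounds (th : R) (h : O -> R[i]) : 0 < th -> th <= 1 ->
  (forall A : nat, exists (b : nat) (cc l0 : R), [/\ 1 <= l0, 0 <= cc & forall l, l0 <= l ->
    exists w : O -> R, [/\ forall q, 0 <= w q,
      forall q T c, q != 0 -> (nm q)%:R <= expR (2 * th * l) / l ^+ b ->
        T%:R <= expR (2 * l) -> cop q c ->
        cabs (@class_disc R O Q (annulus Q 0 T) h q c) <= w q
    & @small_total R O Q canonical (2 * th) l cc b A w]]) ->
  level_of_distribution th h.
Proof.
move=> th0 th1 hyp A A0; pose A1 := (Num.truncn `|A|).+1.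
have [b [cc [l0 [l01 cc0 hl0]]]] := hyp A1.
have cV0 : 0 <= cV by apply: le_trans cV1.
pose kk : R := (8 * nmK Q)%N%:R; have kk0 : 0 <= kk by rewrite ler0n.
pose l1 := l0 + kk * cV; have l1p : 0 < l1.
  by apply: (@lt_le_trans _ _ l0); [lra | rewrite lerDl mulr_ge0].
pose t1 := (cV * expR (2 * l1)) `^ th * 2 ^+ b.+1.
pose n2 := Num.truncn (kk * t1).
pose Hc := 2 * \sum_(x <- annulus Q 0 (Num.truncn (expR (2 * l1)))) cabs (h x).
have Hc0 : 0 <= Hc by rewrite mulr_ge0 // sumr_ge0 // => x _; apply: cabs_ge0.
pose c2 := (size (nball n2))%:R * Hc * l1 `^ A.
have c20 : 0 <= c2 by apply: mulr_ge0; [exact: mulr_ge0 | exact: powR_ge0].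
exists b.+1%:R, (cc * cV + c2) => N N2 /=.
have Np : 0 < N by lra.
pose l := ln N; have NE : N = expR l by rewrite lnK.
have hl2 : 1 / 2 <= l.
  by apply: le_trans (ln2_ge R) _; rewrite ler_ln ?posrE.
have lp : 0 < l by lra.
rewrite -/l; have [V1 V2 V3] := cardA0_bounds hl2; rewrite -NE in V1 V2 V3.
set V := cardA0 K N in V1 V2 V3 *.
have V0 : 0 <= V by apply: le_trans V1.
rewrite powR_mulrn ?(ltW lp) //; set t := V `^ th / _.
have t0 : 0 <= t by rewrite divr_ge0 ?powR_ge0 ?exprn_ge0 // ltW.
have N1 : 1 <= N by lra.
have E0 q := sup_disc_ge0 h q N1.
rewrite (esum_gens t0 E0).
have Vth : V `^ th <= (cV * expR (2 * l)) `^ th.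
  by apply: ge0_ler_powR; rewrite ?nnegrE ?mulr_ge0 ?expR_ge0 // ltW.
have [hl|hl] := lerP l1 l.
  have ll0 : l0 <= l by apply: le_trans hl; rewrite lerDl mulr_ge0.
  have l1' : 1 <= l by apply: le_trans ll0.
  have [w [w0 w1 w2]] := hl0 l ll0.
  have nm_t q : q \in gens t -> (nm q)%:R <= expR (2 * th * l) / l ^+ b.
    rewrite mem_gens // => /and3P[q0 _ hq].
    apply: (@le_trans _ _ (kk * t)).
      apply: (@le_trans _ _ (kk * (size (Rep Q q))%:R)); last exact: ler_wpM2l.
      by rewrite -natrM ler_nat size_Rep_ge.
    have Zth : V `^ th <= cV * expR (2 * th * l).
      apply: (le_trans Vth); rewrite powRM ?expR_ge0 // powR_expR.
      have -> : th * (2 * l) = 2 * th * l by ring.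
      apply: ler_wpM2r; first exact: expR_ge0.
      by rewrite -[leRHS]powRr1 //; apply: ler_powR => //; apply: cV1.
    apply: (@le_trans _ _ (kk * (cV * expR (2 * th * l) / l ^+ b.+1))).
      by apply: ler_wpM2l => //; apply: ler_wpM2r => //; rewrite invr_ge0 exprn_ge0 // ltW.
    have -> : kk * (cV * expR (2 * th * l) / l ^+ b.+1) = expR (2 * th * l) / l ^+ b * (kk * cV / l).
      rewrite exprS; have ln0 : l != 0 by rewrite gt_eqF.
      by field; rewrite ?ln0 ?expf_neq0.
    apply: ler_piMr; first by rewrite divr_ge0 ?expR_ge0 ?exprn_ge0 // ltW.
    by rewrite ler_pdivrMr // mul1r; apply: le_trans hl; rewrite lerDr; lra.
  apply: (@le_trans _ _ (\sum_(q <- gens t) (w q)%:E)%E).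
    rewrite big_seq [leRHS]big_seq; apply: lee_sum => q qg.
    have q0 : q != 0 by move: qg; rewrite mem_gens // => /and3P[].
    apply: sup_disc_le => //; first exact: ltW.
    move=> T d hT cd; apply: w1 => //; first exact: nm_t.
    by rewrite expRM_natl -NE.
  rewrite sumEFin lee_fin; apply: (@le_trans _ _ (cc * (expR (2 * l) / l ^+ A1))).
    pose n := Num.truncn (expR (2 * th * l) / l ^+ b).
    have e0 : 0 <= expR (2 * th * l) / l ^+ b by rewrite divr_ge0 ?expR_ge0 ?exprn_ge0 // ltW.
    have hn : n%:R <= expR (2 * th * l) / l ^+ b by rewrite truncn_le.
    apply: le_trans (w2 n hn); rewrite -[leRHS]big_filter; apply: ler_sum_sub => //.
      by rewrite filter_uniq ?nball_uniq.
    move=> q qg; rewrite mem_filter mem_nball truncn_ge_nat // nm_t // andbT.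
    by move: qg; rewrite mem_gens // => /and3P[-> ->].
  apply: (@le_trans _ _ (cc * cV * (V * l `^ (- A)))).
    rewrite -mulrA; apply: ler_wpM2l => //; rewrite mulrA; apply: ler_pM; rewrite ?expR_ge0 //.
      by rewrite invr_ge0 exprn_ge0 // ltW.
    by rewrite powRN lef_pV2 ?posrE ?exprn_gt0 ?powR_gt0 // powR_shift.
  by apply: ler_wpM2r; [rewrite mulr_ge0 ?powR_ge0 | rewrite lerDl].
(* In the remaining case [l < l1]: the moduli, and the norms of the elements,
   are bounded. *)
have tt1 : t <= t1.
  rewrite /t /t1; apply: ler_pM; first exact: powR_ge0.
  - by rewrite invr_ge0 exprn_ge0 // ltW.
  - apply: (le_trans Vth); apply: ge0_ler_powR; first exact: ltW.
    + by rewrite nnegrE mulr_ge0 ?expR_ge0.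
    + by rewrite nnegrE mulr_ge0 ?expR_ge0.
    by apply: ler_wpM2l => //; rewrite ler_expR; lra.
  rewrite -[2 ^+ _]invrK lef_pV2 ?posrE ?invr_gt0 ?exprn_gt0 // -exprVn.
  by rewrite lerXn2r ?nnegrE ?invr_ge0 // ?(ltW lp) //; lra.
apply: (@le_trans _ _ (\sum_(q <- gens t) Hc%:E)%E).
  rewrite big_seq [leRHS]big_seq; apply: lee_sum => q qg.
  have q0 : q != 0 by move: qg; rewrite mem_gens // => /and3P[].
  apply: sup_disc_le => //; first exact: ltW.
  move=> T d hT cd; apply: (le_trans (ldisc_trivial _ _ _ _)); apply: ler_wpM2l => //.
  apply: ler_sum_sub; rewrite ?annulus_uniq //; last by move=> y _; apply: cabs_ge0.
  move=> y; rewrite !mem_annulus => /andP[-> hy] /=.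
  rewrite truncn_ge_nat ?expR_ge0 //; apply: (@le_trans _ _ (T%:R)); first by rewrite ler_nat.
  by apply: (le_trans hT); rewrite NE -expRM_natl ler_expR; lra.
rewrite sumEFin lee_fin big_const_seq iter_addr_0 count_predT -mulr_natl.
apply: (@le_trans _ _ ((size (nball n2))%:R * Hc)).
  apply: ler_wpM2r => //; rewrite ler_nat; apply: uniq_leq_size.
    by rewrite filter_uniq ?nball_uniq.
  move=> q; rewrite mem_filter => /andP[_]; rewrite !mem_nball => hq; apply: (leq_trans hq).
  by apply: le_truncn; apply: ler_wpM2l.
apply: (@le_trans _ _ (c2 * (V * l `^ (- A)))); last first.
  by apply: ler_wpM2r; [rewrite mulr_ge0 ?powR_ge0 | rewrite lerDr mulr_ge0].
have h1 : 1 <= l1 `^ A * (V * l `^ (- A)).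
  rewrite powRN mulrCA -[1]mulr1; apply: ler_pM => //.
  rewrite ler_pdivlMr ?powR_gt0 // mul1r; apply: ge0_ler_powR; rewrite ?nnegrE ?(ltW lp) ?(ltW l1p) //.
    exact: ltW.
  exact: ltW.
by rewrite /c2 -mulrA; apply: ler_peMr => //; rewrite mulr_ge0.
Qed.

(** An ideal dividing [a] contains [a] and is principal, so it is generated
    by a divisor of [a]. *)
Lemma num_divisors_le a : a != 0 -> (num_ideal_divisors a <= tau Q a)%N.
Proof.
move=> a0; rewrite /num_ideal_divisors; set S := [set d | _]%classic.
pose s := undup [seq principal_ideal d | d <- dvs Q a].
have sub : (S `<=` [set` s])%classic.
  move=> d /= [id [I' iI' e]]; rewrite mem_undup.
  have da : d a.
    have : principal_ideal a a by apply/mem_principal; apply: dvqq.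
    rewrite -e => -[u hu ->]; have [d0 dD dM] := id.
    have : {in u, forall p, d p.1} by move=> p /hu[].
    elim: {hu} u => [|p u IH] hu; first by rewrite big_nil.
    rewrite big_cons; apply: dD; first by rewrite mulrC; apply: dM; apply: hu; rewrite mem_head.
    by apply: IH => p' hp'; apply: hu; rewrite inE hp' orbT.
  have [q [q0 _ eq]] := nz_ideal_generator (conj id (ex_intro2 _ _ a da a0)).
  rewrite eq; apply: map_f; rewrite mem_dvs //; apply/mem_principal.
  by rewrite -eq.
have fs : finite_set [set` s]%classic by apply: finite_seq.
have fS : finite_set S by apply: sub_finite_set sub fs.
apply: (@leq_trans #|` fset_set [set` s]%classic|).
  by apply: fsubset_leq_card; rewrite -fset_set_sub.
rewrite card_seq_set ?undup_uniq //; apply: (leq_trans (size_undup _)).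
by rewrite size_map.
Qed.

Lemma tau_ge1 x : x != 0 -> 1 <= (tau Q x)%:R :> R.
Proof.
move=> x0; rewrite ler1n; have : 1 \in dvs Q x by [rewrite mem_dvs // (nm1_dvq (Q := Q)) ?nm1].
by rewrite /tau; case: (dvs Q x).
Qed.

Lemma divisor_bounded (f : O -> R[i]) : siegel_walfisz f ->
  exists (k : nat) (cf : R), 0 <= cf /\
    forall x, x != 0 -> cabs (f x) <= cf * (tau Q x)%:R ^+ k.
Proof.
move=> [C [D [C0 _ [c hc] _]]]; exists (Num.truncn `|C|).+1, `|c|; split=> // x x0.
apply: (le_trans (hc x x0)); have t1 := tau_ge1 x0.
apply: (@le_trans _ _ (`|c| * (num_ideal_divisors x)%:R `^ C)).
  by apply: ler_wpM2r; [exact: powR_ge0 | exact: ler_norm].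
apply: ler_wpM2l => //; apply: le_trans (powR_shift _ t1).
by apply: ge0_ler_powR; rewrite ?nnegrE ?ler0n ?(ltW C0) // ler_nat num_divisors_le.
Qed.

(** Summing the convolution over a class is summing over the pairs whose
    product lies in the class. *)
Lemma conv_pair_disc (f g : O -> R[i]) (l : R) q (T : nat) c : T%:R <= expR (2 * l) ->
  @class_disc R O Q (annulus Q 0 T) (dirichlet_conv f g) q c =
  pair_disc Q q (annulus Q 0 (Num.truncn (expR (2 * l))))
    (annulus Q 0 (Num.truncn (expR (2 * l)))) f g T c.
Proof.
move=> hT; set S := annulus Q 0 (Num.truncn _).
have TZ : (T <= Num.truncn (expR (2 * l)))%N by rewrite truncn_ge_nat ?expR_ge0.
have S0 x : x \in S -> x != 0 by apply: annulus_neq0.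
have convE a : a \in annulus Q 0 T ->
    dirichlet_conv f g a = \sum_(x <- S) \sum_(y <- S | x * y == a) f x * g y.
  move=> aT; have a0 := annulus_neq0 aT.
  have aS p : p.1 * p.2 = a -> (p.1 \in S) && (p.2 \in S).
    move=> e; have na : (0 < nm p.1 * nm p.2 <= T)%N by rewrite -nmM e -mem_annulus.
    move: na; rewrite !mem_annulus muln_gt0 => /andP[/andP[h1 h2] h3]; rewrite h1 h2 /=.
    rewrite (leq_trans _ (leq_trans h3 TZ)) ?leq_pmulr //=.
    by rewrite (leq_trans _ (leq_trans h3 TZ)) // leq_pmull.
  pose r := [seq p <- [seq (x, y) | x <- S, y <- S] | p.1 * p.2 == a].
  have ur : uniq r by rewrite filter_uniq // allpairs_uniq ?annulus_uniq // => -[? ?] [? ?].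
  rewrite /dirichlet_conv.
  have -> : [set p : O * O | p.1 * p.2 = a]%classic = [set` r]%classic.
    apply/seteqP; split=> p /=; rewrite mem_filter; last by case/andP => /eqP.
    move=> e; rewrite e eqxx /=; have /andP[h1 h2] := aS p e.
    by apply/allpairsP; exists p; rewrite -surjective_pairing.
  rewrite -fsbig_seq // big_filter big_mkcond big_allpairs_dep /=.
  by apply: eq_bigr => x _; rewrite [RHS]big_mkcond.
have key (P : pred O) : \sum_(a <- annulus Q 0 T | P a) dirichlet_conv f g a =
    \sum_(x <- S) \sum_(y <- S | (nm (x * y) <= T)%N && P (x * y)) f x * g y.
  rewrite big_seq_cond (eq_bigr (fun a => \sum_(x <- S) \sum_(y <- S | x * y == a) f x * g y)); last first.
    by move=> a /andP[aT _]; apply: convE.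
  rewrite -big_seq_cond exchange_big /= big_seq [RHS]big_seq; apply: eq_bigr => x xS.
  rewrite (exchange_big_dep predT) //= big_seq [RHS]big_seq_cond.
  rewrite [RHS]big_mkcondr /=; apply: eq_bigr => y yS.
  have xy0 : (0 < nm (x * y))%N by rewrite nmM muln_gt0 !nm_gt0 S0 // S0.
  case: ifPn => hxy.
    have /andP[h1 h2] := hxy; rewrite big_mkcond (bigD1_seq (x * y)) ?annulus_uniq //=; last first.
      by rewrite mem_annulus xy0.
    rewrite h2 eqxx /= big1 ?addr0 // => a ha.
    by rewrite [x * y == a]eq_sym (negbTE ha) andbF.
  rewrite big1_seq // => a /andP[/andP[Pa /eqP e] aT]; exfalso; move/negP: hxy; apply.
  by rewrite e Pa andbT; move: aT; rewrite mem_annulus => /andP[].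
by rewrite /class_disc /pair_disc (key (fun y => dvq q (y - c))) (key (cop q)).
Qed.

End Dictionary.

(** * The induction principle *)

Theorem mainTheorem5 (R : realType) (K : fieldExtType rat)
  (K_imag_quad : imaginary_quadratic R K)
  (K_class_number_one : class_number K = 1%N)
  (zeta0 : ringOfIntegers K)
  (zeta0_gen : roots_of_unity_generator (int_val zeta0))
  (f g : ringOfIntegers K -> R[i])
  (f_inv : forall (a : ringOfIntegers K) (r : nat), (0 < r)%N -> f (zeta0 ^+ r * a) = f a)
  (g_inv : forall (a : ringOfIntegers K) (r : nat), (0 < r)%N -> g (zeta0 ^+ r * a) = g a)
  (f_SW : siegel_walfisz f)
  (g_SW : siegel_walfisz g)
  (theta : R) (theta_gt0 : 0 < theta) (theta_le_half : theta <= 1 / 2)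
  (f_level : level_of_distribution theta f)
  (g_level : level_of_distribution theta g) :
  level_of_distribution theta (dirichlet_conv f g).
Proof.
have [Q [nm_abs emb]] := quadratic_order K_imag_quad K_class_number_one.
have theta1 : theta <= 1 by lra.
have fD := level_well_distributed nm_abs emb theta_gt0 theta1 f_level.
have gD := level_well_distributed nm_abs emb theta_gt0 theta1 g_level.
have [kf [cf [cf0 f_le]]] := divisor_bounded Q f_SW.
have [kg [cg [cg0 g_le]]] := divisor_bounded Q g_SW.
have f_le' x : x != 0 -> cabs (f x) <= cf * (tau Q x)%:R ^+ (kf + kg).
  move=> x0; apply: (le_trans (f_le x x0)); apply: ler_wpM2l => //.
  by apply: ler_weXn2l; [exact: tau_ge1 | exact: leq_addr].
have g_le' x : x != 0 -> cabs (g x) <= cg * (tau Q x)%:R ^+ (kf + kg).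
  move=> x0; apply: (le_trans (g_le x x0)); apply: ler_wpM2l => //.
  by apply: ler_weXn2l; [exact: tau_ge1 | exact: leq_addl].
apply: (level_of_bounds nm_abs emb) => // A.
have [||b [cc [l0 [l01 cc0 hl0]]]] := conv_distributed _ _ cf0 cg0 fD gD f_le' g_le' A.
- by rewrite mulr_gt0.
- by lra.
exists b, cc, l0; split=> // l hl; have [w [w0 w1 w2]] := hl0 l hl.
exists w; split=> // q T c q0 hq hT cq.
by rewrite (@conv_pair_disc R K Q f g l q T c hT); apply: w1.
Qed.
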